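(* Let $C\subset\mathbb{P}^2$ be a cuspidal cubic over $\mathbb{C}$ with cusp $c$ and smooth locus $U$, let $r\in\{6,7,8\}$, and let $u_1,\dots,u_r\in U$ be points not lying on any of the $E_r$ reflection hyperplanes (as described in the context). Let $Y$ be the surface obtained by blowing up $\mathbb{P}^2$ at $u_1,\dots,u_r$ and removing the strict transform of $C$. (a) ($r=7$) There are a smooth conic $D\subset\mathbb{P}^2$, a line $\ell$ tangent to $D$ at a point $t$, six points on $D\setminus\{t\}$ and two points on $\ell\setminus\{t\}$, such that the blow-up of $\mathbb{P}^2$ at the eight points $c,u_1,\dots,u_7$ is isomorphic to the blow-up of $\mathbb{P}^2$ at these six plus two points, by an isomorphism taking the strict transform of $C$ to that of $D$, and the exceptional curve over $c$ to the strict transform of $\ell$. (b) ($r=6$) There are three lines $\ell_1,\ell_2,\ell_3\subset\mathbb{P}^2$ meeting in a single point $t$, three points on $\ell_1\setminus\{t\}$, three points on $\ell_2\setminus\{t\}$ and two points on $\ell_3\setminus\{t\}$, such that the blow-up of $\mathbb{P}^2$ at $u_1,\dots,u_6$, at $c$, and then at the point $c'$ where the strict transform of $C$ touches the exceptional curve over $c$, is isomorphic to the blow-up of $\mathbb{P}^2$ at these eight points, by an isomorphism taking the strict transforms of $C$ and of the exceptional curve over $c$, and the exceptional curve over $c'$, to the strict transforms of $\ell_1,\ell_2,\ell_3$ respectively. (c) Consequently, in each case, let $S$ be a Sakai surface of type $E_r$ obtained from these data by blowing up one further (ninth) point and removing the strict transform of the (possibly degenerate) cubic. Here the ninth point is chosen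 on $U$ if $r=8$, on $\ell\setminus\{t\}$ if $r=7$, and on $\ell_3\setminus\{t\}$ if $r=6$, subject to the genericity condition in the context; the other points are $u_1,\dots,u_8$ if $r=8$, and the eight points of (a), respectively (b), if $r=7$, respectively $r=6$. Then $S$ contains a closed curve isomorphic to the affine line, namely the exceptional curve of the ninth point minus its intersection point with the strict transform of the cubic, whose complement in $S$ is isomorphic to $Y$.
   Context: The smooth locus $U$ of $C$ is identified with the group $\mathbb{C}$, with origin the inflection point, so that three points of $U$ are collinear iff their sum is $0$. The $E_r$ reflection hyperplanes in $U^r$ are given by: $u_i=u_j$; $u_i+u_j+u_k=0$; $\sum_{j=1}^6u_{i_j}=0$; and $2u_{i_1}+\sum_{j=2}^{8}u_{i_j}=0$ when $r=8$ (indices distinct within each equation). Sakai's surfaces: for type $E_8$, blow up nine points of the smooth locus of a cuspidal cubic; for type $E_7$, blow up nine points of the smooth locus of the degenerate cubic formed by a conic and a line touching it (six points on the conic, three on the line); for type $E_6$, blow up nine points of the smooth locus of the degenerate cubic formed by three concurrent lines (three points on each line). In each case, finally remove the strict transform of the cubic. Genericity condition: there is no other cubic through the same nine points. If the ninth point coincides with one of the others, the points are blown up in sequence, and the repeated point means the corresponding point on the strict transform of the cubic. *)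

(* Defs.v *)
From HB Require Import structures.
From mathcomp Require Import all_boot all_order all_algebra.
From mathcomp Require Import boolp classical_sets reals.
From mathcomp Require Import complex mpoly.
Set Implicit Arguments.
Unset Strict Implicit.
Unset Printing Implicit Defensive.
Import GRing.Theory.
Local Open Scope ring_scope.
Local Open Scope classical_set_scope.

(* P(K^n), so that the projective plane is [pspace K 3]. *)
Record pspace (K : fieldType) (n : nat) := PSpace {
  line : {vspace 'rV[K]_n};
  _ : \dim line == 1%N }.
HB.instance Definition _ K n := [isSub for @line K n].
HB.instance Definition _ K n := [Choice of pspace K n by <:].

Section QuasiProjective.
Variable K : fieldType.
Implicit Types m n d : nat.

(* [v] is a vector of homogeneous coordinates of [p]; it is then nonzero,
   because [line p] has dimension 1. *)
Definition coords n (p : pspace K n) (v : 'rV[K]_n) : Prop := line p = <[v]>%VS.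

Definition rep n (p : pspace K n) : 'rV[K]_n := vpick (line p).

Definition vanish n (f : {mpoly K[n]}) (p : pspace K n) : Prop :=
  forall v, coords p v -> f.@[v 0] = 0.

Definition zeros n (f : {mpoly K[n]}) : set (pspace K n) := [set p | vanish f p].

Definition zclosure n (A : set (pspace K n)) : set (pspace K n) :=
  [set p | forall d (f : {mpoly K[n]}),
     f \is d.-homog -> A `<=` zeros f -> vanish f p].

Definition zclosed_in n (A S : set (pspace K n)) : Prop :=
  A `<=` S /\ zclosure A `&` S `<=` A.

(* Regular maps between quasi-projective varieties X, Y are maps given locally
   by forms of equal degree without common zero.  Multiplying the [F i] by a
   common form, one may take the neighbourhood of [x] on which the formula is
   required to be the locus of X where the [F i] do not all vanish. *)
Definition regular_on m n (X : set (pspace K m)) (g : pspace K m -> pspace K n)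
    : Prop :=
  forall x, X x -> exists d (F : 'I_n -> {mpoly K[m]}),
    [/\ forall i, F i \is d.-homog,
        exists i, ~ vanish (F i) x
      & forall y v, X y -> coords y v -> (exists i, (F i).@[v 0] != 0) ->
          coords (g y) (\row_i (F i).@[v 0])].

Definition is_iso m n (X : set (pspace K m)) (Y : set (pspace K n))
    (f : pspace K m -> pspace K n) : Prop :=
  exists g : pspace K n -> pspace K m,
    [/\ regular_on X f, regular_on Y g,
        forall x, X x -> Y (f x) /\ g (f x) = x
      & forall y, Y y -> X (g y) /\ f (g y) = y].

Definition isomorphic m n (X : set (pspace K m)) (Y : set (pspace K n)) : Prop :=
  exists f, is_iso X Y f.

Definition affine_coords (a : K) : 'rV[K]_2 := \row_(i < 2) [:: 1; a]`_i.

Definition affine_line : set (pspace K 2) :=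
  [set p | exists a, coords p (affine_coords a)].

End QuasiProjective.

(* The blow-up of a projective variety X in P(K^n) at distinct points
   q_1, ..., q_k of X is the closure of the graph of
     x |-> (line x q_1, ..., line x q_k),
   that is, of the product of the projections from the q_i.  A line is given by
   its Pluecker coordinates in K^(n * n), and the product
   P(K^n) * P(K^(n * n))^k is embedded in a projective space by Segre. *)
Section BlowUp.
Variable K : fieldType.
Implicit Types n k : nat.

Definition wedge n (x q : 'rV[K]_n) : 'rV[K]_(n * n) :=
  mxvec (x^T *m q - q^T *m x).

Fixpoint bldim n k : nat := if k is k'.+1 then (bldim n k' * (n * n))%N else n.

(* x (x) l_0 (x) ... (x) l_(k-1) *)
Fixpoint segre n k (x : 'rV[K]_n) (l : nat -> 'rV[K]_(n * n))
    : 'rV[K]_(bldim n k) :=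
  if k is k'.+1 then mxvec ((segre k' x l)^T *m l k') else x.

(* For X closed and [qs] distinct points of X, this is the blow-up of X at
   [qs].  For any closed A, it is the closure of the part of the blow-up that
   lies over A minus the centres, i.e. the strict transform of A in the blow-up
   at [qs] of every closed X containing A. *)
Definition blowup n (A : set (pspace K n)) (qs : seq (pspace K n))
    : set (pspace K (bldim n (size qs))) :=
  zclosure [set y | exists x v,
    [/\ A x, x \notin qs, coords x v
      & coords y (segre (size qs) v (fun i => wedge v (map (@rep K n) qs)`_i))]].

Arguments blowup {n} A qs _.

(* The blow-down map, as a relation: [y] is mapped to [x]. *)
Definition over n k (y : pspace K (bldim n k)) (x : pspace K n) : Prop :=
  exists v l, coords x v /\ coords y (segre k v l).

Definition exceptional n (X : set (pspace K n)) (qs : seq (pspace K n))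
    (q : pspace K n) : set (pspace K (bldim n (size qs))) :=
  blowup X qs `&` [set y | over y q].

End BlowUp.
Arguments blowup {K n} A qs _.
Arguments exceptional {K n} X qs q _.

Section PlaneCurves.
Variable K : fieldType.
Implicit Types (F G Q L : {mpoly K[3]}) (p c t : pspace K 3).
Implicit Types us ps ds ls s : seq (pspace K 3).

Definition differential F (v w : 'rV[K]_3) : K :=
  \sum_i (F^`M(i)).@[v 0] * w 0 i.

Definition hessian F (v : 'rV[K]_3) : 'M[K]_3 :=
  \matrix_(i, j) ((F^`M(i))^`M(j)).@[v 0].

Definition smooth_at F p : Prop := exists i, ~ vanish (F^`M(i)) p.

Definition smooth_locus F : set (pspace K 3) := [set p | vanish F p /\ smooth_at F p].

Definition tangent_line F p : set (pspace K 3) :=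
  [set x | forall v w, coords p v -> coords x w -> differential F v w = 0].

Definition irreducible_form F : Prop :=
  F != 0 /\ forall G H, F = G * H -> (msize G <= 1)%N \/ (msize H <= 1)%N.

(* A double point whose tangent cone is a double line.  On an irreducible cubic
   that line cannot meet the cubic with multiplicity more than 3, so this is an
   ordinary cusp. *)
Definition cusp F c : Prop :=
  (forall i, vanish (F^`M(i)) c) /\
  (forall v, coords c v -> \rank (hessian F v) = 1%N).

Definition cuspidal_cubic F c : Prop :=
  [/\ F \is 3.-homog, irreducible_form F & cusp F c].

Definition is_line L : Prop := L \is 1.-homog /\ L != 0.

Definition smooth_conic Q : Prop :=
  Q \is 2.-homog /\ forall p, vanish Q p -> smooth_at Q p.

(* A smooth point whose tangent line meets the curve there with multiplicity at
   least 3. *)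
Definition inflection F p : Prop :=
  smooth_locus F p /\
  forall v w, coords p v -> differential F v w = 0 ->
    w *m hessian F v *m w^T = 0.

Definition collinear p1 p2 p3 : Prop :=
  exists2 L, is_line L & [/\ vanish L p1, vanish L p2 & vanish L p3].

(* The identification [phi] of the additive group with the smooth locus.  The
   collinearity condition on distinct points already determines the group law,
   as [phi] is an isomorphism of varieties. *)
Definition group_identification F (phi : K -> pspace K 3) : Prop :=
  [/\ exists2 g, is_iso (affine_line (K := K)) (smooth_locus F) g
        & forall x a, coords x (affine_coords a) -> g x = phi a,
      inflection F (phi 0)
    & forall a1 a2 a3 : K, uniq [:: a1; a2; a3] ->
        collinear (phi a1) (phi a2) (phi a3) <-> a1 + a2 + a3 = 0].

Definition off_hyperplanes r (a : 'I_r -> K) : Prop :=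
  [/\ forall i j, uniq [:: i; j] -> a i <> a j,
      forall i j k, uniq [:: i; j; k] -> a i + a j + a k <> 0,
      forall s : seq 'I_r, uniq s -> size s = 6 -> \sum_(i <- s) a i <> 0
    & r = 8 -> forall i (s : seq 'I_r), uniq (i :: s) -> size s = 7 ->
        a i *+ 2 + \sum_(j <- s) a j <> 0].

(* [F] is, up to scalars, the only cubic through the points [ps] and [p].  If
   [p] is one of the [ps], then passing through [p] a second time means passing
   through the infinitely near point of the curve F = 0 at [p]: being tangent
   to it there, or singular. *)
Definition only_cubic F ps p : Prop :=
  forall G, G \is 3.-homog ->
    (forall q, q \in ps -> vanish G q) -> vanish G p ->
    (p \in ps -> forall v w, coords p v ->
       differential F v w = 0 -> differential G v w = 0) ->
    exists b : K, G = b *: F.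

Definition points_on (A : set (pspace K 3)) k ps : Prop :=
  [/\ uniq ps, size ps = k & forall p, p \in ps -> A p].

Definition conic_and_tangent Q L t ds ls : Prop :=
  [/\ smooth_conic Q, is_line L, vanish Q t /\ zeros L = tangent_line Q t,
      points_on (zeros Q `\ t) 6 ds & points_on (zeros L `\ t) 2 ls].

Definition concurrent_lines L1 L2 L3 t s1 s2 s3 : Prop :=
  [/\ [/\ is_line L1, is_line L2 & is_line L3],
      [/\ zeros L1 `&` zeros L2 = [set t], zeros L1 `&` zeros L3 = [set t]
        & zeros L2 `&` zeros L3 = [set t]],
      points_on (zeros L1 `\ t) 3 s1, points_on (zeros L2 `\ t) 3 s2
    & points_on (zeros L3 `\ t) 2 s3].

Definition E7_model F c us Q L ds ls : Prop :=
  exists2 f : pspace K (bldim 3 (size (c :: us))) ->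
              pspace K (bldim 3 (size (ds ++ ls))),
    is_iso (blowup setT (c :: us)) (blowup setT (ds ++ ls)) f
  & f @` blowup (zeros F) (c :: us) = blowup (zeros Q) (ds ++ ls) /\
    f @` exceptional setT (c :: us) c = blowup (zeros L) (ds ++ ls).

(* [c'] is the point where the strict transform of F = 0 meets the exceptional
   curve over [c] after [c] and [us] have been blown up. *)
Definition E6_model F c us L1 L2 L3 s1 s2 s3 : Prop :=
  let X := blowup setT (c :: us) in
  let CX := blowup (zeros F) (c :: us) in
  let Ec := exceptional setT (c :: us) c in
  let ps := s1 ++ s2 ++ s3 in
  exists2 c', CX `&` Ec = [set c'] &
  exists2 f : pspace K (bldim (bldim 3 (size (c :: us))) (size [:: c'])) ->
              pspace K (bldim 3 (size ps)),
    is_iso (blowup X [:: c']) (blowup setT ps) f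
  & [/\ f @` blowup CX [:: c'] = blowup (zeros L1) ps,
        f @` blowup Ec [:: c'] = blowup (zeros L2) ps
      & f @` exceptional X [:: c'] c' = blowup (zeros L3) ps].

(* X is the blow-up of the plane at [ps], CX the strict transform of the cubic
   F = 0, and q the point of CX over the ninth point [p]: the preimage of [p] if
   [p] is not one of the [ps], and the infinitely near point of the cubic
   otherwise.  S is the Sakai surface, E the last exceptional curve. *)
Definition sakai_complement n F ps p (Y : set (pspace K n)) : Prop :=
  let X := blowup setT ps in
  let CX := blowup (zeros F) ps in
  exists2 q, CX `&` [set y | over y p] = [set q] &
  let S := blowup X [:: q] `\` blowup CX [:: q] in
  let E := exceptional X [:: q] q in
  exists2 e, E `&` blowup CX [:: q] = [set e] &
  [/\ zclosed_in (E `\ e) S, isomorphic (E `\ e) (affine_line (K := K))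
    & isomorphic (S `\` (E `\ e)) Y].

End PlaneCurves.

(* Main.v *)
Require Import Defs.
From mathcomp Require Import all_boot all_order all_algebra.
From mathcomp Require Import boolp classical_sets reals.
From mathcomp Require Import complex mpoly.
From mathcomp Require Import ring.
Set Implicit Arguments.
Unset Strict Implicit.
Unset Printing Implicit Defensive.
Import GRing.Theory Num.Theory.
Local Open Scope ring_scope.
Local Open Scope classical_set_scope.

(* The cubic, and each component of the degenerate cubics, is a curve
   s |-> gamma(s) with polynomial entries and one further point at s = infinity.
   Strict transforms are closures of such arcs, so an isomorphism of blow-ups
   carries one to another as soon as it matches the parametrizations.

   Let gamma parametrize the cuspidal cubic with c at infinity.  The quadratic
   transformation with base points u_1, u_2, c lifts to an isomorphism of
   blow-ups, the other u_k being off the three fundamental lines because no three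
   of the u_i are collinear.  It maps the cubic to a conic and the exceptional
   curve over c to the tangent line of that conic at its point at infinity; the
   contracted lines u_1 u_2, c u_1, c u_2 give the missing points.  For r = 6, the
   quadratic transformation based at two of the points on the conic and at the
   point of tangency then gives three concurrent lines.

   For (c), blowing up a point q on a curve CX in a surface X and removing the
   strict transform of CX together with the exceptional curve leaves X minus CX.
   Applied to the ninth point, and to c and c', this identifies the complement
   of the exceptional curve with Y. *)

(** * Closures of sets of vectors and regular maps *)

Section Forms.
Variable K : numFieldType.
Implicit Types n m d : nat.

(** The obstacle is that a blow-up is a bare Zariski closure in a large Segre space, so its points
    and its regular maps have to be found by hand. Points: over distinct centres the incidences
    between a point and the lines joining it to the centres are closed conditions, and conversely
    every such flag is a limit along a polynomial arc; hence flags parametrize the blow-up of the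
    plane. Maps: parameters range over an arbitrary type, and the relation [reg] says that one
    vector-valued function of the parameter is given locally by forms in another. An isomorphism is
    then a pair of functions on a common parameter set, each regular in the other. Exceptional
    curves need more, namely limits of secants at a point: a map given by forms acts on them through
    a matrix, its derivative, obtained from generators of the ideal of a point. These limits fill
    the whole tangent plane because the blown-up plane has charts, also at a point of an exceptional
    curve; this is what covers a ninth point infinitely near to one of the others. *)

Definition isform n d (f : 'rV[K]_n -> K) : Prop :=
  exists2 P : {mpoly K[n]}, P \is d.-homog & forall v, f v = P.@[v 0].

Lemma form_ext n d (f g : 'rV[K]_n -> K) : f =1 g -> isform d f -> isform d g.
Proof. by move=> fg [P hP eP]; exists P => // v; rewrite -fg. Qed.

Lemma form_const n (a : K) : @isform n 0 (fun=> a).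
Proof.
exists a%:MP => [|v]; last by rewrite mevalC.
by rewrite -[_%:MP]mulr1 mul_mpolyC dhomogZ ?dhomog1.
Qed.

Lemma form_coord n (i : 'I_n) : isform 1 (fun v => v 0 i).
Proof. by exists 'X_i => [|v]; rewrite ?mevalXU // dhomogX /= mdeg1. Qed.

Lemma form0 n d : @isform n d (fun=> 0).
Proof. by exists 0 => [|v]; rewrite ?meval0 ?dhomog0. Qed.

Lemma form_add n d (f g : 'rV[K]_n -> K) :
  isform d f -> isform d g -> isform d (fun v => f v + g v).
Proof.
move=> [P hP eP] [Q hQ eQ]; exists (P + Q); first exact: dhomogD.
by move=> v; rewrite mevalD eP eQ.
Qed.

Lemma form_opp n d (f : 'rV[K]_n -> K) : isform d f -> isform d (fun v => - f v).
Proof.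
by move=> [P hP eP]; exists (- P) => [|v]; rewrite ?dhomogN // mevalN eP.
Qed.

Lemma form_sub n d (f g : 'rV[K]_n -> K) :
  isform d f -> isform d g -> isform d (fun v => f v - g v).
Proof. by move=> hf hg; apply: form_add => //; apply: form_opp. Qed.

Lemma form_mul n d e (f g : 'rV[K]_n -> K) :
  isform d f -> isform e g -> isform (d + e) (fun v => f v * g v).
Proof.
move=> [P hP eP] [Q hQ eQ]; exists (P * Q); first exact: dhomogM.
by move=> v; rewrite mevalM eP eQ.
Qed.

Lemma form_cmul n d (a : K) (f : 'rV[K]_n -> K) :
  isform d f -> isform d (fun v => a * f v).
Proof. by move=> hf; apply: (@form_mul _ 0) => //; apply: form_const. Qed.

Lemma form_mulc n d (a : K) (f : 'rV[K]_n -> K) :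
  isform d f -> isform d (fun v => f v * a).
Proof. by move=> hf; apply: form_ext (form_cmul a hf) => v; rewrite mulrC. Qed.

Lemma form_exp n d k (f : 'rV[K]_n -> K) :
  isform d f -> isform (k * d) (fun v => f v ^+ k).
Proof.
move=> hf; elim: k => [|k IH]; first exact: form_const.
by rewrite mulSn; apply: form_ext (form_mul hf IH) => v; rewrite exprS.
Qed.

Lemma form_sum n d I (r : seq I) (P : pred I) (f : I -> 'rV[K]_n -> K) :
  (forall i, P i -> isform d (f i)) ->
  isform d (fun v => \sum_(i <- r | P i) f i v).
Proof.
move=> hf; elim: r => [|i r IH].
  by apply: form_ext (form0 n d) => v; rewrite big_nil.
have [Pi|nPi] := boolP (P i).
  by apply: form_ext (form_add (hf i Pi) IH) => v; rewrite big_cons Pi.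
by apply: form_ext IH => v; rewrite big_cons (negPf nPi).
Qed.

(** Every monomial of positive degree is divisible by a variable. The splitting is not unique; it
    serves to make induction on the degree possible, here and for the Taylor formulas. *)
Lemma homog_split n d (P : {mpoly K[n]}) : P \is d.+1.-homog ->
  exists2 Q : 'I_n -> {mpoly K[n]}, forall i, Q i \is d.-homog
    & P = \sum_i 'X_i * Q i.
Proof.
move=> hP; rewrite [P]mpolyE big_seq.
apply: (big_ind (fun P : {mpoly K[n]} =>
  exists2 Q : 'I_n -> {mpoly K[n]}, forall i, Q i \is d.-homog
    & P = \sum_i 'X_i * Q i)).
- exists (fun=> 0) => [i|]; first exact: dhomog0.
  by rewrite big1 // => i _; rewrite mulr0.
- move=> _ _ [Q1 h1 ->] [Q2 h2 ->]; exists (fun i => Q1 i + Q2 i).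
    by move=> i; apply: dhomogD.
  by rewrite -big_split /=; apply: eq_bigr => i _; rewrite mulrDr.
move=> m mP; move/dhomogP: (hP) => /(_ m mP) /= dm.
have [i mi] : exists i, m i != 0%N.
  apply/existsP; apply: contraT; rewrite negb_exists => /forallP H.
  suff: mdeg m = 0%N by rewrite dm.
  by rewrite mdegE big1 // => i _; apply/eqP; move: (H i); rewrite negbK.
have lem : (U_(i) <= m)%MM by rewrite lep1mP.
exists (fun j => if j == i then P@_m *: 'X_[m - U_(i)] else 0).
  move=> j; case: eqP => _; last exact: dhomog0.
  apply: dhomogZ; rewrite dhomogX /= -eqSS -dm -[X in _ == mdeg X](submK lem).
  by rewrite mdegD mdeg1 addn1.
rewrite (bigD1 i) //= eqxx big1 ?addr0.
  by rewrite -scalerAr -mpolyXD addmC submK.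
by move=> j /negPf ->; rewrite mulr0.
Qed.

Lemma form_split n d (f : 'rV[K]_n -> K) : isform d.+1 f ->
  exists2 g : 'I_n -> 'rV[K]_n -> K, forall i, isform d (g i)
    & forall v, f v = \sum_i v 0 i * g i v.
Proof.
move=> [P /homog_split [Q hQ ->] eP]; exists (fun i v => (Q i).@[v 0]).
  by move=> i; exists (Q i).
move=> v; rewrite eP raddf_sum; apply: eq_bigr => i _ /=.
by rewrite mevalM mevalXU.
Qed.

Lemma form_cst n (f : 'rV[K]_n -> K) : isform 0 f -> forall u v, f u = f v.
Proof.
move=> [P hP eP] u v; rewrite !eP.
suff -> : P = (P@_0)%:MP by rewrite !mevalC.
apply/mpolyP => m; rewrite mcoeffC; have [<-|nm] := eqVneq m 0%MM.
  by rewrite mulr1.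
rewrite mulr0; apply: (dhomog_nemf_coeff hP) => /=.
by rewrite mdeg_eq0.
Qed.

Lemma form_scale n d (f : 'rV[K]_n -> K) (a : K) v :
  isform d f -> f (a *: v) = a ^+ d * f v.
Proof.
elim: d f v => [|d IH] f v hf; first by rewrite mul1r; apply: form_cst.
have [g hg eg] := form_split hf; rewrite !eg mulr_sumr.
apply: eq_bigr => i _; rewrite IH // mxE exprS; ring.
Qed.

(** Induction on the degree by [form_split] replaces substitution of polynomials into
    polynomials. *)
Lemma form_comp n m d e (f : 'rV[K]_n -> K) (F : 'rV[K]_m -> 'rV[K]_n) :
  isform d f -> (forall i, isform e (fun v => F v 0 i)) ->
  isform (d * e) (fun v => f (F v)).
Proof.
move=> + hF; elim: d f => [|d IH] f hf.
  by apply: form_ext (form_const m (f 0)) => v; apply: form_cst hf _ _.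
have [g hg eg] := form_split hf; rewrite mulSn.
apply: (@form_ext _ _ (fun v => \sum_i F v 0 i * g i (F v))) => [v|].
  by rewrite -eg.
by apply: form_sum => i _; apply: form_mul => //; apply: IH.
Qed.

(** A power of a coordinate that is nonzero at [v]. Such forms cut out the neighbourhoods on which
    local formulas are compared, and raise degrees without changing points. *)
Lemma form_neq0 n k (v : 'rV[K]_n) : v != 0 ->
  exists2 h : 'rV[K]_n -> K, isform k h & h v != 0.
Proof.
move=> /rV0Pn [i vi]; exists (fun u => u 0 i ^+ k); last exact: expf_neq0.
by rewrite -[k in isform k]muln1; apply: form_exp; apply: form_coord.
Qed.

(* Modulo the ideal generated by the [u_a v_b - u_b v_a], a form of degree [d]
   satisfies [v_c^d f(u) = u_c^d f(v)]. *)
Lemma point_ideal_aux n d (f : 'rV[K]_n -> K) (v : 'rV[K]_n) c : isform d.+1 f ->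
  exists2 g : 'I_n -> 'I_n -> 'rV[K]_n -> K, forall a b, isform d (g a b)
    & forall u, v 0 c ^+ d.+1 * f u - u 0 c ^+ d.+1 * f v =
        \sum_a \sum_b (u 0 a * v 0 b - u 0 b * v 0 a) * g a b u.
Proof.
elim: d f => [|d IH] f hf; have [g hg eg] := form_split hf.
  exists (fun a b u => if b == c then g a 0 else 0) => [a b|u].
    by case: (b == c); [apply: form_const|apply: form0].
  rewrite !eg !expr1 !mulr_sumr -sumrB; apply: eq_bigr => a _.
  rewrite (bigD1 c) //= big1 ?addr0 => [|b /negPf ->]; last by rewrite mulr0.
  rewrite eqxx (form_cst (hg a) u 0) (form_cst (hg a) v 0); ring.
have /choice [h hh] : forall a, exists h : 'I_n -> 'I_n -> 'rV[K]_n -> K,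
    (forall b k, isform d (h b k)) /\
    forall u, v 0 c ^+ d.+1 * g a u - u 0 c ^+ d.+1 * g a v =
      \sum_b \sum_k (u 0 b * v 0 k - u 0 k * v 0 b) * h b k u.
  by move=> a; have [h h1 h2] := IH _ (hg a); exists h.
(* Writing [f] as the sum of the [u_a g_a], the difference splits into [v_c u_a] times the
   difference for [g_a], covered by induction, and [u_c^(d+1) g_a(v)] times [u_a v_c - u_c v_a], a
   generator with second index [c]. *)
exists (fun b k (u : 'rV[K]_n) => v 0 c * (\sum_a u 0 a * h a b k u) +
   (if k == c then u 0 c ^+ d.+1 * g b v else 0)) => [b k|u].
  apply: form_add.
    apply: form_cmul; apply: form_sum => a _; apply: (@form_mul _ 1) => //.
      exact: form_coord.
    by case: (hh a).
  case: (k == c); last exact: form0.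
  apply: form_mulc; rewrite -[X in isform X]muln1; apply: form_exp.
  exact: form_coord.
have E b k : (u 0 b * v 0 k - u 0 k * v 0 b) *
    (v 0 c * (\sum_a u 0 a * h a b k u) +
      (if k == c then u 0 c ^+ d.+1 * g b v else 0)) =
    (\sum_a (v 0 c * u 0 a) *
       ((u 0 b * v 0 k - u 0 k * v 0 b) * h a b k u)) +
    (if k == c then (u 0 b * v 0 c - u 0 c * v 0 b) *
       (u 0 c ^+ d.+1 * g b v) else 0).
  rewrite mulrDr; congr (_ + _); last first.
    by case: eqP => [->|]; rewrite ?mulr0.
  rewrite !mulr_sumr; apply: eq_bigr => a _; ring.
under eq_bigr do under eq_bigr do rewrite E.
under eq_bigr do rewrite big_split /= -big_mkcond big_pred1_eq exchange_big /=.
rewrite big_split /= exchange_big /= -big_split /= !eg !mulr_sumr -sumrB.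
apply: eq_bigr => a _.
under eq_bigr do rewrite -mulr_sumr.
rewrite -mulr_sumr -(hh a).2 !exprS; ring.
Qed.

(** With [f v = 0] the relation modulo the minors becomes a formula for [v_c^(d+1) f], and [c] is
    chosen with [v_c] nonzero. The result lets the coordinates of secants through [v] be factored
    out of a map given by forms. *)
Lemma point_ideal n d (f : 'rV[K]_n -> K) (v : 'rV[K]_n) : v != 0 -> isform d.+1 f ->
  f v = 0 ->
  exists2 g : 'I_n -> 'I_n -> 'rV[K]_n -> K, forall a b, isform d (g a b)
    & forall u, f u = \sum_a \sum_b (u 0 a * v 0 b - u 0 b * v 0 a) * g a b u.
Proof.
move=> /rV0Pn [c vc] hf fv; have [g hg eg] := point_ideal_aux v c hf.
exists (fun a b u => (v 0 c ^+ d.+1)^-1 * g a b u) => [a b|u].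
  exact: form_cmul.
have := eg u; rewrite fv mulr0 subr0 => e.
rewrite -[LHS](mulKf (expf_neq0 d.+1 vc)) e mulr_sumr; apply: eq_bigr => a _.
by rewrite mulr_sumr; apply: eq_bigr => b _; rewrite mulrCA.
Qed.

End Forms.

(** * Homogeneous coordinates and closures of sets of vectors *)

Section Points.
Variable K : numFieldType.
Implicit Types n m : nat.

(** Equality of projective points, extended to all vectors: the zero vector is parallel to itself
    only. *)
Definition par n (u v : 'rV[K]_n) : Prop := exists2 a : K, a != 0 & u = a *: v.

Lemma par_refl n (u : 'rV[K]_n) : par u u.
Proof. by exists 1; rewrite ?oner_eq0 ?scale1r. Qed.

Lemma par_sym n (u v : 'rV[K]_n) : par u v -> par v u.
Proof.
by move=> [a a0 ->]; exists a^-1; rewrite ?invr_eq0 // scalerA mulVf ?scale1r.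
Qed.

Lemma par_trans n (u v w : 'rV[K]_n) : par u v -> par v w -> par u w.
Proof. by move=> [a a0 ->] [b b0 ->]; exists (a * b); rewrite ?mulf_neq0 ?scalerA. Qed.

Lemma par_scale n a (u : 'rV[K]_n) : a != 0 -> par (a *: u) u.
Proof. by exists a. Qed.

Lemma par_eq0 n (u v : 'rV[K]_n) : par u v -> (u == 0) = (v == 0).
Proof. by move=> [a a0 ->]; rewrite scaler_eq0 (negPf a0). Qed.

Lemma par_mul n m (u v : 'rV[K]_n) (A : 'M[K]_(n, m)) :
  par u v -> par (u *m A) (v *m A).
Proof. by move=> [a a0 ->]; exists a; rewrite ?scalemxAl. Qed.

Lemma coords_neq0 n (p : pspace K n) v : coords p v -> v != 0.
Proof.
case: p => l /= dl; rewrite /coords /= => e; apply: contraTneq dl => v0.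
by rewrite e v0 dim_vline eqxx.
Qed.

Lemma coords_par n (p : pspace K n) u v : coords p u -> (coords p v <-> par u v).
Proof.
move=> pu; have u0 := coords_neq0 pu; split.
  move=> pv; have : u \in line p by rewrite pu memv_line.
  rewrite pv => /vlineP [a ea]; exists a => //.
  by apply: contraNneq u0 => a0; rewrite ea a0 scale0r.
move=> [a a0 eu]; rewrite /coords pu eu; apply: subv_anti.
apply/andP; split; rewrite -memvE.
  by rewrite memvZ ?memv_line.
by rewrite -[v in v \in _](scale1r v) -(mulVf a0) -scalerA memvZ ?memv_line.
Qed.

Lemma coords_inj n (p q : pspace K n) v : coords p v -> coords q v -> p = q.
Proof. by move=> pv qv; apply: val_inj; rewrite /= pv qv. Qed.

Lemma coords_rep n (p : pspace K n) : coords p (rep p).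
Proof.
rewrite /coords /rep; case: p => l /= dl; apply/esym/eqP.
have h : vpick l \in l by apply: memv_pick.
rewrite eqEdim -memvE h (eqP dl) dim_vline vpick0.
by rewrite lt0b; apply: contraTneq dl => ->; rewrite dimv0.
Qed.

Lemma rep_neq0 n (p : pspace K n) : rep p != 0.
Proof. exact: coords_neq0 (coords_rep p). Qed.

Lemma coords_ex n (v : 'rV[K]_n) : v != 0 -> exists p : pspace K n, coords p v.
Proof.
move=> v0; have h : \dim <[v]>%VS == 1%N by rewrite dim_vline v0.
by exists (PSpace h).
Qed.

Lemma coords_trans n (p q : pspace K n) u v :
  coords p u -> coords q v -> par u v -> p = q.
Proof.
by move=> pu qv /(coords_par _ pu) pv; apply: coords_inj pv qv.
Qed.

Lemma coords_eqP n (p : pspace K n) v : coords p v -> par v (rep p).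
Proof. by move=> pv; apply/(coords_par _ pv); apply: coords_rep. Qed.

(** The closure is taken on vectors because parametrizations are vector-valued. [S] need be neither
    stable under scalars nor free of the zero vector, which appears wherever a parametrization is
    undefined. *)
Definition vclos n (S : set 'rV[K]_n) : set 'rV[K]_n :=
  [set v | forall d f, isform d f -> (forall u, S u -> f u = 0) -> f v = 0].

Lemma vclos_sub n (S : set 'rV[K]_n) v : S v -> vclos S v.
Proof. by move=> Sv d f hf; apply. Qed.

Lemma vclos_mono n (S S' : set 'rV[K]_n) v :
  (forall u, S u -> exists2 u', S' u' & par u u') -> vclos S v -> vclos S' v.
Proof.
move=> SS' h d f hf fS'; apply: (h d f hf) => u /SS' [u' Su' [a a0 ->]].
by rewrite (form_scale _ _ hf) fS' ?mulr0.
Qed.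

Lemma vclos_idem n (S S' : set 'rV[K]_n) v :
  (forall u, S u -> vclos S' u) -> vclos S v -> vclos S' v.
Proof. by move=> SS' h d f hf fS'; apply: (h d f hf) => u /SS' /(_ d f hf); apply. Qed.

Lemma vclos_par n (S : set 'rV[K]_n) u v : par u v -> vclos S u -> vclos S v.
Proof.
move=> [a a0 ->] h d f hf fS; have := h d f hf fS.
by rewrite (form_scale _ _ hf) => /eqP; rewrite mulf_eq0 expf_eq0 (negPf a0) andbF => /eqP.
Qed.

(** If a form vanishing on [S] and one vanishing on [S'] were both nonzero at [v], so would be their
    product, which vanishes on the union. *)
Lemma vclosU n (S S' : set 'rV[K]_n) v :
  vclos (S `|` S') v -> vclos S v \/ vclos S' v.
Proof.
move=> h; apply: contrapT => /not_orP [] /existsNP [d /existsNP [f]].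
move=> /not_implyP [hf /not_implyP [fS fv]].
move=> /existsNP [d' /existsNP [f' /not_implyP [hf' /not_implyP [fS' fv']]]].
have : f v * f' v = 0.
  by apply: (h _ _ (form_mul hf hf')) => u [/fS ->|/fS' ->]; rewrite ?mul0r ?mulr0.
by move=> /eqP; rewrite mulf_eq0 => /orP [] /eqP.
Qed.

(** The closure of the zero vector alone contains no nonzero vector, so parameters at which a
    parametrization vanishes can be discarded. *)
Lemma vclos_neq0 n (S : set 'rV[K]_n) v : v != 0 ->
  vclos S v -> vclos [set u | S u /\ u != 0] v.
Proof.
move=> v0 h; have : vclos ([set u | S u /\ u != 0] `|` [set 0]) v.
  apply: vclos_mono h => u Su; exists u; last exact: par_refl.
  by have [->|u0] := eqVneq u 0; [right|left].
move=> /vclosU [//|h0]; have /rV0Pn [i /eqP vi] := v0; exfalso; apply: vi.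
by apply: (h0 _ _ (form_coord _ i)) => u ->; rewrite mxE.
Qed.

Definition pc n (S : set 'rV[K]_n) : set (pspace K n) := [set p | vclos S (rep p)].

Lemma pcE n (S : set 'rV[K]_n) p v : coords p v -> (pc S p <-> vclos S v).
Proof.
move=> pv; split; apply: vclos_par; last exact: coords_eqP.
exact: par_sym (coords_eqP pv).
Qed.

Lemma vanishE n d (P : {mpoly K[n]}) p v : P \is d.-homog -> coords p v ->
  (vanish P p <-> P.@[v 0] = 0).
Proof.
move=> hP pv; split; first exact.
move=> Pv u /(coords_par _ pv) /par_sym [a a0 ->].
have hf : isform d (fun w : 'rV[K]_n => P.@[w 0]) by exists P.
by rewrite (form_scale a v hf) Pv mulr0.
Qed.

Definition cone n (A : set (pspace K n)) : set 'rV[K]_n :=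
  [set v | exists2 p, A p & coords p v].

Lemma zclosureE n (A : set (pspace K n)) : zclosure A = pc (cone A).
Proof.
apply/seteqP; split=> p /= h.
  move=> d f [P hP eP] fA; rewrite eP.
  suff /(_ _ (coords_rep p)) : vanish P p by [].
  by apply: h hP _ => q Aq v qv; rewrite -eP; apply: fA; exists q.
move=> d P hP AP; apply/(vanishE hP (coords_rep p)).
apply: (h d (fun v => P.@[v 0])); first by exists P.
by move=> u [q Aq qu]; exact: (AP q Aq u qu).
Qed.

End Points.

(** * Regularity of one parametrization in another *)

Section Reg.
Variable K : numFieldType.
Variable T : Type.
Implicit Types (D S : set T) (n m : nat).

(* [h t] is given near [t0], up to scalars, by forms in [g t]. *)
Definition reg D m n (g : T -> 'rV[K]_m) (h : T -> 'rV[K]_n) (t0 : T) : Prop :=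
  exists d e (F : 'rV[K]_m -> 'rV[K]_n) (N : 'rV[K]_m -> K),
  [/\ forall i, isform d (fun v => F v 0 i), isform e N, N (g t0) != 0
    & forall t, D t -> N (g t) != 0 -> par (F (g t)) (h t)].

Lemma reg_forms D m n d (g : T -> 'rV[K]_m) (F : 'rV[K]_m -> 'rV[K]_n) t0 :
  (forall i, isform d (fun v => F v 0 i)) -> reg D g (fun t => F (g t)) t0.
Proof.
move=> hF; exists d, 0%N, F, (fun=> 1); split=> //; first exact: form_const.
  by rewrite oner_eq0.
by move=> t _ _; apply: par_refl.
Qed.

Lemma reg_refl D m (g : T -> 'rV[K]_m) t0 : reg D g g t0.
Proof. by apply: (@reg_forms _ _ _ 1 g id) => i; apply: form_coord. Qed.

Lemma reg_cst D m n (g : T -> 'rV[K]_m) (v : 'rV[K]_n) t0 : reg D g (fun=> v) t0.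
Proof. by apply: (@reg_forms _ _ _ 0 g (fun=> v)) => i; apply: form_const. Qed.

Lemma reg_mul D m n p (g : T -> 'rV[K]_m) (h : T -> 'rV[K]_n) (A : 'M[K]_(n, p)) t0 :
  reg D g h t0 -> reg D g (fun t => h t *m A) t0.
Proof.
move=> [d [e [F [N [hF hN N0 FN]]]]]; exists d, e, (fun v => F v *m A), N.
split=> // [i|t Dt Nt].
  apply: (@form_ext _ _ _ (fun v => \sum_j F v 0 j * A j i)) => [v|].
    by rewrite mxE.
  by apply: form_sum => j _; apply: form_mulc.
exact: par_mul (FN t Dt Nt).
Qed.

(** Regularity at [t0] depends only on a neighbourhood, here cut out by a form in any map [k] that
    is itself regular in [g]: the form is pulled back along the local formula for [k] and joined to
    the denominator. *)
Lemma reg_loc D m n p e (g : T -> 'rV[K]_m) (h h' : T -> 'rV[K]_n)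
    (k : T -> 'rV[K]_p) (N : 'rV[K]_p -> K) t0 :
  D t0 -> reg D g k t0 -> isform e N -> N (k t0) != 0 ->
  (forall t, D t -> N (k t) != 0 -> par (h t) (h' t)) ->
  reg D g h t0 -> reg D g h' t0.
Proof.
move=> Dt0 [d1 [e1 [F1 [N1 [hF1 hN1 N10 FN1]]]]] hN N0 hh.
move=> [d2 [e2 [F2 [N2 [hF2 hN2 N20 FN2]]]]].
have par_N t : D t -> N1 (g t) != 0 -> (N (F1 (g t)) != 0) = (N (k t) != 0).
  move=> Dt Nt; have [a a0 ->] := FN1 t Dt Nt.
  by rewrite (form_scale _ _ hN) mulf_eq0 expf_eq0 (negPf a0) andbF.
exists d2, (e1 + (e2 + e * d1))%N, F2, (fun v => N1 v * (N2 v * N (F1 v))).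
split=> // [||t Dt].
- by apply: form_mul => //; apply: form_mul => //; apply: form_comp.
- by rewrite !mulf_neq0 // par_N.
rewrite !mulf_eq0 !negb_or => /and3P [n1 n2 n3].
by apply: par_trans (FN2 t Dt n2) (hh t Dt _); rewrite -par_N.
Qed.

Lemma reg_ext D m n (g : T -> 'rV[K]_m) (h h' : T -> 'rV[K]_n) t0 :
  (forall t, D t -> par (h t) (h' t)) -> reg D g h t0 -> reg D g h' t0.
Proof.
move=> hh [d [e [F [N [hF hN N0 FN]]]]]; exists d, e, F, N; split=> // t Dt Nt.
exact: par_trans (FN t Dt Nt) (hh t Dt).
Qed.

Lemma reg_trans D m n p (g : T -> 'rV[K]_m) (h : T -> 'rV[K]_n)
    (k : T -> 'rV[K]_p) t0 :
  D t0 -> reg D g h t0 -> reg D h k t0 -> reg D g k t0.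
Proof.
move=> Dt0 [d1 [e1 [F1 [N1 [hF1 hN1 N10 FN1]]]]].
move=> [d2 [e2 [F2 [N2 [hF2 hN2 N20 FN2]]]]].
have par_N t : D t -> N1 (g t) != 0 -> (N2 (F1 (g t)) != 0) = (N2 (h t) != 0).
  move=> Dt Nt; have [a a0 ->] := FN1 t Dt Nt.
  by rewrite (form_scale _ _ hN2) mulf_eq0 expf_eq0 (negPf a0) andbF.
exists (d2 * d1)%N, (e1 + e2 * d1)%N, (fun v => F2 (F1 v)),
  (fun v => N1 v * N2 (F1 v)); split=> [i| |//|t Dt].
- by apply: (@form_comp _ _ _ _ _ (fun u => F2 u 0 i)).
- by apply: form_mul => //; apply: form_comp.
- by rewrite mulf_neq0 // par_N.
rewrite mulf_eq0 negb_or => /andP [n1 n2].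
apply: par_trans (FN2 t Dt _); last by rewrite -par_N.
have [a a0 ->] := FN1 t Dt n1; exists (a ^+ d2); first exact: expf_neq0.
by apply/rowP => i; rewrite (form_scale a _ (hF2 i)) mxE.
Qed.

(** A test form vanishing on the smaller set vanishes on all of [S] once multiplied by the pulled
    back [N] and by the denominator, and these factors are nonzero at [t0]. *)
Lemma cont_loc D m n e (g : T -> 'rV[K]_m) (h : T -> 'rV[K]_n)
    (N : 'rV[K]_n -> K) S t0 :
  D t0 -> S `<=` D -> reg D g h t0 -> isform e N -> N (h t0) != 0 ->
  vclos (g @` S) (g t0) -> vclos (g @` (S `&` [set t | N (h t) != 0])) (g t0).
Proof.
move=> Dt0 SD [d1 [e1 [F1 [N1 [hF1 hN1 N10 FN1]]]]] hN N0 cl.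
have par_N t : D t -> N1 (g t) != 0 -> (N (F1 (g t)) != 0) = (N (h t) != 0).
  move=> Dt Nt; have [a a0 ->] := FN1 t Dt Nt.
  by rewrite (form_scale _ _ hN) mulf_eq0 expf_eq0 (negPf a0) andbF.
move=> d f hf fS.
have H : isform (d + (e1 + e * d1)) (fun v => f v * (N1 v * N (F1 v))).
  by apply: form_mul => //; apply: form_mul => //; apply: form_comp.
have /eqP : f (g t0) * (N1 (g t0) * N (F1 (g t0))) = 0.
  apply: (cl _ _ H) => u [t St <-]; have Dt := SD t St.
  have [->|n1] := eqVneq (N1 (g t)) 0; first by rewrite mul0r mulr0.
  have [->|] := eqVneq (N (F1 (g t))) 0; first by rewrite !mulr0.
  by rewrite par_N // => n2; rewrite fS ?mul0r //; exists t.
rewrite !mulf_eq0 (negPf N10) /=.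
by rewrite -[N _ == 0]negbK par_N // N0 orbF => /eqP.
Qed.

(** A form in [h], composed with the local formula and multiplied by the denominator, is a form in
    [g]; hence regular maps are continuous. *)
Lemma cont D m n (g : T -> 'rV[K]_m) (h : T -> 'rV[K]_n) S t0 :
  D t0 -> S `<=` D -> reg D g h t0 ->
  vclos (g @` S) (g t0) -> vclos (h @` S) (h t0).
Proof.
move=> Dt0 SD [d1 [e1 [F1 [N1 [hF1 hN1 N10 FN1]]]]] cl d f hf fS.
have H : isform (e1 + d * d1) (fun v => N1 v * f (F1 v)).
  by apply: form_mul => //; apply: form_comp.
have /(cl _ _ H) /eqP : forall u, (g @` S) u -> N1 u * f (F1 u) = 0.
  move=> u [t St <-]; have [->|n1] := eqVneq (N1 (g t)) 0; first by rewrite mul0r.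
  have [a a0 ->] := FN1 t (SD t St) n1.
  by rewrite (form_scale _ _ hf) fS ?mulr0 //; exists t.
rewrite mulf_eq0 (negPf N10) /=; have [a a0 ->] := FN1 t0 Dt0 N10.
by rewrite (form_scale _ _ hf) mulf_eq0 expf_eq0 (negPf a0) andbF => /eqP.
Qed.

Lemma cont_eq0 D m n (g : T -> 'rV[K]_m) (h : T -> 'rV[K]_n) S t0 :
  D t0 -> S `<=` D -> reg D g h t0 -> vclos (g @` S) (g t0) ->
  (forall t, S t -> h t = 0) -> h t0 = 0.
Proof.
move=> Dt0 SD hr /(cont Dt0 SD hr) cl h0; apply/rowP => i; rewrite mxE.
by apply: (cl _ _ (form_coord _ i)) => u [t St <-]; rewrite h0 ?mxE.
Qed.

End Reg.

Lemma reg_pull (K : numFieldType) T T' (D : set T) (D' : set T') (r : T' -> T) m n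
    (g : T -> 'rV[K]_m) (h : T -> 'rV[K]_n) t0 :
  (forall t, D' t -> D (r t)) -> reg D g h (r t0) ->
  reg D' (fun t => g (r t)) (fun t => h (r t)) t0.
Proof.
move=> DD [d [e [F [N [hF hN N0 FN]]]]]; exists d, e, F, N; split=> // t /DD.
exact: FN.
Qed.

(** * Isomorphisms from common parametrizations *)

Section Isomorphisms.
Variable K : numFieldType.
Implicit Types n m : nat.

(** The coordinates of the local formula are forms of one degree and scale alike, so the point of
    [h t] depends only on that of [g t]. *)
Lemma reg_par T (D : set T) m n (g : T -> 'rV[K]_m) (h : T -> 'rV[K]_n) t t' :
  D t -> D t' -> reg D g h t -> par (g t) (g t') -> par (h t) (h t').
Proof.
move=> Dt Dt' [d [e [F [N [hF hN N0 FN]]]]] pg; have [a a0 eg] := par_sym pg.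
have N0' : N (g t') != 0 by rewrite eg (form_scale _ _ hN) mulf_neq0 ?expf_neq0.
apply: par_trans (par_sym (FN t Dt N0)) (par_trans _ (FN t' Dt' N0')).
exists (a^-1 ^+ d); first by rewrite expf_neq0 ?invr_eq0.
apply/rowP => i; rewrite eg mxE (form_scale a (g t) (hF i)) mulrA -exprMn.
by rewrite mulVf // expr1n mul1r.
Qed.

Lemma regular_of_reg T (D : set T) m n (g : T -> 'rV[K]_m) (h : T -> 'rV[K]_n)
    (X : set (pspace K m)) (f : pspace K m -> pspace K n) :
  (forall t, D t -> h t != 0) -> (forall t, D t -> reg D g h t) ->
  (forall p, X p -> exists2 t, D t & coords p (g t)) ->
  (forall t p, D t -> coords p (g t) -> coords (f p) (h t)) ->
  regular_on X f.
Proof.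
move=> h0 hr XD fh x /XD [t Dt xt]; have [d [e [F [N [hF hN N0 FN]]]]] := hr t Dt.
(* [regular_on] has no separate denominator: [N] is multiplied into the coordinates, whose common
   zeros then absorb the locus where the formula may fail. *)
have /choice [P hP] : forall i, exists P : {mpoly K[m]},
    P \is (e + d).-homog /\ forall v : 'rV_m, N v * F v 0 i = P.@[v 0].
  by move=> i; have [P h1 h2] := form_mul hN (hF i); exists P.
exists (e + d)%N, P; split=> [i| |y v /XD [t' Dt' yt'] yv [i Pi0]].
- by case: (hP i).
- have [a a0 eF] := FN t Dt N0; have /rV0Pn [i hi] := h0 t Dt.
  exists i => /(_ _ xt); rewrite -(hP i).2 eF mxE => /eqP.
  by rewrite !mulf_eq0 (negPf N0) (negPf a0) (negPf hi).
move: Pi0; rewrite -(hP i).2 mulf_eq0 negb_or => /andP [Nv _].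
have [a a0 ev] : par v (g t') by apply/(coords_par _ yv).
have -> : \row_i (P i).@[v 0] = N v *: F v by apply/rowP => j; rewrite !mxE -(hP j).2.
apply/(coords_par _ (fh t' y Dt' yt')); apply: par_sym.
apply: par_trans (par_scale _ Nv) _; have N' : N (g t') != 0.
  by move: Nv; rewrite ev (form_scale _ _ hN) mulf_eq0 negb_or => /andP [].
apply: par_trans (FN t' Dt' N'); exists (a ^+ d); first exact: expf_neq0.
by apply/rowP => j; rewrite ev (form_scale a _ (hF j)) mxE.
Qed.

(** The common parameter set makes the graph of the isomorphism part of the data, so no formula
    between the ambient spaces is needed, and [T] may consist of flags or of pairs of flags. The
    values [p0] and [q0] are taken outside X and Y. *)
Lemma iso_param T (D : set T) m n (g : T -> 'rV[K]_m) (h : T -> 'rV[K]_n)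
    (X : set (pspace K m)) (Y : set (pspace K n)) (p0 : pspace K m) (q0 : pspace K n) :
  (forall t, D t -> g t != 0 /\ h t != 0) ->
  (forall t, D t -> reg D g h t) -> (forall t, D t -> reg D h g t) ->
  (forall p, X p <-> exists2 t, D t & coords p (g t)) ->
  (forall q, Y q <-> exists2 t, D t & coords q (h t)) ->
  exists2 f, is_iso X Y f
    & forall t p q, D t -> coords p (g t) -> coords q (h t) -> f p = q.
Proof.
move=> gh0 rgh rhg HX HY.
have mk a b (u : T -> 'rV[K]_a) (v : T -> 'rV[K]_b) (r0 : pspace K b) :
    (forall t, D t -> v t != 0) -> (forall t, D t -> reg D u v t) ->
    exists f : pspace K a -> pspace K b,
      forall t p, D t -> coords p (u t) -> coords (f p) (v t).
  move=> v0 ruv; have /choice [f hf] : forall p : pspace K a, exists q : pspace K b,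
      forall t, D t -> coords p (u t) -> coords q (v t).
    move=> p; have [[t Dt pt]|np] := pselect (exists2 t, D t & coords p (u t)).
      have [q qt] := coords_ex (v0 t Dt); exists q => t' Dt' pt'.
      apply/(coords_par _ qt)/(reg_par Dt Dt' (ruv t Dt)).
      exact/(coords_par _ pt).
    by exists r0 => t Dt pt; case: np; exists t.
  by exists f => t p Dt pt; apply: hf.
have [f hf] := mk _ _ g h q0 (fun t Dt => (gh0 t Dt).2) rgh.
have [f' hf'] := mk _ _ h g p0 (fun t Dt => (gh0 t Dt).1) rhg.
exists f; last first.
  by move=> t p q Dt pt qt; apply: coords_inj (hf t p Dt pt) qt.
exists f'; split.
- apply: (@regular_of_reg _ D _ _ g h) => // [t /gh0 []//|p /HX //].
- apply: (@regular_of_reg _ D _ _ h g) => // [t /gh0 []//|p /HY //].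
- move=> p /HX [t Dt pt]; have qt := hf t p Dt pt; split; first by apply/HY; exists t.
  exact: coords_inj (hf' t _ Dt qt) pt.
- move=> q /HY [t Dt qt]; have pt := hf' t q Dt qt; split; first by apply/HX; exists t.
  exact: coords_inj (hf t _ Dt pt) qt.
Qed.

Lemma image_pc T (D S : set T) m n (g : T -> 'rV[K]_m) (h : T -> 'rV[K]_n)
    (X : set (pspace K m)) (Y : set (pspace K n)) (f : pspace K m -> pspace K n) :
  (forall t, D t -> g t != 0 /\ h t != 0) ->
  (forall t, D t -> reg D g h t) -> (forall t, D t -> reg D h g t) ->
  (forall p, X p -> exists2 t, D t & coords p (g t)) ->
  (forall q, Y q -> exists2 t, D t & coords q (h t)) ->
  (forall t p q, D t -> coords p (g t) -> coords q (h t) -> f p = q) ->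
  S `<=` D -> pc (g @` S) `<=` X -> pc (h @` S) `<=` Y ->
  f @` pc (g @` S) = pc (h @` S).
Proof.
move=> gh0 rgh rhg HX HY fgh SD gX hY; apply/seteqP; split=> [_ [p Sp <-]|q Sq].
  have [t Dt pt] := HX p (gX p Sp); have [q qt] := coords_ex (gh0 t Dt).2.
  rewrite (fgh t p q Dt pt qt); apply/(pcE _ qt)/(cont Dt SD (rgh t Dt)).
  exact/(pcE _ pt).
have [t Dt qt] := HY q (hY q Sq); have [p pt] := coords_ex (gh0 t Dt).1.
exists p; last exact: fgh pt qt.
apply/(pcE _ pt)/(cont Dt SD (rhg t Dt)); exact/(pcE _ qt).
Qed.

Lemma reg_of_regular m n (X : set (pspace K m)) (f : pspace K m -> pspace K n) x :
  X x -> regular_on X f -> reg X (@rep K m) (fun p => rep (f p)) x.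
Proof.
move=> Xx /(_ x Xx) [d [F [hF [i Fi] H]]].
exists d, d, (fun v => \row_i (F i).@[v 0]), (fun v => (F i).@[v 0]); split.
- by move=> j; exists (F j) => // v; rewrite mxE.
- by exists (F i).
- apply: contra_notN Fi => /eqP Fi; exact/(vanishE (hF i) (coords_rep x)).
- move=> y Xy Fy; apply/coords_eqP; apply: H => //; first exact: coords_rep.
  by exists i.
Qed.

Lemma is_iso_trans m n k (X : set (pspace K m)) (Y : set (pspace K n))
    (Z : set (pspace K k)) f g :
  is_iso X Y f -> is_iso Y Z g -> is_iso X Z (g \o f).
Proof.
have tr a b c (A : set (pspace K a)) (B : set (pspace K b)) (u : pspace K a -> pspace K b)
    (v : pspace K b -> pspace K c) : regular_on A u -> regular_on B v ->
    (forall x, A x -> B (u x)) -> regular_on A (v \o u).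
  move=> ru rv AB; apply: (@regular_of_reg _ A _ _ (@rep K a) (fun p => rep (v (u p)))).
  - by move=> t _; apply: rep_neq0.
  - move=> t At; apply: (reg_trans At (reg_of_regular At ru)).
    exact: (reg_pull AB (reg_of_regular (AB t At) rv)).
  - by move=> p Ap; exists p => //; apply: coords_rep.
  - move=> t p At /coords_inj -/(_ t (coords_rep t)) ->; exact: coords_rep.
move=> [f' [rf rf' ff' f'f]] [g' [rg rg' gg' g'g]].
exists (f' \o g'); split.
- by apply: tr rf rg _ => x /ff' [].
- by apply: tr rg' rf' _ => x /g'g [].
- move=> x /ff' [Yf e] /=; have [Zg e'] := gg' _ Yf; split=> //.
  by rewrite e'.
- move=> z /g'g [Yg e] /=; have [Xf e'] := f'f _ Yg; split=> //.
  by rewrite e'.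
Qed.

Lemma isomorphic_trans m n k (X : set (pspace K m)) (Y : set (pspace K n))
    (Z : set (pspace K k)) :
  isomorphic X Y -> isomorphic Y Z -> isomorphic X Z.
Proof. by move=> [f hf] [g hg]; exists (g \o f); apply: is_iso_trans hf hg. Qed.

Lemma is_iso_sym m n (X : set (pspace K m)) (Y : set (pspace K n)) f :
  is_iso X Y f -> exists2 g, is_iso Y X g
    & [/\ forall x, X x -> g (f x) = x & forall y, Y y -> f (g y) = y].
Proof.
move=> [g [rf rg fg gf]]; exists g; first by exists f.
by split=> [x /fg []|y /gf []].
Qed.

Lemma isomorphic_sym m n (X : set (pspace K m)) (Y : set (pspace K n)) :
  isomorphic X Y -> isomorphic Y X.
Proof. by move=> [f /is_iso_sym [g hg _]]; exists g. Qed.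

Lemma is_iso_restr m n (X : set (pspace K m)) (Y : set (pspace K n)) f
    (A : set (pspace K m)) (B : set (pspace K n)) :
  is_iso X Y f -> A `<=` X -> f @` A = B ->
  is_iso A B f /\ is_iso (X `\` A) (Y `\` B) f.
Proof.
move=> [g [rf rg fg gf]] AX fAB.
have sub a b (U V : set (pspace K a)) (u : pspace K a -> pspace K b) :
    U `<=` V -> regular_on V u -> regular_on U u.
  move=> UV ru x /UV /ru [d [F [h1 h2 h3]]]; exists d, F; split=> // y v /UV.
  exact: h3.
have BY : B `<=` Y by rewrite -fAB => _ [x /AX /fg [Yx _] <-].
split; exists g; split.
- exact: sub AX rf.
- exact: sub BY rg.
- move=> x Ax; split; last by case: (fg x (AX x Ax)).
  by rewrite -fAB; exists x.
- rewrite -fAB => _ [x Ax <-]; rewrite (fg x (AX x Ax)).2; split=> //.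
- by apply: sub rf => x [].
- by apply: sub rg => x [].
- move=> x [Xx nAx]; have [Yx e] := fg x Xx; split=> //; split=> //.
  rewrite -fAB => -[x' Ax' e']; apply: nAx.
  by rewrite -e -e' (fg x' (AX x' Ax')).2.
- move=> y [Yy nBy]; have [Xy e] := gf y Yy; split=> //; split=> //.
  by move=> Agy; apply: nBy; rewrite -fAB; exists (g y).
Qed.

End Isomorphisms.

(** * Segre and Pluecker coordinates *)

Section Tensors.
Variable K : numFieldType.
Implicit Types n m : nat.

Definition tens m n (u : 'rV[K]_m) (v : 'rV[K]_n) : 'rV[K]_(m * n) :=
  mxvec (u^T *m v).

Lemma tensE m n (u : 'rV[K]_m) (v : 'rV[K]_n) i j :
  tens u v 0 (mxvec_index i j) = u 0 i * v 0 j.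
Proof. by rewrite mxvecE mxE big_ord1 mxE. Qed.

Lemma tens_ext m n (w w' : 'rV[K]_(m * n)) :
  (forall i j, w 0 (mxvec_index i j) = w' 0 (mxvec_index i j)) -> w = w'.
Proof. by move=> H; apply/rowP => k; case/mxvec_indexP: k => i j. Qed.

Lemma tensZ m n a b (u : 'rV[K]_m) (v : 'rV[K]_n) :
  tens (a *: u) (b *: v) = (a * b) *: tens u v.
Proof. by apply: tens_ext => i j; rewrite mxE !tensE !mxE; ring. Qed.

Lemma tens_eq0 m n (u : 'rV[K]_m) (v : 'rV[K]_n) :
  (tens u v == 0) = (u == 0) || (v == 0).
Proof.
apply/eqP/orP => [t0|[/eqP ->|/eqP ->]]; last 2 first.
- by apply: tens_ext => i j; rewrite tensE !mxE mul0r.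
- by apply: tens_ext => i j; rewrite tensE !mxE mulr0.
have [_|/rV0Pn [i ui]] := eqVneq u 0; [by left|right].
apply/eqP/rowP => j; rewrite mxE; have := tensE u v i j.
by rewrite t0 mxE => /esym/eqP; rewrite mulf_eq0 (negPf ui) => /eqP.
Qed.

Lemma tens_neq0 m n (u : 'rV[K]_m) (v : 'rV[K]_n) :
  u != 0 -> v != 0 -> tens u v != 0.
Proof. by move=> u0 v0; rewrite tens_eq0 negb_or u0. Qed.

Lemma par_tens m n (u u' : 'rV[K]_m) (v v' : 'rV[K]_n) :
  par u u' -> par v v' -> par (tens u v) (tens u' v').
Proof.
by move=> [a a0 ->] [b b0 ->]; exists (a * b); rewrite ?mulf_neq0 ?tensZ.
Qed.

Lemma tens_par m n (u u' : 'rV[K]_m) (v v' : 'rV[K]_n) : u != 0 -> v != 0 ->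
  par (tens u v) (tens u' v') -> par u u' /\ par v v'.
Proof.
move=> u0 v0 [a a0 e]; have : tens u' v' != 0.
  by apply: contraNneq (tens_neq0 u0 v0) => t0; rewrite e t0 scaler0.
rewrite tens_eq0 negb_or => /andP [u0' v0'].
have E i j : u 0 i * v 0 j = a * (u' 0 i * v' 0 j) by rewrite -!tensE e mxE.
move: (u0) (v0) => /rV0Pn [i0 ui0] /rV0Pn [j0 vj0].
have n0 : u' 0 i0 * v' 0 j0 != 0.
  by apply: contraNneq (mulf_neq0 ui0 vj0) => t0; rewrite E t0 mulr0.
move: n0; rewrite mulf_eq0 negb_or => /andP [ui0' vj0']; split.
  exists (a * v' 0 j0 / v 0 j0); first by rewrite !mulf_neq0 ?invr_eq0.
  apply/rowP => i; rewrite mxE; apply: (mulIf vj0); rewrite E; field.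
  by rewrite vj0.
exists (a * u' 0 i0 / u 0 i0); first by rewrite !mulf_neq0 ?invr_eq0.
apply/rowP => i; rewrite mxE; apply: (mulfI ui0); rewrite E; field.
by rewrite ui0.
Qed.

Lemma wedgeE n (x q : 'rV[K]_n) i j :
  wedge x q 0 (mxvec_index i j) = x 0 i * q 0 j - x 0 j * q 0 i.
Proof. by rewrite mxvecE !mxE !big_ord1 !mxE; ring. Qed.

Lemma wedgeZ n a b (x q : 'rV[K]_n) : wedge (a *: x) (b *: q) = (a * b) *: wedge x q.
Proof. by apply: tens_ext => i j; rewrite mxE !wedgeE !mxE; ring. Qed.

Lemma wedgeDl n (x y q : 'rV[K]_n) : wedge (x + y) q = wedge x q + wedge y q.
Proof. by apply: tens_ext => i j; rewrite mxE !wedgeE !mxE; ring. Qed.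

Lemma wedgeZl n a (x q : 'rV[K]_n) : wedge (a *: x) q = a *: wedge x q.
Proof. by apply: tens_ext => i j; rewrite mxE !wedgeE !mxE; ring. Qed.

Lemma wedgexx n (x : 'rV[K]_n) : wedge x x = 0.
Proof. by apply: tens_ext => i j; rewrite wedgeE mxE; ring. Qed.

Lemma par_wedge n (x q x' q' : 'rV[K]_n) :
  par x x' -> par q q' -> par (wedge x q) (wedge x' q').
Proof.
by move=> [a a0 ->] [b b0 ->]; exists (a * b); rewrite ?mulf_neq0 ?wedgeZ.
Qed.

Lemma wedge_eq0 n (x q : 'rV[K]_n) : q != 0 -> wedge x q = 0 -> exists a, x = a *: q.
Proof.
move=> /rV0Pn [j qj] w0; exists (x 0 j / q 0 j); apply/rowP => i; rewrite mxE.
have := wedgeE x q i j; rewrite w0 mxE => /esym/eqP; rewrite subr_eq0 => /eqP e.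
by apply: (mulIf qj); rewrite e; field.
Qed.

Lemma wedge_par n (x q : 'rV[K]_n) : x != 0 -> q != 0 ->
  (wedge x q == 0) <-> par x q.
Proof.
move=> x0 q0; split=> [/eqP /(wedge_eq0 q0) [a e]|[a a0 ->]].
  by exists a => //; apply: contraNneq x0 => a0; rewrite e a0 scale0r.
by rewrite wedgeZl wedgexx scaler0.
Qed.

Section RegTens.
Variables (T : Type) (D : set T).

Lemma reg_tens m n p (g : T -> 'rV[K]_p) (u : T -> 'rV[K]_m) (v : T -> 'rV[K]_n) t0 :
  reg D g u t0 -> reg D g v t0 -> reg D g (fun t => tens (u t) (v t)) t0.
Proof.
move=> [d1 [e1 [F1 [N1 [hF1 hN1 N10 FN1]]]]] [d2 [e2 [F2 [N2 [hF2 hN2 N20 FN2]]]]].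
exists (d1 + d2)%N, (e1 + e2)%N, (fun w => tens (F1 w) (F2 w)), (fun w => N1 w * N2 w).
split.
- move=> k; case/mxvec_indexP: k => i j.
  apply: (@form_ext _ _ _ (fun w => F1 w 0 i * F2 w 0 j)) => [w|].
    by rewrite tensE.
  exact: form_mul.
- exact: form_mul.
- exact: mulf_neq0.
move=> t Dt; rewrite mulf_eq0 negb_or => /andP [n1 n2].
by apply: par_tens; [apply: FN1|apply: FN2].
Qed.

(** The projection from a Segre product is regular: the entries of the tensor along an index [b]
    with [v_b] nonzero are [v_b] times those of [u]. *)
Lemma reg_tensl m n (u : T -> 'rV[K]_m) (v : T -> 'rV[K]_n) t0 :
  u t0 != 0 -> v t0 != 0 -> reg D (fun t => tens (u t) (v t)) u t0.
Proof.
move=> /rV0Pn [a ua] /rV0Pn [b vb].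
exists 1%N, 1%N, (fun w => \row_i w 0 (mxvec_index i b)), (fun w => w 0 (mxvec_index a b)).
split.
- move=> i; apply: (@form_ext _ _ _ (fun w => w 0 (mxvec_index i b))) => [w|].
    by rewrite mxE.
  exact: form_coord.
- exact: form_coord.
- by rewrite tensE mulf_neq0.
move=> t _; rewrite tensE mulf_eq0 negb_or => /andP [_ vb']; exists (v t 0 b) => //.
by apply/rowP => i; rewrite !mxE tensE mulrC.
Qed.

Lemma reg_tensr m n (u : T -> 'rV[K]_m) (v : T -> 'rV[K]_n) t0 :
  u t0 != 0 -> v t0 != 0 -> reg D (fun t => tens (u t) (v t)) v t0.
Proof.
move=> /rV0Pn [a ua] /rV0Pn [b vb].
exists 1%N, 1%N, (fun w => \row_j w 0 (mxvec_index a j)), (fun w => w 0 (mxvec_index a b)).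
split.
- move=> i; apply: (@form_ext _ _ _ (fun w => w 0 (mxvec_index a i))) => [w|].
    by rewrite mxE.
  exact: form_coord.
- exact: form_coord.
- by rewrite tensE mulf_neq0.
move=> t _; rewrite tensE mulf_eq0 negb_or => /andP [ua' _]; exists (u t 0 a) => //.
by apply/rowP => i; rewrite !mxE tensE.
Qed.

Lemma reg_wedge n p (g : T -> 'rV[K]_p) (u : T -> 'rV[K]_n) (q : 'rV[K]_n) t0 :
  D t0 -> reg D g u t0 -> reg D g (fun t => wedge (u t) q) t0.
Proof.
move=> Dt0 /(reg_trans Dt0); apply.
apply: (@reg_forms _ _ _ _ _ 1 u (fun w => wedge w q)) => k.
case/mxvec_indexP: k => i j.
apply: (@form_ext _ _ _ (fun w => w 0 i * q 0 j - w 0 j * q 0 i)) => [w|].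
  by rewrite wedgeE.
by apply: form_sub; apply: form_mulc; apply: form_coord.
Qed.

Lemma reg_wedge2 n p (g : T -> 'rV[K]_p) (u v : T -> 'rV[K]_n) t0 :
  D t0 -> reg D g u t0 -> reg D g v t0 -> reg D g (fun t => wedge (u t) (v t)) t0.
Proof.
move=> Dt0 ru rv; apply: (reg_trans Dt0 (reg_tens ru rv)).
pose F (w : 'rV[K]_(n * n)) := mxvec (\matrix_(i, j)
  (w 0 (mxvec_index i j) - w 0 (mxvec_index j i))).
apply: (@reg_ext _ _ _ _ _ _ (fun t => F (tens (u t) (v t)))).
  move=> t _; rewrite (_ : F _ = wedge (u t) (v t)); first exact: par_refl.
  by apply: tens_ext => i j; rewrite mxvecE mxE !tensE wedgeE.
apply: (@reg_forms _ _ _ _ _ 1) => k; case/mxvec_indexP: k => i j.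
apply: (@form_ext _ _ _ (fun w => w 0 (mxvec_index i j) - w 0 (mxvec_index j i))) => [w|].
  by rewrite mxvecE mxE.
by apply: form_sub; apply: form_coord.
Qed.

End RegTens.

(** The 2 by 2 minors are forms vanishing on decomposable tensors, hence at [w]; a nonzero entry of
    [w] then gives the two factors as a column and a normalized row. *)
Lemma tens_closed m n (S : set 'rV[K]_(m * n)) w :
  (forall w', S w' -> exists u v, w' = tens u v) -> vclos S w ->
  exists u v, w = tens u v.
Proof.
move=> hS cl; have [->|/rV0Pn [k]] := eqVneq w 0.
  by exists 0, 0; apply/esym/eqP; rewrite tens_eq0 eqxx.
case/mxvec_indexP: k => a b wab.
exists (\row_i w 0 (mxvec_index i b)), ((w 0 (mxvec_index a b))^-1 *: \row_j w 0 (mxvec_index a j)).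
apply: tens_ext => i j; rewrite tensE !mxE.
have /eqP : w 0 (mxvec_index i j) * w 0 (mxvec_index a b) -
    w 0 (mxvec_index i b) * w 0 (mxvec_index a j) = 0.
  apply: (cl 2%N (fun w => w 0 (mxvec_index i j) * w 0 (mxvec_index a b) -
    w 0 (mxvec_index i b) * w 0 (mxvec_index a j))).
    by apply: form_sub; apply: (@form_mul _ _ 1 1); apply: form_coord.
  by move=> w' /hS [u [v ->]]; rewrite !tensE; ring.
rewrite subr_eq0 => /eqP e; apply: (mulIf wab); rewrite e.
by field.
Qed.

Section Segre.
Variable n : nat.
Implicit Types (x : 'rV[K]_n) (l : nat -> 'rV[K]_(n * n)).

Lemma segreS k x l : segre k.+1 x l = tens (segre k x l) (l k).
Proof. by []. Qed.

Lemma segre_neq0 k x l : x != 0 -> (forall i, (i < k)%N -> l i != 0) ->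
  segre k x l != 0.
Proof.
move=> x0; elim: k => [//|k IH] l0; rewrite segreS tens_neq0 ?l0 ?ltnS //.
by apply: IH => i ik; apply: l0; rewrite ltnW.
Qed.

Lemma segre_eq0 k x l : segre k x l != 0 ->
  x != 0 /\ forall i, (i < k)%N -> l i != 0.
Proof.
elim: k => [//|k IH]; rewrite segreS tens_eq0 negb_or => /andP [/IH [x0 l0] lk].
by split=> // i; rewrite ltnS leq_eqVlt => /orP [/eqP -> //|ik]; apply: l0.
Qed.

Lemma par_segre k x x' l l' : par x x' -> (forall i, (i < k)%N -> par (l i) (l' i)) ->
  par (segre k x l) (segre k x' l').
Proof.
move=> xx; elim: k => [//|k IH] ll; rewrite !segreS; apply: par_tens; last exact: ll.
by apply: IH => i ik; apply: ll; rewrite ltnW.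
Qed.

Lemma segre_par k x x' l l' : segre k x l != 0 ->
  par (segre k x l) (segre k x' l') ->
  par x x' /\ forall i, (i < k)%N -> par (l i) (l' i).
Proof.
elim: k => [//|k IH]; rewrite !segreS tens_eq0 negb_or => /andP [s0 lk].
move=> /(tens_par s0 lk) [/(IH s0) [xx ll] lkk]; split=> // i.
by rewrite ltnS leq_eqVlt => /orP [/eqP -> //|]; apply: ll.
Qed.

Lemma eq_segre k x l l' : (forall i, (i < k)%N -> l i = l' i) ->
  segre k x l = segre k x l'.
Proof.
elim: k => [//|k IH] ll; rewrite !segreS ll // IH // => i ik.
by apply: ll; rewrite ltnW.
Qed.

Lemma segre_closed k (S : set 'rV[K]_(bldim n k)) w : w != 0 ->
  (forall w', S w' -> exists x l, w' = segre k x l) -> vclos S w ->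
  exists x l, w = segre k x l.
Proof.
elim: k S w => [|k IH] S w w0 hS cl; first by exists w, (fun=> 0).
have [u [v e]] : exists u v, w = tens u v.
  by apply: tens_closed cl => w' /hS [x [l ->]]; exists (segre k x l), (l k).
have /andP [u0 v0] : (u != 0) && (v != 0) by rewrite -negb_or -tens_eq0 -e.
have [x [l eu]] : exists x l, u = segre k x l.
  (* The last factor is split off and the induction hypothesis applied to the closure of the
     remaining ones, since projecting away the last factor is continuous. *)
  pose D := [set uv : 'rV[K]_(bldim n k) * 'rV[K]_(n * n) | uv.1 != 0 /\ uv.2 != 0].
  pose S' := [set uv : 'rV[K]_(bldim n k) * 'rV[K]_(n * n) |
    [/\ uv.1 != 0, uv.2 != 0, exists x l, uv.1 = segre k x l & S (tens uv.1 uv.2)]].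
  apply: (IH [set uv.1 | uv in S']) => //.
    by move=> _ [[u' v'] [_ _ ? _] <-].
  apply: (@cont _ _ D _ _ (fun uv => tens uv.1 uv.2) fst S' (u, v)).
  - by split.
  - by move=> uv [].
  - exact: reg_tensl.
  rewrite /= -e; apply: vclos_mono (vclos_neq0 w0 cl) => w' [Sw' w0'].
  exists w'; last exact: par_refl; have [x [l ew']] := hS w' Sw'.
  move: w0'; rewrite ew' segreS tens_eq0 negb_or => /andP [a b].
  by exists (segre k x l, l k) => //; split=> //; [exists x, l|rewrite -segreS -ew'].
exists x, (fun i => if i == k then v else l i); rewrite e eu segreS eqxx.
by congr tens; apply: eq_segre => i ik; rewrite ltn_eqF.
Qed.

Section RegSegre.
Variables (T : Type) (D : set T) (x : T -> 'rV[K]_n) (l : T -> nat -> 'rV[K]_(n * n)).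

Lemma reg_segre k p (g : T -> 'rV[K]_p) t0 : reg D g x t0 ->
  (forall i, (i < k)%N -> reg D g (l ^~ i) t0) ->
  reg D g (fun t => segre k (x t) (l t)) t0.
Proof.
move=> rx; elim: k => [//|k IH] rl; apply: reg_tens; last exact: rl.
by apply: IH => i ik; apply: rl; rewrite ltnW.
Qed.

Lemma segre_regx k t0 : D t0 -> segre k (x t0) (l t0) != 0 ->
  reg D (fun t => segre k (x t) (l t)) x t0.
Proof.
move=> Dt0; elim: k => [_|k IH]; first exact: reg_refl.
rewrite segreS tens_eq0 negb_or => /andP [s0 lk].
by apply: reg_trans Dt0 _ (IH s0); apply: reg_tensl.
Qed.

Lemma segre_regl k i t0 : D t0 -> segre k (x t0) (l t0) != 0 -> (i < k)%N ->
  reg D (fun t => segre k (x t) (l t)) (l ^~ i) t0.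
Proof.
move=> Dt0; elim: k => [//|k IH]; rewrite segreS tens_eq0 negb_or => /andP [s0 lk].
rewrite ltnS leq_eqVlt => /orP [/eqP ->|ik]; first exact: reg_tensr.
by apply: reg_trans Dt0 _ (IH s0 ik); apply: reg_tensl.
Qed.

End RegSegre.

End Segre.

End Tensors.

(** * Polynomial arcs *)

Section Arcs.
Variable K : numFieldType.
Implicit Types (n m k : nat) (s : K) (E : seq K) (P Q : K -> Prop).

(** For all but finitely many parameters. No topology on the field enters: limits along an arc come
    from polynomial identities. *)
Definition cof P : Prop := exists E, forall s, s \notin E -> P s.

Lemma cof_true P : (forall s, P s) -> cof P.
Proof. by move=> h; exists [::]. Qed.

Lemma cof_imp P Q : (forall s, P s -> Q s) -> cof P -> cof Q.
Proof. by move=> PQ [E hE]; exists E => s /hE /PQ. Qed.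

Lemma cof_and P Q : cof P -> cof Q -> cof (fun s => P s /\ Q s).
Proof.
move=> [E hE] [E' hE']; exists (E ++ E') => s.
by rewrite mem_cat negb_or => /andP [/hE ? /hE' ?].
Qed.

Lemma cof_all k (R : nat -> K -> Prop) :
  (forall i, (i < k)%N -> cof (R i)) -> cof (fun s => forall i, (i < k)%N -> R i s).
Proof.
elim: k => [|k IH] h; first exact: cof_true.
have := cof_and (IH (fun i ik => h i (ltnW ik))) (h k (ltnSn k)).
apply: cof_imp => s [h1 h2] i; rewrite ltnS leq_eqVlt => /orP [/eqP -> //|].
exact: h1.
Qed.

Lemma cof_neq s0 : cof (fun s => s != s0).
Proof. by exists [:: s0] => s; rewrite inE. Qed.

Lemma cof_ex P : cof P -> exists s, P s.
Proof.
move=> [E hE]; pose r := [seq i%:R : K | i <- iota 0 (size E).+1].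
have ur : uniq r.
  rewrite map_inj_in_uniq ?iota_uniq // => i j _ _ /eqP.
  by rewrite eqr_nat => /eqP.
have [/allP rE|/allPn [s _ /hE]] := boolP (all (mem E) r); last by exists s.
by have := uniq_leq_size ur rE; rewrite size_map size_iota ltnn.
Qed.

Definition ispoly (f : K -> K) : Prop := exists p : {poly K}, forall s, f s = p.[s].

Lemma ispoly_ext (f g : K -> K) : f =1 g -> ispoly f -> ispoly g.
Proof. by move=> fg [p hp]; exists p => s; rewrite -fg. Qed.

Lemma ispoly_cst a : ispoly (fun=> a).
Proof. by exists a%:P => s; rewrite hornerC. Qed.

Lemma ispoly_id : ispoly id.
Proof. by exists 'X => s; rewrite hornerX. Qed.

Lemma ispoly_horner (p : {poly K}) : ispoly (horner p).
Proof. by exists p. Qed.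

Lemma ispoly_add (f g : K -> K) : ispoly f -> ispoly g -> ispoly (fun s => f s + g s).
Proof. by move=> [p hp] [q hq]; exists (p + q) => s; rewrite hornerD hp hq. Qed.

Lemma ispoly_mul (f g : K -> K) : ispoly f -> ispoly g -> ispoly (fun s => f s * g s).
Proof. by move=> [p hp] [q hq]; exists (p * q) => s; rewrite hornerM hp hq. Qed.

Lemma ispoly_opp (f : K -> K) : ispoly f -> ispoly (fun s => - f s).
Proof. by move=> [p hp]; exists (- p) => s; rewrite hornerN hp. Qed.

Lemma ispoly_sub (f g : K -> K) : ispoly f -> ispoly g -> ispoly (fun s => f s - g s).
Proof. by move=> hf hg; apply: ispoly_add => //; apply: ispoly_opp. Qed.

Lemma ispoly_sum I (r : seq I) (f : I -> K -> K) :
  (forall i, ispoly (f i)) -> ispoly (fun s => \sum_(i <- r) f i s).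
Proof.
move=> hf; elim: r => [|i r IH].
  by apply: ispoly_ext (ispoly_cst 0) => s; rewrite big_nil.
by apply: ispoly_ext (ispoly_add (hf i) IH) => s; rewrite big_cons.
Qed.

Lemma ispoly_cof (f : K -> K) s0 : ispoly f -> f s0 != 0 -> cof (fun s => f s != 0).
Proof.
move=> [p hp] fs0; apply: contrapT => nc.
have H k : exists r : seq K, [/\ size r = k, uniq r & all (root p) r].
  elim: k => [|k [r [sr ur rr]]]; first by exists [::].
  have /existsNP [s /not_implyP [sr' /negP]] : ~ forall s, s \notin r -> f s != 0.
    by move=> h; apply: nc; exists r.
  rewrite negbK hp => fs; exists (s :: r); rewrite /= sr sr' ur rr.
  by split=> //; rewrite /root fs.
have [r [sr ur rr]] := H (size p); have p0 : p != 0.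
  by apply: contraNneq fs0 => p0; rewrite hp p0 horner0.
by have := max_poly_roots p0 rr ur; rewrite sr ltnn.
Qed.

Lemma ispoly_eq0 (f : K -> K) : ispoly f -> cof (fun s => f s = 0) -> forall s, f s = 0.
Proof.
move=> hf cf s; apply/eqP; apply: contraT => fs.
have [s' [e]] := cof_ex (cof_and cf (ispoly_cof hf fs)).
by rewrite e eqxx.
Qed.

Definition ispolyv n (f : K -> 'rV[K]_n) : Prop := forall i, ispoly (fun s => f s 0 i).

Lemma ispolyv_cst n (v : 'rV[K]_n) : ispolyv (fun=> v).
Proof. by move=> i; apply: ispoly_cst. Qed.

Lemma ispolyv_add n (f g : K -> 'rV[K]_n) :
  ispolyv f -> ispolyv g -> ispolyv (fun s => f s + g s).
Proof.
by move=> hf hg i; apply: ispoly_ext (ispoly_add (hf i) (hg i)) => s; rewrite mxE.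
Qed.

Lemma ispolyv_scale n (a : K -> K) (f : K -> 'rV[K]_n) :
  ispoly a -> ispolyv f -> ispolyv (fun s => a s *: f s).
Proof.
by move=> ha hf i; apply: ispoly_ext (ispoly_mul ha (hf i)) => s; rewrite mxE.
Qed.

Lemma ispolyv_mul n m (f : K -> 'rV[K]_n) (A : 'M_(n, m)) :
  ispolyv f -> ispolyv (fun s => f s *m A).
Proof.
move=> hf i; apply: (@ispoly_ext (fun s => \sum_j f s 0 j * A j i)) => [s|].
  by rewrite mxE.
by apply: ispoly_sum => j; apply: ispoly_mul => //; apply: ispoly_cst.
Qed.

Lemma ispolyv_tens n m (f : K -> 'rV[K]_n) (g : K -> 'rV[K]_m) :
  ispolyv f -> ispolyv g -> ispolyv (fun s => tens (f s) (g s)).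
Proof.
move=> hf hg k; case/mxvec_indexP: k => i j.
by apply: ispoly_ext (ispoly_mul (hf i) (hg j)) => s; rewrite tensE.
Qed.

Lemma ispolyv_wedge n (f g : K -> 'rV[K]_n) :
  ispolyv f -> ispolyv g -> ispolyv (fun s => wedge (f s) (g s)).
Proof.
move=> hf hg k; case/mxvec_indexP: k => i j.
apply: ispoly_ext (ispoly_sub (ispoly_mul (hf i) (hg j)) (ispoly_mul (hf j) (hg i))) => s.
by rewrite wedgeE.
Qed.

Lemma ispolyv_segre n k (f : K -> 'rV[K]_n) (l : K -> nat -> 'rV[K]_(n * n)) :
  ispolyv f -> (forall i, (i < k)%N -> ispolyv (l ^~ i)) ->
  ispolyv (fun s => segre k (f s) (l s)).
Proof.
move=> hf; elim: k => [//|k IH] hl; apply: ispolyv_tens; last exact: hl.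
by apply: IH => i ik; apply: hl; rewrite ltnW.
Qed.

Lemma ispolyv_cof n (f : K -> 'rV[K]_n) s0 :
  ispolyv f -> f s0 != 0 -> cof (fun s => f s != 0).
Proof.
move=> hf /rV0Pn [i /(ispoly_cof (hf i))]; apply: cof_imp => s fi.
by apply/rV0Pn; exists i.
Qed.

Lemma form_poly n d (F : 'rV[K]_n -> K) (f : K -> 'rV[K]_n) :
  isform d F -> ispolyv f -> ispoly (fun s => F (f s)).
Proof.
move=> + hf; elim: d F => [|d IH] F hF.
  by apply: ispoly_ext (ispoly_cst (F 0)) => s; apply: form_cst hF _ _.
have [G hG eG] := form_split hF.
apply: (@ispoly_ext (fun s => \sum_i f s 0 i * G i (f s))) => [s|].
  by rewrite eG.
by apply: ispoly_sum => i; apply: ispoly_mul => //; apply: IH.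
Qed.

(** A form restricted to a polynomial arc is a polynomial in one variable; vanishing at all but
    finitely many parameters, it vanishes at all of them. This is how limit points of curves and of
    blow-ups are produced. *)
Lemma arc n (f : K -> 'rV[K]_n) (S : set 'rV[K]_n) :
  ispolyv f -> cof (fun s => vclos S (f s)) -> forall s, vclos S (f s).
Proof.
move=> hf cS s d F hF FS; apply: (ispoly_eq0 (form_poly hF hf)).
by apply: cof_imp cS => s' h; apply: (h d F hF FS).
Qed.

Lemma affine0 s : affine_coords s 0 0 = 1.
Proof. by rewrite mxE. Qed.

Lemma affine1 s : affine_coords s 0 1 = s.
Proof. by rewrite mxE. Qed.

Lemma affine_neq0 s : affine_coords s != 0.
Proof. by apply/rV0Pn; exists 0; rewrite affine0 oner_eq0. Qed.

Lemma ispolyv_affine : ispolyv (@affine_coords K).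
Proof.
move=> [[|[|//]] i2]; last by apply: ispoly_ext ispoly_id => s; rewrite mxE.
by apply: ispoly_ext (ispoly_cst 1) => s; rewrite mxE.
Qed.

Lemma par_affine s s' : par (affine_coords s) (affine_coords s') -> s = s'.
Proof.
move=> [a a0 e]; have := affine0 s; rewrite e mxE affine0 mulr1 => a1.
by have := affine1 s; rewrite e mxE affine1 a1 mul1r.
Qed.

Lemma reg_poly T (D : set T) m n (g : T -> 'rV[K]_m) (f : K -> 'rV[K]_n) (sg : T -> K) t0 :
  D t0 -> reg D g (fun t => affine_coords (sg t)) t0 -> ispolyv f ->
  reg D g (fun t => f (sg t)) t0.
Proof.
move=> Dt0 rg /choice [p hp]; apply: reg_trans Dt0 rg _.
(* The polynomials are homogenized to a common degree that bounds them all; the extra powers of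
   [u_0] are harmless, [u_0] being 1 on affine coordinates. *)
pose d := \max_i size (p i).
pose F (u : 'rV[K]_2) : 'rV[K]_n :=
  \row_i \sum_(k < d.+1) (p i)`_k * (u 0 1 ^+ k * u 0 0 ^+ (d - k)).
apply: (@reg_ext _ _ _ _ _ _ (fun t => F (affine_coords (sg t)))).
  move=> t _; rewrite (_ : F _ = f (sg t)); first exact: par_refl.
  apply/rowP => i; rewrite mxE hp (@horner_coef_wide _ d.+1); last first.
    by apply: leqW; apply: leq_bigmax_cond.
  by apply: eq_bigr => k _; rewrite affine0 affine1 expr1n mulr1.
apply: (@reg_forms _ _ _ _ _ d _ F) => i.
apply: (@form_ext _ _ _ (fun u : 'rV[K]_2 =>
  \sum_(k < d.+1) (p i)`_k * (u 0 1 ^+ k * u 0 0 ^+ (d - k)))) => [u|].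
  by rewrite mxE.
apply: form_sum => k _; apply: form_cmul; have /subnKC {1}<- : (k <= d)%N by rewrite -ltnS.
by apply: form_mul; rewrite -[X in isform X]muln1; apply: form_exp; apply: form_coord.
Qed.

End Arcs.

(** * Blow-ups of the plane as sets of flags *)

Section Space3.
Variable K : numFieldType.
Implicit Types (x q w u v : 'rV[K]_3) (l : 'rV[K]_(3 * 3)).

Definition row3 (a b c : K) : 'rV[K]_3 := \row_(i < 3) [:: a; b; c]`_i.

Lemma row3E0 a b c : row3 a b c 0 0 = a. Proof. by rewrite mxE. Qed.
Lemma row3E1 a b c : row3 a b c 0 1 = b. Proof. by rewrite mxE. Qed.
Lemma row3E2 a b c : row3 a b c 0 2 = c. Proof. by rewrite mxE. Qed.
Definition row3E := (row3E0, row3E1, row3E2).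

Lemma ord3P (P : 'I_3 -> Prop) : P 0 -> P 1 -> P 2 -> forall i, P i.
Proof.
move=> h0 h1 h2 [[|[|[|//]]] hi].
- by rewrite (_ : Ordinal hi = 0) //; apply: val_inj.
- by rewrite (_ : Ordinal hi = 1) //; apply: val_inj.
- by rewrite (_ : Ordinal hi = 2) //; apply: val_inj.
Qed.

Lemma sum3 (f : 'I_3 -> K) : \sum_i f i = f 0 + f 1 + f 2.
Proof.
rewrite !big_ord_recl big_ord0 addr0 addrA.
by congr (f _ + f _ + f _); apply: val_inj.
Qed.

Lemma row3_ext u v : u 0 0 = v 0 0 -> u 0 1 = v 0 1 -> u 0 2 = v 0 2 -> u = v.
Proof. by move=> h0 h1 h2; apply/rowP; apply: ord3P. Qed.

Lemma row3K u : row3 (u 0 0) (u 0 1) (u 0 2) = u.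
Proof. by apply: row3_ext; rewrite row3E. Qed.

Lemma ispolyv_row3 (a b c : K -> K) : ispoly a -> ispoly b -> ispoly c ->
  ispolyv (fun s => row3 (a s) (b s) (c s)).
Proof.
move=> ha hb hc; apply: ord3P; [apply: ispoly_ext ha|apply: ispoly_ext hb|apply: ispoly_ext hc];
  by move=> s; rewrite row3E.
Qed.

Definition dot u v : K := u 0 0 * v 0 0 + u 0 1 * v 0 1 + u 0 2 * v 0 2.

Lemma dotE u v : dot u v = (u *m v^T) 0 0.
Proof. by rewrite mxE sum3 /dot !mxE. Qed.

Lemma dotC u v : dot u v = dot v u.
Proof. by rewrite /dot; ring. Qed.

Lemma dotZl a u v : dot (a *: u) v = a * dot u v.
Proof. by rewrite /dot !mxE; ring. Qed.

Lemma dotZr a u v : dot u (a *: v) = a * dot u v.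
Proof. by rewrite /dot !mxE; ring. Qed.

Lemma dotDl u v w : dot (u + v) w = dot u w + dot v w.
Proof. by rewrite /dot !mxE; ring. Qed.

Lemma dot_par u v u' v' : par u u' -> par v v' -> dot u v = 0 -> dot u' v' = 0.
Proof.
move=> [a a0 ->] [b b0 ->]; rewrite dotZl dotZr => /eqP.
by rewrite !mulf_eq0 (negPf a0) (negPf b0) => /eqP.
Qed.

Definition cross u v := row3 (u 0 1 * v 0 2 - u 0 2 * v 0 1)
  (u 0 2 * v 0 0 - u 0 0 * v 0 2) (u 0 0 * v 0 1 - u 0 1 * v 0 0).

Lemma dot_crossl u v : dot u (cross u v) = 0.
Proof. by rewrite /dot !row3E; ring. Qed.

Lemma dot_crossr u v : dot v (cross u v) = 0.
Proof. by rewrite /dot !row3E; ring. Qed.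

Lemma cross_cross n x q : cross n (cross x q) = dot n q *: x - dot n x *: q.
Proof. by apply: row3_ext; rewrite /cross !row3E /dot !mxE; ring. Qed.

Lemma crossZ a b u v : cross (a *: u) (b *: v) = (a * b) *: cross u v.
Proof. by apply: row3_ext; rewrite [RHS]mxE /cross !row3E !mxE; ring. Qed.

Lemma par_cross u u' v v' : par u u' -> par v v' -> par (cross u v) (cross u' v').
Proof.
by move=> [a a0 ->] [b b0 ->]; exists (a * b); rewrite ?mulf_neq0 ?crossZ.
Qed.

Lemma wedge_cross u v : (wedge u v == 0) = (cross u v == 0).
Proof.
apply/eqP/eqP => h0; last first.
  have E i : cross u v 0 i = 0 by rewrite h0 mxE.
  have := E 0; have := E 1; have := E 2; rewrite !row3E => e2 e1 e0.
  apply: tens_ext => i j; rewrite wedgeE mxE.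
  by move: i j; apply: ord3P; apply: ord3P; rewrite ?subrr //; apply/eqP;
    rewrite -1?oppr_eq0 ?opprB; apply/eqP; rewrite // mulrC [X in _ - X]mulrC.
have E i j : u 0 i * v 0 j - u 0 j * v 0 i = 0 by rewrite -wedgeE h0 mxE.
by apply: row3_ext; rewrite row3E !mxE; have := E 1 2; have := E 2 0; have := E 0 1.
Qed.

(** Both covectors are multiples of the cross product: the line joining two distinct points is
    unique. *)
Lemma cross_par n n' x q : n != 0 -> n' != 0 -> cross x q != 0 ->
  dot x n = 0 -> dot q n = 0 -> dot x n' = 0 -> dot q n' = 0 -> par n n'.
Proof.
move=> n0 n0' c0 xn qn xn' qn'.
have [a e] : exists a, n = a *: cross x q.
  apply: wedge_eq0 => //; apply/eqP; rewrite wedge_cross cross_cross.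
  by rewrite dotC qn dotC xn !scale0r subrr.
have [a' e'] : exists a, n' = a *: cross x q.
  apply: wedge_eq0 => //; apply/eqP; rewrite wedge_cross cross_cross.
  by rewrite dotC qn' dotC xn' !scale0r subrr.
have a0 : a != 0 by apply: contraNneq n0 => a0; rewrite e a0 scale0r.
have a0' : a' != 0 by apply: contraNneq n0' => a0'; rewrite e' a0' scale0r.
by rewrite e e'; apply: par_trans (par_scale _ a0) (par_sym (par_scale _ a0')).
Qed.

(** A line through [q] is the join with a second point [w], found with coordinate zero at an index
    where [q] is nonzero. *)
Lemma cross_surj n q : q != 0 -> dot q n = 0 -> exists w, cross w q = n.
Proof.
move=> /rV0Pn [i qi]; rewrite /dot; move: i qi; apply: ord3P => qi /eqP.
- rewrite -addrA addr_eq0 => /eqP e.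
  exists (row3 0 (- n 0 2 / q 0 0) (n 0 1 / q 0 0)).
  apply: row3_ext; rewrite !row3E; [|by field|by field].
  by apply: (mulfI qi); rewrite e; field.
- rewrite addrAC addrC addr_eq0 => /eqP e.
  exists (row3 (n 0 2 / q 0 1) 0 (- n 0 0 / q 0 1)).
  apply: row3_ext; rewrite !row3E; [by field| |by field].
  by apply: (mulfI qi); rewrite e; field.
- rewrite addrC addr_eq0 => /eqP e.
  exists (row3 (- n 0 1 / q 0 2) (n 0 0 / q 0 2) 0).
  apply: row3_ext; rewrite !row3E; [by field|by field|].
  by apply: (mulfI qi); rewrite e; field.
Qed.

Definition Psi : 'M[K]_(3, 3 * 3) :=
  \matrix_k mxvec (\matrix_(i, j) cross (delta_mx 0 i) (delta_mx 0 j) 0 k).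

(* The Pluecker coordinates of the line that a covector defines. *)
Definition psi v : 'rV[K]_(3 * 3) := v *m Psi.

Lemma psiE v i j :
  psi v 0 (mxvec_index i j) = dot v (cross (delta_mx 0 i) (delta_mx 0 j)).
Proof.
rewrite mxE sum3 /dot.
rewrite !(mxE _ _ 0 (mxvec_index i j), mxE _ _ 1 (mxvec_index i j), mxE _ _ 2 (mxvec_index i j)).
by rewrite !mxvecE ![matrix_of_fun _ _ _ _]mxE.
Qed.

Lemma psi_cross u v : psi (cross u v) = wedge u v.
Proof.
apply: tens_ext => i j; rewrite psiE wedgeE /dot.
move: i j; apply: ord3P; apply: ord3P; rewrite !row3E !mxE /=; ring.
Qed.

Definition phi_index (k : 'I_3) : 'I_(3 * 3) :=
  nth (mxvec_index 0 0) [:: mxvec_index 1 2; mxvec_index 2 0; mxvec_index 0 1] k.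

(** A left inverse of [psi], reading a covector off three entries of an antisymmetric matrix. On
    arbitrary vectors [psi] after [Phi] need not be the identity; equality is the linear condition
    for coming from a covector. *)
Definition Phi : 'M[K]_(3 * 3, 3) := \matrix_(a, k) (a == phi_index k)%:R.

Lemma PhiE l k : (l *m Phi) 0 k = l 0 (phi_index k).
Proof.
rewrite mxE (bigD1 (phi_index k)) //= mxE eqxx mulr1 big1 ?addr0 // => a /negPf h.
by rewrite mxE h mulr0.
Qed.

Lemma psiK v : psi v *m Phi = v.
Proof.
by apply: row3_ext; rewrite PhiE /phi_index /= psiE /dot !row3E !mxE /=; ring.
Qed.

Lemma psi_eq0 v : (psi v == 0) = (v == 0).
Proof.
apply/eqP/eqP => [e|->]; last by rewrite /psi mul0mx.
by rewrite -[v]psiK e mul0mx.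
Qed.

End Space3.

(** * Points of the blown-up plane *)

Section Lifts.
Variable K : numFieldType.

Section General.
Variable n : nat.
Implicit Types (A B : set (pspace K n)) (qs : seq (pspace K n)) (v : 'rV[K]_n).

Definition blift qs v : 'rV[K]_(bldim n (size qs)) :=
  segre (size qs) v (fun i => wedge v (map (@rep K n) qs)`_i).

Definition lifts A qs : set 'rV[K]_(bldim n (size qs)) :=
  blift qs @` cone (A `&` [set x | x \notin qs]).
Arguments lifts A qs _ : clear implicits.

Lemma rep_nth qs i : (i < size qs)%N ->
  exists2 p, p \in qs & (map (@rep K n) qs)`_i = rep p.
Proof.
case: qs => [//|q qs] iq; exists (nth q (q :: qs) i); first exact: mem_nth.
by rewrite (nth_map q).
Qed.

Lemma nth_rep qs p : p \in qs ->
  (index p qs < size qs)%N /\ (map (@rep K n) qs)`_(index p qs) = rep p.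
Proof.
by move=> pq; rewrite index_mem pq (nth_map p) ?index_mem // nth_index.
Qed.

Lemma rep_inj : injective (@rep K n).
Proof. by move=> p q e; apply: (coords_inj (coords_rep p)); rewrite e; apply: coords_rep. Qed.

Lemma wedge_rep p q v : coords p v -> p != q -> wedge v (rep q) != 0.
Proof.
move=> pv; apply: contraNneq => /eqP /(wedge_par (coords_neq0 pv) (rep_neq0 q)) h.
by apply/eqP; apply: coords_trans pv (coords_rep q) h.
Qed.

Lemma lift_neq0 qs p v : coords p v -> p \notin qs -> blift qs v != 0.
Proof.
move=> pv pq; apply: segre_neq0 (coords_neq0 pv) _ => i /rep_nth [q qq ->].
by apply: (wedge_rep pv); apply: contraNneq pq => ->.
Qed.

Lemma par_lift qs u v : par u v -> par (blift qs u) (blift qs v).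
Proof.
move=> uv; apply: par_segre => // i _; apply: par_wedge => //; exact: par_refl.
Qed.

Lemma blowupE A qs : blowup A qs = pc (lifts A qs).
Proof.
rewrite /blowup zclosureE; apply/seteqP; split=> y; apply: vclos_mono => u.
  move=> [q [x [v [Ax xq xv qv]]] qu]; exists (blift qs v).
    by exists v => //; exists x.
  exact/par_sym/(coords_par _ qv).
move=> [v [x [Ax xq] xv] <-].
have [q qv] := coords_ex (lift_neq0 xv xq); exists (blift qs v); last exact: par_refl.
by exists q => //; exists x, v.
Qed.

Lemma blowup_mono A B qs : A `<=` B -> blowup A qs `<=` blowup B qs.
Proof.
move=> AB y; rewrite !blowupE; apply: vclos_mono => _ [v [x [Ax xq] xv] <-].
exists (blift qs v); last exact: par_refl.
by exists v => //; exists x => //; split=> //; apply: AB.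
Qed.

Lemma blowupU A B qs : blowup (A `|` B) qs = blowup A qs `|` blowup B qs.
Proof.
apply/seteqP; split=> y; last first.
  by move=> [|]; apply: blowup_mono => x; [left|right].
rewrite !blowupE => h; have /vclosU : vclos (lifts A qs `|` lifts B qs) (rep y).
  apply: vclos_mono h => _ [v [x [[Ax|Bx] xq] xv] <-];
  (exists (blift qs v); last exact: par_refl); [left|right];
  by exists v => //; exists x.
by [].
Qed.

Lemma reg_lift T (D : set T) p (g : T -> 'rV[K]_p) (x : T -> 'rV[K]_n) qs t0 :
  D t0 -> reg D g x t0 -> reg D g (fun t => blift qs (x t)) t0.
Proof.
by move=> Dt0 rx; apply: reg_segre => // i _; apply: reg_wedge.
Qed.

End General.

Arguments lifts {n} A qs _.

Implicit Types (A B : set (pspace K 3)) (ps qs : seq (pspace K 3)) (p q : pspace K 3).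
Implicit Types (x v w : 'rV[K]_3) (u : 'rV[K]_3 -> 'rV[K]_3).

(** The Segre point belonging to a flag. The lines are a function on representatives of the centres
    rather than a list, so that flags do not depend on the order of the centres. *)
Definition sg ps x u : 'rV[K]_(bldim 3 (size ps)) :=
  segre (size ps) x (fun i => psi (u (map (@rep K 3) ps)`_i)).

(* A point of the blow-up of the plane at [ps] is a point [x] of the plane with,
   for each [p] in [ps], a line [u (rep p)] through [x] and [p]. *)
Definition flags ps : set ('rV[K]_3 * ('rV[K]_3 -> 'rV[K]_3)) :=
  [set t | t.1 != 0 /\ forall p, p \in ps ->
    [/\ t.2 (rep p) != 0, dot t.1 (t.2 (rep p)) = 0 & dot (rep p) (t.2 (rep p)) = 0]].

Lemma lift_sg ps x : blift ps x = sg ps x (cross x).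
Proof. by apply: eq_segre => i _; rewrite psi_cross. Qed.

Lemma cross_rep p q v : coords p v -> p != q -> cross v (rep q) != 0.
Proof. by move=> pv pq; rewrite -wedge_cross; apply: wedge_rep pv pq. Qed.

Lemma cross_coords p q v : coords p v -> cross v (rep q) != 0 -> p != q.
Proof.
move=> pv; apply: contraNneq => pq; rewrite -wedge_cross.
by apply/(wedge_par (coords_neq0 pv) (rep_neq0 q)); rewrite -pq; apply: coords_eqP.
Qed.

Lemma flags_cross ps p v : coords p v -> p \notin ps -> flags ps (v, cross v).
Proof.
move=> pv pp; split=> [|q qp] /=; first exact: coords_neq0 pv.
split; rewrite ?dot_crossl ?dot_crossr //.
by apply: (cross_rep pv); apply: contraNneq pp => ->.
Qed.

Lemma sg_neq0 ps t : flags ps t -> sg ps t.1 t.2 != 0.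
Proof.
move=> [x0 h]; apply: segre_neq0 => // i /rep_nth [p pp ->].
by rewrite psi_eq0; case: (h p pp).
Qed.

Lemma par_sg ps x x' u u' : par x x' ->
  (forall p, p \in ps -> par (u (rep p)) (u' (rep p))) ->
  par (sg ps x u) (sg ps x' u').
Proof.
move=> xx uu; apply: par_segre => // i /rep_nth [p pp ->].
exact: par_mul (uu p pp).
Qed.

Lemma sg_par ps x x' u u' : sg ps x u != 0 -> par (sg ps x u) (sg ps x' u') ->
  par x x' /\ forall p, p \in ps -> par (u (rep p)) (u' (rep p)).
Proof.
move=> s0 /(segre_par s0) [xx uu]; split=> // p /nth_rep [ip ep].
have := uu _ ip; rewrite ep => /(@par_mul _ _ _ _ _ (Phi K)).
by rewrite !psiK.
Qed.

Lemma flags_off ps p t : flags ps t -> coords p t.1 -> p \notin ps ->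
  forall q, q \in ps -> par (t.2 (rep q)) (cross t.1 (rep q)).
Proof.
move=> [x0 h] pt pp q qp; have [n0 xn qn] := h q qp.
have c0 : cross t.1 (rep q) != 0.
  by apply: (cross_rep pt); apply: contraNneq pp => ->.
by apply: (@cross_par _ _ _ t.1 (rep q)); rewrite ?dot_crossl ?dot_crossr.
Qed.

Lemma sg_off ps p t : flags ps t -> coords p t.1 -> p \notin ps ->
  par (sg ps t.1 t.2) (blift ps t.1).
Proof.
by move=> ft pt pp; rewrite lift_sg; apply: par_sg (flags_off ft pt pp); apply: par_refl.
Qed.

Lemma ispolyv_sg ps (x : K -> 'rV[K]_3) (u : K -> 'rV[K]_3 -> 'rV[K]_3) :
  ispolyv x -> (forall p, p \in ps -> ispolyv (fun s => u s (rep p))) ->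
  ispolyv (fun s => sg ps (x s) (u s)).
Proof.
move=> hx hu; apply: ispolyv_segre => // i /rep_nth [p pp ->].
exact: ispolyv_mul (hu p pp).
Qed.

Lemma ispolyv_cross (x y : K -> 'rV[K]_3) :
  ispolyv x -> ispolyv y -> ispolyv (fun s => cross (x s) (y s)).
Proof.
by move=> hx hy; apply: ispolyv_row3; apply: ispoly_sub; apply: ispoly_mul.
Qed.

Section RegSg.
Variables (T : Type) (D : set T).

Lemma reg_sg m ps (g : T -> 'rV[K]_m) (x : T -> 'rV[K]_3) (u : T -> 'rV[K]_3 -> 'rV[K]_3) t0 :
  reg D g x t0 -> (forall p, p \in ps -> reg D g (fun t => u t (rep p)) t0) ->
  reg D g (fun t => sg ps (x t) (u t)) t0.
Proof.
move=> rx ru; apply: reg_segre => // i /rep_nth [p pp ->].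
exact: reg_mul (ru p pp).
Qed.

Lemma sg_regx ps (x : T -> 'rV[K]_3) (u : T -> 'rV[K]_3 -> 'rV[K]_3) t0 :
  D t0 -> sg ps (x t0) (u t0) != 0 -> reg D (fun t => sg ps (x t) (u t)) x t0.
Proof. exact: segre_regx. Qed.

Lemma sg_regu ps (x : T -> 'rV[K]_3) (u : T -> 'rV[K]_3 -> 'rV[K]_3) t0 p :
  D t0 -> sg ps (x t0) (u t0) != 0 -> p \in ps ->
  reg D (fun t => sg ps (x t) (u t)) (fun t => u t (rep p)) t0.
Proof.
move=> Dt0 s0 /nth_rep [ip ep].
have := reg_mul (Phi K) (@segre_regl _ _ _ D x
  (fun t i => psi (u t (map (@rep K 3) ps)`_i)) (size ps) _ t0 Dt0 s0 ip).
by apply: reg_ext => t _; rewrite ep psiK; apply: par_refl.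
Qed.

(** The scalar is packaged as a 1 by 1 matrix because [reg] speaks of vectors. *)
Lemma reg_dot m (g : T -> 'rV[K]_m) (x y : T -> 'rV[K]_3) t0 :
  D t0 -> reg D g x t0 -> reg D g y t0 -> reg D g (fun t => (dot (x t) (y t))%:M : 'rV_1) t0.
Proof.
move=> Dt0 rx ry; apply: reg_trans Dt0 (reg_tens rx ry) _.
pose F (w : 'rV[K]_(3 * 3)) : 'rV[K]_1 :=
  (w 0 (mxvec_index 0 0) + w 0 (mxvec_index 1 1) + w 0 (mxvec_index 2 2))%:M.
apply: (@reg_ext _ _ _ _ _ _ (fun t => F (tens (x t) (y t)))).
  by move=> t _; rewrite /F !tensE; apply: par_refl.
apply: (@reg_forms _ _ _ _ _ 1) => i; rewrite ord1.
apply: (@form_ext _ _ _ (fun w : 'rV[K]_(3 * 3) => w 0 (mxvec_index 0 0) +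
  w 0 (mxvec_index 1 1) + w 0 (mxvec_index 2 2))) => [w|]; first by rewrite mxE eqxx mulr1n.
by apply: form_add; [apply: form_add|]; apply: form_coord.
Qed.

Lemma dot_closed m (g : T -> 'rV[K]_m) (x y : T -> 'rV[K]_3) S t0 :
  D t0 -> S `<=` D -> reg D g x t0 -> reg D g y t0 -> vclos (g @` S) (g t0) ->
  (forall t, S t -> dot (x t) (y t) = 0) -> dot (x t0) (y t0) = 0.
Proof.
move=> Dt0 SD rx ry cl h; have H := cont_eq0 Dt0 SD (reg_dot Dt0 rx ry) cl.
have /rowP /(_ 0) : (dot (x t0) (y t0))%:M = 0 :> 'rV[K]_1.
  by apply: H => t St; rewrite h //; apply/rowP => i; rewrite !mxE mul0rn.
by rewrite !mxE eqxx mulr1n.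
Qed.

End RegSg.

(** Being decomposable, having lines as factors, and the incidences of these lines with the point
    and with the centres are closed conditions, and they hold over the complement of the centres. *)
Lemma blowup_flags A ps y : uniq ps -> blowup A ps y ->
  exists2 t, flags ps t & coords y (sg ps t.1 t.2) /\ vclos (cone A) t.1.
Proof.
move=> ups; rewrite blowupE /pc /=; set w := rep y => cl.
have w0 : w != 0 := rep_neq0 y.
have [x [l ew]] : exists x l, w = segre (size ps) x l.
  apply: segre_closed w0 _ cl => _ [v _ <-].
  by exists v, (fun i => wedge v (map (@rep K 3) ps)`_i).
have s0 : segre (size ps) x l != 0 by rewrite -ew.
pose D := [set t : 'rV[K]_3 * (nat -> 'rV[K]_(3 * 3)) | segre (size ps) t.1 t.2 != 0].
pose S := [set t : 'rV[K]_3 * (nat -> 'rV[K]_(3 * 3)) |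
  cone (A `&` [set x | x \notin ps]) t.1 /\
  forall i, (i < size ps)%N -> t.2 i = wedge t.1 (map (@rep K 3) ps)`_i].
pose g (t : 'rV[K]_3 * (nat -> 'rV[K]_(3 * 3))) := segre (size ps) t.1 t.2.
have gS : forall t, S t -> g t = blift ps t.1 by move=> t [_ h]; apply: eq_segre.
have SD : S `<=` D.
  move=> t St; have [[p [_ pp] pt] _] := St.
  by rewrite /D /= -/(g t) (gS t St); apply: lift_neq0 pt pp.
have clS : vclos (g @` S) (g (x, l)).
  rewrite /g /= -ew; apply: vclos_mono cl => _ [v cv <-].
  exists (blift ps v); last exact: par_refl.
  by exists (v, fun i => wedge v (map (@rep K 3) ps)`_i); split.
have Dt : D (x, l) by [].
have rx := @segre_regx _ _ _ D fst snd (size ps) (x, l) Dt s0.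
have rl i (ip : (i < size ps)%N) := @segre_regl _ _ _ D fst snd (size ps) i (x, l) Dt s0 ip.
(* The linear equations characterizing images of covectors, passed to the closure. *)
have lpsi i : (i < size ps)%N -> psi (l i *m Phi K) = l i.
  move=> ip; apply/eqP; rewrite -subr_eq0; apply/eqP.
  have := @cont_eq0 _ _ D _ _ g (fun t => t.2 i *m (Phi K *m Psi K - 1%:M)) S (x, l) Dt SD.
  rewrite /= mulmxBr mulmxA mulmx1; apply; [exact: reg_mul (rl i ip)|by []|].
  move=> t [_ ht]; rewrite ht // -psi_cross mulmxBr mulmxA mulmx1 psiK.
  by rewrite subrr.
have xl i : (i < size ps)%N -> dot x (l i *m Phi K) = 0.
  move=> ip; apply: (dot_closed Dt SD rx _ clS (y := fun t => t.2 i *m Phi K)).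
    exact: reg_mul (rl i ip).
  by move=> t [_ ht]; rewrite ht // -psi_cross psiK dot_crossl.
have pl i : (i < size ps)%N -> dot (map (@rep K 3) ps)`_i (l i *m Phi K) = 0.
  move=> ip; apply: (dot_closed Dt SD _ _ clS (x := fun=> _) (y := fun t => t.2 i *m Phi K)).
  - exact: reg_cst.
  - exact: reg_mul (rl i ip).
  - by move=> t [_ ht]; rewrite ht // -psi_cross psiK dot_crossr.
have umap : uniq (map (@rep K 3) ps) by rewrite (map_inj_uniq (@rep_inj 3)).
(* The list of factors is turned into a function on representatives; this is where distinctness of
   the centres enters. *)
exists (x, fun v => l (index v (map (@rep K 3) ps)) *m Phi K).
  have [x0 l0] := segre_eq0 s0; split=> //= p pp.
  have [ip ep] := nth_rep pp.
  have -> : index (rep p) (map (@rep K 3) ps) = index p ps.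
    by rewrite -{1}ep index_uniq ?size_map.
  split; [by rewrite -psi_eq0 lpsi ?l0|exact: xl|].
  by have := pl _ ip; rewrite ep.
split=> /=; last first.
  have := cont Dt SD rx clS; apply: vclos_mono => _ [t [[p [Ap _] pt] _] <-].
  by exists t.1; [exists p|apply: par_refl].
rewrite (_ : sg _ _ _ = w); first exact: coords_rep.
by rewrite ew; apply: eq_segre => i ip; rewrite index_uniq ?size_map // lpsi.
Qed.

(** Only flags over a centre [p] require a limit. The point moves away from [p] along the line
    prescribed at [p]; that line is kept constant, and every other line joins the moving point to
    its centre. *)
Lemma sg_blowup ps t : uniq ps -> flags ps t -> vclos (lifts setT ps) (sg ps t.1 t.2).
Proof.
move=> ups ft; have [x0 hx] := ft; have [p pt] := coords_ex x0.
have [pp|pp] := boolP (p \in ps); last first.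
  apply: vclos_par (par_sym (sg_off ft pt pp)) _; apply: vclos_sub.
  by exists t.1 => //; exists p.
have [n0 xn pn] := hx p pp; have [w ew] := cross_surj (rep_neq0 p) pn.
pose u s v := if v == rep p then t.2 (rep p) else cross (t.1 + s *: w) v.
pose x s := t.1 + s *: w.
have px : ispolyv x.
  apply: ispolyv_add; first exact: ispolyv_cst.
  by apply: ispolyv_scale; [apply: ispoly_id|apply: ispolyv_cst].
have pu q : q \in ps -> ispolyv (fun s => u s (rep q)).
  move=> _; rewrite /u; case: eqP => _; first exact: ispolyv_cst.
  by apply: ispolyv_cross => //; apply: ispolyv_cst.
have par0 : par (sg ps (x 0) (u 0)) (sg ps t.1 t.2).
  apply: par_sg => [|q qp]; first by rewrite /x scale0r addr0; apply: par_refl.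
  rewrite /u; case: eqP => [->|/eqP qr]; first exact: par_refl.
  rewrite scale0r addr0; have [m0 xm qm] := hx q qp.
  apply: (@cross_par _ _ _ t.1 (rep q)); rewrite ?dot_crossl ?dot_crossr //;
    by apply: cross_rep pt _; apply: contraNneq qr => ->.
apply: vclos_par par0 _; apply: arc (ispolyv_sg px pu) _ 0.
have h1 : cof (fun s => forall i, (i < size ps)%N ->
    (map (@rep K 3) ps)`_i != rep p -> cross (x s) (map (@rep K 3) ps)`_i != 0).
  apply: cof_all => i /rep_nth [q qp ->].
  have [e|ne] := eqVneq (rep q) (rep p); first exact: cof_true.
  apply: (cof_imp (fun s h _ => h)).
  apply: (ispolyv_cof (s0 := 0)); first by apply: ispolyv_cross => //; apply: ispolyv_cst.
  rewrite /x scale0r addr0; apply: cross_rep pt _.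
  by apply: contraNneq ne => ->.
(* Since [t.1] is a multiple of [rep p], the join of the moving point with [p] is [s] times the
   prescribed line. *)
have crossp s : cross (x s) (rep p) = s *: t.2 (rep p).
  have [a a0 ea] := coords_eqP pt.
  rewrite -ew /x ea; apply: row3_ext; rewrite /cross !mxE /=; ring.
apply: cof_imp (cof_and h1 (cof_neq 0)) => s [h s0].
have c0 q : q \in ps -> cross (x s) (rep q) != 0.
  move=> qp; have [ip ep] := nth_rep qp.
  have [e|ne] := eqVneq (rep q) (rep p); last by have := h _ ip; rewrite ep; apply.
  by rewrite e crossp scaler_eq0 negb_or s0.
have xs0 : x s != 0.
  apply: contraNneq (c0 p pp) => ->; apply/eqP.
  by apply: row3_ext; rewrite /cross !mxE /=; ring.
have [q qx] := coords_ex xs0; apply: (@vclos_par _ _ _ (blift ps (x s))).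
  rewrite lift_sg; apply: par_sg (par_refl _) _ => r rp; rewrite /u.
  case: eqP => [->|_]; last exact: par_refl.
  by rewrite crossp; apply: par_scale.
apply: vclos_sub; exists (x s) => //; exists q => //; split=> //=.
by apply/negP => /c0 /(cross_coords qx); rewrite eqxx.
Qed.

Lemma blowupT ps y : uniq ps ->
  blowup setT ps y <-> exists2 t, flags ps t & coords y (sg ps t.1 t.2).
Proof.
move=> ups; split=> [/(blowup_flags ups) [t ft [yt _]]|[t ft yt]]; first by exists t.
by rewrite blowupE; apply/(pcE _ yt); apply: sg_blowup.
Qed.

End Lifts.

Arguments lifts {K n} A qs _.

(** * Blowing up a point of a projective variety *)

Section Directions.
Variable K : numFieldType.
Implicit Types m n : nat.

Lemma sum_mxvec m n (f : 'I_(m * n) -> K) :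
  \sum_k f k = \sum_i \sum_j f (mxvec_index i j).
Proof.
rewrite pair_bigA (reindex _ (curry_mxvec_bij m n)) /=.
by apply: eq_bigr => -[i j] _.
Qed.

(** Each coordinate of the wedge is a form in [y] vanishing at [v], hence a combination of the
    [y_a v_b - y_b v_a]. The matrix [A] turns secants of the source into secants of the image; at
    [y = v] it acts as a derivative. *)
Lemma wedge_forms m n d (F : 'rV[K]_m -> 'rV[K]_n) (v : 'rV[K]_m) : v != 0 ->
  (forall i, isform d.+1 (fun y => F y 0 i)) ->
  exists2 A : 'rV[K]_m -> 'M[K]_(m * m, n * n),
    forall a b, isform d (fun y => A y a b)
    & forall y, wedge (F y) (F v) = wedge y v *m A y.
Proof.
move=> v0 hF; have /choice [G hG] : forall k : 'I_(n * n),
    exists G : 'rV[K]_m -> 'M[K]_m, (forall a b, isform d (fun y => G y a b)) /\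
    forall y, wedge (F y) (F v) 0 k =
      \sum_a \sum_b (y 0 a * v 0 b - y 0 b * v 0 a) * G y a b.
  case/mxvec_indexP=> i j.
  have hf : isform d.+1 (fun y => F y 0 i * F v 0 j - F y 0 j * F v 0 i).
    by apply: form_sub; apply: form_mulc.
  have [|g hg eg] := point_ideal v0 hf; first by rewrite mulrC subrr.
  exists (fun y => \matrix_(a, b) g a b y); split=> [a b|y].
    by apply: form_ext (hg a b) => y; rewrite mxE.
  rewrite wedgeE eg; apply: eq_bigr => a _; apply: eq_bigr => b _.
  by rewrite mxE.
exists (fun y => \matrix_(e, k) mxvec (G k y) 0 e) => [e k|y].
  case/mxvec_indexP: e => a b.
  by apply: form_ext ((hG k).1 a b) => y; rewrite mxE mxvecE.
apply/rowP => k; rewrite (hG k).2 mxE sum_mxvec; apply: eq_bigr => a _.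
by apply: eq_bigr => b _; rewrite mxE mxvecE wedgeE.
Qed.

Section RegMx.
Variables (T : Type) (D : set T).

Lemma reg_mulmx m n k (g : T -> 'rV[K]_k) (u : T -> 'rV[K]_m) (A : T -> 'M[K]_(m, n)) t0 :
  D t0 -> reg D g u t0 -> reg D g (fun t => mxvec (A t)) t0 ->
  reg D g (fun t => u t *m A t) t0.
Proof.
move=> Dt0 ru rA; apply: reg_trans Dt0 (reg_tens ru rA) _.
pose F (w : 'rV[K]_(m * (m * n))) : 'rV[K]_n :=
  \row_k \sum_i w 0 (mxvec_index i (mxvec_index i k)).
apply: (@reg_ext _ _ _ _ _ _ (fun t => F (tens (u t) (mxvec (A t))))).
  move=> t _; rewrite (_ : F _ = u t *m A t); first exact: par_refl.
  by apply/rowP => j; rewrite !mxE; apply: eq_bigr => i _; rewrite tensE mxvecE.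
apply: (@reg_forms _ _ _ _ _ 1) => j.
apply: (@form_ext _ _ _ (fun w : 'rV[K]_(m * (m * n)) =>
  \sum_i w 0 (mxvec_index i (mxvec_index i j)))) => [w|]; first by rewrite mxE.
by apply: form_sum => i _; apply: form_coord.
Qed.

Lemma reg_mxforms m n k d (g : T -> 'rV[K]_k) (A : 'rV[K]_k -> 'M[K]_(m, n)) t0 :
  (forall a b, isform d (fun y => A y a b)) -> reg D g (fun t => mxvec (A (g t))) t0.
Proof.
move=> hA; apply: (@reg_forms _ _ _ _ _ d g (fun y => mxvec (A y))) => e.
case/mxvec_indexP: e => a b.
by apply: form_ext (hA a b) => y; rewrite mxvecE.
Qed.

(** Multiplying by a linear form that is nonzero at [g t0] makes the degree positive, as factoring
    out secants requires. *)
Lemma reg_succ m n (g : T -> 'rV[K]_m) (h : T -> 'rV[K]_n) t0 :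
  g t0 != 0 -> reg D g h t0 ->
  exists d e (F : 'rV[K]_m -> 'rV[K]_n) (N : 'rV[K]_m -> K),
  [/\ forall i, isform d.+1 (fun v => F v 0 i), isform e N, N (g t0) != 0
    & forall t, D t -> N (g t) != 0 -> par (F (g t)) (h t)].
Proof.
move=> g0 [d [e [F [N [hF hN N0 FN]]]]]; have [L hL L0] := form_neq0 1 g0.
exists d, (1 + e)%N, (fun v => L v *: F v), (fun v => L v * N v); split.
- move=> i; apply: (@form_ext _ _ _ (fun v => L v * F v 0 i)) => [v|].
    by rewrite mxE.
  by rewrite -add1n; apply: form_mul.
- exact: form_mul.
- exact: mulf_neq0.
move=> t Dt; rewrite mulf_eq0 negb_or => /andP [Lt Nt].
by apply: par_trans (FN t Dt Nt); apply: par_scale.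
Qed.

End RegMx.

Section Transport.
Variables (T : Type) (D : set T).

(* [l] is a limit direction at [g c] of the secants from [g c] to [g t], [t] in [S]. *)
Definition dirs m (g : T -> 'rV[K]_m) (c : T) (S : set T) (l : 'rV[K]_(m * m)) : Prop :=
  vclos [set tens (g t) (wedge (g t) (g c)) | t in S] (tens (g c) l).

(** [M] is the derivative at [c] of the map taking [g] to [h], acting on projectivized directions.
    It is phrased for arbitrary families: if [l'] is [l *m M] over [c] and the secant of [h]
    elsewhere, then at parameters over [c] it is regular in the point and [l]. The same matrix thus
    serves for limits of secants and for points of a blow-up. *)
Definition transports m n (g : T -> 'rV[K]_m) (h : T -> 'rV[K]_n) (c : T)
    (M : 'M[K]_(m * m, n * n)) : Prop :=
  forall T2 (D2 : set T2) (r : T2 -> T) (l : T2 -> 'rV[K]_(m * m))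
    (l' : T2 -> 'rV[K]_(n * n)),
  (forall s, D2 s -> D (r s) /\ ((par (g (r s)) (g c) /\ par (l' s) (l s *m M)) \/
     (par (l s) (wedge (g (r s)) (g c)) /\ par (l' s) (wedge (h (r s)) (h c))))) ->
  forall s, D2 s -> l s != 0 -> par (g (r s)) (g c) ->
  reg D2 (fun s => tens (g (r s)) (l s)) l' s.

Lemma transportsP m n (g : T -> 'rV[K]_m) (h : T -> 'rV[K]_n) c d e
    (F : 'rV[K]_m -> 'rV[K]_n) (N : 'rV[K]_m -> K) (A : 'rV[K]_m -> 'M[K]_(m * m, n * n)) :
  D c -> g c != 0 -> 
  (forall i, isform d.+1 (fun v => F v 0 i)) -> isform e N -> N (g c) != 0 ->
  (forall t, D t -> N (g t) != 0 -> par (F (g t)) (h t)) ->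
  (forall a b, isform d (fun y => A y a b)) ->
  (forall y, wedge (F y) (F (g c)) = wedge y (g c) *m A y) ->
  transports g h c (A (g c)).
Proof.
move=> Dc g0 hF hN N0 FN hA eA T2 D2 r l l' HD2 s Ds l0 gs.
have gs0 : g (r s) != 0 by rewrite (par_eq0 gs).
have rg : reg D2 (fun s => tens (g (r s)) (l s)) (fun s => g (r s)) s by apply: reg_tensl.
have rl : reg D2 (fun s => tens (g (r s)) (l s)) l s by apply: reg_tensr.
have rA : reg D2 (fun s => tens (g (r s)) (l s)) (fun s => l s *m A (g (r s))) s.
  by apply: reg_mulmx => //; apply: reg_trans Ds rg _; apply: reg_mxforms hA.
apply: (reg_loc Ds rg hN _ _ rA).
  have [a a0 ->] := gs; rewrite (form_scale _ _ hN) mulf_neq0 //.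
  exact: expf_neq0.
move=> s' /HD2 [Ds' [[[a a0 ->] ll]|[[a a0 ->] ll]]] Ns'.
  apply: par_sym; apply: par_trans ll _; exists (a ^+ d)^-1.
    by rewrite invr_eq0 expf_neq0.
  have -> : A (a *: g c) = a ^+ d *: A (g c).
    by apply/matrixP => i j; rewrite (form_scale _ _ (hA i j)) mxE.
  by rewrite -scalemxAr scalerA mulVf ?scale1r ?expf_neq0.
rewrite -scalemxAl -eA; apply: par_trans (par_scale _ a0) _.
by apply: par_trans (par_wedge (FN _ Ds' Ns') (FN c Dc N0)) (par_sym ll).
Qed.

Lemma transports_dirs m n (g : T -> 'rV[K]_m) (h : T -> 'rV[K]_n) c M S l :
  D c -> S `<=` D -> g c != 0 -> l != 0 -> reg D g h c -> transports g h c M ->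
  dirs g c S l -> dirs h c S (l *m M).
Proof.
move=> Dc SD g0 l0 rgh tr dl.
(* The extra parameter [None] carries the point [g c] with the direction [l], the parameters in [S]
   carry true secants; [dirs] then says that [None] is in the closure of the others. *)
pose D2 := [set o | if o is Some t then S t else True].
pose r o := if o is Some t then t else c.
pose L o := if o is Some t then wedge (g t) (g c) else l.
pose L' o := if o is Some t then wedge (h t) (h c) else l *m M.
have hD2 o : D2 o -> D (r o) /\ ((par (g (r o)) (g c) /\ par (L' o) (L o *m M)) \/
     (par (L o) (wedge (g (r o)) (g c)) /\ par (L' o) (wedge (h (r o)) (h c)))).
  case: o => [t /SD Dt|_] /=; split=> //; [right|left]; split; exact: par_refl.
have D2N : D2 None by [].
have rl := tr _ D2 r L L' hD2 None D2N l0 (par_refl _).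
have rh : reg D2 (fun o => tens (g (r o)) (L o)) (fun o => h (r o)) None.
  have := @reg_tensl _ _ D2 _ _ (fun o => g (r o)) L None g0 l0.
  by move=> /(reg_trans D2N); apply; apply: (@reg_pull _ _ _ D D2 r) => // o /hD2 [].
pose S2 := [set o | if o is Some t then S t else False].
have S2D : S2 `<=` D2 by case.
have H := cont D2N S2D (reg_tens rh rl); rewrite /dirs; apply: vclos_mono (H _).
  by move=> _ [[t|] St <-] //; eexists; last exact: par_refl; exists t.
apply: vclos_mono dl => _ [t St <-]; eexists; last exact: par_refl.
by exists (Some t).
Qed.

End Transport.

(** The composite of the two local formulas is the identity up to a scalar depending on the point,
    so the two derivatives compose to a scalar on every secant, and in the limit on every
    direction. *)
Lemma dirs_iso T (D : set T) m n (g : T -> 'rV[K]_m) (h : T -> 'rV[K]_n) c :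
  D c -> g c != 0 -> h c != 0 -> reg D g h c -> reg D h g c ->
  exists M M', [/\ transports D g h c M, transports D h g c M',
    forall S l, S `<=` D -> l != 0 -> dirs g c S l -> par (l *m M *m M') l
  & forall S l, S `<=` D -> l != 0 -> dirs h c S l -> par (l *m M' *m M) l].
Proof.
move=> Dc g0 h0 rgh rhg.
have half a b (u : T -> 'rV[K]_a) (v : T -> 'rV[K]_b) d e
      (F : 'rV[K]_a -> 'rV[K]_b) (N : 'rV[K]_a -> K)
      (A : 'rV[K]_a -> 'M[K]_(a * a, b * b)) d' e'
      (F' : 'rV[K]_b -> 'rV[K]_a) (N' : 'rV[K]_b -> K)
      (A' : 'rV[K]_b -> 'M[K]_(b * b, a * a)) :
    u c != 0 -> v c != 0 ->
    (forall i, isform d.+1 (fun v => F v 0 i)) -> isform e N -> N (u c) != 0 ->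
    (forall t, D t -> N (u t) != 0 -> par (F (u t)) (v t)) ->
    (forall i, isform d'.+1 (fun v => F' v 0 i)) -> isform e' N' -> N' (v c) != 0 ->
    (forall t, D t -> N' (v t) != 0 -> par (F' (v t)) (u t)) ->
    (forall i j, isform d (fun y => A y i j)) ->
    (forall i j, isform d' (fun y => A' y i j)) ->
    (forall y, wedge (F y) (F (u c)) = wedge y (u c) *m A y) ->
    (forall y, wedge (F' y) (F' (v c)) = wedge y (v c) *m A' y) ->
    reg D u v c ->
    forall (S : set T) (l : 'rV[K]_(a * a)), S `<=` D -> l != 0 -> dirs u c S l ->
      par (l *m A (u c) *m A' (v c)) l.
  move=> u0 v0 hF hN N0 FN hF' hN' N0' FN' hA hA' eA eA' ruv S l SD l0 dl.
  have [y y0 eFc] := FN c Dc N0; have [z z0 eFc'] := FN' c Dc N0'.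
  have /rV0Pn [i ui] := u0.
  (* Near [c], [F' (F w)] is an unknown multiple of [w]; [y] and [z] are the scalars of [F] and [F']
     at [c]. Multiplying by [i]-th coordinates eliminates the unknown multiple, so a matrix of forms
     annihilates the secant. *)
  pose P (w : 'rV[K]_a) : 'M[K]_(a * a) :=
    w 0 i *: (A w *m A' (F w)) - (y * z * F' (F w) 0 i)%:M.
  have hP j k : isform (d'.+1 * d.+1) (fun w => P w j k).
    apply: (@form_ext _ _ _ (fun w : 'rV[K]_a => w 0 i * (\sum_e A w j e * A' (F w) e k) -
        y * z * F' (F w) 0 i * (j == k)%:R)) => [w|].
      by rewrite /P !mxE mulr_natr.
    apply: form_sub.
      rewrite mulSn addSn -add1n; apply: form_mul; first exact: form_coord.
      apply: form_sum => e2 _; apply: form_mul => //.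
      exact: (@form_comp _ _ _ _ _ (fun w : 'rV[K]_b => A' w e2 k)).
    apply: form_mulc; apply: form_cmul.
    exact: (@form_comp _ _ _ _ _ (fun w : 'rV[K]_b => F' w 0 i)).
  pose D2 := [set o | if o is Some t then S t else True].
  pose S2 := [set o | if o is Some t then S t else False].
  pose r o := if o is Some t then t else c.
  pose L o := if o is Some t then wedge (u t) (u c) else l.
  have D2N : D2 None by [].
  have S2D : S2 `<=` D2 by case.
  have D2D o : D2 o -> D (r o) by case: o => [t /SD|].
  pose G o := tens (u (r o)) (L o).
  have rg : reg D2 G (fun o => u (r o)) None by apply: reg_tensl.
  have rl : reg D2 G L None by apply: reg_tensr.
  have rh : reg D2 G (fun o => v (r o)) None.
    by apply: reg_trans D2N rg _; apply: (@reg_pull _ _ _ D D2 r).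
  have rP : reg D2 G (fun o => L o *m P (u (r o))) None.
    apply: reg_mulmx => //; apply: reg_trans D2N rg _.
    exact: (@reg_mxforms _ D2 _ _ _ _ (fun o => u (r o)) P None hP).
  have cl0 : vclos (G @` S2) (G None).
    apply: vclos_mono dl => _ [t St <-]; eexists; last exact: par_refl.
    by exists (Some t).
  have cl1 := cont_loc D2N S2D rg hN N0 cl0.
  have S3D : S2 `&` [set o | N (u (r o)) != 0] `<=` D2 by move=> o [/S2D].
  have cl2 := cont_loc D2N S3D rh hN' N0' cl1.
  have S4D : S2 `&` [set o | N (u (r o)) != 0] `&` [set o | N' (v (r o)) != 0] `<=` D2.
    by move=> o [/S3D].
  have := cont_eq0 D2N S4D rP cl2.
  have scA w (b0 : K) : A' (b0 *: w) = b0 ^+ d' *: A' w.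
    by apply/matrixP => j k; rewrite (form_scale _ _ (hA' j k)) mxE.
  have scF w (b0 : K) j : F' (b0 *: w) 0 j = b0 ^+ d'.+1 * F' w 0 j.
    by rewrite (form_scale _ _ (hF' j)).
  have H o : (S2 `&` [set o | N (u (r o)) != 0] `&` [set o | N' (v (r o)) != 0]) o ->
      L o *m P (u (r o)) = 0.
    case: o => [t [[/= St Nt] Nt']|[[]] //].
    have [x x0 eFt] := FN t (SD t St) Nt; have [x' x0' eFt'] := FN' t (SD t St) Nt'.
    rewrite /P mulmxBr -scalemxAr mulmxA -eA eFt eFc wedgeZ scA -scalemxAl -scalemxAr.
    rewrite -eA' eFc' eFt' wedgeZ scF eFt' mxE mul_mx_scalar !scalerA -scalerBl.
    by apply/eqP; rewrite scaler_eq0; apply/orP; left; rewrite exprS; apply/eqP; ring.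
  move=> /(_ H) /=; rewrite /P mulmxBr -scalemxAr mulmxA eFc scA scF eFc' mxE.
  rewrite mul_mx_scalar -scalemxAr scalerA => /eqP; rewrite subr_eq0 => /eqP e1.
  have n1 : u c 0 i * y ^+ d' != 0 by rewrite mulf_neq0 ?expf_neq0.
  exists ((u c 0 i * y ^+ d')^-1 * (y * z * (y ^+ d'.+1 * (z * u c 0 i)))).
    by rewrite !mulf_neq0 ?invr_eq0 ?expf_neq0.
  by rewrite -scalerA -e1 scalerA mulVf ?scale1r.
have [d [e [F [N [hF hN N0 FN]]]]] := reg_succ g0 rgh.
have [d' [e' [F' [N' [hF' hN' N0' FN']]]]] := reg_succ h0 rhg.
have [A hA eA] := wedge_forms g0 hF; have [A' hA' eA'] := wedge_forms h0 hF'.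
exists (A (g c)), (A' (h c)); split.
- exact: (transportsP Dc g0 hF hN N0 FN hA eA).
- exact: (transportsP Dc h0 hF' hN' N0' FN' hA' eA').
- exact: (half _ _ g h d e F N A d' e' F' N' A').
- exact: (half _ _ h g d' e' F' N' A' d e F N A).
Qed.

End Directions.

(** * The blow-up of a point depends only on a neighbourhood *)

Section BlowupIso.
Variable K : numFieldType.

Definition closed_image T (D : set T) m (g : T -> 'rV[K]_m) : Prop :=
  forall v, v != 0 -> vclos (g @` D) v -> exists2 t, D t & par v (g t).

(* [g] and [h] parametrize isomorphic varieties, and near [c] the maps [a] and [b]
   are local isomorphisms, so that the closures of the graphs of the projections
   from [a c] and from [b c] are blow-ups at the same point. *)
Record blowup_data T (D : set T) (c : T) m n k l (g : T -> 'rV[K]_m)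
    (h : T -> 'rV[K]_n) (a : T -> 'rV[K]_k) (b : T -> 'rV[K]_l) : Prop := BlowupData {
  bd_c : D c;
  bd_g0 : forall t, D t -> g t != 0;
  bd_h0 : forall t, D t -> h t != 0;
  bd_a0 : forall t, D t -> a t != 0;
  bd_b0 : forall t, D t -> b t != 0;
  bd_gh : forall t, D t -> reg D g h t;
  bd_hg : forall t, D t -> reg D h g t;
  bd_ga : forall t, D t -> reg D g a t;
  bd_hb : forall t, D t -> reg D h b t;
  bd_ag : reg D a g c;
  bd_bh : reg D b h c;
  bd_clg : closed_image D g;
  bd_clh : closed_image D h }.

Lemma blowup_data_sym T (D : set T) c m n k l (g : T -> 'rV[K]_m)
    (h : T -> 'rV[K]_n) (a : T -> 'rV[K]_k) (b : T -> 'rV[K]_l) :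
  blowup_data D c g h a b -> blowup_data D c h g b a.
Proof. by case. Qed.

Definition graph T (c : T) m k (g : T -> 'rV[K]_m) (a : T -> 'rV[K]_k) (S : set T) :
    set 'rV[K]_(m * (k * k)) :=
  [set tens (g t) (wedge (a t) (a c)) | t in S].

(** The graph of the isomorphism between the two blow-ups: off [c] both directions are the actual
    secants, over [c] they correspond under the derivatives [M] and [M']. *)
Definition bl_rel T (D : set T) (c : T) m n k l (g : T -> 'rV[K]_m)
    (h : T -> 'rV[K]_n) (a : T -> 'rV[K]_k) (b : T -> 'rV[K]_l)
    (M : 'M[K]_(k * k, l * l)) (M' : 'M[K]_(l * l, k * k)) :
    set (T * ('rV[K]_(k * k) * 'rV[K]_(l * l))) :=
  [set s | [/\ D s.1, s.2.1 != 0 /\ s.2.2 != 0,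
    vclos (graph c g a D) (tens (g s.1) s.2.1),
    vclos (graph c h b D) (tens (h s.1) s.2.2)
    & [/\ par (a s.1) (a c), par (b s.1) (b c), par s.2.2 (s.2.1 *m M) &
          par s.2.1 (s.2.2 *m M')] \/
      [/\ wedge (a s.1) (a c) != 0, wedge (b s.1) (b c) != 0,
          par s.2.1 (wedge (a s.1) (a c)) & par s.2.2 (wedge (b s.1) (b c))]]].

Lemma bl_rel_sym T (D : set T) c m n k l (g : T -> 'rV[K]_m)
    (h : T -> 'rV[K]_n) (a : T -> 'rV[K]_k) (b : T -> 'rV[K]_l) M M' t u v :
  bl_rel D c g h a b M M' (t, (u, v)) -> bl_rel D c h g b a M' M (t, (v, u)).
Proof.
by move=> [/= Dt [u0 v0] cu cv [[? ? ? ?]|[? ? ? ?]]]; split=> //; [left|right].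
Qed.

Lemma blowup_data_par T (D : set T) c m n k l (g : T -> 'rV[K]_m)
    (h : T -> 'rV[K]_n) (a : T -> 'rV[K]_k) (b : T -> 'rV[K]_l) t :
  blowup_data D c g h a b -> D t -> par (a t) (a c) ->
  [/\ par (g t) (g c), par (h t) (h c) & par (b t) (b c)].
Proof.
move=> [Dc g0 h0 a0 b0 gh hg ga hb ag bh clg clh] Dt pa.
have pg : par (g c) (g t) by apply: reg_par Dc Dt ag (par_sym pa).
have ph : par (h c) (h t) by apply: reg_par Dc Dt (gh c Dc) pg.
have pb : par (b c) (b t) by apply: reg_par Dc Dt (hb c Dc) ph.
by split; apply: par_sym.
Qed.

Lemma graph_fst T (D S : set T) c m k (g : T -> 'rV[K]_m) (a : T -> 'rV[K]_k) p :
  (forall v, v != 0 -> vclos (g @` S) v -> exists2 t, D t & par v (g t)) ->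
  pc (graph c g a S) p -> exists t v, [/\ D t, v != 0 & coords p (tens (g t) v)].
Proof.
move=> clg cl; have [u [v ew]] : exists u v, rep p = tens u v.
  by apply: tens_closed cl => _ [t _ <-]; exists (g t), (wedge (a t) (a c)).
have /andP [u0 v0] : (u != 0) && (v != 0).
  by rewrite -negb_or -tens_eq0 -ew rep_neq0.
have cl' : vclos (graph c g a S) (tens u v) by rewrite -ew.
have [t Dt ut] : exists2 t, D t & par u (g t).
  apply: clg => //.
  pose D3 := [set o : option T | if o is Some t then S t /\ wedge (a t) (a c) != 0 else True].
  pose y o := if o is Some t then g t else u.
  pose z o := if o is Some t then wedge (a t) (a c) else v.
  pose S3 := [set o : option T | if o is Some t then S t /\ wedge (a t) (a c) != 0 else False].
  have S3D : S3 `<=` D3 by case.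
  have := @cont _ _ D3 _ _ (fun o => tens (y o) (z o)) y S3 None I S3D
    (@reg_tensl _ _ D3 _ _ y z None u0 v0).
  move=> H; apply: vclos_mono (H _) => [_ [[t|] St <-] //|].
    by exists (g t); [exists t => //; case: St|apply: par_refl].
  have n0 : tens u v != 0 by apply: tens_neq0.
  apply: vclos_mono (vclos_neq0 n0 cl') => _ [[t Dt <-]].
  rewrite tens_eq0 negb_or => /andP [_ w0]; exists (tens (g t) (wedge (a t) (a c))).
    by exists (Some t).
  exact: par_refl.
exists t, v; split=> //.
apply/(coords_par _ (coords_rep p)); rewrite ew; apply: par_tens => //.
exact: par_refl.
Qed.

(** Being proportional to the secant from [a c] to [a t] is a closed condition that holds on the
    graph; where the secant is nonzero it determines [v]. *)
Lemma graph_off T (D S : set T) c m k (g : T -> 'rV[K]_m) (a : T -> 'rV[K]_k) t v :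
  D t -> S `<=` D -> g t != 0 -> v != 0 -> reg D g a t -> wedge (a t) (a c) != 0 ->
  vclos (graph c g a S) (tens (g t) v) -> par v (wedge (a t) (a c)).
Proof.
move=> Dt SD gt0 v0 ga w0 clt.
pose D3 := [set o : option T | if o is Some t then S t else True].
pose S3 := [set o : option T | if o is Some t then S t else False].
pose r o : T := if o is Some t' then t' else t.
pose z o := if o is Some t then wedge (a t) (a c) else v.
have S3D : S3 `<=` D3 by case.
have cl3 : vclos ([set tens (g (r o)) (z o) | o in S3]) (tens (g (r None)) (z None)).
  apply: vclos_mono clt => _ [t' Dt' <-]; eexists; last exact: par_refl.
  by exists (Some t').
apply/(wedge_par v0 w0)/eqP; have D3N : D3 None by [].
have D3D o : D3 o -> D (r o) by case: o => [t' /SD|].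
have rg := @reg_tensl _ _ D3 _ _ (fun o => g (r o)) z None gt0 v0.
have rz := @reg_tensr _ _ D3 _ _ (fun o => g (r o)) z None gt0 v0.
have ra : reg D3 (fun o => tens (g (r o)) (z o)) (fun o => wedge (a (r o)) (a c)) None.
  apply: reg_wedge => //; apply: (reg_trans D3N rg).
  by apply: (@reg_pull _ _ _ D D3 r).
have := cont_eq0 D3N S3D (reg_wedge2 D3N rz ra) cl3; apply.
by case=> // t' _; rewrite /= wedgexx.
Qed.

Lemma bl_rel_surj T (D : set T) c m n k l (g : T -> 'rV[K]_m)
    (h : T -> 'rV[K]_n) (a : T -> 'rV[K]_k) (b : T -> 'rV[K]_l) M M' p :
  blowup_data D c g h a b -> reg D a b c -> transports D a b c M ->
  (forall S u, S `<=` D -> u != 0 -> dirs a c S u -> par (u *m M *m M') u) ->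
  pc (graph c g a D) p ->
  exists2 s, bl_rel D c g h a b M M' s & coords p (tens (g s.1) s.2.1).
Proof.
move=> bd rab trM MM' cl; have [Dc g0 h0 a0 b0 gh hg ga hb ag bh clg clh] := bd.
have [t [v [Dt v0 pt]]] := graph_fst clg cl.
have clt : vclos (graph c g a D) (tens (g t) v) by apply/(pcE _ pt).
pose D3 := [set o : option T | if o is Some t then D t else True].
pose S3 := [set o : option T | if o is Some t then D t else False].
pose r t o : T := if o is Some t' then t' else t.
pose z o := if o is Some t then wedge (a t) (a c) else v.
have S3D : S3 `<=` D3 by case.
have cl3 s : vclos (graph c g a D) (tens (g s) v) ->
    vclos ([set tens (g (r s o)) (z o) | o in S3]) (tens (g (r s None)) (z None)).
  apply: vclos_mono => _ [t' Dt' <-]; eexists; last exact: par_refl.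
  by exists (Some t').
have [/eqP w0|w0] := eqVneq (wedge (a t) (a c)) 0; last first.
  have nb : wedge (b t) (b c) != 0.
    apply: contraNneq w0 => /eqP /(wedge_par (b0 t Dt) (b0 c Dc)) pb.
    have [_ _ pa] := blowup_data_par (blowup_data_sym bd) Dt pb.
    exact/(wedge_par (a0 t Dt) (a0 c Dc)).
  exists (t, (v, wedge (b t) (b c))) => //=; split=> //=.
    by apply: vclos_sub; exists t.
  right; split=> //; last exact: par_refl.
  exact: (graph_off Dt (fun _ x => x) (g0 t Dt) v0 (ga t Dt) w0 clt).
have pa : par (a t) (a c) by apply/(wedge_par (a0 t Dt) (a0 c Dc)).
have [pg ph pb] := blowup_data_par bd Dt pa.
have clc : vclos (graph c g a D) (tens (g c) v).
  by apply: vclos_par clt; apply: par_tens pg (par_refl _).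
have D3N : D3 None by [].
have D3D o : D3 o -> D (r c o) by case: o.
(* The first factor is changed from [g] to [a], in whose ambient space the secants are taken, so
   that the derivative of [b] with respect to [a] applies to [v]. *)
have dv : dirs a c D v.
  have rg : reg D3 (fun o => tens (g (r c o)) (z o)) (fun o => g (r c o)) None.
    exact: (@reg_tensl _ _ D3 _ _ (fun o => g (r c o)) z None (g0 c Dc) v0).
  have rz : reg D3 (fun o => tens (g (r c o)) (z o)) z None.
    exact: (@reg_tensr _ _ D3 _ _ (fun o => g (r c o)) z None (g0 c Dc) v0).
  have ra : reg D3 (fun o => tens (g (r c o)) (z o)) (fun o => a (r c o)) None.
    apply: (reg_trans D3N rg).
    by apply: (@reg_pull _ _ _ D D3 (r c)) => //; apply: ga.
  have := cont D3N S3D (reg_tens ra rz) (cl3 c clc).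
  apply: vclos_mono => _ [[t'|] // Dt' <-]; eexists; last exact: par_refl.
  by exists t'.
have MMv := MM' D v (fun _ x => x) v0 dv.
have vM0 : v *m M != 0.
  apply: contraNneq v0 => vM0; move: MMv; rewrite vM0 mul0mx => /par_eq0.
  by rewrite eqxx.
have db := transports_dirs Dc (fun _ x => x) (a0 c Dc) v0 rab trM dv.
exists (t, (v, v *m M)) => //=; split=> //=; last first.
  by left; split=> //; [exact: par_refl|exact: par_sym].
suff : vclos (graph c h b D) (tens (h c) (v *m M)).
  by apply: vclos_par; apply: par_tens (par_sym ph) (par_refl _).
pose z' o := if o is Some t then wedge (b t) (b c) else v *m M.
have rb : reg D3 (fun o => tens (b (r c o)) (z' o)) (fun o => b (r c o)) None.
  exact: (@reg_tensl _ _ D3 _ _ (fun o => b (r c o)) z' None (b0 c Dc) vM0).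
have rz : reg D3 (fun o => tens (b (r c o)) (z' o)) z' None.
  exact: (@reg_tensr _ _ D3 _ _ (fun o => b (r c o)) z' None (b0 c Dc) vM0).
have rh : reg D3 (fun o => tens (b (r c o)) (z' o)) (fun o => h (r c o)) None.
  apply: (reg_trans D3N rb).
  by apply: (@reg_pull _ _ _ D D3 (r c)).
have H := cont D3N S3D (reg_tens rh rz); apply: vclos_mono (H _).
  move=> _ [[t'|] // Dt' <-]; eexists; last exact: par_refl.
  by exists t'.
apply: vclos_mono db => _ [t' Dt' <-]; eexists; last exact: par_refl.
by exists (Some t').
Qed.

(** Over [c] regularity of the second direction is what [transports] provides; off [c] the secant of
    [a] stays nonzero nearby, and there the second direction is the secant of [b]. *)
Lemma bl_rel_reg T (D : set T) c m n k l (g : T -> 'rV[K]_m)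
    (h : T -> 'rV[K]_n) (a : T -> 'rV[K]_k) (b : T -> 'rV[K]_l) M M' s :
  blowup_data D c g h a b -> transports D a b c M ->
  bl_rel D c g h a b M M' s ->
  reg (bl_rel D c g h a b M M') (fun s => tens (g s.1) s.2.1)
    (fun s => tens (h s.1) s.2.2) s.
Proof.
move=> bd trM Ds; have [Dc g0 h0 a0 b0 gh hg ga hb ag bh clg clh] := bd.
set D2 := bl_rel _ _ _ _ _ _ _ _; have [D1 [u0 v0] _ _ cs] := Ds.
have D2D s' : D2 s' -> D s'.1 by case.
have rg : reg D2 (fun s => tens (g s.1) s.2.1) (fun s => g s.1) s.
  exact: (@reg_tensl _ _ D2 _ _ (fun s => g s.1) (fun s => s.2.1) s (g0 _ D1) u0).
have ru : reg D2 (fun s => tens (g s.1) s.2.1) (fun s => s.2.1) s.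
  exact: (@reg_tensr _ _ D2 _ _ (fun s => g s.1) (fun s => s.2.1) s (g0 _ D1) u0).
have rh : reg D2 (fun s => tens (g s.1) s.2.1) (fun s => h s.1) s.
  apply: (reg_trans Ds rg); apply: (@reg_pull _ _ _ D D2 fst) => //; exact: gh.
have ra : reg D2 (fun s => tens (g s.1) s.2.1) (fun s => a s.1) s.
  apply: (reg_trans Ds rg); apply: (@reg_pull _ _ _ D D2 fst) => //; exact: ga.
apply: reg_tens => //; case: cs => [[pa pb _ _]|[wa wb _ _]].
  apply: (reg_trans Ds (reg_tens ra ru)); apply: trM => // s' Ds'.
  split; first exact: D2D.
  by case: Ds' => _ _ _ _ [[? ? ? ?]|[? ? ? ?]]; [left|right].
have rw : reg D2 (fun s => tens (g s.1) s.2.1) (fun s => wedge (a s.1) (a c)) s.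
  exact: reg_wedge.
have [N hN N0] := form_neq0 1 wa.
apply: (reg_loc Ds rw hN N0 (h := fun s => wedge (b s.1) (b c))).
  move=> s' [Ds' [us' vs'] _ _ [[pa _ _ _]|[_ _ _ pv]] Ns']; last exact: par_sym.
  have /eqP w0 : wedge (a s'.1) (a c) == 0 by apply/(wedge_par (a0 _ Ds') (a0 c Dc)).
  have := form_scale 0 (wedge (a s.1) (a c)) hN; rewrite scale0r expr1 mul0r => N00.
  by move: Ns'; rewrite w0 N00 eqxx.
apply: reg_wedge => //; apply: (reg_trans Ds rh).
by apply: (@reg_pull _ _ _ D D2 fst) => //; apply: hb.
Qed.

Definition over_pt m k (v : 'rV[K]_m) : set (pspace K (m * k)) :=
  [set y | exists l, coords y (tens v l)].

(** At [c] the maps [a], [g], [h] and [b] are regular in each other, so the derivatives between [a]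
    and [b] exist and identify the fibres over [c]. Away from [c] both blow-ups are graphs of secant
    maps. *)
Lemma blowup_iso T (D : set T) c m n k l (g : T -> 'rV[K]_m)
    (h : T -> 'rV[K]_n) (a : T -> 'rV[K]_k) (b : T -> 'rV[K]_l) :
  blowup_data D c g h a b ->
  exists f, [/\ is_iso (pc (graph c g a D)) (pc (graph c h b D)) f,
    forall S, S `<=` D -> f @` pc (graph c g a S) = pc (graph c h b S) &
    f @` (pc (graph c g a D) `&` over_pt (g c)) = pc (graph c h b D) `&` over_pt (h c)].
Proof.
move=> bd; have [Dc g0 h0 a0 b0 gh hg ga hb ag bh clg clh] := bd.
have rab : reg D a b c.
  by apply: reg_trans Dc ag (reg_trans Dc (gh c Dc) (hb c Dc)).
have rba : reg D b a c.
  by apply: reg_trans Dc bh (reg_trans Dc (hg c Dc) (ga c Dc)).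
have [M [M' [trM trM' MM M'M]]] := dirs_iso Dc (a0 c Dc) (b0 c Dc) rab rba.
set D2 := bl_rel D c g h a b M M'.
pose G (s : T * ('rV[K]_(k * k) * 'rV[K]_(l * l))) := tens (g s.1) s.2.1.
pose H (s : T * ('rV[K]_(k * k) * 'rV[K]_(l * l))) := tens (h s.1) s.2.2.
have HX p : pc (graph c g a D) p <-> exists2 s, D2 s & coords p (G s).
  split=> [/(bl_rel_surj bd rab trM MM) //|[s [Ds _ cl _ _] ps]].
  exact/(pcE _ ps).
have HY p : pc (graph c h b D) p <-> exists2 s, D2 s & coords p (H s).
  split=> [|[s [Ds _ _ cl _] ps]]; last exact/(pcE _ ps).
  move=> /(bl_rel_surj (blowup_data_sym bd) rba trM' M'M) [[t [u v]] Ds ps].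
  by exists (t, (v, u)) => //; apply: bl_rel_sym.
have GH0 s : D2 s -> G s != 0 /\ H s != 0.
  by move=> [Ds [u0 v0] _ _ _]; rewrite !tens_neq0 ?g0 ?h0.
have rGH s : D2 s -> reg D2 G H s by apply: bl_rel_reg.
have rHG s : D2 s -> reg D2 H G s.
  case: s => t [u v] Ds0; have Ds := bl_rel_sym Ds0.
  pose sw (s : T * ('rV[K]_(k * k) * 'rV[K]_(l * l))) := (s.1, (s.2.2, s.2.1)).
  have D2sw s : D2 s -> bl_rel D c h g b a M' M (sw s).
    by case: s => t' [u' v'] Ds'; apply: bl_rel_sym.
  exact: (@reg_pull _ _ _ _ D2 sw _ _ _ _ (t, (u, v)) D2sw
    (bl_rel_reg (blowup_data_sym bd) trM' Ds)).
have [p0 _] := coords_ex (tens_neq0 (g0 c Dc) (tens_neq0 (a0 c Dc) (a0 c Dc))).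
have [q0 _] := coords_ex (tens_neq0 (h0 c Dc) (tens_neq0 (b0 c Dc) (b0 c Dc))).
have [f hf fGH] := iso_param p0 q0 GH0 rGH rHG HX HY.
have HX1 p : pc (graph c g a D) p -> exists2 s, D2 s & coords p (G s) by move=> /HX.
have HY1 p : pc (graph c h b D) p -> exists2 s, D2 s & coords p (H s) by move=> /HY.
have gmono T' m' k' (c' : T') (g' : T' -> 'rV[K]_m') (a' : T' -> 'rV[K]_k') S S' :
    S `<=` S' -> pc (graph c' g' a' S) `<=` pc (graph c' g' a' S').
  move=> SS p; apply: vclos_mono => w [t /SS St <-]; eexists; last exact: par_refl.
  by exists t.
exists f; split=> // [S SD|].
  (* The parameters whose directions are actual secants. Those with zero secant drop out, and they
     are the same for [a] and for [b], being the ones over [c]. *)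
  pose S2 := [set s | [/\ D2 s, S s.1, s.2.1 = wedge (a s.1) (a c)
    & s.2.2 = wedge (b s.1) (b c)]].
  have S2D : S2 `<=` D2 by move=> s [].
  have mkS t : S t -> wedge (a t) (a c) != 0 \/ wedge (b t) (b c) != 0 ->
      S2 (t, (wedge (a t) (a c), wedge (b t) (b c))).
    move=> St w; have Dt := SD t St.
    have [wa wb] : wedge (a t) (a c) != 0 /\ wedge (b t) (b c) != 0.
      have ab : wedge (a t) (a c) == 0 <-> wedge (b t) (b c) == 0.
        split=> [/(wedge_par (a0 t Dt) (a0 c Dc)) pa|/(wedge_par (b0 t Dt) (b0 c Dc)) pb].
          have [_ _ pb] := blowup_data_par bd Dt pa.
          exact/(wedge_par (b0 t Dt) (b0 c Dc)).
        have [_ _ pa] := blowup_data_par (blowup_data_sym bd) Dt pb.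
        exact/(wedge_par (a0 t Dt) (a0 c Dc)).
      split; apply/negP => /ab => e; case: w => /negP; apply=> //; exact/ab.
    split=> //=; split=> //=.
    - by apply: vclos_sub; exists t.
    - by apply: vclos_sub; exists t.
    - by right; split=> //; exact: par_refl.
  have eG : pc (G @` S2) = pc (graph c g a S).
    apply/seteqP; split=> p.
      apply: vclos_mono => _ [[t [u v]] [_ St /= -> _] <-]; eexists; last exact: par_refl.
      by exists t.
    move=> /(vclos_neq0 (rep_neq0 p)); apply: vclos_mono => _ [[t St <-]].
    rewrite tens_eq0 negb_or => /andP [_ w0]; eexists; last exact: par_refl.
    by exists (t, (wedge (a t) (a c), wedge (b t) (b c))) => //; apply: mkS => //; left.
  have eH : pc (H @` S2) = pc (graph c h b S).
    apply/seteqP; split=> p.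
      apply: vclos_mono => _ [[t [u v]] [_ St /= _ ->] <-]; eexists; last exact: par_refl.
      by exists t.
    move=> /(vclos_neq0 (rep_neq0 p)); apply: vclos_mono => _ [[t St <-]].
    rewrite tens_eq0 negb_or => /andP [_ w0]; eexists; last exact: par_refl.
    by exists (t, (wedge (a t) (a c), wedge (b t) (b c))) => //; apply: mkS => //; right.
  rewrite -eG -eH; apply: (image_pc GH0 rGH rHG HX1 HY1 fGH S2D).
    by rewrite eG; apply: gmono.
  by rewrite eH; apply: gmono.
have [f' hf' [ff' f'f]] := is_iso_sym hf.
have overE s : D2 s -> par (g s.1) (g c) <-> par (h s.1) (h c).
  move=> [Ds _ _ _ _]; split=> [pg|ph].
    by apply/par_sym/(reg_par Dc Ds (gh c Dc))/par_sym.
  by apply/par_sym/(reg_par Dc Ds (hg c Dc))/par_sym.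
apply/seteqP; split=> [_ [p [Xp [e pe]] <-]|q [Yq [e qe]]].
  have [s Ds ps] := HX1 p Xp; have [_ Hs0] := GH0 s Ds.
  have [q qs] := coords_ex Hs0; rewrite (fGH s p q Ds ps qs).
  split; first by apply/HY; exists s.
  have [_ [u0 v0] _ _ _] := Ds.
  have [pg _] : par (g s.1) (g c) /\ par s.2.1 e.
    apply: tens_par => //; first by apply: g0; case: Ds.
    exact/(coords_par _ ps).
  exists s.2.2; apply/(coords_par _ qs); apply: par_tens (par_refl _).
  exact/(overE s Ds).
have [s Ds qs] := HY1 q Yq; have [Gs0 _] := GH0 s Ds.
have [p ps] := coords_ex Gs0; exists p; last exact: fGH ps qs.
split; first by apply/HX; exists s.
have [_ [u0 v0] _ _ _] := Ds.
have [ph _] : par (h s.1) (h c) /\ par s.2.2 e.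
  apply: tens_par => //; first by apply: h0; case: Ds.
  exact/(coords_par _ qs).
exists s.2.1; apply/(coords_par _ ps); apply: par_tens (par_refl _).
exact/(overE s Ds).
Qed.

End BlowupIso.

(** * Functoriality, complements, and adding a centre *)

Section PointBlowup.
Variable K : numFieldType.
Implicit Types ps qs : seq (pspace K 3).

Definition zclosed m (A : set (pspace K m)) : Prop := pc (cone A) `<=` A.

Lemma pc_closed m (S : set 'rV[K]_m) : zclosed (pc S).
Proof.
move=> p; apply: vclos_idem => v [q Sq qv].
exact/(pcE _ qv).
Qed.

Lemma blowup_closed m (A : set (pspace K m)) (qs : seq (pspace K m)) : zclosed (blowup A qs).
Proof. by rewrite blowupE; apply: pc_closed. Qed.

Lemma zclosedI m (A B : set (pspace K m)) : zclosed A -> zclosed B -> zclosed (A `&` B).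
Proof.
move=> cA cB p h; split; [apply: cA|apply: cB]; apply: vclos_mono h => v [q [Aq Bq] qv];
  by exists v; [exists q|apply: par_refl].
Qed.

Lemma zclosedU m (A B : set (pspace K m)) : zclosed A -> zclosed B -> zclosed (A `|` B).
Proof.
move=> cA cB p h; have /vclosU : vclos (cone A `|` cone B) (rep p).
  apply: vclos_mono h => v [q [Aq|Bq] qv]; exists v; try exact: par_refl.
    by left; exists q.
  by right; exists q.
by move=> [/cA|/cB]; [left|right].
Qed.

Lemma closed_rep m (A : set (pspace K m)) : zclosed A -> closed_image A (@rep K m).
Proof.
move=> cA v v0 cl; have [p pv] := coords_ex v0; exists p; last exact: coords_eqP.
apply: cA; apply/(pcE _ pv); apply: vclos_mono cl => _ [q Aq <-].
by exists (rep q); [exists q => //; apply: coords_rep|apply: par_refl].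
Qed.

Lemma over_closed m k (v : 'rV[K]_m) : v != 0 -> zclosed (@over_pt K m k v).
Proof.
move=> v0 p cl; have [u [l el]] : exists u l, rep p = tens u l.
  apply: tens_closed cl => w [q [l ql] /(coords_par _ ql) /par_sym [a a0 ->]].
  by exists (a *: v), l; rewrite -[l in RHS]scale1r tensZ mulr1.
have /andP [u0 l0] : (u != 0) && (l != 0).
  by rewrite -negb_or -tens_eq0 -el rep_neq0.
have : wedge u v = 0.
  pose D := [set t : 'rV[K]_m * 'rV[K]_k | t.1 != 0 /\ t.2 != 0].
  pose S := [set t : 'rV[K]_m * 'rV[K]_k | [/\ t.1 != 0, t.2 != 0 & par t.1 v]].
  have SD : S `<=` D by move=> t [].
  have Dt : D (u, l) by [].
  have := @cont_eq0 _ _ D _ _ (fun t => tens t.1 t.2) (fun t => wedge t.1 v) S (u, l) Dt SD.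
  apply.
  - by apply: reg_wedge => //; apply: reg_tensl.
  - rewrite /= -el; apply: vclos_mono cl => w [q [l' ql'] qw].
    have := coords_neq0 ql'; rewrite tens_eq0 negb_or => /andP [_ l0'].
    exists (tens v l'); last exact/par_sym/(coords_par _ ql').
    by exists (v, l') => //; split=> //; apply: par_refl.
  - by move=> t [_ _ [a _ ->]]; rewrite wedgeZl wedgexx scaler0.
move=> /eqP /(wedge_par u0 v0) uv; exists l; apply/(coords_par _ (coords_rep p)).
by rewrite el; apply: par_tens => //; apply: par_refl.
Qed.

(** The centre may be kept in [A]: it contributes the zero vector, which does not affect the nonzero
    vectors of a closure. *)
Lemma blowup1E m (A : set (pspace K m)) q :
  blowup A [:: q] = pc (graph q (@rep K m) (@rep K m) A).
Proof.
rewrite blowupE; apply/seteqP; split=> p.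
  apply: vclos_mono => _ [v [x [Ax xq] xv] <-].
  exists (tens (rep x) (wedge (rep x) (rep q))); first by exists x.
  have vx := coords_eqP xv; apply: (par_tens vx); apply: (par_wedge vx).
  exact: par_refl.
move=> /(vclos_neq0 (rep_neq0 p)); apply: vclos_mono => _ [[x Ax <-]].
rewrite tens_eq0 negb_or => /andP [_ w0]; eexists; last exact: par_refl.
exists (rep x) => //; exists x; last exact: coords_rep.
split=> //=; rewrite inE; apply: contraNneq w0 => ->.
by rewrite wedgexx.
Qed.

Lemma over1E m (y : pspace K (bldim m 1)) (q : pspace K m) v : coords q v ->
  Defs.over y q <-> @over_pt K m (m * m) v y.
Proof.
move=> qv; split=> [[u [l [qu yl]]]|[l yl]].
  exists (l 0%N); apply/(coords_par _ yl); apply: par_tens (par_refl _).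
  exact/(coords_par _ qu).
by exists v, (fun=> l).
Qed.

Lemma exceptional1E m (X : set (pspace K m)) q :
  exceptional X [:: q] q = blowup X [:: q] `&` @over_pt K m (m * m) (rep q).
Proof.
apply/seteqP; split=> y [Xy oy]; split=> //.
  exact/(over1E _ (coords_rep q)).
exact/(over1E _ (coords_rep q)).
Qed.

Lemma iso_regs m n (X : set (pspace K m)) (Y : set (pspace K n)) f :
  is_iso X Y f ->
  (forall x, X x -> reg X (@rep K m) (fun p => rep (f p)) x) /\
  (forall x, X x -> reg X (fun p => rep (f p)) (@rep K m) x).
Proof.
move=> [g [rf rg fg gf]]; split=> x Xx; first exact: reg_of_regular.
have Yf := (fg x Xx).1; have := reg_of_regular Yf rg.
move=> /(@reg_pull _ _ _ Y X f _ _ (@rep K n) (fun p => rep (g p)) x (fun t Xt => (fg t Xt).1)).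
by apply: reg_ext => t Xt; rewrite (fg t Xt).2; apply: par_refl.
Qed.

(** The points of X are their own parameters, and secants are taken in the ambient spaces of X and
    Y, so the local maps [a] and [b] are [g] and [h] themselves. *)
Lemma blowup_pt_iso m n (X : set (pspace K m)) (Y : set (pspace K n)) f q :
  is_iso X Y f -> zclosed X -> zclosed Y -> X q ->
  exists F, [/\ is_iso (blowup X [:: q]) (blowup Y [:: f q]) F,
    forall A, A `<=` X -> F @` blowup A [:: q] = blowup (f @` A) [:: f q]
  & F @` exceptional X [:: q] q = exceptional Y [:: f q] (f q)].
Proof.
move=> fiso cX cY Xq; have [r1 r2] := iso_regs fiso.
have fX : f @` X = Y.
  have [g [_ _ fg gf]] := fiso; apply/seteqP; split=> [_ [x /fg [Yx _] <-] //|y].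
  by move=> /gf [Xy e]; exists (g y).
have clf : closed_image X (fun p => rep (f p)).
  move=> v v0 cl; have [y Yy vy] : exists2 y, Y y & par v (rep y).
    apply: closed_rep => //; apply: vclos_mono cl => _ [x Xx <-].
    by exists (rep (f x)); [exists (f x) => //; rewrite -fX; exists x|apply: par_refl].
  by move: Yy vy; rewrite -fX => -[x Xx <-] vy; exists x.
have bd : blowup_data X q (@rep K m) (fun p => rep (f p)) (@rep K m) (fun p => rep (f p)).
  split=> //; try by move=> *; apply: rep_neq0.
  - by move=> t _; apply: reg_refl.
  - by move=> t _; apply: reg_refl.
  - exact: reg_refl.
  - exact: reg_refl.
  - exact: closed_rep.
have gr A : pc (graph q (fun p => rep (f p)) (fun p => rep (f p)) A) = blowup (f @` A) [:: f q].
  rewrite blowup1E; apply/seteqP; split=> p; apply: vclos_mono => _ [t At <-].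
    by eexists; last exact: par_refl; exists (f t) => //; exists t.
  by have [x Ax <-] := At; eexists; last exact: par_refl; exists x.
have [F [F1 F2 F3]] := blowup_iso bd; exists F.
have eY := gr X; rewrite fX in eY.
rewrite !exceptional1E -eY !blowup1E; split=> // A AX.
by rewrite blowup1E -gr; apply: F2.
Qed.

(** Off the exceptional curve a point of the blow-up is a point of X together with its secant to
    [q], so the blow-down is injective there. As [q] lies in A, no secant from a point of X minus A
    is zero. *)
Lemma blowup_complement m (X A : set (pspace K m)) q :
  zclosed X -> zclosed A -> A `<=` X -> A q ->
  isomorphic (blowup X [:: q] `\` (blowup A [:: q] `|` exceptional X [:: q] q)) (X `\` A).
Proof.
move=> cX cA AX Aq.
pose D := X `\` A; pose g (t : pspace K m) := tens (rep t) (wedge (rep t) (rep q)).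
have off t : D t -> wedge (rep t) (rep q) != 0.
  move=> [_ nAt]; apply: (wedge_rep (coords_rep t)).
  by apply: contra_notN nAt => /eqP ->.
have g0 t : D t -> g t != 0 by move=> /off w0; rewrite tens_neq0 ?rep_neq0.
have HX p : (blowup X [:: q] `\` (blowup A [:: q] `|` exceptional X [:: q] q)) p <->
    exists2 t, D t & coords p (g t).
  rewrite exceptional1E !blowup1E; split=> [[Xp nAE]|[t Dt pt]].
    have [t [l [Xt l0 pt]]] := graph_fst (closed_rep cX) Xp.
    have tq : wedge (rep t) (rep q) != 0.
      apply/negP => /(wedge_par (rep_neq0 t) (rep_neq0 q)) h; apply: nAE; right.
      split=> //; exists l; apply/(coords_par _ pt); apply: par_tens => //.
      exact: par_refl.
    have cl : vclos (graph q (@rep K m) (@rep K m) X) (tens (rep t) l) by apply/(pcE _ pt).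
    have pl := graph_off Xt (fun _ x => x) (rep_neq0 t) l0 (reg_refl X _ t) tq cl.
    have pg : coords p (g t).
      by apply/(coords_par _ pt); apply: par_tens => //; apply: par_refl.
    exists t => //; split=> // At; apply: nAE; left; apply/(pcE _ pg).
    by apply: vclos_sub; exists t.
  have [Xt nAt] := Dt; split; first by apply/(pcE _ pt); apply: vclos_sub; exists t.
  case=> [Ap|[_ [l pl]]].
    have [t' [l [At' l0 pt']]] := graph_fst (closed_rep cA) Ap.
    have [tt _] : par (rep t') (rep t) /\ par l (wedge (rep t) (rep q)).
      by apply: tens_par => //; [apply: rep_neq0|apply/(coords_par _ pt')].
    by apply: nAt; rewrite -(coords_trans (coords_rep t') (coords_rep t) tt).
  have [tt _] : par (rep t) (rep q) /\ par (wedge (rep t) (rep q)) l.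
    by apply: tens_par; [apply: rep_neq0|apply: off|apply/(coords_par _ pt)].
  have /eqP := off t Dt; apply; apply/eqP.
  exact/(wedge_par (rep_neq0 t) (rep_neq0 q)).
have rg0 : tens (rep q) (tens (rep q) (rep q)) != 0 by rewrite !tens_neq0 ?rep_neq0.
have [p0 _] := coords_ex rg0.
have [|t Dt|t Dt|p|f hf _] := @iso_param _ _ D _ _ g (@rep K m) _ (X `\` A) p0 q _ _ _ HX.
- by move=> t Dt; rewrite g0 ?rep_neq0.
- apply: (@reg_tensl _ _ D _ _ (@rep K m) (fun t => wedge (rep t) (rep q))).
    exact: rep_neq0.
  exact: off.
- by apply: reg_tens; [|apply: reg_wedge => //]; apply: reg_refl.
- split=> [Dp|[t Dt pt]]; first by exists p => //; apply: coords_rep.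
  by rewrite (coords_inj pt (coords_rep t)).
by exists f.
Qed.

(* The number of centres is a separate argument, because [size (rcons ps p)] does
   not compute. *)
Definition blowupk k (A : set (pspace K 3)) (qs : seq (pspace K 3)) :
    set (pspace K (bldim 3 k)) :=
  pc ((fun v : 'rV[K]_3 => segre k v (fun i => wedge v (map (@rep K 3) qs)`_i)) @`
    cone (A `&` [set x | x \notin qs])).
Arguments blowupk k A qs _ : clear implicits.

Lemma lift_rcons ps t v :
  segre (size ps).+1 v (fun i => wedge v (map (@rep K 3) (rcons ps t))`_i) =
  tens (blift ps v) (wedge v (rep t)).
Proof.
rewrite segreS map_rcons nth_rcons size_map ltnn eqxx; congr tens.
by apply: eq_segre => i ip; rewrite nth_rcons size_map ip.
Qed.

Lemma lift_cross_neq0 ps (v : 'rV[K]_3) p : blift ps v != 0 -> coords p v -> p \notin ps.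
Proof.
move=> l0 pv; apply/negP => /nth_rep [ip ep].
have [_ /(_ _ ip)] := segre_eq0 l0; rewrite ep => /eqP; apply; apply/eqP.
by apply/(wedge_par (coords_neq0 pv) (rep_neq0 p)); apply: coords_eqP.
Qed.

Lemma flags_closed ps : uniq ps ->
  closed_image (flags ps) (fun t : 'rV[K]_3 * ('rV[K]_3 -> 'rV[K]_3) => sg ps t.1 t.2).
Proof.
move=> ups v v0 cl; have [p pv] := coords_ex v0.
have /(blowupT _ ups) [t ft pt] : blowup setT ps p.
  rewrite blowupE; apply/(pcE _ pv); apply: vclos_idem cl => _ [t ft <-].
  exact: sg_blowup.
by exists t => //; apply/(coords_par _ pv).
Qed.

Lemma reg_fst_sg ps (D : set ('rV[K]_3 * ('rV[K]_3 -> 'rV[K]_3))) t p :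
  D `<=` flags ps -> D t -> coords p t.1 -> p \notin ps ->
  reg D fst (fun t => sg ps t.1 t.2) t.
Proof.
move=> Df Dt pt pp; have l0 := lift_neq0 pt pp; have [N hN N0] := form_neq0 1 l0.
have rl : reg D fst (fun t => blift ps t.1) t by apply: reg_lift => //; apply: reg_refl.
apply: (reg_loc Dt rl hN N0 _ rl) => s Ds Ns.
have ls0 : blift ps s.1 != 0.
  apply: contraNneq Ns => ->; have := form_scale 0 (blift ps t.1) hN.
  by rewrite scale0r expr1 mul0r => ->.
have [s0 _] := Df s Ds; have [q qs] := coords_ex s0.
exact/par_sym/(sg_off (Df s Ds) qs)/(lift_cross_neq0 ls0 qs).
Qed.

(** Near a point [t] that is not a centre, the plane and its blow-up at [ps] are locally isomorphic.
    The iterated blow-up takes secants in the Segre space, the simultaneous one in the plane; this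
    is the freedom between [a] and [b] in [blowup_data]. *)
Lemma blowup_rcons_aux ps t t' k : uniq ps -> t \notin ps ->
  coords t' (blift ps (rep t)) -> k = (size ps).+1 ->
  exists F : pspace K (bldim (bldim 3 (size ps)) (size [:: t'])) -> pspace K (bldim 3 k),
  [/\ is_iso (blowup (blowup setT ps) [:: t']) (blowupk k setT (rcons ps t)) F,
    forall A, F @` blowup (blowup A ps) [:: t'] = blowupk k A (rcons ps t)
  & F @` exceptional (blowup setT ps) [:: t'] t' =
    blowupk k setT (rcons ps t) `&` [set y | Defs.over y t]].
Proof.
move=> ups tp tt' ->.
pose g (s : 'rV[K]_3 * ('rV[K]_3 -> 'rV[K]_3)) := sg ps s.1 s.2.
pose D := flags ps; pose c := (rep t, cross (rep t)).
have Dc : D c by apply: flags_cross (coords_rep t) tp.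
have gc : g c = blift ps (rep t) by rewrite lift_sg.
have bd : blowup_data D c g g g fst.
  split=> //; try by move=> s Ds; apply: sg_neq0.
  - by move=> s [].
  - by move=> s _; apply: reg_refl.
  - by move=> s _; apply: reg_refl.
  - by move=> s _; apply: reg_refl.
  - by move=> s Ds; apply: sg_regx => //; apply: sg_neq0.
  - exact: reg_refl.
  - exact: reg_fst_sg (fun _ x => x) Dc (coords_rep t) tp.
  - exact: flags_closed.
  - exact: flags_closed.
pose SA (A : set (pspace K 3)) := [set s | D s /\ vclos (lifts A ps) (g s)].
have SAD A : SA A `<=` D by move=> s [].
have DE : SA setT = D.
  by apply/seteqP; split=> [s []//|s Ds]; split=> //; apply: sg_blowup.
have eg A : pc (graph c g g (SA A)) = blowup (blowup A ps) [:: t'].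
  rewrite blowup1E; apply/seteqP; split=> p; apply: vclos_mono => u [s].
    move=> [Ds As] <-; have [q qs] := coords_ex (sg_neq0 Ds).
    exists (tens (rep q) (wedge (rep q) (rep t'))).
      by exists q => //; rewrite blowupE; apply/(pcE _ qs).
    have qe := coords_eqP qs; apply: (par_tens qe); apply: (par_wedge qe).
    by rewrite gc; apply: coords_eqP.
  move=> As <-; have [s' Ds' [ss' _]] := blowup_flags ups As.
  exists (tens (g s') (wedge (g s') (g c))).
    by exists s' => //; split=> //; move: As; rewrite blowupE => /(pcE _ ss').
  have qe := par_sym (coords_eqP ss'); apply: (par_tens qe); apply: (par_wedge qe).
  by rewrite gc; apply/par_sym/coords_eqP.
have eh A : pc (graph c g fst (SA A)) = blowupk (size ps).+1 A (rcons ps t).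
  apply/seteqP; split=> p; last first.
    apply: vclos_mono => _ [v [x [Ax xp] xv] <-].
    exists (tens (g (v, cross v)) (wedge v (rep t))).
      have xp' : x \notin ps by move: xp; rewrite /= mem_rcons inE negb_or => /andP [].
      exists (v, cross v) => //; split; first exact: flags_cross xv xp'.
      rewrite /g /= -lift_sg; apply: vclos_sub; exists v => //; exists x => //.
    by rewrite lift_rcons // lift_sg; apply: par_refl.
  (* A point of the strict transform with nonzero secant is a limit of lifts; near it the secants
     stay nonzero, so the lifts may be taken away from [t] as well. *)
  move=> /(vclos_neq0 (rep_neq0 p)); apply: vclos_idem => _ [[s [Ds As] <-]].
  rewrite tens_eq0 negb_or => /andP [gs0 w0].
  pose S2 := [set s : 'rV[K]_3 * ('rV[K]_3 -> 'rV[K]_3) |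
    D s /\ exists2 v, cone (A `&` [set x | x \notin ps]) v & s = (v, cross v)].
  have S2D : S2 `<=` D by move=> s' [].
  have cl : vclos (g @` S2) (g s).
    apply: vclos_mono As => _ [v [x [Ax xp] xv] <-]; eexists; last exact: par_refl.
    exists (v, cross v); last by rewrite /g /= -lift_sg.
    split; first exact: flags_cross xv xp.
    by exists v => //; exists x.
  have rx : reg D g fst s by apply: sg_regx.
  have rw : reg D g (fun s => wedge s.1 (rep t)) s by apply: reg_wedge.
  have [N hN N0] := form_neq0 1 w0.
  have S3D : S2 `&` [set s | N (wedge s.1 (rep t)) != 0] `<=` D by move=> s' [/S2D].
  have := cont Ds S3D (reg_tens (reg_refl D g s) rw) (cont_loc Ds S2D rw hN N0 cl).
  apply: vclos_mono => _ [s' [[Ds' [v [x [Ax xp] xv] es']] /= Ns'] <-].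
  rewrite es' /g /= -lift_sg -lift_rcons //.
  eexists; last exact: par_refl; exists v => //; exists x => //; split=> //=.
  rewrite mem_rcons inE negb_or xp andbT; apply: contraNneq Ns' => xt.
  have /eqP -> : wedge s'.1 (rep t) == 0.
    rewrite es'; apply/(wedge_par (coords_neq0 xv) (rep_neq0 t)).
    by rewrite -xt; apply: coords_eqP.
  by have := form_scale 0 (wedge s.1 (rep t)) hN; rewrite scale0r expr1 mul0r => ->.
have [F [F1 F2 F3]] := blowup_iso bd; exists F; rewrite -!DE !eg !eh in F1 F3 *.
split=> // [A|]; first by rewrite -eg -eh; apply: F2.
rewrite exceptional1E.
have -> : @over_pt K _ (bldim 3 (size ps) * bldim 3 (size ps)) (rep t') = over_pt (g c).
  have pt : par (rep t') (g c) by rewrite gc; apply/par_sym/coords_eqP.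
  apply/seteqP; split=> y [l yl]; exists l; apply/(coords_par _ yl);
    apply: par_tens (par_refl _) => //; exact: par_sym.
rewrite F3; apply/seteqP; split=> y [Xy]; last first.
  move=> [v [l [tv yl]]]; split=> //; move: Xy; rewrite -eh DE.
  move=> /(graph_fst (flags_closed ups)) [s [u [Ds u0 ys]]].
  have [gs _] : par (segre (size ps) v l) (g s) /\ par (l (size ps)) u.
    have := coords_neq0 yl; rewrite segreS tens_eq0 negb_or => /andP [a b].
    by apply: tens_par => //; apply/(coords_par _ yl).
  have [sv _] := segre_par (sg_neq0 Ds) (par_sym gs).
  have ts : coords t s.1 by apply/(coords_par _ tv); apply: par_sym.
  exists u; apply/(coords_par _ ys); apply: par_tens (par_refl _).
  rewrite gc; apply: par_trans (sg_off Ds ts tp) _.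
  by apply: par_lift; apply: coords_eqP.
move=> [l yl]; split=> //; rewrite gc in yl.
exists (rep t), (fun i => if i == size ps then l else wedge (rep t) (map (@rep K 3) ps)`_i).
split; first exact: coords_rep.
rewrite segreS eqxx (@eq_segre _ _ _ _ _ (fun i => wedge (rep t) (map (@rep K 3) ps)`_i)) //.
by move=> i ip; rewrite ltn_eqF.
Qed.

Lemma blowup_rcons ps t t' : uniq ps -> t \notin ps -> coords t' (blift ps (rep t)) ->
  exists F, [/\ is_iso (blowup (blowup setT ps) [:: t']) (blowup setT (rcons ps t)) F,
    forall A, F @` blowup (blowup A ps) [:: t'] = blowup A (rcons ps t)
  & F @` exceptional (blowup setT ps) [:: t'] t' = exceptional setT (rcons ps t) t].
Proof.
move=> ups tp tt'; have [F [F1 F2 F3]] := blowup_rcons_aux ups tp tt' (size_rcons ps t).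
have bE A : blowupk (size (rcons ps t)) A (rcons ps t) = blowup A (rcons ps t).
  by rewrite blowupE.
by exists F; rewrite -!bE; split=> // [A|]; rewrite ?F2 ?bE // F3 bE.
Qed.

End PointBlowup.

(** * Curves with one point at infinity *)

Section Curves.
Variable K : numFieldType.
Implicit Types (A : set (pspace K 3)) (ps : seq (pspace K 3)).
Implicit Types (B : 'M[K]_3) (kappa : {poly K}) (s : K).

Definition rows3 (u v w : 'rV[K]_3) : 'M[K]_3 :=
  \matrix_(i < 3) nth u [:: u; v; w] i.

Lemma rows3E (u v w x : 'rV[K]_3) :
  x *m rows3 u v w = x 0 0 *: u + x 0 1 *: v + x 0 2 *: w.
Proof. by apply/rowP => j; rewrite !mxE sum3 !mxE. Qed.

Lemma unit3 B : (forall u : 'rV[K]_3, u *m B = 0 -> u = 0) -> B \in unitmx.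
Proof.
move=> h; rewrite -row_free_unit -kermx_eq0; apply/rowV0P => v /sub_kermxP.
exact: h.
Qed.

Lemma mul_unit_eq0 B (u : 'rV[K]_3) : B \in unitmx -> (u *m B == 0) = (u == 0).
Proof.
move=> uB; apply/eqP/eqP => [e|->]; last by rewrite mul0mx.
by rewrite -(mulmxK uB u) e mul0mx.
Qed.

Lemma par_unit B (u v : 'rV[K]_3) : B \in unitmx -> par (u *m B) (v *m B) -> par u v.
Proof. by move=> uB /(@par_mul _ _ _ _ _ (invmx B)); rewrite !mulmxK. Qed.

(** The graph of [kappa] in the affine chart where the middle coordinate of the frame [B] is 1.
    Lines are the case [kappa = 0]. *)
Definition gamma B kappa s : 'rV[K]_3 := row3 s 1 kappa.[s] *m B.

Lemma gamma_poly B kappa : ispolyv (gamma B kappa).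
Proof.
apply: ispolyv_mul; apply: ispolyv_row3; first exact: ispoly_id.
  exact: ispoly_cst.
exact: ispoly_horner.
Qed.

Lemma row3_neq0 (a b c : K) : b != 0 -> row3 a b c != 0.
Proof. by move=> b0; apply/rV0Pn; exists 1; rewrite row3E. Qed.

Lemma gamma_neq0 B kappa s : B \in unitmx -> gamma B kappa s != 0.
Proof. by move=> uB; rewrite mul_unit_eq0 // row3_neq0 ?oner_eq0. Qed.

Definition affine_proj : 'M[K]_(3, 2) := \matrix_(i < 3, j < 2) (i + j == 1)%N%:R.

Lemma affine_projE (u : 'rV[K]_3) j :
  (u *m affine_proj) 0 j = if j == 0 then u 0 1 else u 0 0.
Proof.
rewrite mxE sum3 !mxE; case: j => [[|[|//]] hj] /=; ring.
Qed.

Lemma gamma_affine B kappa s : B \in unitmx ->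
  gamma B kappa s *m (invmx B *m affine_proj) = affine_coords s.
Proof.
move=> uB; rewrite mulmxA mulmxK //; apply/rowP => j; rewrite affine_projE !row3E mxE.
by case: j => [[|[|//]] hj].
Qed.

Lemma gamma_inj B kappa s s' : B \in unitmx ->
  par (gamma B kappa s) (gamma B kappa s') -> s = s'.
Proof.
move=> uB /(@par_mul _ _ _ _ _ (invmx B *m affine_proj)).
by rewrite !gamma_affine //; apply: par_affine.
Qed.

Lemma reg_gamma_affine T (D : set T) m (g : T -> 'rV[K]_m) (x : T -> 'rV[K]_3)
    (sg : T -> K) B kappa t0 : B \in unitmx ->
  (forall t, D t -> par (x t) (gamma B kappa (sg t))) -> reg D g x t0 ->
  reg D g (fun t => affine_coords (sg t)) t0.
Proof.
move=> uB hx rx; apply: reg_ext (reg_mul (invmx B *m affine_proj) rx) => t Dt.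
rewrite -(gamma_affine kappa _ uB); apply: par_mul; exact: hx.
Qed.

Lemma cof_in ps (R : pspace K 3 -> K -> Prop) :
  (forall p, p \in ps -> cof (R p)) -> cof (fun s => forall p, p \in ps -> R p s).
Proof.
elim: ps => [|p ps IH] h; first exact: cof_true.
have := cof_and (h p (mem_head _ _)) (IH (fun q qp => h q (mem_behead (s := p :: ps) qp))).
by apply: cof_imp => s [h1 h2] q; rewrite inE => /orP [/eqP ->|/h2].
Qed.

Lemma cof_inv (P : K -> Prop) : cof P -> cof (fun s => P s^-1).
Proof.
move=> [E hE]; exists (map (@GRing.inv K) E) => s sE; apply: hE.
by apply: contra sE => sE; apply/mapP; exists s^-1; rewrite ?invrK.
Qed.

(* The point [t] is the limit of the affine curve at infinity. *)
Definition pcurve A (t : pspace K 3) B kappa : Prop :=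
  [/\ B \in unitmx, forall p, A p <-> p = t \/ exists s, coords p (gamma B kappa s)
    & exists R, [/\ ispolyv R, coords t (R 0)
        & forall s, s != 0 -> par (R s) (gamma B kappa s^-1)]].

Section Lines.
Variables (B : 'M[K]_3) (kappa : {poly K}).
Hypothesis uB : B \in unitmx.
Let gam := gamma B kappa.

(** If [v] is not on the affine curve, the join of [v] with the moving point works. If [v] is the
    point at [s0], this join vanishes there; dividing out [s - s0] leaves the tangent line at
    [s0]. *)
Lemma curve_line (v : 'rV[K]_3) : v != 0 -> exists u : K -> 'rV[K]_3,
  ispolyv u /\ forall s, [/\ u s != 0, dot (gam s) (u s) = 0 & dot v (u s) = 0].
Proof.
move=> v0; have [[s0 vs0]|nv] := pselect (exists s0, par v (gam s0)); last first.
  exists (fun s => cross (gam s) v); split.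
    by apply: ispolyv_cross; [apply: gamma_poly|apply: ispolyv_cst].
  move=> s; rewrite dot_crossl dot_crossr; split=> //; rewrite -wedge_cross.
  apply/negP => /(wedge_par (gamma_neq0 _ _ uB) v0) h; apply: nv.
  by exists s; apply: par_sym.
(* The difference quotient of [kappa]: in the frame [B], (1, 0, d(s)) is the direction of the chord
   from [s0] to [s]. *)
have [d ed] : exists d : {poly K}, kappa - kappa.[s0]%:P = d * ('X - s0%:P).
  apply/factor_theorem; rewrite /root !hornerE subrr //.
have dE s : gam s = gam s0 + (s - s0) *: (row3 1 0 d.[s] *m B).
  rewrite /gam /gamma scalemxAl -mulmxDl; congr (_ *m B).
  have := congr1 (horner^~ s) ed; rewrite /= !hornerE => eds.
  apply: row3_ext; rewrite !mxE /=; [ring|ring|].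
  by rewrite mulrC -eds; ring.
have [b b0 ev] := vs0.
exists (fun s => cross (row3 1 0 d.[s] *m B) v); split.
  apply: ispolyv_cross; last exact: ispolyv_cst.
  apply: ispolyv_mul; apply: ispolyv_row3; try exact: ispoly_cst.
  exact: ispoly_horner.
move=> s; rewrite dot_crossr dE dotDl dotZl dot_crossl mulr0 addr0; split=> //.
  rewrite -wedge_cross; apply/negP => /eqP /(wedge_eq0 v0) [a].
  rewrite ev scalerA /gam /gamma scalemxAl => e.
  have /rowP e2 : row3 1 0 d.[s] = a * b *: row3 s0 1 kappa.[s0].
    by apply: (can_inj (mulmxK uB)).
  have := e2 1; rewrite row3E mxE row3E mulr1 => ab.
  have := e2 0; rewrite row3E mxE row3E -ab mul0r => /eqP.
  by rewrite oner_eq0.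
apply: (@dot_par _ v (cross (row3 1 0 d.[s] *m B) v)); last exact: dot_crossr.
  by exists b.
exact: par_refl.
Qed.

Definition lines_along (U : 'rV[K]_3 -> K -> 'rV[K]_3) : Prop :=
  forall v, v != 0 -> ispolyv (U v) /\
    forall s, [/\ U v s != 0, dot (gam s) (U v s) = 0 & dot v (U v s) = 0].

Lemma lines_along_ex : exists U, lines_along U.
Proof.
have /choice [U hU] : forall v, exists u : K -> 'rV[K]_3, v != 0 -> ispolyv u /\
    forall s, [/\ u s != 0, dot (gam s) (u s) = 0 & dot v (u s) = 0].
  move=> v; have [->|v0] := eqVneq v 0; first by exists (fun=> 0).
  by have [u hu] := curve_line v0; exists u.
by exists U.
Qed.

Variable U : 'rV[K]_3 -> K -> 'rV[K]_3.
Hypothesis hU : lines_along U.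
Variable ps : seq (pspace K 3).

(** Unlike [blift] along the curve, this lift is nonzero at every parameter, also where the curve
    passes through a centre; it parametrizes the strict transform over the affine curve. *)
Definition clift s : 'rV[K]_(bldim 3 (size ps)) := sg ps (gam s) (U ^~ s).

Definition off s : Prop := forall p, p \in ps -> cross (gam s) (rep p) != 0.

Lemma clift_flags s : flags ps (gam s, U ^~ s).
Proof.
split=> [|p pp] /=; first exact: gamma_neq0.
by have [_ /(_ s)] := hU (rep_neq0 p).
Qed.

Lemma clift_neq0 s : clift s != 0.
Proof. exact: sg_neq0 (clift_flags s). Qed.

Lemma clift_poly : ispolyv clift.
Proof.
apply: ispolyv_sg; first exact: gamma_poly.
by move=> p _; have [] := hU (rep_neq0 p).
Qed.

Lemma off_notin s p : off s -> coords p (gam s) -> p \notin ps.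
Proof. by move=> os ps'; apply/negP => /os /(cross_coords ps'); rewrite eqxx. Qed.

Lemma notin_off s p : coords p (gam s) -> p \notin ps -> off s.
Proof.
move=> ps' pp q qp; apply: cross_rep ps' _.
by apply: contraNneq pp => ->.
Qed.

Lemma clift_off s : off s -> par (clift s) (blift ps (gam s)).
Proof.
have [p ps'] := coords_ex (gamma_neq0 kappa s uB) => os.
exact: sg_off (clift_flags s) ps' (off_notin os ps').
Qed.

Lemma cof_off : cof off.
Proof.
apply: cof_in => p pp.
have [[s0 h]|nh] := pselect (exists s0, par (gam s0) (rep p)).
  apply: cof_imp (cof_neq s0) => s ss0; rewrite -wedge_cross.
  apply: contraNneq ss0 => /eqP /(wedge_par (gamma_neq0 _ _ uB) (rep_neq0 p)) h'.
  exact/eqP/(gamma_inj uB (par_trans h' (par_sym h))).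
apply: cof_true => s; rewrite -wedge_cross; apply/negP.
by move=> /(wedge_par (gamma_neq0 _ _ uB) (rep_neq0 p)) h; apply: nh; exists s.
Qed.

Definition glifts (P : K -> Prop) : set 'rV[K]_(bldim 3 (size ps)) :=
  [set blift ps (gam s) | s in [set s | P s /\ off s]].

Lemma clift_vclos (P : K -> Prop) s : cof P -> vclos (glifts P) (clift s).
Proof.
move=> cP; apply: arc clift_poly _ s; apply: cof_imp (cof_and cP cof_off) => s [Ps os].
apply: vclos_par (par_sym (clift_off os)) _; apply: vclos_sub.
by exists s.
Qed.

Definition affine_curve : set (pspace K 3) := [set p | exists s, coords p (gam s)].

Lemma glifts_affine : vclos (lifts affine_curve ps) `<=` vclos (glifts (fun=> True)).
Proof.
move=> w; apply: vclos_mono => _ [v [p [[s sp] pp] pv] <-].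
exists (blift ps (gam s)); last first.
  by apply: par_lift; apply/(coords_par _ pv).
by exists s => //; split=> //; apply: notin_off sp pp.
Qed.

Lemma affine_glifts P : vclos (glifts P) `<=` vclos (lifts affine_curve ps).
Proof.
move=> w; apply: vclos_mono => _ [s [_ os] <-]; exists (blift ps (gam s)); last exact: par_refl.
have [p sp] := coords_ex (gamma_neq0 kappa s uB).
exists (gam s) => //; exists p => //; split; first by exists s.
exact: off_notin os sp.
Qed.

Lemma clift_affine s : vclos (lifts affine_curve ps) (clift s).
Proof. by apply: (@affine_glifts (fun=> True)); apply: clift_vclos; apply: cof_true. Qed.

(** The parameter is regular in the point of the curve, hence so are the lines [U]. They agree with
    the lines of the flag at general points, therefore in the closure, which leaves one point over
    each point of the affine curve. *)
Lemma curve_fiber t s : flags ps t -> vclos (lifts affine_curve ps) (sg ps t.1 t.2) ->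
  par t.1 (gam s) -> par (sg ps t.1 t.2) (clift s).
Proof.
move=> ft /glifts_affine cl ts; apply: par_sg => // p pp.
pose D := [set z : ('rV[K]_3 * ('rV[K]_3 -> 'rV[K]_3)) * K |
  flags ps z.1 /\ par z.1.1 (gam z.2)].
pose S := [set z : ('rV[K]_3 * ('rV[K]_3 -> 'rV[K]_3)) * K |
  z.1 = (gam z.2, cross (gam z.2)) /\ off z.2].
have SD : S `<=` D.
  move=> [z s'] [/= -> os]; split; last exact: par_refl.
  have [q qs] := coords_ex (gamma_neq0 kappa s' uB).
  exact: flags_cross qs (off_notin os qs).
pose g (z : ('rV[K]_3 * ('rV[K]_3 -> 'rV[K]_3)) * K) := sg ps z.1.1 z.1.2.
have Dz : D (t, s) by [].
have cl' : vclos (g @` S) (g (t, s)).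
  apply: vclos_mono cl => _ [s' [_ os] <-]; eexists; last exact: par_refl.
  by exists ((gam s', cross (gam s')), s') => //; rewrite /g /= lift_sg.
have g0 : g (t, s) != 0 := sg_neq0 ft.
have rx : reg D g (fun z => z.1.1) (t, s).
  exact: (@sg_regx _ _ D ps (fun z => z.1.1) (fun z => z.1.2) _ Dz g0).
have ru : reg D g (fun z => z.1.2 (rep p)) (t, s).
  exact: (@sg_regu _ _ D ps (fun z => z.1.1) (fun z => z.1.2) _ p Dz g0 pp).
have rs : reg D g (fun z => affine_coords z.2) (t, s).
  exact: (@reg_gamma_affine _ D _ g (fun z => z.1.1) snd B kappa (t, s) uB (fun z h => h.2) rx).
have [pU lU] := hU (rep_neq0 p).
have rU : reg D g (fun z => U (rep p) z.2) (t, s) by apply: (reg_poly Dz rs pU).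
have [n0 _ _] := (ft.2 p pp); have [m0 _ _] := lU s.
apply/(wedge_par n0 m0)/eqP; have := cont_eq0 Dz SD (reg_wedge2 Dz ru rU) cl'; apply.
move=> [z s'] [/= -> /(_ p pp) c0] /=; have [l0 xl pl] := lU s'.
apply/eqP/(wedge_par c0 l0).
by apply: (@cross_par _ _ _ (gam s') (rep p)); rewrite ?dot_crossl ?dot_crossr.
Qed.

(** The homogenized equation of the graph vanishes on the closure, and where the middle coordinate
    is nonzero it can be solved for the last one. *)
Lemma affine_curve_closed v : vclos (cone affine_curve) v -> (v *m invmx B) 0 1 != 0 ->
  exists s, par v (gam s).
Proof.
move=> cl; set w := v *m invmx B => w1.
pose d := size kappa.
pose f (v : 'rV[K]_3) := (v *m invmx B) 0 2 * (v *m invmx B) 0 1 ^+ d -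
  \sum_(k < d.+1) kappa`_k * ((v *m invmx B) 0 0 ^+ k * (v *m invmx B) 0 1 ^+ (d.+1 - k)).
have hl i : isform 1 (fun v : 'rV[K]_3 => (v *m invmx B) 0 i).
  apply: (@form_ext _ _ _ (fun v => \sum_j v 0 j * invmx B j i)) => [u|].
    by rewrite mxE.
  by apply: form_sum => j _; apply: form_mulc; apply: form_coord.
have hl' k i : isform k (fun v : 'rV[K]_3 => (v *m invmx B) 0 i ^+ k).
  by rewrite -[X in isform X]muln1; apply: form_exp.
have hf : isform d.+1 f.
  apply: form_sub; first by apply: (@form_mul _ _ 1 d).
  apply: form_sum => k _; apply: form_cmul; have /subnKC {1}<- : (k <= d.+1)%N.
    exact: ltnW.
  exact: form_mul.
have fg s : f (gam s) = 0.
  rewrite /f /gam /gamma mulmxK // !row3E expr1n mulr1 (@horner_coef_wide _ d.+1) //.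
  by apply/eqP; rewrite subr_eq0; apply/eqP/eq_bigr => k _; rewrite expr1n mulr1.
have : f v = 0.
  apply: (cl _ _ hf) => u [p [s sp] pu].
  have [a a0 ->] : par u (gam s) by apply/(coords_par _ pu).
  by rewrite (form_scale _ _ hf) fg mulr0.
rewrite /f -/w => /eqP; rewrite subr_eq0 => /eqP e.
exists (w 0 0 / w 0 1); exists (w 0 1) => //.
rewrite /gam /gamma scalemxAl -[LHS](mulmxKV uB) -/w; congr (_ *m B).
apply: row3_ext; rewrite [RHS]mxE row3E; [by field|by rewrite mulr1|].
have wd : w 0 1 ^+ d != 0 by rewrite expf_neq0.
apply: (mulIf wd); rewrite e (@horner_coef_wide _ d.+1) // mulr_sumr mulr_suml.
apply: eq_bigr => k _; have kd : (k <= d)%N by rewrite -ltnS.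
have -> : w 0 1 ^+ d = w 0 1 ^+ (d - k) * w 0 1 ^+ k by rewrite -exprD subnK.
rewrite exprMn exprVn subSn // exprS; field.
exact: expf_neq0.
Qed.

Lemma clift_reg s : reg setT clift (@affine_coords K) s /\ reg setT (@affine_coords K) clift s.
Proof.
split; last first.
  exact: (@reg_poly _ _ setT _ _ (@affine_coords K) clift id s I (reg_refl _ _ s) clift_poly).
apply: (@reg_gamma_affine _ _ _ _ gam id B kappa) => //.
  by move=> t _; apply: par_refl.
by apply: (@sg_regx _ _ setT ps gam (fun s => U ^~ s)) => //; apply: clift_neq0.
Qed.

(** The secants of the affine line at [s] are the multiples [s' - s] of one vector, which is
    therefore the only limit direction. *)
Lemma affine_dirs s : let w := wedge (\row_(i < 2) (i : nat)%:R) (affine_coords s) in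
  [/\ w != 0, dirs (@affine_coords K) s setT w &
  forall l, l != 0 -> dirs (@affine_coords K) s setT l -> par l w].
Proof.
set w := wedge _ _ => /=.
have e s' : wedge (affine_coords s') (affine_coords s) = (s' - s) *: w.
  apply: tens_ext => i j; rewrite mxE !wedgeE !mxE.
  by case: i j => [[|[|//]] hi] [[|[|//]] hj] /=; ring.
have w0 : w != 0.
  apply/rV0Pn; exists (mxvec_index 1 0); rewrite wedgeE !mxE /=.
  by rewrite mulr1 mul0r subr0 oner_eq0.
split=> // [|l l0 dl].
  apply: (@arc _ _ (fun s' => tens (affine_coords s') w) _ _ _ s).
    by apply: ispolyv_tens; [apply: ispolyv_affine|apply: ispolyv_cst].
  apply: cof_imp (cof_neq s) => s' ss'.
  apply: (@vclos_par _ _ _ (tens (affine_coords s') (wedge (affine_coords s') (affine_coords s)))).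
    by apply: par_tens (par_refl _) _; rewrite e; apply: par_scale; rewrite subr_eq0.
  by apply: vclos_sub; exists s'.
apply/(wedge_par l0 w0)/eqP; apply: tens_ext => j k; rewrite wedgeE mxE.
pose F (y : 'rV[K]_(2 * (2 * 2))) :=
  y 0 (mxvec_index 0 j) * w 0 k - y 0 (mxvec_index 0 k) * w 0 j.
have hF : isform 1 F by apply: form_sub; apply: form_mulc; apply: form_coord.
have := dl 1%N F hF; rewrite /F !tensE !affine0 !mul1r; apply.
by move=> _ [s' _ <-]; rewrite !tensE e !mxE; ring.
Qed.

(** The lift and the affine parameter are regular in each other, so the single direction of the
    affine line is transported to the strict transform. *)
Lemma clift_dirs s : exists2 w, w != 0 & dirs clift s setT w /\
  forall l, l != 0 -> dirs clift s setT l -> par l w.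
Proof.
have [r1 r2] := clift_reg s; have [w0 dw wl] := affine_dirs s.
set w := wedge _ _ in w0 dw wl.
have [M [M' [tr tr' MM M'M]]] :=
  dirs_iso (I : setT s) (affine_neq0 s) (clift_neq0 s) r2 r1.
have ST : [set: K] `<=` setT by [].
have MMw := MM _ _ ST w0 dw; exists (w *m M).
  apply: contraNneq w0 => wM; move: MMw; rewrite wM mul0mx => /par_eq0.
  by rewrite eqxx => <-.
split; first exact: (transports_dirs (D := setT) I ST (affine_neq0 s) w0 r2 tr dw).
move=> l l0 dl; have MMl := M'M _ _ ST l0 dl.
apply: par_trans (par_sym MMl) _; apply: par_mul; apply: wl.
  apply: contraNneq l0 => lM; move: MMl; rewrite lM mul0mx => /par_eq0.
  by rewrite eqxx => <-.
exact: (transports_dirs (D := setT) I ST (clift_neq0 s) l0 r1 tr' dl).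
Qed.

End Lines.

Arguments glifts B kappa ps P _ : clear implicits.

(** When it is not a centre, the point at infinity is the limit of the arc [R]; finitely many
    parameters can be left out because each is a limit along the curve. The freedom in [P] lets two
    curves on different surfaces be compared where both lifts are defined. *)
Lemma curve_lifts A (t : pspace K 3) B kappa ps (P : K -> Prop) : pcurve A t B kappa -> uniq ps -> cof P ->
  blowup A ps = pc (glifts B kappa ps P).
Proof.
move=> [uB hA [R [pR tR hR]]] ups cP; rewrite blowupE; apply/seteqP; split=> y; last first.
  move=> /(affine_glifts uB); apply: vclos_mono => _ [v [p [[s sp] pp] pv] <-].
  exists (blift ps v); last exact: par_refl.
  by exists v => //; exists p => //; split=> //; apply/hA; right; exists s.
have [U hU] := lines_along_ex kappa uB.
apply: vclos_idem => _ [v [p [/hA [->|[s sp]] pp] pv] <-]; last first.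
  have os : off B kappa ps s by apply: notin_off sp pp.
  apply: (@vclos_par _ _ _ (blift ps (gamma B kappa s))).
    by apply: par_lift; apply/(coords_par _ sp).
  by apply: vclos_par (clift_off uB hU os) _; apply: (clift_vclos uB hU).
apply: (@vclos_par _ _ _ (blift ps (R 0))).
  by apply: par_lift; apply/(coords_par _ tR).
apply: (@arc _ _ (fun s => blift ps (R s)) _ _ _ 0).
  apply: ispolyv_segre => // i _; apply: ispolyv_wedge => //; exact: ispolyv_cst.
have := cof_and (cof_neq 0) (cof_and (cof_inv cP) (cof_inv (cof_off kappa uB ps))).
apply: cof_imp => s [s0 [Ps os]]; apply: vclos_par (par_sym (par_lift _ (hR s s0))) _.
by apply: vclos_sub; exists s^-1.
Qed.

End Curves.

Arguments glifts {K} B kappa ps P _.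

(** * Charts of the blown-up plane *)

Section Charts.
Variable K : numFieldType.
Implicit Types (ps : seq (pspace K 3)).

Lemma dirs_loc T (D S : set T) m n e (g : T -> 'rV[K]_m) (k : T -> 'rV[K]_n)
    (N : 'rV[K]_n -> K) c l : D c -> S `<=` D -> g c != 0 -> l != 0 -> reg D g k c ->
  isform e N -> N (k c) != 0 -> dirs g c S l -> dirs g c (S `&` [set t | N (k t) != 0]) l.
Proof.
move=> Dc SD g0 l0 rk hN N0 dl.
pose D3 := [set o : option T | if o is Some t then S t else True].
pose S3 := [set o : option T | if o is Some t then S t else False].
pose r o : T := if o is Some t then t else c.
pose z o := if o is Some t then wedge (g t) (g c) else l.
have S3D : S3 `<=` D3 by case.
have D3N : D3 None by [].
have D3D o : D3 o -> D (r o) by case: o => [t /SD|].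
pose G o := tens (g (r o)) (z o).
have rg : reg D3 G (fun o => k (r o)) None.
  apply: (reg_trans D3N (@reg_tensl _ _ D3 _ _ (fun o => g (r o)) z None g0 l0)).
  exact: (@reg_pull _ _ _ D D3 r).
have cl : vclos (G @` S3) (G None).
  apply: vclos_mono dl => _ [t St <-]; eexists; last exact: par_refl.
  by exists (Some t).
have := cont_loc D3N S3D rg hN N0 cl; apply: vclos_mono.
move=> _ [[t|] [// St /= Nt] <-]; eexists; last exact: par_refl.
by exists t.
Qed.

Lemma dirs_reindex T T' m (S : set T) (S' : set T') (g : T -> 'rV[K]_m)
    (g' : T' -> 'rV[K]_m) c c' l :
  par (g c) (g' c') -> (forall t, S t -> exists2 t', S' t' & par (g t) (g' t')) ->
  dirs g c S l -> dirs g' c' S' l.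
Proof.
move=> cc h dl; apply: (@vclos_par _ _ _ (tens (g c) l)).
  exact: par_tens cc (par_refl _).
apply: vclos_mono dl => _ [t /h [t' St' tt] <-].
exists (tens (g' t') (wedge (g' t') (g' c'))); first by exists t'.
by apply: (par_tens tt); apply: par_wedge.
Qed.

(** Homogeneous coordinates on a part [D] of a plane, mapped to the blow-up near the flag [t0] with
    regular inverse. Openness of [D] is expressed along lines through [c], enough to realize every
    direction at [c]; the last condition says that conversely every limit direction of the surface
    is seen in the chart. *)
Definition chart ps (t0 : 'rV[K]_3 * ('rV[K]_3 -> 'rV[K]_3)) : Prop :=
  exists (D : set 'rV[K]_3) h c, [/\ D c, c != 0, reg D id h c, reg D h id c
  & [/\ par (h c) (sg ps t0.1 t0.2), forall v, D v -> vclos (lifts setT ps) (h v),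
        forall w, cof (fun s => D (c + s *: w))
      & forall l, l != 0 -> dirs (fun t => sg ps t.1 t.2) t0 (flags ps) l -> dirs h c D l]].

Lemma form_zero n (N : 'rV[K]_n -> K) : isform 1 N -> N 0 = 0.
Proof. by move=> hN; have := form_scale 0 0 hN; rewrite scale0r expr1 mul0r. Qed.

Lemma segre_lift_point ps (v : 'rV[K]_3) : blift ps v != 0 ->
  exists2 p, coords p v & p \notin ps.
Proof.
move=> l0; have [v0 _] := segre_eq0 l0; have [p pv] := coords_ex v0.
by exists p => //; apply: lift_cross_neq0 l0 pv.
Qed.

(** Away from the centres the lift of the plane is itself the chart. *)
Lemma chart_off ps t0 p : flags ps t0 -> coords p t0.1 -> p \notin ps -> chart ps t0.
Proof.
move=> ft pt pp; have l0 := lift_neq0 pt pp.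
exists [set v | blift ps v != 0], (blift ps), t0.1; split=> //.
- by case: ft.
- by apply: reg_lift => //; apply: reg_refl.
- exact: (@segre_regx _ _ _ [set v | blift ps v != 0] id
    (fun v i => wedge v (map (@rep K 3) ps)`_i)).
split.
- exact/par_sym/(sg_off ft pt pp).
- move=> v /segre_lift_point [q qv qp]; apply: vclos_sub; exists v => //.
  by exists q.
- move=> w; apply: (@ispolyv_cof _ _ (fun s => blift ps (t0.1 + s *: w)) 0); last first.
    by rewrite scale0r addr0.
  have hx : ispolyv (fun s => t0.1 + s *: w).
    apply: ispolyv_add; first exact: ispolyv_cst.
    by apply: ispolyv_scale; [apply: ispoly_id|apply: ispolyv_cst].
  by apply: ispolyv_segre => // i _; apply: ispolyv_wedge => //; apply: ispolyv_cst.
- move=> l ln dl; have [N hN N0] := form_neq0 1 l0.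
  have rl : reg (flags ps) (fun t => sg ps t.1 t.2) (fun t => blift ps t.1) t0.
    apply: reg_lift => //.
    by apply: (@sg_regx _ _ (flags ps) ps fst snd) => //; apply: sg_neq0.
  have := dirs_loc ft (fun _ x => x) (sg_neq0 ft) ln rl hN N0 dl.
  apply: dirs_reindex => [|t [ft' /= Nt]]; first exact: sg_off ft pt pp.
  have lt0 : blift ps t.1 != 0.
    by apply: contraNneq Nt => ->; rewrite form_zero.
  have [q qt qp] := segre_lift_point lt0.
  by exists t.1 => //; apply: sg_off ft' qt qp.
Qed.

Lemma reg_cross T (D : set T) m (g : T -> 'rV[K]_m) (x : T -> 'rV[K]_3) (v : 'rV[K]_3) t0 :
  D t0 -> reg D g x t0 -> reg D g (fun t => cross (x t) v) t0.
Proof.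
move=> Dt rx; have := reg_mul (Phi K) (reg_wedge v Dt rx); apply: reg_ext => t _.
by rewrite -psi_cross psiK; apply: par_refl.
Qed.

Lemma basis3 (u v w : 'rV[K]_3) : dot (cross u v) w != 0 -> rows3 u v w \in unitmx.
Proof.
move=> d0; apply: unit3 => x; rewrite rows3E => e.
have D y : dot y (x 0 0 *: u + x 0 1 *: v + x 0 2 *: w) = 0.
  by rewrite e dotC /dot !mxE; ring.
have E (y : 'rV[K]_3) : x 0 0 * dot y u + x 0 1 * dot y v + x 0 2 * dot y w = 0.
  by rewrite -(D y) /dot !mxE; ring.
have x2 : x 0 2 = 0.
  have := E (cross u v); rewrite ![dot (cross u v) _]dotC dot_crossl dot_crossr !mulr0 !add0r.
  by move=> /eqP; rewrite mulf_eq0 dotC (negPf d0) orbF => /eqP.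
have x1 : x 0 1 = 0.
  have := E (cross u w); rewrite ![dot (cross u w) _]dotC dot_crossl dot_crossr !mulr0 add0r addr0.
  have -> : dot v (cross u w) = - dot (cross u v) w by rewrite /dot /cross !row3E; ring.
  by move=> /eqP; rewrite mulf_eq0 oppr_eq0 (negPf d0) orbF => /eqP.
have x0 : x 0 0 = 0.
  have := E (cross v w); rewrite ![dot (cross v w) _]dotC dot_crossl dot_crossr !mulr0 !addr0.
  have -> : dot u (cross v w) = dot (cross u v) w by rewrite /dot /cross !row3E; ring.
  by move=> /eqP; rewrite mulf_eq0 (negPf d0) orbF => /eqP.
by apply: row3_ext; rewrite mxE.
Qed.

(** Applied to the coordinates read off from a point and a line through [p], the chart below returns
    that point up to a scalar; the hypothesis expresses that the point lies on the line. *)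
Lemma chart_id (a x1 x2 n0 n1 : K) (P w b : 'rV[K]_3) : x1 * n1 = x2 * n0 ->
  (a * n0) ^+ 2 *: P + (x1 * n0) *: ((a * n0) *: w + (a * n1) *: b) =
  (a * n0 ^+ 2) *: (a *: P + x1 *: w + x2 *: b).
Proof.
move=> e; apply/rowP => j; rewrite !mxE.
have -> : x1 * n0 * (a * n0 * w 0 j + a * n1 * b 0 j) =
    a * n0 * (x1 * n0 * w 0 j + (x1 * n1) * b 0 j) by ring.
by rewrite e; ring.
Qed.

(* On the blow-up at [p], with [P] a representative of [p], [w] the direction of the
   given line and [b] a third vector, [(v0 : v1 : v2)] stands for the point
   [v0^2 P + v1 (v0 w + v2 b)] and the line through [p] in the direction [v0 w + v2 b]. *)
Lemma chart_on ps t0 p : uniq ps -> flags ps t0 -> coords p t0.1 -> p \in ps -> chart ps t0.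
Proof.
move=> ups ft pt pp; have [P0 ht] := ft; have [n00 Pn0 pn0] := ht p pp.
set P := t0.1 in pt P0 Pn0; set n0 := t0.2 (rep p) in n00 Pn0 pn0.
have [w ew] := cross_surj P0 Pn0.
(* [b] is a basis vector off the line [n0], which is spanned by [P] and [w]. *)
have /rV0Pn [i ni] := n00; pose b : 'rV[K]_3 := delta_mx 0 i.
have db : dot b n0 = n0 0 i.
  by rewrite /b /dot !mxE; move: (i); apply: ord3P => /=; ring.
have uB : rows3 P w b \in unitmx.
  apply: basis3; have -> : dot (cross P w) b = - dot b n0.
    by rewrite -ew /dot /cross !row3E; ring.
  by rewrite db oppr_eq0.
pose x (v : 'rV[K]_3) := v 0 0 ^+ 2 *: P + v 0 1 *: (v 0 0 *: w + v 0 2 *: b).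
pose dir (v : 'rV[K]_3) := v 0 0 *: w + v 0 2 *: b.
pose n (v : 'rV[K]_3) := cross (dir v) P.
pose u (v q : 'rV[K]_3) := if q == rep p then n v else cross (x v) q.
pose h v := sg ps (x v) (u v).
pose D := [set v : 'rV[K]_3 | v 0 0 != 0 /\
  forall q, q \in ps -> q != p -> cross (x v) (rep q) != 0].
pose c := row3 (1 : K) 0 0.
have xc : x c = P by rewrite /x /c !row3E expr1n !scale1r scale0r addr0.
have nc : n c = n0 by rewrite /n /dir /c !row3E scale1r scale0r addr0.
have Pq q : q \in ps -> q != p -> cross P (rep q) != 0.
  by move=> qp qn; apply: cross_rep pt _; rewrite eq_sym.
have Dc : D c by split=> [|q qp qn]; rewrite ?row3E ?oner_eq0 // xc; apply: Pq.
have xB v : x v *m invmx (rows3 P w b) = row3 (v 0 0 ^+ 2) (v 0 0 * v 0 1) (v 0 1 * v 0 2).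
  apply: (can_inj (mulmxK uB)); rewrite mulmxKV // rows3E !row3E /x scalerDr !scalerA.
  by rewrite addrA [v 0 1 * v 0 0]mulrC.
have dbn v : dot b (n v) = v 0 0 * n0 0 i.
  by rewrite -db -ew /n /dir /dot /cross !row3E !mxE; ring.
have dwn v : - dot w (n v) = v 0 2 * n0 0 i.
  by rewrite -db -ew /n /dir /dot /cross !row3E !mxE; ring.
have fD v : D v -> flags ps (x v, u v).
  move=> [v0 hv]; split=> /= [|q qp].
    have : x v *m invmx (rows3 P w b) != 0.
      by rewrite xB; apply/rV0Pn; exists 0; rewrite row3E expf_neq0.
    by apply: contraNneq => ->; rewrite mul0mx.
  rewrite /u; have [/rep_inj ->|qn] := eqVneq (rep q) (rep p); last first.
    by rewrite dot_crossl dot_crossr hv //; apply: contraNneq qn => ->.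
  split.
  - have : dot b (n v) != 0 by rewrite dbn mulf_neq0.
    by apply: contraNneq => ->; rewrite dotC /dot !mxE; apply/eqP; ring.
  - by rewrite /x /n /dir dotDl !dotZl dot_crossr dot_crossl; ring.
  - apply: (@dot_par _ P (n v)); [exact: coords_eqP|exact: par_refl|exact: dot_crossr].
have nr q : q \in ps -> rep q != rep p -> q != p.
  by move=> _; apply: contraNneq => ->.
have hc0 : h c != 0 := sg_neq0 (fD c Dc).
have rhx : reg D h x c by apply: (@sg_regx _ _ D ps x u).
have rhn : reg D h n c.
  have := @sg_regu _ _ D ps x u c p Dc hc0 pp; apply: reg_ext => v _.
  by rewrite /u eqxx; apply: par_refl.
pose xi (v : 'rV[K]_3) := v *m invmx (rows3 P w b).
pose nu (v : 'rV[K]_3) := v *m (rows3 b (- w) 0)^T.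
have nuE v : nu v 0 0 = dot b v /\ nu v 0 1 = - dot w v.
  by rewrite /nu !mxE !sum3 !mxE /dot /= !mxE; split; ring.
(* The inverse of the chart: [x v] has coordinates (v0^2 : v0 v1 : v1 v2) and [n v] gives the pair
   (v0 : v2), so these products are proportional to (v0 : v1 : v2) when [v0] is nonzero. *)
pose psi2 (a d : 'rV[K]_3) := row3 (xi a 0 0 * nu d 0 0) (xi a 0 1 * nu d 0 0)
  (xi a 0 0 * nu d 0 1).
exists D, h, c; split=> //.
- by apply/rV0Pn; exists 0; rewrite row3E oner_eq0.
- have rx : reg D id x c.
    apply: (@reg_forms _ _ _ _ _ 2 id x) => j.
    apply: (@form_ext _ _ _ (fun v : 'rV[K]_3 => v 0 0 * v 0 0 * P 0 j +
        v 0 1 * (v 0 0 * w 0 j + v 0 2 * b 0 j))) => [v|].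
      by rewrite !mxE; ring.
    apply: form_add; first by apply: form_mulc; apply: (@form_mul _ _ 1 1); apply: form_coord.
    apply: (@form_mul _ _ 1 1); first exact: form_coord.
    by apply: form_add; apply: form_mulc; apply: form_coord.
  have rn : reg D id n c.
    apply: reg_cross => //; apply: (@reg_forms _ _ _ _ _ 1 id dir) => j.
    apply: (@form_ext _ _ _ (fun v : 'rV[K]_3 => v 0 0 * w 0 j + v 0 2 * b 0 j)) => [v|].
      by rewrite !mxE.
    by apply: form_add; apply: form_mulc; apply: form_coord.
  apply: reg_sg => // q qp; rewrite /u.
  by case: eqP => // _; apply: reg_cross.
- have r1 : reg D h (fun v => tens (xi (x v)) (nu (n v))) c.
    by apply: reg_tens; apply: reg_mul.
  pose F (y : 'rV[K]_(3 * 3)) := row3 (y 0 (mxvec_index 0 0)) (y 0 (mxvec_index 1 0))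
    (y 0 (mxvec_index 0 1)).
  have r2 := @reg_forms _ _ D _ _ 1 (fun v => tens (xi (x v)) (nu (n v))) F c _.
  apply: reg_ext (reg_trans Dc r1 (r2 _)) => [v [v0 _]|]; last first.
    by apply: ord3P; [apply: form_ext (form_coord K (mxvec_index 0 0))|
      apply: form_ext (form_coord K (mxvec_index 1 0))|
      apply: form_ext (form_coord K (mxvec_index 0 1))] => y; rewrite row3E.
  have [nu0 nu1] := nuE (n v).
  exists (v 0 0 ^+ 2 * n0 0 i); first by rewrite mulf_neq0 ?expf_neq0.
  rewrite /F !tensE nu0 nu1 dbn dwn /xi xB !row3E.
  by apply: row3_ext; rewrite row3E mxE; ring.
split.
- apply: par_sg => [|q qp]; first by rewrite xc; apply: par_refl.
  rewrite /u; case: eqP => [/rep_inj ->|/eqP qn]; first by rewrite nc; apply: par_refl.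
  have [m0 xm qm] := ht q qp; rewrite xc.
  by apply: (@cross_par _ _ _ P (rep q)); rewrite ?dot_crossl ?dot_crossr ?Pq ?nr.
- by move=> v /fD fv; apply: (sg_blowup ups fv).
- move=> d; pose v s := c + s *: d.
  have pv j : ispoly (fun s => v s 0 j).
    apply: (@ispoly_ext _ (fun s => c 0 j + s * d 0 j)) => [s|]; first by rewrite !mxE.
    apply: ispoly_add; first exact: ispoly_cst.
    by apply: ispoly_mul; [apply: ispoly_id|apply: ispoly_cst].
  have px : ispolyv (fun s => x (v s)).
    apply: ispolyv_add.
      by apply: ispolyv_scale; [apply: ispoly_mul|apply: ispolyv_cst].
    apply: ispolyv_scale => //; apply: ispolyv_add;
      by apply: ispolyv_scale => //; apply: ispolyv_cst.
  have v0 : v 0 = c by rewrite /v scale0r addr0.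
  apply: cof_and.
    by apply: (ispoly_cof (s0 := 0) (pv 0)); rewrite v0 row3E oner_eq0.
  apply: cof_in => q qp; have [->|qn] := eqVneq q p; first exact: cof_true.
  have hq : ispolyv (fun s => cross (x (v s)) (rep q)).
    by apply: ispolyv_cross => //; apply: ispolyv_cst.
  apply: cof_imp (ispolyv_cof (s0 := 0) hq _) => [s hs _ //|].
  by rewrite v0 xc; apply: Pq.
(* Near [t0] the point avoids the other centres [rs]; together with two nonvanishing coordinates
   this puts the nearby flags in the image of the chart. *)
move=> l l0 dl; pose rs := rem p ps.
have rsE q : (q \in rs) = (q != p) && (q \in ps) by rewrite mem_rem_uniq ?inE.
have prs : p \notin rs by rewrite rsE eqxx.
pose s2 (t : 'rV[K]_3 * ('rV[K]_3 -> 'rV[K]_3)) := sg ps t.1 t.2.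
have s20 : s2 t0 != 0 := sg_neq0 ft.
have r1 : reg (flags ps) s2 (fun t => xi t.1) t0.
  by apply: reg_mul; apply: (@sg_regx _ _ (flags ps) ps fst snd).
have r2 : reg (flags ps) s2 (fun t => nu (t.2 (rep p))) t0.
  by apply: reg_mul; apply: (@sg_regu _ _ (flags ps) ps fst snd).
have r3 : reg (flags ps) s2 (fun t => blift rs t.1) t0.
  by apply: reg_lift => //; apply: (@sg_regx _ _ (flags ps) ps fst snd).
have l3 : blift rs t0.1 != 0 := lift_neq0 pt prs.
have [N hN N0] := form_neq0 1 l3.
have xi0 : xi t0.1 0 0 != 0.
  by rewrite -/P -xc /xi xB !row3E expr1n oner_eq0.
have nu0 : nu (t0.2 (rep p)) 0 0 != 0 by rewrite (nuE _).1 -/n0 db.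
have h1 := dirs_loc ft (fun _ y => y) s20 l0 r1 (form_coord K 0) xi0 dl.
have SD1 : flags ps `&` [set t | xi t.1 0 0 != 0] `<=` flags ps by move=> t [].
have h2 := dirs_loc ft SD1 s20 l0 r2 (form_coord K 0) nu0 h1.
have SD2 : flags ps `&` [set t | xi t.1 0 0 != 0] `&`
    [set t | nu (t.2 (rep p)) 0 0 != 0] `<=` flags ps by move=> t [/SD1].
have := dirs_loc ft SD2 s20 l0 r3 hN N0 h2.
apply: dirs_reindex.
  apply: par_sym; apply: par_sg => [|q qp]; first by rewrite xc; apply: par_refl.
  rewrite /u; case: eqP => [/rep_inj ->|/eqP qn]; first by rewrite nc; apply: par_refl.
  have [m0 xm qm] := ht q qp; rewrite xc.
  by apply: (@cross_par _ _ _ P (rep q)); rewrite ?dot_crossl ?dot_crossr ?Pq ?nr.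
move=> t [[[fl /= x0 nu00] Nt]]; have [_ hf] := fl; have [m0 xm pm] := hf p pp.
set m := t.2 (rep p) in nu00 m0 xm pm; set a := xi t.1 0 0 in x0.
have Pm : dot P m = 0.
  apply: (@dot_par _ (rep p) m) => //; last exact: par_refl.
  exact/par_sym/coords_eqP.
have tE : t.1 = a *: P + xi t.1 0 1 *: w + xi t.1 0 2 *: b.
  by rewrite -rows3E mulmxKV.
have [nb nw] := nuE m.
have rel : xi t.1 0 1 * nu m 0 1 = xi t.1 0 2 * nu m 0 0.
  have e := xm; rewrite [X in dot X _]tE !dotDl !dotZl Pm mulr0 add0r -nb in e.
  apply/eqP; rewrite -subr_eq0 nw mulrN -opprD oppr_eq0 addrC addrC.
  by rewrite e.
pose v := psi2 t.1 m.
have xv : x v = (a * nu m 0 0 ^+ 2) *: t.1.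
  by rewrite [X in _ = _ *: X]tE /x /v /psi2 !row3E -/a; apply: chart_id.
have pxv : par (x v) t.1 by rewrite xv; apply: par_scale; rewrite mulf_neq0 ?expf_neq0.
have lt0 : blift rs t.1 != 0 by apply: contraNneq Nt => ->; rewrite form_zero.
have [y yt yrs] := segre_lift_point lt0.
have cq q : q \in ps -> q != p -> cross (x v) (rep q) != 0.
  move=> qp qn; rewrite (par_eq0 (par_cross pxv (par_refl _))); apply: cross_rep yt _.
  by apply: contraNneq yrs => ->; rewrite rsE qn.
have Dv : D v by split=> //; rewrite /v row3E mulf_neq0.
exists v => //; apply: par_sg => [|q qp]; first exact: par_sym.
rewrite /u; case: eqP => [/rep_inj ->|/eqP qn]; last first.
  have [mq0 xq qq] := hf q qp.
  apply: (@cross_par _ _ _ (x v) (rep q)); rewrite ?dot_crossl ?dot_crossr ?cq ?nr //.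
  exact: dot_par (par_sym pxv) (par_refl _) xq.
have [nv0 _ _] := (fD v Dv).2 p pp; rewrite /u /= eqxx in nv0.
rewrite -/m; apply: (@cross_par _ _ _ (dir v) P); rewrite ?dot_crossl ?dot_crossr //.
rewrite /dir /v !row3E dotDl !dotZl -/a -nb; have -> : dot w m = - nu m 0 1 by rewrite nw opprK.
ring.
Qed.

End Charts.

(** * Tangent directions and the exceptional curve of the ninth point *)

Section Sakai.
Variable K : numFieldType.
Implicit Types (ps : seq (pspace K 3)).

Definition wedge_mx (c : 'rV[K]_3) : 'M[K]_(3, 3 * 3) :=
  \matrix_i wedge (delta_mx 0 i) c.

Lemma wedge_mxE (v c : 'rV[K]_3) : v *m wedge_mx c = wedge v c.
Proof.
apply: tens_ext => j k; rewrite wedgeE mxE sum3 !mxE !mxvecE !mxE !big_ord1 !mxE /=.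
by move: j k; apply: ord3P; apply: ord3P => /=; ring.
Qed.

Lemma dirs_linear (D : set 'rV[K]_3) (c : 'rV[K]_3) l n (M : 'M[K]_(3 * 3, n)) :
  c != 0 -> (forall v, wedge v c *m M = 0) -> dirs id c D l -> l *m M = 0.
Proof.
move=> /rV0Pn [i ci] hM dl; apply/rowP => k; rewrite [RHS]mxE; apply: (mulfI ci).
pose F (y : 'rV[K]_(3 * (3 * 3))) := \sum_j y 0 (mxvec_index i j) * M j k.
have FE (u : 'rV[K]_3) v : F (tens u v) = u 0 i * (v *m M) 0 k.
  by rewrite mxE mulr_sumr; apply: eq_bigr => j _; rewrite tensE mulrA.
rewrite -FE mulr0; apply: (dl 1%N).
  by apply: form_sum => j _; apply: form_mulc; apply: form_coord.
by move=> _ [v _ <-]; rewrite FE hM mxE mulr0.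
Qed.

(** Secants at [c] satisfy linear equations that pass to limits and characterize the vectors
    [wedge w c]; conversely the points [c + s *: w] approach [c] in the direction of [w]. *)
Lemma plane_dirs (D : set 'rV[K]_3) (c : 'rV[K]_3) l : c != 0 -> l != 0 ->
  (forall w, cof (fun s => D (c + s *: w))) ->
  dirs id c D l <-> exists w, l = wedge w c.
Proof.
move=> c0 l0 hD; split=> [dl|[w el]].
  have h1 : l *m (Phi K *m Psi K - 1%:M) = 0.
    apply: dirs_linear c0 _ dl => v.
    by rewrite mulmxBr mulmxA mulmx1 -psi_cross psiK subrr.
  have h2 : l *m (Phi K *m c^T) = 0.
    apply: dirs_linear c0 _ dl => v.
    rewrite mulmxA -psi_cross psiK; apply/rowP => j; rewrite ord1 -dotE dotC.
    by rewrite dot_crossr mxE.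
  have [|w ew] := @cross_surj K (l *m Phi K) c c0.
    by rewrite dotC dotE -mulmxA h2 mxE.
  exists w; rewrite -psi_cross ew /psi; apply/eqP; rewrite eq_sym -subr_eq0.
  by rewrite -mulmxA -[X in _ - X]mulmx1 -mulmxBr h1.
rewrite {}el in l0 *.
have h : forall s, vclos [set tens (id v) (wedge (id v) (id c)) | v in D]
    (tens (c + s *: w) (wedge w c)); last by have := h 0; rewrite scale0r addr0.
apply: arc.
  apply: ispolyv_tens; last exact: ispolyv_cst.
  apply: ispolyv_add; first exact: ispolyv_cst.
  by apply: ispolyv_scale; [apply: ispoly_id|apply: ispolyv_cst].
apply: cof_imp (cof_and (hD w) (cof_neq 0)) => s [Ds s0].
apply: (@vclos_par _ _ _ (tens (c + s *: w) (wedge (c + s *: w) c))).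
  apply: par_tens (par_refl _) _; rewrite wedgeDl wedgexx add0r wedgeZl.
  exact: par_scale.
by apply: vclos_sub; exists (c + s *: w).
Qed.

Lemma dirs_neq0 T m (g : T -> 'rV[K]_m) c S l : g c != 0 -> l != 0 -> dirs g c S l ->
  dirs g c (S `&` [set t | g t != 0]) l.
Proof.
move=> g0 l0 /(vclos_neq0 (tens_neq0 g0 l0)); apply: vclos_mono => _ [[t St <-]].
rewrite tens_eq0 negb_or => /andP [gt0 _]; eexists; last exact: par_refl.
by exists t.
Qed.

(** The derivative of the chart carries the directions of the plane onto those of the surface. They
    fill the image of [W], of dimension 2 since the kernel of [W] is spanned by [c]; this is
    smoothness of the blow-up at [q]. *)
Lemma surface_dirs ps t0 q : uniq ps -> flags ps t0 -> chart ps t0 ->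
  coords q (sg ps t0.1 t0.2) ->
  exists (W : 'M[K]_(3, bldim 3 (size ps) * bldim 3 (size ps))) (c : 'rV[K]_3),
  [/\ c != 0, c *m W = 0, forall v, v *m W = 0 -> exists a, v = a *: c
    & forall l, l != 0 -> dirs (@rep K _) q (blowup setT ps) l <-> exists v, l = v *m W].
Proof.
move=> ups ft [D [h [c [Dc c0 rh hr [hc hD cD loc]]]]] qt.
have s0 := sg_neq0 ft; have hc0 : h c != 0 by rewrite (par_eq0 hc).
have [M [M' [tr tr' MM M'M]]] := dirs_iso Dc c0 hc0 rh hr.
have DD : D `<=` D by [].
exists (wedge_mx c *m M), c; split=> //.
- by rewrite mulmxA wedge_mxE wedgexx mul0mx.
- move=> v; rewrite mulmxA wedge_mxE => e; apply: (wedge_eq0 c0); apply/eqP.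
  apply: contraT => w0; have dw : dirs id c D (wedge v c).
    by apply/(plane_dirs c0 w0 cD); exists v.
  by have := par_eq0 (MM _ _ DD w0 dw); rewrite e mul0mx eqxx (negPf w0).
move=> l l0; split=> [dl|[v ev]].
  have ds : dirs (fun t => sg ps t.1 t.2) t0 (flags ps) l.
    apply: dirs_reindex dl; first exact/par_sym/coords_eqP.
    move=> x /(blowupT _ ups) [t ft' xt]; exists t => //.
    exact/par_sym/coords_eqP.
  have dh := loc l l0 ds; have pl := M'M _ _ DD l0 dh.
  have lM0 : l *m M' != 0.
    apply: contraNneq l0 => lM; move: pl; rewrite lM mul0mx => /par_eq0.
    by rewrite eqxx => <-.
  have := transports_dirs Dc DD hc0 l0 hr tr' dh.
  move=> /(plane_dirs c0 lM0 cD) [w ew]; have [a a0 el] := par_sym pl.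
  by exists (a *: w); rewrite -scalemxAl mulmxA wedge_mxE -ew.
have w0 : wedge v c != 0.
  by apply: contraNneq l0 => w0; rewrite ev mulmxA wedge_mxE w0 mul0mx.
have dw : dirs id c D (wedge v c) by apply/(plane_dirs c0 w0 cD); exists v.
have := transports_dirs Dc DD c0 w0 rh tr dw; rewrite -wedge_mxE -mulmxA -ev.
move=> /(dirs_neq0 hc0 l0); apply: dirs_reindex.
  by apply: par_trans hc _; apply: coords_eqP.
move=> u [Du hu]; have [y yu] := coords_ex hu; exists y; last exact: coords_eqP.
by rewrite blowupE; apply/(pcE _ yu); apply: hD.
Qed.

Lemma exceptional1P m (X : set (pspace K m)) q y : exceptional X [:: q] q y <->
  exists l, [/\ l != 0, dirs (@rep K m) q X l & coords y (tens (rep q) l)].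
Proof.
rewrite exceptional1E blowup1E; split=> [[Xy [l yl]]|[l [l0 dl yl]]].
  exists l; split=> //; last exact/(pcE _ yl).
  by have := coords_neq0 yl; rewrite tens_eq0 negb_or => /andP [].
by split; [apply/(pcE _ yl)|exists l].
Qed.

Lemma exceptional1_closed m (X : set (pspace K m)) q : zclosed (exceptional X [:: q] q).
Proof.
rewrite exceptional1E; apply: zclosedI; first exact: blowup_closed.
exact: over_closed (rep_neq0 q).
Qed.

(** A projective line minus its point [e]: independence of [e] and [l] lets the affine coordinates
    be recovered linearly from the point. *)
Lemma affine_line_iso m (q : pspace K m) k (e l : 'rV[K]_k) :
  (forall a b, a *: e + b *: l = 0 -> a = 0 /\ b = 0) ->
  isomorphic [set y | exists a, coords y (tens (rep q) (l + a *: e))] (affine_line (K := K)).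
Proof.
move=> ind; pose v := tens (rep q) l; pose w := tens (rep q) e.
pose L : 'M[K]_(2, m * k) := \matrix_(i < 2) [:: v; w]`_i.
have LE (u : 'rV[K]_2) : u *m L = u 0 0 *: v + u 0 1 *: w.
  apply/rowP => j; rewrite !mxE big_ord_recl big_ord1 !mxE /=.
  by rewrite (_ : lift ord0 ord0 = 1) //; apply: val_inj.
have tE a b : a *: v + b *: w = tens (rep q) (a *: l + b *: e).
  by apply: tens_ext => i j; rewrite !(mxE, tensE); ring.
have rf : row_free L.
  rewrite -kermx_eq0; apply/rowV0P => u /sub_kermxP; rewrite LE tE => /eqP.
  rewrite tens_eq0 (negPf (rep_neq0 q)) /= addrC => /eqP /ind [u1 u0].
  apply/rowP => j; rewrite mxE; case: j => [[|[|//]] hj].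
    by rewrite (_ : Ordinal hj = 0) //; apply: val_inj.
  by rewrite (_ : Ordinal hj = 1) //; apply: val_inj.
pose g a := affine_coords a *m L.
have gE a : g a = tens (rep q) (l + a *: e).
  by rewrite /g LE affine0 affine1 tE scale1r.
have g0 a : g a != 0.
  rewrite gE tens_neq0 ?rep_neq0 //; apply/eqP => e0; have := ind a 1.
  rewrite scale1r addrC => /(_ e0) [_] /eqP.
  by rewrite oner_eq0.
have [q0 _] := coords_ex (affine_neq0 (0 : K)); have [p0 _] := coords_ex (g0 0).
have [||a _|y|y|f hf _] := @iso_param _ _ setT _ _ g (@affine_coords K)
  [set y | exists a, coords y (tens (rep q) (l + a *: e))] (affine_line (K := K)) p0 q0.
- by move=> a _; rewrite g0 affine_neq0.
- move=> a _; have := reg_mul (pinvmx L) (reg_refl setT g a); apply: reg_ext => b _.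
  by rewrite /g mulmxKp //; apply: par_refl.
- exact: reg_mul (reg_refl _ _ _).
- by split=> [[a ya]|[a _ ya]]; exists a; rewrite // -?gE // gE.
- by split=> [[a ya]|[a _ ya]]; exists a.
by exists f.
Qed.

Lemma dot_delta (v : 'rV[K]_3) i : dot v (delta_mx 0 i) = v 0 i.
Proof. by rewrite /dot !mxE; move: i; apply: ord3P => /=; ring. Qed.

Lemma third_vector (c v : 'rV[K]_3) : cross c v != 0 ->
  exists2 w, dot (cross c v) w != 0 & rows3 c v w \in unitmx.
Proof.
move=> /rV0Pn [i hi]; have d0 : dot (cross c v) (delta_mx 0 i) != 0.
  by rewrite dot_delta.
by exists (delta_mx 0 i) => //; apply: basis3.
Qed.

Lemma over_sg ps t p y : flags ps t -> coords y (sg ps t.1 t.2) ->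
  Defs.over y p <-> coords p t.1.
Proof.
move=> ft yt; split=> [[v [l [pv yl]]]|pt].
  have pp : par (sg ps t.1 t.2) (segre (size ps) v l) by apply/(coords_par _ yt).
  have [tv _] := segre_par (sg_neq0 ft) pp.
  by apply/(coords_par _ pv); apply: par_sym.
by exists t.1, (fun i => psi (t.2 (map (@rep K 3) ps)`_i)).
Qed.

(** The cubic is split into an affine curve through [p] and a part [C'] away from [p], so near [q]
    only the strict transform of the former matters. Its single tangent direction is the point [e]
    of the exceptional curve, whose points are all the tangent directions of the surface. *)
Lemma sakai_of_curve n (G : {mpoly K[3]}) ps p (Y : set (pspace K n)) B kappa
    (C' : set (pspace K 3)) s :
  uniq ps -> B \in unitmx -> zeros G = affine_curve B kappa `|` C' ->
  coords p (gamma B kappa s) -> ~ pc (cone C') p ->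
  isomorphic (blowup setT ps `\` blowup (zeros G) ps) Y -> sakai_complement G ps p Y.
Proof.
move=> ups uB GE ps' pC isoY.
have [U hU] := lines_along_ex kappa uB.
pose X := blowup setT ps; pose C1 := blowup (affine_curve B kappa) ps; pose C2 := blowup C' ps.
have CE : blowup (zeros G) ps = C1 `|` C2 by rewrite GE blowupU.
pose t0 := (gamma B kappa s, U ^~ s); have ft0 : flags ps t0 := clift_flags uB hU ps s.
have [q qt] := coords_ex (clift_neq0 uB hU ps s).
have C2p y : C2 y -> ~ Defs.over y p.
  move=> C2y; have [t ft [yt cl]] := blowup_flags ups C2y.
  by move=> /(over_sg _ ft yt) pt; apply: pC; apply/(pcE _ pt).
have op : Defs.over q p by apply/(over_sg p ft0 qt).
have qC1 : C1 q by rewrite /C1 blowupE; apply/(pcE _ qt); apply: clift_affine.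
have C1X : C1 `<=` X by apply: blowup_mono.
have CX : blowup (zeros G) ps `<=` X by apply: blowup_mono.
exists q.
  apply/seteqP; split=> [y [+ oy]|_ ->]; last by split; rewrite // CE; left.
  rewrite CE => -[C1y|/C2p //]; have [t ft [yt _]] := blowup_flags ups C1y.
  have cl : vclos (lifts (affine_curve B kappa) ps) (sg ps t.1 t.2).
    by move: C1y; rewrite /C1 blowupE => /(pcE _ yt).
  have pt : coords p t.1 by apply/(over_sg p ft yt).
  have := curve_fiber uB hU ft cl; move=> /(_ s) h.
  by apply: coords_trans yt qt (h _); apply/(coords_par _ pt).
have ch : chart ps t0.
  (* If [p] is already a centre, [q] is an infinitely near point and lies on an exceptional
     curve. *)
  have [pp|pp] := boolP (p \in ps); first exact: chart_on ups ft0 ps' pp.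
  exact: chart_off ft0 ps' pp.
have [W [c [c0 cW kW dW]]] := surface_dirs ups ft0 ch qt.
have [e0 e00 [de0 deU]] := clift_dirs uB hU ps s.
have dC1 l : l != 0 -> dirs (@rep K _) q C1 l -> par l e0.
  move=> l0 dl; apply: (deU l l0).
  pose S := [set t | flags ps t /\ vclos (lifts (affine_curve B kappa) ps) (sg ps t.1 t.2)].
  have SF : S `<=` flags ps by move=> t [].
  have dS : dirs (fun t => sg ps t.1 t.2) t0 S l.
    apply: dirs_reindex dl; first exact/par_sym/coords_eqP.
    move=> x C1x; have [t ft [xt _]] := blowup_flags ups C1x.
    exists t; last exact/par_sym/coords_eqP; split=> //.
    by move: C1x; rewrite /C1 blowupE => /(pcE _ xt).
  have rx : reg (flags ps) (fun t => sg ps t.1 t.2) (fun t => t.1 *m invmx B) t0.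
    apply: reg_mul; apply: (@sg_regx _ _ (flags ps) ps fst snd) => //.
    exact: sg_neq0.
  have x1 : (t0.1 *m invmx B) 0 1 != 0 by rewrite mulmxK // row3E oner_eq0.
  (* Points of the closure lying over infinity are discarded, so that the remaining ones are values
     of [clift]. *)
  have := dirs_loc ft0 SF (sg_neq0 ft0) l0 rx (form_coord K 1) x1 dS.
  apply: dirs_reindex => [|t [[ft cl] /= t1]]; first exact: par_refl.
  have ct : vclos (cone (affine_curve B kappa)) t.1.
    have [y yt] := coords_ex (sg_neq0 ft).
    have C1y : blowup (affine_curve B kappa) ps y by rewrite blowupE; apply/(pcE _ yt).
    have [t' ft' [yt' cl']] := blowup_flags ups C1y.
    apply: vclos_par cl'; have pp : par (sg ps t'.1 t'.2) (sg ps t.1 t.2).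
      by apply/(coords_par _ yt').
    by have [] := sg_par (sg_neq0 ft') pp.
  have [s' ts'] := affine_curve_closed uB ct t1.
  by exists s' => //; apply: curve_fiber ft cl ts'.
have dC1' : dirs (@rep K _) q C1 e0.
  apply: dirs_reindex de0; first exact: coords_eqP.
  move=> s' _; have [y ys] := coords_ex (clift_neq0 uB hU ps s').
  exists y; last exact: coords_eqP.
  by rewrite /C1 blowupE; apply/(pcE _ ys); apply: clift_affine.
have dX : dirs (@rep K _) q X e0.
  apply: dirs_reindex dC1'; first exact: par_refl.
  by move=> y /C1X Xy; exists y => //; apply: par_refl.
have [e ee] := coords_ex (tens_neq0 (rep_neq0 q) e00).
have eE : exceptional X [:: q] q e by apply/exceptional1P; exists e0.
have eC : blowup (blowup (zeros G) ps) [:: q] e.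
  rewrite CE blowupU; left; rewrite blowup1E; exact/(pcE _ ee).
have EC : exceptional X [:: q] q `&` blowup (blowup (zeros G) ps) [:: q] = [set e].
  apply/seteqP; split=> [y [/exceptional1P [l [l0 dl yl]]]|_ -> //].
  rewrite CE blowupU => -[Cy|]; last first.
    rewrite blowup1E => /(graph_fst (closed_rep (@blowup_closed K 3 C' ps))).
    move=> [z [u [C2z u0 yz]]]; exfalso.
    have [zq _] : par (rep z) (rep q) /\ par u l.
      by apply: tens_par; rewrite ?rep_neq0 //; apply/(coords_par _ yz).
    apply: (C2p z C2z); suff -> : z = q by [].
    exact: coords_trans (coords_rep z) (coords_rep q) zq.
  have le : par l e0 by apply: dC1 => //; move: Cy; rewrite blowup1E => /(pcE _ yl).
  by apply: coords_trans yl ee _; apply: par_tens (par_refl _) le.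
have Ee : exceptional X [:: q] q `\ e =
    (blowup X [:: q] `\` blowup (blowup (zeros G) ps) [:: q]) `&` exceptional X [:: q] q.
  apply/seteqP; split=> y; last by move=> [[Xy nCy] Ey]; split=> // ye; apply: nCy; rewrite ye.
  move=> [Ey ye]; split=> //; split; first by case: Ey.
  by move=> Cy; apply: ye; rewrite -EC.
exists e => //; split.
- split; first by rewrite Ee => y [].
  move=> y [cy [Xy nCy]]; rewrite Ee; split=> //; apply: exceptional1_closed.
  rewrite zclosureE in cy; apply: vclos_mono cy => v [z [Ez _] zv].
  by exists v; [exists z|apply: par_refl].
- have [v0 ev0] : exists v, e0 = v *m W by apply/(dW e0 e00).
  have cv0 : cross c v0 != 0.
    rewrite -wedge_cross; apply: contraNneq (e00) => w0; rewrite ev0.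
    have v0n : v0 != 0 by apply: contraNneq e00 => v00; rewrite ev0 v00 mul0mx.
    have /(wedge_par c0 v0n) [a a0 ec] : wedge c v0 == 0 by rewrite w0.
    by apply/eqP; apply: (scalerI a0); rewrite scalemxAl -ec cW scaler0.
  (* [e0] is completed to a basis of the tangent plane by the image of a vector independent of [c]
     and [v0]. *)
  have [v2 d2 u3] := third_vector cv0; pose l2 := v2 *m W.
  have ind a b : a *: e0 + b *: l2 = 0 -> a = 0 /\ b = 0.
    rewrite ev0 !scalemxAl -mulmxDl => /kW [d ed].
    have b0 : b = 0.
      have := congr1 (dot (cross c v0)) ed.
      have -> : dot (cross c v0) (a *: v0 + b *: v2) = b * dot (cross c v0) v2.
        by rewrite /dot /cross !row3E !mxE; ring.
      have -> : dot (cross c v0) (d *: c) = 0 by rewrite dotZr dotC dot_crossl mulr0.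
      by move=> /eqP; rewrite mulf_eq0 (negPf d2) orbF => /eqP.
    split=> //; have : a *: e0 = 0.
      rewrite ev0 scalemxAl; move: ed; rewrite b0 scale0r addr0 => ->.
      by rewrite -scalemxAl cW scaler0.
    by move=> /eqP; rewrite scaler_eq0 (negPf e00) orbF => /eqP.
  have -> : exceptional X [:: q] q `\ e =
      [set y | exists a, coords y (tens (rep q) (l2 + a *: e0))].
    apply/seteqP; split=> [y [/exceptional1P [l [l0 dl yl]] ye]|y [a ya]].
      have [v ev] : exists v, l = v *m W by apply/(dW l l0).
      pose x := v *m invmx (rows3 c v0 v2).
      have el : l = x 0 1 *: e0 + x 0 2 *: l2.
        rewrite ev -[v](mulmxKV u3) -/x rows3E !mulmxDl -!scalemxAl cW scaler0 add0r.
        by rewrite -ev0.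
      have [x2|x2] := eqVneq (x 0 2) 0.
        exfalso; apply: ye; apply: coords_trans yl ee _; apply: par_tens (par_refl _) _.
        rewrite el x2 scale0r addr0; apply: par_scale; apply: contraNneq l0 => x1.
        by rewrite el x2 x1 !scale0r addr0.
      exists (x 0 1 / x 0 2); apply/(coords_par _ yl); apply: par_tens (par_refl _) _.
      exists (x 0 2) => //; rewrite el scalerDr scalerA [x 0 2 * _]mulrC.
      by rewrite divfK // addrC.
    have l0 : l2 + a *: e0 != 0.
      apply/eqP => e0'; have := ind a 1; rewrite scale1r addrC => /(_ e0') [_] /eqP.
      by rewrite oner_eq0.
    split.
      apply/exceptional1P; exists (l2 + a *: e0); split=> //.
      apply/(dW _ l0); exists (v2 + a *: v0).
      by rewrite mulmxDl -scalemxAl -ev0.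
    move=> ye; have := coords_neq0 ya; rewrite ye in ya => _.
    have [_ [b b0 eb]] : par (rep q) (rep q) /\ par (l2 + a *: e0) e0.
      by apply: tens_par; rewrite ?rep_neq0 //; apply/(coords_par _ ya).
    have [] := ind (a - b) 1; last by move=> _ /eqP; rewrite oner_eq0.
    by rewrite scalerBl scale1r addrAC [_ + l2]addrC eb subrr.
  exact: affine_line_iso.
(* Removing the punctured exceptional curve from S amounts to removing the strict transform and the
   whole exceptional curve, because [e] lies on the strict transform. *)
apply: isomorphic_trans isoY.
have -> : (blowup X [:: q] `\` blowup (blowup (zeros G) ps) [:: q]) `\`
    (exceptional X [:: q] q `\ e) =
    blowup X [:: q] `\` (blowup (blowup (zeros G) ps) [:: q] `|` exceptional X [:: q] q).
  apply/seteqP; split=> y.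
    move=> [[Xy nCy] nE]; split=> // -[//|Ey]; apply: nE; split=> //.
    by move=> ye; apply: nCy; rewrite ye.
  by move=> [Xy nCE]; split; [split=> // Cy|move=> [Ey _]]; apply: nCE; [left|right].
apply: blowup_complement => //; try exact: blowup_closed.
by rewrite CE; left.
Qed.

End Sakai.

(** * Quadratic transformations *)

Section Cremona.
Variable K : numFieldType.
Implicit Types (ps : seq (pspace K 3)) (i j k : 'I_3) (B : 'M[K]_3).

(** Indices in ['I_3] are added modulo 3, so [i], [i + 1], [i + 1 + 1] are all of them; the symmetry
    of the quadratic transformation is exploited in this form. *)
Lemma cyc3 (P : 'I_3 -> Prop) i : P i -> P (i + 1) -> P (i + 1 + 1) -> forall m, P m.
Proof.
have e12 : 1 + 1 = 2 :> 'I_3 by apply: val_inj.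
have e21 : 2 + 1 = 0 :> 'I_3 by apply: val_inj.
by move: i; apply: ord3P; rewrite ?add0r ?e12 ?e21 ?add0r => *; apply: ord3P.
Qed.

Lemma sum_cyc3 i (f : 'I_3 -> K) : f 0 + f 1 + f 2 = f i + f (i + 1) + f (i + 1 + 1).
Proof.
have e12 : 1 + 1 = 2 :> 'I_3 by apply: val_inj.
have e21 : 2 + 1 = 0 :> 'I_3 by apply: val_inj.
by move: i; apply: ord3P; rewrite ?add0r ?e12 ?e21 ?add0r //; ring.
Qed.

Lemma cyc_neq i : [/\ i + 1 != i, i + 1 + 1 != i & i + 1 + 1 != i + 1].
Proof. by move: i; apply: ord3P. Qed.

Lemma dot_cyc i (u v : 'rV[K]_3) : dot u v =
  u 0 i * v 0 i + u 0 (i + 1) * v 0 (i + 1) + u 0 (i + 1 + 1) * v 0 (i + 1 + 1).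
Proof. exact: (sum_cyc3 i (fun m => u 0 m * v 0 m)). Qed.

Lemma cyc_ext i (u v : 'rV[K]_3) : u 0 i = v 0 i -> u 0 (i + 1) = v 0 (i + 1) ->
  u 0 (i + 1 + 1) = v 0 (i + 1 + 1) -> u = v.
Proof. by move=> h0 h1 h2; apply/rowP; apply: (@cyc3 _ i). Qed.

Lemma wedge_cyc i (u v : 'rV[K]_3) :
  u 0 i * v 0 (i + 1) = u 0 (i + 1) * v 0 i ->
  u 0 i * v 0 (i + 1 + 1) = u 0 (i + 1 + 1) * v 0 i ->
  u 0 (i + 1) * v 0 (i + 1 + 1) = u 0 (i + 1 + 1) * v 0 (i + 1) -> wedge u v = 0.
Proof.
move=> h1 h2 h3; apply: tens_ext => j k; rewrite wedgeE mxE; apply/eqP; rewrite subr_eq0.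
apply/eqP; move: k; apply: (@cyc3 _ i); move: j; apply: (@cyc3 _ i) => //;
  by rewrite ?h1 ?h2 ?h3.
Qed.

(* The quadratic transformation is the relation "all [x_i y_i] are equal". *)
Definition inverse (x y : 'rV[K]_3) : Prop := forall i j, x 0 i * y 0 i = x 0 j * y 0 j.

Lemma inverseC x y : inverse x y -> inverse y x.
Proof. by move=> h i j; rewrite ![y 0 _ * _]mulrC. Qed.

Lemma inverse_par (x y x' y' : 'rV[K]_3) : par x x' -> par y y' -> inverse x y -> inverse x' y'.
Proof.
move=> /par_sym [a a0 ->] /par_sym [b b0 ->] h i j.
by rewrite !mxE mulrACA (h i j) mulrACA.
Qed.

(** All coordinates of [y] are nonzero, so the relation forces [x_j] to be a constant divided by
    [s_j]. *)
Lemma inverse_inj (x y r s : 'rV[K]_3) : x != 0 -> (forall i, r 0 i != 0) -> (forall i, s 0 i != 0) ->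
  inverse r s -> inverse x y -> par y s -> par x r.
Proof.
move=> /rV0Pn [i xi] r0 s0 rs xy [a a0 ey].
have E j : x 0 j * s 0 j = x 0 i * s 0 i.
  apply: (mulfI a0); have := xy j i; rewrite ey !mxE.
  by rewrite [x 0 j * _]mulrCA [x 0 i * _]mulrCA.
exists (x 0 i / r 0 i); first by rewrite mulf_neq0 ?invr_eq0.
apply/rowP => j; rewrite mxE; apply: (mulIf (s0 j)); rewrite E -[RHS]mulrA (rs j i).
by field; apply: r0.
Qed.

(* For lines through the base points the transformation exchanges the coordinates. *)
Definition line_inverse i (n m : 'rV[K]_3) : Prop :=
  n 0 (i + 1) * m 0 (i + 1) = n 0 (i + 1 + 1) * m 0 (i + 1 + 1).

Definition swap i (n : 'rV[K]_3) : 'rV[K]_3 :=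
  \row_m if m == i then n 0 i else if m == i + 1 then n 0 (i + 1 + 1) else n 0 (i + 1).

Lemma swapE i n : [/\ swap i n 0 i = n 0 i, swap i n 0 (i + 1) = n 0 (i + 1 + 1)
  & swap i n 0 (i + 1 + 1) = n 0 (i + 1)].
Proof.
have [h1 h2 h3] := cyc_neq i.
by rewrite !mxE !eqxx (negPf h1) (negPf h2) (negPf h3).
Qed.

Lemma swapK i n : swap i (swap i n) = n.
Proof.
have [h1 h2 h3] := swapE i n; have [h1' h2' h3'] := swapE i (swap i n).
by apply: (@cyc_ext i); rewrite ?h1' ?h2' ?h3'.
Qed.

Lemma swap_inverse i n : line_inverse i n (swap i n).
Proof. by have [_ h2 h3] := swapE i n; rewrite /line_inverse h2 h3 mulrC. Qed.

Lemma swap_par i (n m : 'rV[K]_3) : n != 0 -> m != 0 -> n 0 i = 0 -> m 0 i = 0 ->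
  line_inverse i n m -> par (swap i n) m.
Proof.
move=> n0 m0 ni mi nm; have [h1 h2 h3] := swapE i n.
have s0 : swap i n != 0.
  by apply: contraNneq n0 => e; rewrite -(swapK i n) e; apply/eqP/rowP => l; rewrite !mxE !if_same.
apply/(wedge_par s0 m0)/eqP/(@wedge_cyc i); rewrite ?h1 ?h2 ?h3 ?ni ?mi ?mul0r ?mulr0 //.
Qed.

(** In the order [i], [i+1], [i+2] the image of [x] is [(x_(i+1) x_(i+2), x_i x_(i+2), x_i
    x_(i+1))]. If the line [n] joins [x] to the [i]-th base point, then [(x_(i+1) : x_(i+2)) =
    (n_(i+2) : - n_(i+1))]; substituting this gives a formula that still makes sense at that base
    point. *)
Definition cre i (x n : 'rV[K]_3) : 'rV[K]_3 :=
  \row_m if m == i then x 0 (i + 1) * n 0 (i + 1)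
         else if m == i + 1 then x 0 i * n 0 (i + 1) else - (x 0 i * n 0 (i + 1 + 1)).

Lemma creE i x n : [/\ cre i x n 0 i = x 0 (i + 1) * n 0 (i + 1),
  cre i x n 0 (i + 1) = x 0 i * n 0 (i + 1)
  & cre i x n 0 (i + 1 + 1) = - (x 0 i * n 0 (i + 1 + 1))].
Proof.
have [h1 h2 h3] := cyc_neq i.
by rewrite !mxE !eqxx (negPf h1) (negPf h2) (negPf h3).
Qed.

Lemma cre_neq0 i (x n : 'rV[K]_3) : x 0 i != 0 -> n != 0 -> n 0 i = 0 -> cre i x n != 0.
Proof.
move=> xi n0 ni; have [h1 h2 h3] := creE i x n; apply: contraNneq n0 => c0.
apply/eqP/(@cyc_ext i); rewrite ?ni mxE //; apply: (mulfI xi); rewrite mulr0.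
  by rewrite -h2 c0 mxE.
by apply: oppr_inj; rewrite -h3 c0 mxE oppr0.
Qed.

(** The line relation and the incidence of [y] with the nonzero covector [m] determine
    [y_(i+1) : y_(i+2)] even when [x] is the base point. So the image of a flag is unique where
    [x_i] is nonzero. *)
Lemma cre_par i (x n y m : 'rV[K]_3) : x 0 i != 0 -> y != 0 -> n != 0 -> n 0 i = 0 ->
  m != 0 -> m 0 i = 0 -> dot x n = 0 -> dot y m = 0 -> inverse x y -> line_inverse i n m ->
  par (cre i x n) y.
Proof.
move=> xi y0 n0 ni m0 mi xn ym xy nm; have [h1 h2 h3] := creE i x n.
have c0 := cre_neq0 xi n0 ni.
rewrite (dot_cyc i) mi mulr0 add0r in ym.
have X0 : n 0 (i + 1) * y 0 (i + 1 + 1) + n 0 (i + 1 + 1) * y 0 (i + 1) = 0.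
  set X := (X in X = 0).
  have e1 : m 0 (i + 1) * X = 0.
    have -> : m 0 (i + 1) * X = (n 0 (i + 1) * m 0 (i + 1)) * y 0 (i + 1 + 1) +
       n 0 (i + 1 + 1) * (y 0 (i + 1) * m 0 (i + 1)) by rewrite /X; ring.
    rewrite nm; have -> : y 0 (i + 1) * m 0 (i + 1) = - (y 0 (i + 1 + 1) * m 0 (i + 1 + 1)).
      by apply/eqP; rewrite -addr_eq0 ym.
    by ring.
  have e2 : m 0 (i + 1 + 1) * X = 0.
    have -> : m 0 (i + 1 + 1) * X = n 0 (i + 1) * (y 0 (i + 1 + 1) * m 0 (i + 1 + 1)) +
       (n 0 (i + 1 + 1) * m 0 (i + 1 + 1)) * y 0 (i + 1) by rewrite /X; ring.
    rewrite -nm; have -> : y 0 (i + 1 + 1) * m 0 (i + 1 + 1) = - (y 0 (i + 1) * m 0 (i + 1)).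
      by apply/eqP; rewrite -addr_eq0 addrC ym.
    by ring.
  apply/eqP; apply: contraNT m0 => X0; apply/eqP/(@cyc_ext i); rewrite ?mi mxE //.
    by apply: (mulIf X0); rewrite e1 mul0r.
  by apply: (mulIf X0); rewrite e2 mul0r.
have X1 : n 0 (i + 1) * y 0 (i + 1 + 1) = - (n 0 (i + 1 + 1) * y 0 (i + 1)).
  by apply/eqP; rewrite -addr_eq0 X0.
apply/(wedge_par c0 y0)/eqP/(@wedge_cyc i); rewrite ?h1 ?h2 ?h3.
- by rewrite mulrAC (xy _ i) mulrAC.
- rewrite -mulrA X1 mulrN mulNr mulrCA (xy _ i); ring.
- by rewrite -mulrA X1 mulrN mulNr mulrA.
Qed.

Lemma cre_inverse i (x n : 'rV[K]_3) : dot x n = 0 -> n 0 i = 0 -> inverse x (cre i x n).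
Proof.
move=> xn ni; have [h1 h2 h3] := creE i x n.
rewrite (dot_cyc i) ni mulr0 add0r in xn.
have e1 : x 0 (i + 1) * cre i x n 0 (i + 1) = x 0 i * cre i x n 0 i.
  by rewrite h1 h2; ring.
have e2 : x 0 (i + 1 + 1) * cre i x n 0 (i + 1 + 1) = x 0 i * cre i x n 0 i.
  rewrite h1 h3; have -> : x 0 (i + 1) * n 0 (i + 1) = - (x 0 (i + 1 + 1) * n 0 (i + 1 + 1)).
    by apply/eqP; rewrite -addr_eq0 xn.
  by ring.
have E m : x 0 m * cre i x n 0 m = x 0 i * cre i x n 0 i by move: m; apply: (@cyc3 _ i).
by move=> j k; rewrite !E.
Qed.

(* A line through the [m]-th base point is mapped to a line through its image. *)
Lemma cre_swap i m (x n n' : 'rV[K]_3) : dot x n = 0 -> n 0 i = 0 -> dot x n' = 0 -> n' 0 m = 0 ->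
  (m = i -> n' = n) -> dot (cre i x n) (swap m n') = 0.
Proof.
move=> xn ni xn' nm nn; have [h1 h2 h3] := creE i x n; have [s1 s2 s3] := swapE m n'.
have e3 : i + 1 + 1 + 1 = i by move: (i); apply: ord3P; apply: val_inj.
rewrite (dot_cyc i) ni mulr0 add0r in xn.
move: m nm nn s1 s2 s3; apply: (@cyc3 _ i) => nm nn; rewrite ?e3 => s1 s2 s3.
- by rewrite (dot_cyc i) h1 h2 h3 s1 s2 s3 nm (nn erefl); ring.
- rewrite (dot_cyc i) nm mulr0 addr0 in xn'.
  rewrite (dot_cyc i) h1 h2 h3 s1 s2 s3 nm mulr0 addr0.
  have -> : - (x 0 i * n 0 (i + 1 + 1)) * n' 0 i = n 0 (i + 1 + 1) * (- (x 0 i * n' 0 i)).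
    by ring.
  have -> : - (x 0 i * n' 0 i) = x 0 (i + 1 + 1) * n' 0 (i + 1 + 1).
    by apply/esym/eqP; rewrite -addr_eq0 addrC xn'.
  transitivity (n' 0 (i + 1 + 1) * (x 0 (i + 1) * n 0 (i + 1) + x 0 (i + 1 + 1) * n 0 (i + 1 + 1))).
    by ring.
  by rewrite xn mulr0.
- rewrite (dot_cyc i) nm mulr0 addr0 in xn'.
  rewrite (dot_cyc i) h1 h2 h3 s1 s2 s3 nm mulr0 addr0.
  transitivity (n 0 (i + 1) * (x 0 i * n' 0 i + x 0 (i + 1) * n' 0 (i + 1))).
    by ring.
  by rewrite xn' mulr0.
Qed.

(** For corresponding pairs [x], [y] and [r], [r'], if [n] joins [x] and [r], then the covector with
    entries [x_k r_k n_k] joins [y] and [r']. At [x = r] it becomes [r_k^2 n_k], the action of the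
    derivative on lines through [r]. *)
Lemma dot_hadamard (x n y : 'rV[K]_3) (f : 'rV[K]_3) : inverse x y ->
  dot f n = 0 -> dot y (\row_k (x 0 k * f 0 k * n 0 k)) = 0.
Proof.
move=> xy fn; have -> : dot y (\row_k (x 0 k * f 0 k * n 0 k)) = (x 0 0 * y 0 0) * dot f n.
  rewrite /dot !mxE !mulrDr; congr (_ + _ + _); first by ring.
    by rewrite (xy 0 1); ring.
  by rewrite (xy 0 2); ring.
by rewrite fn mulr0.
Qed.

(** The products [r_k r'_k] are all equal, so multiplying by both squares is multiplication by a
    constant. *)
Lemma square_inverse (r r' n m : 'rV[K]_3) : (forall i, r 0 i != 0) ->
  (forall i, r' 0 i != 0) -> inverse r r' -> par (\row_k (r 0 k ^+ 2 * n 0 k)) m ->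
  par (\row_k (r' 0 k ^+ 2 * m 0 k)) n.
Proof.
move=> r0 r0' rr [a a0 /rowP ea]; pose q := r 0 0 * r' 0 0.
have q0 : q != 0 by rewrite mulf_neq0.
exists (a^-1 * q ^+ 2); first by rewrite mulf_neq0 ?invr_eq0 ?expf_neq0.
apply/rowP => k; have := ea k; rewrite !mxE => eak.
apply: (mulfI a0); rewrite [LHS]mulrCA -eak (_ : q = r 0 k * r' 0 k); last exact: rr.
by rewrite !mulrA mulfV // mul1r; ring.
Qed.

(** [B] and [B'] are frames at the base points of the transformation and of its inverse, scaled so
    that it becomes [inverse]; [rs] lists the other centres with their images, all off the
    fundamental lines. The lists of centres are constrained as sets, so each side can use the order
    that the theorem asks for. *)
Record cremona_data B B' (p p' : 'I_3 -> pspace K 3) (rs : seq (pspace K 3 * pspace K 3))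
    (ps ps' : seq (pspace K 3)) : Prop := CremonaData {
  cr_B : B \in unitmx;
  cr_B' : B' \in unitmx;
  cr_p : forall i, par (rep (p i) *m invmx B) (delta_mx 0 i);
  cr_p' : forall i, par (rep (p' i) *m invmx B') (delta_mx 0 i);
  cr_r : forall z, z \in rs -> forall i, (rep z.1 *m invmx B) 0 i != 0;
  cr_r' : forall z, z \in rs -> forall i, (rep z.2 *m invmx B') 0 i != 0;
  cr_rr : forall z, z \in rs -> inverse (rep z.1 *m invmx B) (rep z.2 *m invmx B');
  cr_u : uniq ps;
  cr_u' : uniq ps';
  cr_ps : forall q, q \in ps <-> (exists i, q = p i) \/ exists2 z, z \in rs & q = z.1;
  cr_ps' : forall q, q \in ps' <-> (exists i, q = p' i) \/ exists2 z, z \in rs & q = z.2 }.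

Lemma cremona_data_sym B B' p p' rs ps ps' : cremona_data B B' p p' rs ps ps' ->
  cremona_data B' B p' p [seq (z.2, z.1) | z <- rs] ps' ps.
Proof.
move=> [uB uB' hp hp' hr hr' hrr u u' hps hps']; split=> //.
- by move=> z /mapP [y yr ->]; apply: hr'.
- by move=> z /mapP [y yr ->]; apply: hr.
- by move=> z /mapP [y yr ->]; apply/inverseC/hrr.
- move=> q; rewrite hps'; split=> -[?|[z zr ->]]; [by left| |by left|].
    by right; exists (z.2, z.1) => //; apply/mapP; exists z.
  by right; move: zr => /mapP [y yr ->]; exists y.
- move=> q; rewrite hps; split=> -[?|[z zr ->]]; [by left| |by left|].
    by right; exists (z.2, z.1) => //; apply/mapP; exists z.
  by right; move: zr => /mapP [y yr ->]; exists y.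
Qed.

Notation flag := ('rV[K]_3 * ('rV[K]_3 -> 'rV[K]_3))%type.

(** The graph of the lifted isomorphism. At a base point [inverse] leaves the image undetermined,
    and the line through that base point supplies it; at a further centre the lines are related by
    the derivative, which multiplies covectors by the squares of the coordinates. *)
Definition cremona_rel B B' (p p' : 'I_3 -> pspace K 3) (rs : seq (pspace K 3 * pspace K 3))
    (ps ps' : seq (pspace K 3)) : set (flag * flag) :=
  [set t | [/\ flags ps t.1, flags ps' t.2,
    inverse (t.1.1 *m invmx B) (t.2.1 *m invmx B'),
    forall i, line_inverse i (t.1.2 (rep (p i)) *m B^T) (t.2.2 (rep (p' i)) *m B'^T)
  & forall z, z \in rs -> par t.1.1 (rep z.1) ->
      par (\row_k ((rep z.1 *m invmx B) 0 k ^+ 2 * (t.1.2 (rep z.1) *m B^T) 0 k))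
          (t.2.2 (rep z.2) *m B'^T)]].

Lemma cremona_rel_sym B B' p p' rs ps ps' t t' : cremona_data B B' p p' rs ps ps' ->
  cremona_rel B B' p p' rs ps ps' (t, t') ->
  cremona_rel B' B p' p [seq (z.2, z.1) | z <- rs] ps' ps (t', t).
Proof.
move=> cd [/= f f' inv lin pt]; split=> //=.
- exact: inverseC.
- by move=> i; rewrite /line_inverse; have := lin i; rewrite /line_inverse mulrC => ->; rewrite mulrC.
move=> _ /mapP [z zr ->] /= tz; have [uB uB' _ _ hr hr' hrr _ _ _ _] := cd.
have tz' : par t.1 (rep z.1).
  apply: (par_unit (B := invmx B)); first by rewrite unitmx_inv.
  apply: (@inverse_inj _ (t'.1 *m invmx B') _ (rep z.2 *m invmx B')) => //.
  - by rewrite mul_unit_eq0 ?unitmx_inv //; case: f.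
  - exact: hr.
  - exact: hr'.
  - exact: hrr.
  - exact: par_mul.
apply: (@square_inverse (rep z.1 *m invmx B)).
- exact: hr.
- exact: hr'.
- exact: hrr.
- exact: pt.
Qed.

End Cremona.

(** * The lifted transformation as a regular map *)

Section CremonaIso.
Variable K : numFieldType.
Implicit Types (ps : seq (pspace K 3)) (B : 'M[K]_3).
Notation flag := ('rV[K]_3 * ('rV[K]_3 -> 'rV[K]_3))%type.

Lemma dot_mul B (x n : 'rV[K]_3) : B \in unitmx ->
  dot (x *m invmx B) (n *m B^T) = dot x n.
Proof. by move=> uB; rewrite !dotE trmx_mul trmxK mulmxA mulmxKV. Qed.

Lemma dot_mulV B (y m : 'rV[K]_3) : B \in unitmx ->
  dot (y *m B) (m *m invmx B^T) = dot y m.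
Proof.
move=> uB; rewrite -(dot_mul (y *m B) (m *m invmx B^T) uB) mulmxK // mulmxKV //.
by rewrite unitmx_tr.
Qed.

Lemma par_delta_inj i j : par (delta_mx 0 i : 'rV[K]_3) (delta_mx 0 j) -> i = j.
Proof.
move=> [a a0 /rowP /(_ i)]; rewrite !mxE !eqxx /=.
by case: eqP => // _ /eqP; rewrite mulr0 oner_eq0.
Qed.

Section Data.
Variables (B B' : 'M[K]_3) (p p' : 'I_3 -> pspace K 3) (rs : seq (pspace K 3 * pspace K 3)).
Variables (ps ps' : seq (pspace K 3)).
Hypothesis cd : cremona_data B B' p p' rs ps ps'.

Let uB := cr_B cd.
Let uB' := cr_B' cd.
Let uBT : B^T \in unitmx. Proof. by rewrite unitmx_tr uB. Qed.
Let uBT' : B'^T \in unitmx. Proof. by rewrite unitmx_tr uB'. Qed.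

Lemma cremona_p_in i : p i \in ps.
Proof. by apply/(cr_ps cd); left; exists i. Qed.

Lemma cremona_p'_in i : p' i \in ps'.
Proof. by apply/(cr_ps' cd); left; exists i. Qed.

Lemma cremona_r_in z : z \in rs -> z.1 \in ps /\ z.2 \in ps'.
Proof. by move=> zr; split; [apply/(cr_ps cd)|apply/(cr_ps' cd)]; right; exists z. Qed.

Lemma cremona_line (t : flag) i : flags ps t ->
  [/\ t.2 (rep (p i)) *m B^T != 0, (t.2 (rep (p i)) *m B^T) 0 i = 0
    & dot (t.1 *m invmx B) (t.2 (rep (p i)) *m B^T) = 0].
Proof.
move=> [_ /(_ _ (cremona_p_in i)) [n0 xn pn]]; split.
- by rewrite mul_unit_eq0.
- rewrite -dot_delta dotC; apply: dot_par (cr_p cd i) (par_refl _) _.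
  by rewrite dot_mul.
- by rewrite dot_mul.
Qed.

Lemma cremona_point (x x' : 'rV[K]_3) z : x != 0 -> z \in rs ->
  inverse (x *m invmx B) (x' *m invmx B') -> par x' (rep z.2) -> par x (rep z.1).
Proof.
move=> x0 zr xx xz; apply: (@par_unit _ (invmx B)); first by rewrite unitmx_inv.
apply: (@inverse_inj _ _ (x' *m invmx B') _ (rep z.2 *m invmx B')) => //.
- by rewrite mul_unit_eq0 ?unitmx_inv.
- exact: cr_r cd _ zr.
- exact: cr_r' cd _ zr.
- exact: cr_rr cd _ zr.
- exact: par_mul.
Qed.

(** Some coordinate of the point is nonzero, and [cre] computes the image from the line through the
    corresponding base point. The lines of the image flag are then chosen centre by centre. *)
Lemma cremona_ex (t : flag) : flags ps t ->
  exists t', cremona_rel B B' p p' rs ps ps' (t, t').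
Proof.
move=> ft; have [x0 ht] := ft; pose x := t.1 *m invmx B.
have : x != 0 by rewrite mul_unit_eq0 ?unitmx_inv.
move=> /rV0Pn [i xi]; pose nu m := t.2 (rep (p m)) *m B^T.
have hn m := cremona_line m ft; rewrite -/x in hn.
pose y := cre i x (nu i).
have [ni0 nii xni] := hn i.
have xy : inverse x y by apply: cre_inverse.
have y0 : y != 0 by apply: cre_neq0.
have B'y : y *m B' *m invmx B' = y by rewrite mulmxK.
have yB0 : y *m B' != 0 by rewrite mul_unit_eq0.
have xyB : inverse x (y *m B' *m invmx B') by rewrite B'y.
have inv_r z w : z \in rs -> w \in rs -> z.2 = w.2 -> z.1 = w.1.
  move=> zr wr e; apply: (coords_trans (coords_rep _) (coords_rep _)).
  apply: (@cremona_point _ (rep z.2)) => //; first exact: rep_neq0.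
    exact: cr_rr cd _ zr.
  by rewrite e; apply: par_refl.
pose good q n' := [/\ n' != 0, dot (y *m B') n' = 0, dot (rep q) n' = 0,
  forall m, q = p' m -> line_inverse m (nu m) (n' *m B'^T)
  & forall z, z \in rs -> q = z.2 -> par t.1 (rep z.1) ->
      par (\row_k ((rep z.1 *m invmx B) 0 k ^+ 2 * (t.2 (rep z.1) *m B^T) 0 k)) (n' *m B'^T)].
have ex_good q : q \in ps' -> exists n', good q n'.
  move=> /(cr_ps' cd) [[m ->]|[z zr ->]].
    have [nm0 nmm xnm] := hn m; pose n' := swap m (nu m) *m invmx B'^T.
    have n'B : n' *m B'^T = swap m (nu m) by rewrite mulmxKV.
    have s0 : swap m (nu m) != 0.
      apply: contraNneq nm0 => e; rewrite -[X in X == 0](swapK m) -/(nu m) e.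
      by apply/eqP/rowP => l; rewrite !mxE !if_same.
    exists n'; split.
    - by rewrite mul_unit_eq0 ?unitmx_inv.
    - by rewrite dot_mulV //; apply: cre_swap => // ->.
    - rewrite -(dot_mul (rep (p' m)) n' uB') n'B.
      apply: dot_par (par_sym (cr_p' cd m)) (par_refl _) _.
      by rewrite dotC dot_delta; have [-> _ _] := swapE m (nu m).
    - move=> m' e; have mm : m' = m.
        apply: par_delta_inj; apply: par_trans (cr_p' cd m).
        by rewrite e; apply/par_sym/(cr_p' cd).
      by rewrite mm n'B; apply: swap_inverse.
    - move=> z zr e; have := cr_r' cd zr; rewrite -e => h.
      have [a a0 ea] := cr_p' cd m; have [h1 _ _] := cyc_neq m.
      by have := h (m + 1); rewrite ea !mxE (negPf h1) andbF mulr0 eqxx.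
  have np m : z.2 <> p' m.
    move=> e; have := cr_r' cd zr; rewrite e => h.
    have [a a0 ea] := cr_p' cd m; have [h1 _ _] := cyc_neq m.
    by have := h (m + 1); rewrite ea !mxE (negPf h1) andbF mulr0 eqxx.
  (* If the point is not [z.1], its image is not [z.2] and the line is their join; otherwise the
     derivative gives the line. *)
  have [tz|ntz] := pselect (par t.1 (rep z.1)); last first.
    exists (cross (y *m B') (rep z.2)); split.
    - rewrite -wedge_cross; apply/negP => /(wedge_par yB0 (rep_neq0 _)) yz; apply: ntz.
      exact: cremona_point zr xyB yz.
    - exact: dot_crossl.
    - exact: dot_crossr.
    - by move=> m /np.
    - by move=> w wr e tw; case: ntz; rewrite (inv_r z w zr wr e).
  have [z1 z2] := cremona_r_in zr; have [n0 xn zn] := ht _ z1.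
  set r := rep z.1 *m invmx B; set n := t.2 (rep z.1) *m B^T.
  have rr := cr_rr cd zr; rewrite -/r in rr.
  pose m := \row_k (r 0 k ^+ 2 * n 0 k).
  have rn : dot r n = 0 by rewrite dot_mul.
  have mE : m = \row_k (r 0 k * r 0 k * n 0 k) by apply/rowP => k; rewrite !mxE.
  have m0 : m != 0.
    have : n != 0 by rewrite mul_unit_eq0.
    move=> /rV0Pn [k nk]; apply/rV0Pn; exists k.
    by rewrite mxE mulf_neq0 ?expf_neq0 //; apply: cr_r cd _ zr _.
  have r'm : dot (rep z.2 *m invmx B') m = 0 by rewrite mE; apply: dot_hadamard.
  have yr' : par y (rep z.2 *m invmx B').
    apply: (@inverse_inj _ y x _ r) => //.
    - exact: cr_r' cd _ zr.
    - exact: cr_r cd _ zr.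
    - exact: inverseC.
    - exact: inverseC.
    - exact: par_mul.
  exists (m *m invmx B'^T); split.
  - by rewrite mul_unit_eq0 ?unitmx_inv.
  - by rewrite dot_mulV //; apply: dot_par (par_sym yr') (par_refl _) r'm.
  - by rewrite -(dot_mul _ _ uB') mulmxKV.
  - by move=> l /np.
  - move=> w wr e _; rewrite -(inv_r z w zr wr e) mulmxKV //; exact: par_refl.
have /choice [u' hu'] : forall v, exists n', forall q, q \in ps' -> rep q = v -> good q n'.
  move=> v; have [[q qp <-]|nq] := pselect (exists2 q, q \in ps' & rep q = v).
    by have [n' g] := ex_good q qp; exists n' => q' _ /rep_inj ->.
  by exists 0 => q qp qv; case: nq; exists q.
have hq q : q \in ps' -> good q (u' (rep q)) by move=> qp; apply: hu'.
exists (y *m B', u'); split=> //=.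
- by split=> //= q /hq [].
- by move=> m; have [_ _ _ /(_ m erefl)] := hq _ (cremona_p'_in m).
- by move=> z zr; have [_ z2] := cremona_r_in zr; have [_ _ _ _ /(_ z zr erefl)] := hq _ z2.
Qed.

Lemma reg_hadamard T (D : set T) m (g : T -> 'rV[K]_m) (x n : T -> 'rV[K]_3) (r : 'rV[K]_3) t0 :
  D t0 -> reg D g x t0 -> reg D g n t0 ->
  reg D g (fun t => \row_k (x t 0 k * r 0 k * n t 0 k)) t0.
Proof.
move=> Dt0 rx rn; apply: (reg_trans Dt0 (reg_tens rx rn)).
pose F (w : 'rV[K]_(3 * 3)) : 'rV[K]_3 := \row_k (w 0 (mxvec_index k k) * r 0 k).
apply: (@reg_ext _ _ _ _ _ _ (fun t => F (tens (x t) (n t)))).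
  move=> t _; rewrite (_ : F _ = \row_k (x t 0 k * r 0 k * n t 0 k)); first exact: par_refl.
  by apply/rowP => k; rewrite !mxE tensE mulrAC.
apply: (@reg_forms _ _ _ _ _ 1) => k.
apply: (@form_ext _ _ _ (fun w : 'rV[K]_(3 * 3) => w 0 (mxvec_index k k) * r 0 k)) => [w|].
  by rewrite mxE.
by apply: form_mulc; apply: form_coord.
Qed.

Lemma reg_cre T (D : set T) m (g : T -> 'rV[K]_m) (x n : T -> 'rV[K]_3) i t0 :
  D t0 -> reg D g x t0 -> reg D g n t0 -> reg D g (fun t => cre i (x t) (n t)) t0.
Proof.
move=> Dt0 rx rn; apply: (reg_trans Dt0 (reg_tens rx rn)).
pose F (w : 'rV[K]_(3 * 3)) : 'rV[K]_3 := \row_m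
  if m == i then w 0 (mxvec_index (i + 1) (i + 1))
  else if m == i + 1 then w 0 (mxvec_index i (i + 1)) else - w 0 (mxvec_index i (i + 1 + 1)).
apply: (@reg_ext _ _ _ _ _ _ (fun t => F (tens (x t) (n t)))).
  move=> t _; rewrite (_ : F _ = cre i (x t) (n t)); first exact: par_refl.
  by apply/rowP => k; rewrite !mxE !tensE.
apply: (@reg_forms _ _ _ _ _ 1) => k.
apply: (@form_ext _ _ _ (fun w : 'rV[K]_(3 * 3) =>
  if k == i then w 0 (mxvec_index (i + 1) (i + 1))
  else if k == i + 1 then w 0 (mxvec_index i (i + 1)) else - w 0 (mxvec_index i (i + 1 + 1)))) => [w|].
  by rewrite mxE.
case: (k == i); first exact: form_coord.
by case: (k == i + 1); [|apply: form_opp]; apply: form_coord.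
Qed.

Lemma reg_swap T (D : set T) m (g : T -> 'rV[K]_m) (n : T -> 'rV[K]_3) i t0 :
  D t0 -> reg D g n t0 -> reg D g (fun t => swap i (n t)) t0.
Proof.
move=> Dt0 rn; apply: (reg_trans Dt0 rn).
apply: (@reg_forms _ _ _ _ _ 1 n (swap i)) => k.
apply: (@form_ext _ _ _ (fun w : 'rV[K]_3 => if k == i then w 0 i
  else if k == i + 1 then w 0 (i + 1 + 1) else w 0 (i + 1))) => [w|].
  by rewrite mxE.
by case: (k == i); [|case: (k == i + 1)]; apply: form_coord.
Qed.

End Data.

(** The point is regular by [cre], the lines at base points by [swap]. At a further centre [r] the
    join is regular when the point is elsewhere; near [r] the one formula [x_k r_k n_k] covers the
    centre itself and the points beside it. *)
Lemma cremona_reg B B' p p' rs ps ps' s : cremona_data B B' p p' rs ps ps' ->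
  cremona_rel B B' p p' rs ps ps' s ->
  reg (cremona_rel B B' p p' rs ps ps') (fun s => sg ps s.1.1 s.1.2)
    (fun s => sg ps' s.2.1 s.2.2) s.
Proof.
move=> cd Ds; set D := cremona_rel _ _ _ _ _ _ _.
have uB := cr_B cd; have uB' := cr_B' cd.
have uBT' : B'^T \in unitmx by rewrite unitmx_tr.
have uBT : B^T \in unitmx by rewrite unitmx_tr.
have cd' := cremona_data_sym cd.
have line t i (Dt : D t) := cremona_line cd i (let: And5 f _ _ _ _ := Dt in f).
have line' t i (Dt : D t) := cremona_line cd' i (let: And5 _ f _ _ _ := Dt in f).
have [f f' inv lin pt] := Ds; have s0 := sg_neq0 f; have s0' := sg_neq0 f'.
pose G (s : flag * flag) := sg ps s.1.1 s.1.2.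
have rx : reg D G (fun t => t.1.1) s.
  exact: (@sg_regx _ _ D ps (fun t => t.1.1) (fun t => t.1.2)).
have ru q : q \in ps -> reg D G (fun t => t.1.2 (rep q)) s.
  exact: (@sg_regu _ _ D ps (fun t => t.1.1) (fun t => t.1.2)).
have rxi : reg D G (fun t => t.1.1 *m invmx B) s by apply: reg_mul.
have rnu q : q \in ps -> reg D G (fun t => t.1.2 (rep q) *m B^T) s.
  by move=> qp; apply: reg_mul; apply: ru.
have [x0 _] := f; have xi0 : s.1.1 *m invmx B != 0 by rewrite mul_unit_eq0 ?unitmx_inv.
have rx' : reg D G (fun t => t.2.1) s.
  have /rV0Pn [i xi] := xi0.
  have pip := cremona_p_in cd i.
  have rc := reg_cre i Ds rxi (rnu _ pip).
  have rc' : reg D G (fun t => t.2.1 *m invmx B') s.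
    apply: (reg_loc Ds rxi (form_coord K i) xi _ rc) => t Dt xit.
    have [n0 ni xn] := line t i Dt; have [m0 mi ym] := line' t i Dt.
    have [_ [x'0 _] it lt _] := Dt.
    apply: cre_par n0 ni m0 mi xn ym it (lt i) => //.
    by rewrite mul_unit_eq0 ?unitmx_inv.
  have := reg_mul B' rc'; apply: reg_ext => t Dt.
  by rewrite mulmxKV //; apply: par_refl.
apply: reg_sg => // q /(cr_ps' cd) [[i ->]|[z zr ->]].
  have rs' := reg_swap i Ds (rnu _ (cremona_p_in cd i)).
  have := reg_mul (invmx B'^T) rs'; apply: reg_ext => t Dt.
  have [n0 ni xn] := line t i Dt; have [m0 mi ym] := line' t i Dt.
  have [_ _ _ lt _] := Dt.
  have := par_mul (invmx B'^T) (swap_par n0 m0 ni mi (lt i)).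
  by rewrite mulmxK.
have [z1 z2] := cremona_r_in cd zr.
have [tz|ntz] := pselect (par s.1.1 (rep z.1)); last first.
  have rc := reg_cross (rep z.2) Ds rx'.
  have x'0 : s.2.1 != 0 by case: f'.
  have c0 : cross s.2.1 (rep z.2) != 0.
    rewrite -wedge_cross; apply/negP => /(wedge_par x'0 (rep_neq0 _)) yz; apply: ntz.
    exact: cremona_point cd _ _ _ x0 zr inv yz.
  have [N hN N0] := form_neq0 1 c0.
  apply: (reg_loc Ds rc hN N0 _ rc) => t Dt Nt.
  have c0t : cross t.2.1 (rep z.2) != 0.
    by apply: contraNneq Nt => ->; rewrite form_zero.
  have [_ [_ ft'] _ _ _] := Dt; have [m0 ym zm] := ft' _ z2.
  by apply: (@cross_par _ _ _ t.2.1 (rep z.2)); rewrite ?dot_crossl ?dot_crossr.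
pose r := rep z.1 *m invmx B.
have r0 k : r 0 k != 0 by apply: cr_r cd _ zr k.
have rh := reg_hadamard r Ds rxi (rnu _ z1).
(* Avoiding the three fundamental lines keeps the product formula from giving the zero covector. *)
pose N (v : 'rV[K]_3) := v 0 0 * (v 0 1 * v 0 2).
have hN : isform 3 N by apply: (@form_mul _ _ 1 2); [|apply: (@form_mul _ _ 1 1)]; apply: form_coord.
have N0 : N (s.1.1 *m invmx B) != 0.
  have [a a0 ->] := par_mul (invmx B) tz.
  by rewrite (form_scale _ _ hN) -/r /N !mulf_neq0 ?expf_neq0.
suff rl : reg D G (fun t => t.2.2 (rep z.2) *m B'^T) s.
  have := reg_mul (invmx B'^T) rl; apply: reg_ext => t Dt.
  by rewrite mulmxK //; apply: par_refl.
apply: (reg_loc Ds rxi hN N0 _ rh).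
move=> t Dt Nt; have xk k : (t.1.1 *m invmx B) 0 k != 0.
  by move: Nt k; rewrite /N !mulf_eq0 !negb_or => /and3P [h0 h1 h2]; apply: ord3P.
have [ft ft' it lt pz] := Dt.
have [n0 xn zn] := ft.2 _ z1; have [m0 ym zm] := ft'.2 _ z2.
have [tz'|ntz'] := pselect (par t.1.1 (rep z.1)).
  apply: par_trans (pz z zr tz'); have [a a0 ea] := par_mul (invmx B) tz'.
  exists a => //; apply/rowP => k; rewrite ea !mxE -/r; ring.
have x'0 : t.2.1 != 0 by case: ft'.
have c0 : cross (t.2.1 *m invmx B') (rep z.2 *m invmx B') != 0.
  rewrite -wedge_cross; apply/negP => /wedge_par; rewrite !mul_unit_eq0 ?unitmx_inv //.
  move=> /(_ x'0 (rep_neq0 _)) /par_unit; rewrite unitmx_inv => /(_ uB') yz; apply: ntz'.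
  by apply: cremona_point cd _ _ _ _ zr it yz; case: ft.
apply: (@cross_par _ _ _ (t.2.1 *m invmx B') (rep z.2 *m invmx B')) => //.
- have : t.1.2 (rep z.1) *m B^T != 0 by rewrite mul_unit_eq0.
  move=> /rV0Pn [k nk]; apply/rV0Pn; exists k.
  by rewrite mxE !mulf_neq0.
- by rewrite mul_unit_eq0.
- by apply: dot_hadamard => //; rewrite dot_mul.
- have -> : \row_k ((t.1.1 *m invmx B) 0 k * r 0 k * (t.1.2 (rep z.1) *m B^T) 0 k) =
      \row_k (r 0 k * (t.1.1 *m invmx B) 0 k * (t.1.2 (rep z.1) *m B^T) 0 k).
    by apply/rowP => k; rewrite [LHS]mxE [RHS]mxE [X in _ = X * _]mulrC.
  by apply: dot_hadamard; [apply: cr_rr cd _ zr|rewrite dot_mul].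
- by rewrite dot_mul.
- by rewrite dot_mul.
Qed.

End CremonaIso.

(** * Images of curves and of exceptional curves *)

Section CremonaMarks.
Variable K : numFieldType.
Implicit Types (ps : seq (pspace K 3)) (B : 'M[K]_3).
Notation flag := ('rV[K]_3 * ('rV[K]_3 -> 'rV[K]_3))%type.

Lemma flags_of_lift ps (v : 'rV[K]_3) : blift ps v != 0 -> flags ps (v, cross v).
Proof. by move=> /segre_lift_point [q qv qp]; apply: flags_cross qv qp. Qed.

Lemma lift_off ps (v : 'rV[K]_3) p : blift ps v != 0 -> p \in ps -> ~ par v (rep p).
Proof.
move=> /segre_lift_point [q qv qp] pp vp; move: qp.
by rewrite (coords_trans qv (coords_rep p) vp) pp.
Qed.

(* The points of the strict transform of the line [n] over centres on it are those
   where the line through the centre is [n] itself. *)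
Lemma line_lift ps (n : 'rV[K]_3) t : n != 0 -> flags ps t -> dot t.1 n = 0 ->
  (forall q, q \in ps -> par t.1 (rep q) -> par (t.2 (rep q)) n) ->
  vclos (lifts [set q | dot (rep q) n = 0] ps) (sg ps t.1 t.2).
Proof.
move=> n0 [x0 ht] xn hn.
(* A second point of the line, so that [t.1 + s *: d] moves along it. *)
have [d dn xd] : exists2 d, dot d n = 0 & cross t.1 d != 0.
  have [w ew] := cross_surj n0 (etrans (dotC n t.1) xn).
  have [d dd] := cross_surj x0 xn.
  have d0 : cross d t.1 != 0 by rewrite dd.
  have /rV0Pn [i ni] := n0; have [v ev] : exists v, cross t.1 v != 0 /\ dot v n = 0.
    have [[j cj]|h] := pselect (exists j, cross t.1 (cross (delta_mx 0 j) n) != 0).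
      by exists (cross (delta_mx 0 j) n); rewrite dotC dot_crossr.
    exfalso; have E j : cross t.1 (cross (delta_mx 0 j) n) = 0.
      by apply/eqP; apply: contrapT => /negP e; apply: h; exists j.
    have Ej j : t.1 0 j *: n = 0.
      have := E j; rewrite cross_cross xn scale0r sub0r dot_delta => /eqP.
      by rewrite oppr_eq0 => /eqP.
    move/rV0Pn: x0 => [j xj]; have /eqP := Ej j.
    by rewrite scaler_eq0 (negPf xj) (negPf n0).
  by exists v; case: ev.
pose x s := t.1 + s *: d.
have px : ispolyv x.
  apply: ispolyv_add; first exact: ispolyv_cst.
  by apply: ispolyv_scale; [apply: ispoly_id|apply: ispolyv_cst].
pose u s v := if dot v n == 0 then n else cross (x s) v.
have xsn s : dot (x s) n = 0 by rewrite /x dotDl dotZl dn xn mulr0 addr0.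
have crossx v : v != 0 -> dot v n = 0 -> cof (fun s => cross (x s) v != 0).
  move=> v0 vn; have pc' : ispolyv (fun s => cross (x s) v).
    by apply: ispolyv_cross => //; apply: ispolyv_cst.
  have [c0|c0] := eqVneq (cross t.1 v) 0; last first.
    by apply: (ispolyv_cof (s0 := 0) pc'); rewrite /x scale0r addr0.
  apply: (ispolyv_cof (s0 := 1) pc'); apply: contra xd => /eqP c1.
  have dv : cross d v = 0.
    have -> : cross d v = cross (x 1) v - cross t.1 v.
      by apply: row3_ext; rewrite /x /cross !mxE /=; ring.
    by rewrite c1 c0 subrr.
  have /wedge_par : wedge t.1 v == 0 by rewrite wedge_cross c0.
  move=> /(_ x0 v0) [a a0 ->].
  have -> : cross (a *: v) d = - a *: cross d v.
    by apply: row3_ext; rewrite /cross !mxE /=; ring.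
  by rewrite dv scaler0.
have c_off q : q \in ps -> dot (rep q) n != 0 -> forall s, x s != 0 -> cross (x s) (rep q) != 0.
  move=> qp qn s xs; rewrite -wedge_cross; apply/negP => /(wedge_par xs (rep_neq0 q)) xq.
  have := dot_par xq (par_refl n) (xsn s) => /eqP; by rewrite (negPf qn).
have par0 : par (sg ps (x 0) (u 0)) (sg ps t.1 t.2).
  have xe : x 0 = t.1 by rewrite /x scale0r addr0.
  apply: par_sg => [|q qp]; first by rewrite xe; apply: par_refl.
  have [m0 xm qm] := ht q qp; rewrite /u; case: eqP => [qn|/eqP qn].
    have [xq|nxq] := pselect (par t.1 (rep q)); first exact/par_sym/hn.
    have c0 : cross t.1 (rep q) != 0.
      by rewrite -wedge_cross; apply/negP => /(wedge_par x0 (rep_neq0 q)).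
    exact: cross_par c0 xn qn xm qm.
  have c0 := c_off q qp qn 0; rewrite xe in c0 *.
  by apply: cross_par (c0 x0) _ _ xm qm; rewrite ?dot_crossl ?dot_crossr ?c0.
apply: vclos_par par0 _; apply: arc (ispolyv_sg px _) _ 0.
  move=> q _; rewrite /u; case: eqP => _; first exact: ispolyv_cst.
  by apply: ispolyv_cross => //; apply: ispolyv_cst.
have cx : cof (fun s => x s != 0).
  by apply: (ispolyv_cof (s0 := 0) px); rewrite /x scale0r addr0.
have call : cof (fun s => forall q, q \in ps -> dot (rep q) n = 0 -> cross (x s) (rep q) != 0).
  apply: cof_in => q qp; have [qn|qn] := eqVneq (dot (rep q) n) 0.
    by apply: cof_imp (crossx _ (rep_neq0 q) qn) => s h _.
  by apply: cof_true => s /eqP; rewrite (negPf qn).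
apply: cof_imp (cof_and cx call) => s [xs0 hs].
have cq q : q \in ps -> cross (x s) (rep q) != 0.
  by move=> qp; have [/hs|/c_off] := eqVneq (dot (rep q) n) 0; apply.
have [y yx] := coords_ex xs0; apply: (@vclos_par _ _ _ (blift ps (x s))).
  rewrite lift_sg; apply: par_sg (par_refl _) _ => q qp; rewrite /u.
  case: eqP => [qn|_]; last exact: par_refl.
  by apply: cross_par (cq q qp) _ _ (xsn s) qn; rewrite ?dot_crossl ?dot_crossr ?cq.
apply: vclos_sub; exists (x s) => //; exists y => //; split.
  exact: dot_par (coords_eqP yx) (par_refl n) (xsn s).
by apply/negP => /cq /(cross_coords yx); rewrite eqxx.
Qed.

Lemma perp2 (a b c d : K) : a * c + b * d = 0 -> (a != 0) || (b != 0) ->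
  exists e, c = e * b /\ d = - (e * a).
Proof.
move=> h; have [b0|b0] := eqVneq b 0.
  rewrite b0 mul0r addr0 in h; rewrite orbF => a0; exists (- d / a).
  move/eqP: h; rewrite mulf_eq0 (negPf a0) => /eqP ->; rewrite b0 mulr0; split=> //.
  by field.
move=> _; exists (c / b); split; first by field.
apply: (mulfI b0); have -> : b * d = - (a * c) by apply/eqP; rewrite -addr_eq0 addrC h.
by field.
Qed.

Lemma coords_pair_neq0 B (q : pspace K 3) (v : 'rV[K]_3) i : B \in unitmx ->
  par (rep q *m invmx B) (delta_mx 0 i) -> v != 0 -> ~ par v (rep q) ->
  ((v *m invmx B) 0 (i + 1) != 0) || ((v *m invmx B) 0 (i + 1 + 1) != 0).
Proof.
move=> uB qi v0 nv; apply: contra_notT nv; rewrite negb_or !negbK => /andP [/eqP e1 /eqP e2].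
apply: (@par_unit _ (invmx B)); first by rewrite unitmx_inv.
apply: par_trans (par_sym qi).
have : v *m invmx B != 0 by rewrite mul_unit_eq0 ?unitmx_inv.
move: (v *m invmx B) e1 e2 => x e1 e2 x0.
have [h1 h2 h3] := cyc_neq i; exists (x 0 i).
  by apply: contraNneq x0 => xi; apply/eqP/(@cyc_ext _ i); rewrite mxE.
by apply: (@cyc_ext _ i); rewrite !mxE ?eqxx ?mulr1 // ?e1 ?e2 ?(negPf h1) ?(negPf h2) ?andbF ?mulr0.
Qed.

Section Iso.
Variables (B B' : 'M[K]_3) (p p' : 'I_3 -> pspace K 3) (rs : seq (pspace K 3 * pspace K 3)).
Variables (ps ps' : seq (pspace K 3)).
Hypothesis cd : cremona_data B B' p p' rs ps ps'.

(** Away from all centres the lines of both flags are joins; [perp2] expresses them through the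
    coordinates of the points, and the line conditions follow from [inverse]. *)
Lemma cremona_rel_lift (v v' : 'rV[K]_3) : blift ps v != 0 -> blift ps' v' != 0 ->
  inverse (v *m invmx B) (v' *m invmx B') ->
  cremona_rel B B' p p' rs ps ps' ((v, cross v), (v', cross v')).
Proof.
move=> l0 l0' vv; have f := flags_of_lift l0; have f' := flags_of_lift l0'.
split=> //= [i|z zr]; last first.
  by have [z1 _] := cremona_r_in cd zr; move=> /(lift_off l0 z1).
have cd' := cremona_data_sym cd.
have [n0 ni xn] := cremona_line cd i f; have [m0 mi ym] := cremona_line cd' i f'.
have xp := coords_pair_neq0 (cr_B cd) (cr_p cd i) (proj1 f) (lift_off l0 (cremona_p_in cd i)).
have yp := coords_pair_neq0 (cr_B' cd) (cr_p' cd i) (proj1 f') (lift_off l0' (cremona_p_in cd' i)).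
rewrite (dot_cyc i) ni mulr0 add0r in xn; rewrite (dot_cyc i) mi mulr0 add0r in ym.
have [a [a1 a2]] := perp2 xn xp; have [b [b1 b2]] := perp2 ym yp.
rewrite /line_inverse /= a1 a2 b1 b2 mulrNN.
by rewrite mulrACA [RHS]mulrACA (vv (i + 1) (i + 1 + 1)).
Qed.

(** The second clause transports curves with matching parametrizations. For the third, a point over
    [p i] is a direction there, and as the direction varies its image runs through the fundamental
    line opposite to [p' i]. *)
Lemma cremona_iso : exists f, [/\ is_iso (blowup setT ps) (blowup setT ps') f,
  forall V : set ('rV[K]_3 * 'rV[K]_3), (forall v, V v ->
      [/\ blift ps v.1 != 0, blift ps' v.2 != 0 & inverse (v.1 *m invmx B) (v.2 *m invmx B')]) ->
    f @` pc [set blift ps v.1 | v in V] = pc [set blift ps' v.2 | v in V]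
  & forall i, f @` exceptional setT ps (p i) =
      blowup [set q | (rep q *m invmx B') 0 i = 0] ps'].
Proof.
pose D := cremona_rel B B' p p' rs ps ps'.
have cd' := cremona_data_sym cd; have uB := cr_B cd; have uB' := cr_B' cd.
pose G (s : flag * flag) := sg ps s.1.1 s.1.2.
pose H (s : flag * flag) := sg ps' s.2.1 s.2.2.
have GH0 s : D s -> G s != 0 /\ H s != 0.
  by move=> [f f' _ _ _]; split; apply: sg_neq0.
have rGH s : D s -> reg D G H s by apply: cremona_reg.
have back t t' : cremona_rel B' B p' p [seq (z.2, z.1) | z <- rs] ps' ps (t', t) -> D (t, t').
  move=> /(cremona_rel_sym cd'); rewrite -map_comp.
  by rewrite (_ : [seq _ | i <- rs] = rs) // -[RHS]map_id; apply: eq_map => -[].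
have rHG s : D s -> reg D H G s.
  case: s => t t' Ds0; have Ds := cremona_rel_sym cd Ds0.
  pose sw (s : flag * flag) := (s.2, s.1).
  have Dsw s : D s -> cremona_rel B' B p' p [seq (z.2, z.1) | z <- rs] ps' ps (sw s).
    by case: s => u u' Du; apply: cremona_rel_sym.
  exact: (@reg_pull _ _ _ _ D sw _ _ _ _ (t, t') Dsw (cremona_reg cd' Ds)).
have HX y : blowup setT ps y <-> exists2 s, D s & coords y (G s).
  rewrite (blowupT _ (cr_u cd)); split=> [[t ft yt]|[s Ds ys]].
    by have [t' Dt] := cremona_ex cd ft; exists (t, t').
  by exists s.1 => //; case: Ds.
have HY y : blowup setT ps' y <-> exists2 s, D s & coords y (H s).
  rewrite (blowupT _ (cr_u' cd)); split=> [[t ft yt]|[s Ds ys]].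
    by have [t' /back Dt] := cremona_ex cd' ft; exists (t', t).
  by exists s.2 => //; case: Ds.
have n0 : tens (delta_mx 0 0 : 'rV[K]_3) (delta_mx 0 0 : 'rV[K]_3) != 0.
  rewrite tens_neq0 //; apply/rV0Pn; exists 0; by rewrite mxE oner_eq0.
have inh k (qs : seq (pspace K 3)) : exists y : pspace K (bldim 3 k), True.
  have d0 : (delta_mx 0 0 : 'rV[K]_3) != 0 by apply/rV0Pn; exists 0; rewrite mxE oner_eq0.
  have s0 : segre k (delta_mx 0 0 : 'rV[K]_3) (fun=> tens (delta_mx 0 0) (delta_mx 0 0)) != 0.
    by apply: segre_neq0.
  by have [y _] := coords_ex s0; exists y.
have [p0 _] := inh (size ps) ps; have [q0 _] := inh (size ps') ps.
have [f hf fGH] := iso_param p0 q0 GH0 rGH rHG HX HY.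
have HX1 y : blowup setT ps y -> exists2 s, D s & coords y (G s) by move=> /HX.
have HY1 y : blowup setT ps' y -> exists2 s, D s & coords y (H s) by move=> /HY.
have sub1 S : S `<=` D -> pc (G @` S) `<=` blowup setT ps.
  move=> SD y Sy; apply: blowup_closed; apply: vclos_mono Sy => _ [s Ss <-].
  have [z zs] := coords_ex (GH0 s (SD s Ss)).1.
  by exists (G s); [exists z => //; apply/HX; exists s => //; apply: SD|apply: par_refl].
have sub2 S : S `<=` D -> pc (H @` S) `<=` blowup setT ps'.
  move=> SD y Sy; apply: blowup_closed; apply: vclos_mono Sy => _ [s Ss <-].
  have [z zs] := coords_ex (GH0 s (SD s Ss)).2.
  by exists (H s); [exists z => //; apply/HY; exists s => //; apply: SD|apply: par_refl].
have img S (SD : S `<=` D) := image_pc GH0 rGH rHG HX1 HY1 fGH SD (sub1 S SD) (sub2 S SD).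
exists f; split=> // [V hV|i].
  pose S := [set ((v.1, cross v.1), (v.2, cross v.2)) | v in V].
  have SD : S `<=` D by move=> _ [v /hV [h1 h2 h3] <-]; apply: cremona_rel_lift.
  have eG : G @` S = [set blift ps v.1 | v in V].
    apply/seteqP; split=> w.
      by move=> [_ [v Vv <-] <-]; exists v; rewrite // /G /= lift_sg.
    move=> [v Vv <-]; exists ((v.1, cross v.1), (v.2, cross v.2)); first by exists v.
    by rewrite /G /= lift_sg.
  have eH : H @` S = [set blift ps' v.2 | v in V].
    apply/seteqP; split=> w.
      by move=> [_ [v Vv <-] <-]; exists v; rewrite // /H /= lift_sg.
    move=> [v Vv <-]; exists ((v.1, cross v.1), (v.2, cross v.2)); first by exists v.
    by rewrite /H /= lift_sg.
  by rewrite -eG -eH; apply: img.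
pose S := [set s | D s /\ par s.1.1 (rep (p i))].
have SD : S `<=` D by move=> s [].
have SE : pc (G @` S) = exceptional setT ps (p i).
  apply/seteqP; split=> y.
    move=> Sy; have Xy := sub1 S SD y Sy; split=> //.
    have [s Ds ys] := HX1 y Xy; have [fl _ _ _ _] := Ds.
    apply/(over_sg (p i) fl ys)/(coords_par _ (coords_rep _))/par_sym.
    have rx : reg D G (fun t => t.1.1) s.
      exact: (@sg_regx _ _ D ps (fun t => t.1.1) (fun t => t.1.2) s Ds (sg_neq0 fl)).
    apply/(wedge_par (proj1 fl) (rep_neq0 _))/eqP.
    have clS : vclos (G @` S) (G s) by apply/(pcE _ ys).
    apply: (cont_eq0 Ds SD (reg_wedge (rep (p i)) Ds rx) clS) => t [Dt ti].
    apply/eqP/(wedge_par _ (rep_neq0 _)) => //; by case: Dt => -[].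
  move=> [Xy oy]; have [s Ds ys] := HX1 y Xy; apply/(pcE _ ys); apply: vclos_sub.
  exists s => //; split=> //; have [fl _ _ _ _] := Ds.
  by apply/coords_eqP/(over_sg (p i) fl ys).
pose n := (delta_mx 0 i : 'rV[K]_3) *m invmx B'^T.
have uBT' : B'^T \in unitmx by rewrite unitmx_tr.
have nE (x : 'rV[K]_3) : dot x n = (x *m invmx B') 0 i.
  by rewrite -(dot_mul x n uB') mulmxKV // dot_delta.
have n0' : n != 0.
  rewrite mul_unit_eq0 ?unitmx_inv //; apply/rV0Pn; exists i.
  by rewrite mxE !eqxx oner_eq0.
have LE : [set q | (rep q *m invmx B') 0 i = 0] = [set q | dot (rep q) n = 0].
  by apply/seteqP; split=> q /=; rewrite nE.
rewrite -SE img //; apply/seteqP; split=> y.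
  rewrite LE blowupE; apply: vclos_idem => _ [s [Ds si] <-].
  have [fl fl' inv lin pt] := Ds; have [h1 h2 h3] := cyc_neq i.
  have [a a0 ea] : par (s.1.1 *m invmx B) (delta_mx 0 i).
    exact: par_trans (par_mul _ si) (cr_p cd i).
  have xi : (s.1.1 *m invmx B) 0 i != 0 by rewrite ea !mxE !eqxx mulr1.
  have xj j : j != i -> (s.1.1 *m invmx B) 0 j = 0.
    by move=> ji; rewrite ea !mxE (negPf ji) andbF mulr0.
  have yi : (s.2.1 *m invmx B') 0 i = 0.
    have := inv i (i + 1); rewrite (xj _ h1) mul0r => /eqP.
    by rewrite mulf_eq0 (negPf xi) => /eqP.
  have [x'0 ht'] := fl'.
  (* When the image is a base point [p' j], it must lie on the strict transform of the fundamental
     line: the swapped line through [p' j] is that line. *)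
  apply: line_lift => //; first by rewrite nE.
  move=> q /(cr_ps' cd) [[j ->]|[z zr ->]] xq; last first.
    have [b b0 eb] := par_mul (invmx B') (par_sym xq).
    by have := cr_r' cd zr i; rewrite eb mxE yi mulr0 eqxx.
  have ji : j != i.
    apply/eqP => ji; have [b b0 eb] := par_trans (par_mul (invmx B') (par_sym xq)) (par_refl _).
    have [c c0 ec] := par_sym (cr_p' cd j).
    have : (delta_mx 0 i : 'rV[K]_3) 0 i = 0.
      by rewrite -{1}ji ec eb mxE [X in _ * X]mxE yi !mulr0.
    by rewrite mxE !eqxx => /eqP; rewrite oner_eq0.
  have [n00 nj xn] := cremona_line cd j fl; have [m0 mj ym] := cremona_line cd' j fl'.
  have ni : (s.1.2 (rep (p j)) *m B^T) 0 i = 0.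
    rewrite dotC ea dotZr dot_delta in xn; move/eqP: xn.
    by rewrite mulf_eq0 (negPf a0) => /eqP.
  apply: (@par_unit _ B'^T) => //; rewrite /n mulmxKV //.
  apply: par_trans (par_sym (swap_par n00 m0 nj mj (lin j))) _.
  set nu := s.1.2 (rep (p j)) *m B^T in n00 nj ni *.
  have [s1 s2 s3] := swapE j nu; have [g1 g2 g3] := cyc_neq j.
  have : i = j + 1 \/ i = j + 1 + 1.
    move: ji; rewrite eq_sym; move: (i); apply: (@cyc3 _ j); rewrite ?eqxx //; by [left|right].
  case=> ei.
    have n2 : nu 0 (j + 1 + 1) != 0.
      apply: contraNneq n00 => n2; apply/eqP/(@cyc_ext _ j); rewrite [RHS]mxE;
        [exact: nj|by rewrite -ei|exact: n2].
    exists (nu 0 (j + 1 + 1)) => //; apply: (@cyc_ext _ j); rewrite [RHS]mxE [X in _ = _ * X]mxE ei.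
    - by rewrite s1 nj eq_sym (negPf g1) andbF mulr0.
    - by rewrite s2 !eqxx mulr1.
    - by rewrite s3 -ei ni ei (negPf g3) andbF mulr0.
  have n2 : nu 0 (j + 1) != 0.
    apply: contraNneq n00 => n2; apply/eqP/(@cyc_ext _ j); rewrite [RHS]mxE;
      [exact: nj|exact: n2|by rewrite -ei].
  exists (nu 0 (j + 1)) => //; apply: (@cyc_ext _ j); rewrite [RHS]mxE [X in _ = _ * X]mxE ei.
  - by rewrite s1 nj eq_sym (negPf g2) andbF mulr0.
  - by rewrite s2 -ei ni ei eq_sym (negPf g3) andbF mulr0.
  - by rewrite s3 !eqxx mulr1.
(* Conversely, a point of the line that is not a centre has its two other coordinates nonzero, which
   forces its preimage to lie over [p i]. *)
rewrite blowupE; apply: vclos_mono => _ [v [q [qi qp] qv] <-].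
have l0 := lift_neq0 qv qp; have [z zv] := coords_ex l0.
have Yz : blowup setT ps' z.
  by rewrite blowupE; apply/(pcE _ zv); apply: vclos_sub; exists v => //; exists q.
have [s Ds zs] := HY1 z Yz; exists (H s); last exact/(coords_par _ zv).
exists s => //; split=> //; have [fl fl' inv lin pt] := Ds.
have fv := flags_of_lift l0; rewrite lift_sg in zv.
have [vx _] : par v s.2.1 /\ forall q, q \in ps' -> par (cross v (rep q)) (s.2.2 (rep q)).
  by apply: sg_par (sg_neq0 fv) _; apply/(coords_par _ zv).
have yi : (s.2.1 *m invmx B') 0 i = 0.
  rewrite -nE; apply: (dot_par _ (par_refl n) (etrans (nE _) qi)).
  by apply: par_trans (par_sym (coords_eqP qv)) vx.
have nvp j : ~ par s.2.1 (rep (p' j)).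
  by move=> h; apply: (lift_off l0 (cremona_p_in cd' j)); apply: par_trans vx h.
have yp j := coords_pair_neq0 (cr_B' cd) (cr_p' cd j) (proj1 fl') (@nvp j).
have [h1 h2 h3] := cyc_neq i; have e3 : i + 1 + 1 + 1 = i.
  by move: (i); apply: ord3P; apply: val_inj.
have y1 : (s.2.1 *m invmx B') 0 (i + 1) != 0 by have := yp (i + 1 + 1); rewrite e3 yi eqxx.
have y2 : (s.2.1 *m invmx B') 0 (i + 1 + 1) != 0.
  by have := yp (i + 1); rewrite e3 yi eqxx orbF.
have x1 : (s.1.1 *m invmx B) 0 (i + 1) = 0.
  by have /eqP := inv (i + 1) i; rewrite yi mulr0 mulf_eq0 (negPf y1) orbF => /eqP.
have x2 : (s.1.1 *m invmx B) 0 (i + 1 + 1) = 0.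
  by have /eqP := inv (i + 1 + 1) i; rewrite yi mulr0 mulf_eq0 (negPf y2) orbF => /eqP.
apply: contrapT => nx; have := coords_pair_neq0 uB (cr_p cd i) (proj1 fl) nx.
by rewrite x1 x2 eqxx.
Qed.

End Iso.

End CremonaMarks.

(** * Normal forms of cuspidal cubics, conics and lines *)

Section Taylor.
Variable K : numFieldType.
Implicit Types (P Q F : {mpoly K[3]}) (c w v : 'rV[K]_3).

Definition hess_form P c w : K := \sum_i \sum_j (P^`M(i)^`M(j)).@[c 0] * (w 0 i * w 0 j).

Lemma mderivXU (i j : 'I_3) : ('X_i : {mpoly K[3]})^`M(j) = (i == j)%:R%:MP.
Proof.
rewrite mderivX mnm1E; case: eqP => [->|_]; last by rewrite scale0r mpolyC0.
rewrite (_ : (U_(j) - U_(j))%MM = 0%MM) ?scale1r ?mpolyX0 ?mpolyC1 //.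
by apply/mnmP => k; rewrite mnmBE subnn mnm0E.
Qed.

Lemma differentialM P Q c w : differential (P * Q) c w =
  differential P c w * Q.@[c 0] + P.@[c 0] * differential Q c w.
Proof.
rewrite /differential mulr_suml mulr_sumr -big_split /=; apply: eq_bigr => i _.
by rewrite mderivM mevalD !mevalM; ring.
Qed.

Lemma differentialX i c w : differential 'X_i c w = w 0 i.
Proof.
rewrite /differential (bigD1 i) //= mderivXU eqxx mevalC mul1r big1 ?addr0 // => j ji.
by rewrite mderivXU eq_sym (negPf ji) mevalC mul0r.
Qed.

Lemma hess_formM P Q c w : hess_form (P * Q) c w = hess_form P c w * Q.@[c 0] +
  2 * (differential P c w * differential Q c w) + P.@[c 0] * hess_form Q c w.
Proof.
have E i j : ((P * Q)^`M(i)^`M(j)).@[c 0] * (w 0 i * w 0 j) =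
    (P^`M(i)^`M(j)).@[c 0] * (w 0 i * w 0 j) * Q.@[c 0] +
    ((P^`M(i)).@[c 0] * w 0 i) * ((Q^`M(j)).@[c 0] * w 0 j) +
    ((Q^`M(i)).@[c 0] * w 0 i) * ((P^`M(j)).@[c 0] * w 0 j) +
    P.@[c 0] * ((Q^`M(i)^`M(j)).@[c 0] * (w 0 i * w 0 j)).
  by rewrite mderivM mderivD !mderivM !mevalD !mevalM; ring.
rewrite /hess_form; under eq_bigr do under eq_bigr do rewrite E.
under eq_bigr do rewrite !big_split /=.
rewrite !big_split /=; congr (_ + _); last first.
  by rewrite mulr_sumr; apply: eq_bigr => i _; rewrite mulr_sumr.
rewrite -addrA; congr (_ + _).
  by rewrite mulr_suml; apply: eq_bigr => i _; rewrite mulr_suml.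
have D (f g : 'I_3 -> K) : \sum_i \sum_j f i * g j = (\sum_i f i) * (\sum_j g j).
  by rewrite mulr_suml; apply: eq_bigr => i _; rewrite mulr_sumr.
rewrite !D /differential; ring.
Qed.

Lemma hess_formX i c w : hess_form 'X_i c w = 0.
Proof.
by rewrite /hess_form big1 // => j _; rewrite big1 // => k _; rewrite mderivXU mderivC meval0 mul0r.
Qed.

Lemma differentialD P Q c w :
  differential (P + Q) c w = differential P c w + differential Q c w.
Proof.
rewrite /differential -big_split /=; apply: eq_bigr => i _.
by rewrite mderivD mevalD mulrDl.
Qed.

Lemma hess_formD P Q c w : hess_form (P + Q) c w = hess_form P c w + hess_form Q c w.
Proof.
rewrite /hess_form -big_split /=; apply: eq_bigr => i _.
by rewrite -big_split /=; apply: eq_bigr => j _; rewrite !mderivD mevalD mulrDl.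
Qed.

Lemma differentialC a c w : differential a%:MP c w = 0.
Proof. by rewrite /differential big1 // => i _; rewrite mderivC meval0 mul0r. Qed.

Lemma hess_formC a c w : hess_form a%:MP c w = 0.
Proof.
by rewrite /hess_form big1 // => i _; rewrite big1 // => j _; rewrite !mderivC meval0 mul0r.
Qed.

Lemma homog0_const P : P \is 0.-homog -> exists a, P = a%:MP.
Proof.
move=> hP; exists (P@_0); apply/mpolyP => m; rewrite mcoeffC.
have [<-|nm] := eqVneq m 0%MM; first by rewrite mulr1.
rewrite mulr0; apply: (dhomog_nemf_coeff hP) => /=.
by rewrite mdeg_eq0.
Qed.

(** Reduces a property that is additive in the form to products with a variable; repeated down to
    degree 0 it leaves scalar multiples of products of coordinates. *)
Lemma homog_ind d (S : {mpoly K[3]} -> Prop) : S 0 ->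
  (forall P Q, S P -> S Q -> S (P + Q)) ->
  (forall i P, P \is d.-homog -> S ('X_i * P)) -> forall P, P \is d.+1.-homog -> S P.
Proof.
move=> S0 SD SX P /homog_split [Q hQ ->].
by apply: (big_ind S) => // i _; apply: SX.
Qed.

Lemma taylor2 F c w z : F \is 2.-homog ->
  F.@[(z *: c + w) 0] = z ^+ 2 * F.@[c 0] + z * differential F c w + F.@[w 0].
Proof.
pose S P := P.@[(z *: c + w) 0] = z ^+ 2 * P.@[c 0] + z * differential P c w + P.@[w 0].
move: F; apply: (@homog_ind 1 S) => [|P Q hP hQ|i P hP].
- by rewrite /S -mpolyC0 differentialC !mevalC; ring.
- by rewrite /S in hP hQ *; rewrite !mevalD differentialD hP hQ; ring.
move: P hP; apply: (@homog_ind 0 (fun P => S ('X_i * P))) => [|P Q hP hQ|j P hP].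
- by rewrite /S mulr0 -mpolyC0 differentialC !mevalC; ring.
- by rewrite /S in hP hQ *; rewrite mulrDr !mevalD differentialD hP hQ; ring.
have [a ->] := homog0_const hP; rewrite /S.
rewrite !mevalM !mevalXU !mevalC !differentialM !differentialX differentialC.
by rewrite !mevalM !mevalXU !mevalC !mxE; ring.
Qed.

(** The expansion is exact for a cubic form, the terms of order at most two in [w] being those at
    [c] and the last one the value at [w]. By the Leibniz rules it is checked on products of three
    variables. *)
Lemma taylor3 F c w z : F \is 3.-homog ->
  F.@[(z *: c + w) 0] = z ^+ 3 * F.@[c 0] + z ^+ 2 * differential F c w +
    z * (2^-1 * hess_form F c w) + F.@[w 0].
Proof.
pose S P := P.@[(z *: c + w) 0] = z ^+ 3 * P.@[c 0] + z ^+ 2 * differential P c w +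
  z * (2^-1 * hess_form P c w) + P.@[w 0].
move: F; apply: (@homog_ind 2 S) => [|P Q hP hQ|i P hP].
- by rewrite /S -mpolyC0 differentialC hess_formC !mevalC; ring.
- by rewrite /S in hP hQ *; rewrite !mevalD differentialD hess_formD hP hQ; ring.
move: P hP; apply: (@homog_ind 1 (fun P => S ('X_i * P))) => [|P Q hP hQ|j P hP].
- by rewrite /S mulr0 -mpolyC0 differentialC hess_formC !mevalC; ring.
- by rewrite /S in hP hQ *; rewrite mulrDr !mevalD differentialD hess_formD hP hQ; ring.
move: P hP; apply: (@homog_ind 0 (fun P => S ('X_i * ('X_j * P)))) => [|P Q hP hQ|k P hP].
- by rewrite /S !mulr0 -mpolyC0 differentialC hess_formC !mevalC; ring.
- by rewrite /S in hP hQ *; rewrite !mulrDr !mevalD differentialD hess_formD hP hQ; ring.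
have [a ->] := homog0_const hP; rewrite /S.
rewrite !(hess_formM, differentialM, mevalM, differentialX, hess_formX, differentialC, hess_formC).
by rewrite !(mevalM, mevalXU, mevalC) !mxE; field.
Qed.

Lemma poly_funext (p : {poly K}) : (forall s, p.[s] = 0) -> p = 0.
Proof.
move=> h; apply/eqP; apply: contraT => p0.
have := max_poly_roots p0 (rs := [seq i%:R | i <- iota 0 (size p)]).
rewrite size_map size_iota ltnn => H; apply: H.
  by apply/allP => _ /mapP [i _ ->]; rewrite /root h.
rewrite map_inj_in_uniq ?iota_uniq // => i j _ _ /eqP.
by rewrite eqr_nat => /eqP.
Qed.

(* Kronecker substitution *)
Lemma mpoly_funext P : (forall v : 'rV[K]_3, P.@[v 0] = 0) -> P = 0.
Proof.
move=> h; pose D := msize P.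
pose e (m : 'X_{1..3}) := (m 0%R + D * (m 1%R + D * m 2%R))%N.
have mD m i : m \in msupp P -> (m i < D)%N.
  move=> mP; apply: leq_ltn_trans (msize_mdeg_lt mP).
  by rewrite mdegE (bigD1 i) //= leq_addr.
have einj : {in msupp P &, injective e}.
  move=> m m' mP mP' ee; have D0 : (0 < D)%N by apply: leq_ltn_trans (mD m 0 mP).
  have dm a b : (a < D)%N -> ((a + D * b) %/ D = b /\ (a + D * b) %% D = a)%N.
    by move=> aD; rewrite addnC mulnC divnMDl // modnMDl divn_small // modn_small // addn0.
  have E (n : 'X_{1..3}) : n \in msupp P ->
      [/\ (e n %% D)%N = n 0, ((e n %/ D) %% D)%N = n 1 & ((e n %/ D) %/ D)%N = n 2].
    move=> nP; have [q0 r0] := dm _ (n 1%R + D * n 2%R)%N (mD n 0 nP).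
    by have [q1 r1] := dm _ (n 2%R) (mD n 1 nP); rewrite /e q0 r0 q1 r1.
  have [a0 a1 a2] := E m mP; have [b0 b1 b2] := E m' mP'.
  by apply/mnmP; apply: ord3P; rewrite -?a0 -?a1 -?a2 -?b0 -?b1 -?b2 ee.
pose q : {poly K} := \sum_(m <- msupp P) P@_m *: 'X^(e m).
have q0 : q = 0.
  apply: poly_funext => s; have := h (row3 s (s ^+ D) (s ^+ D ^+ D)).
  rewrite mevalE horner_sum => E; rewrite -[RHS]E; apply: eq_bigr => m _.
  rewrite hornerZ hornerXn; congr (_ * _).
  have -> (f : 'I_3 -> K) : \prod_i f i = f 0 * f 1 * f 2.
    rewrite !big_ord_recl big_ord0 mulr1 mulrA.
    by congr (f _ * f _ * f _); apply: val_inj.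
  by rewrite !row3E -!exprM -!exprD /e; congr (s ^+ _); ring.
apply/mpolyP => m; rewrite mcoeff0; have [mP|/memN_msupp_eq0 //] := boolP (m \in msupp P).
have := congr1 (fun p : {poly K} => p`_(e m)) q0.
rewrite coef0 coef_sum (bigD1_seq m) ?msupp_uniq //= coefZ coefXn eqxx mulr1.
rewrite big_seq_cond big1 ?addr0 // => n /andP [nP nm].
rewrite coefZ coefXn; case: eqP => [/(einj _ _ mP nP) E|_]; last by rewrite mulr0.
by rewrite E eqxx in nm.
Qed.

End Taylor.

(** * Curves that are graphs of polynomials *)

Section Graphs.
Variable K : numFieldType.
Implicit Types (F Q L : {mpoly K[3]}) (B : 'M[K]_3) (kappa : {poly K}) (A : set (pspace K 3)).
Implicit Types (p q t c : pspace K 3).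

(** With [d] the degree of [kappa], at least 2, the arc is [s^d] times the curve at [1/s]: at 0 its
    first two entries vanish and the last is the leading coefficient, so the curve ends at (0 : 0 :
    1). *)
Lemma pcurve_poly A t B kappa : B \in unitmx -> (2 < size kappa)%N ->
  coords t (row3 0 0 1 *m B) ->
  (forall p, A p <-> p = t \/ exists s, coords p (gamma B kappa s)) -> pcurve A t B kappa.
Proof.
move=> uB sk tB hA; split=> //; pose d := (size kappa).-1.
have ed : size kappa = d.+1 by rewrite prednK // (ltn_trans _ sk).
have d1 : (1 < d)%N by rewrite -ltnS -ed.
pose R s := row3 (s ^+ d.-1) (s ^+ d) (\sum_(i < d.+1) kappa`_i * s ^+ (d - i)).
have poly_exp m : ispoly (fun s : K => s ^+ m).
  by exists 'X^m => s; rewrite hornerXn.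
exists (fun s => R s *m B); split.
- apply: ispolyv_mul; apply: ispolyv_row3 => //.
  apply: ispoly_sum => i; apply: ispoly_mul; [exact: ispoly_cst|exact: poly_exp].
- apply/(coords_par _ tB); apply: par_mul; exists (kappa`_d)^-1.
    by rewrite invr_eq0 /d -lead_coefE lead_coef_eq0 -size_poly_gt0 ed.
  rewrite /R !expr0n big_ord_recr /= subnn expr0 mulr1 big1 => [|i _]; last first.
    by rewrite expr0n subn_eq0 leqNgt ltn_ord mulr0.
  apply: row3_ext; rewrite !mxE /= ?add0r ?mulVf //.
  + by case: d d1 {ed R} => [|[|d]] //; rewrite mulr0.
  + by case: d d1 {ed R} => [|d] //; rewrite mulr0.
  by rewrite -/d -lead_coefE lead_coef_eq0 -size_poly_gt0 ed.
move=> s s0; rewrite /gamma; apply: par_mul; exists (s ^+ d); first exact: expf_neq0.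
rewrite /R; apply: row3_ext; rewrite !mxE /= ?mulr1 //.
  by case: d d1 {ed R} => [|d] //= _; rewrite exprSr mulfK.
rewrite horner_coef ed mulr_sumr; apply: eq_bigr => i _.
rewrite mulrCA; congr (_ * _); rewrite exprVn -expfB_cond ?(negPf s0) //.
by rewrite -ltnS ltn_ord.
Qed.

Lemma pcurve_line A t B : B \in unitmx -> coords t (row3 1 0 0 *m B) ->
  (forall p, A p <-> p = t \/ exists s, coords p (gamma B 0 s)) -> pcurve A t B 0.
Proof.
move=> uB tB hA; split=> //; exists (fun s => row3 1 s 0 *m B); split=> //.
  apply: ispolyv_mul; apply: ispolyv_row3; [exact: ispoly_cst|exact: ispoly_id|exact: ispoly_cst].
move=> s s0; rewrite /gamma; apply: par_mul; exists s => //.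
by apply: row3_ext; rewrite !mxE /= ?mulr1 ?mulfV // horner0 mulr0.
Qed.

Lemma basis_coords B p (x y z : K) : B \in unitmx -> rep p *m invmx B = row3 x y z ->
  coords p (row3 x y z *m B).
Proof. by move=> uB <-; rewrite mulmxKV //; exact: coords_rep. Qed.

Lemma graph_points F d B kappa p b : F \is d.-homog -> B \in unitmx -> b != 0 ->
  (forall s z, F.@[(row3 s 1 z *m B) 0] = b * (z - kappa.[s])) -> (rep p *m invmx B) 0 1 != 0 ->
  vanish F p <-> exists s, coords p (gamma B kappa s).
Proof.
move=> hF uB b0 FE; move e: (rep p *m invmx B) => w w1; have pw := coords_rep p.
have ew : rep p = w *m B by rewrite -e mulmxKV.
pose s := w 0 0 / w 0 1; pose z := w 0 2 / w 0 1.
have ps : coords p (row3 s 1 z *m B).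
  apply/(coords_par _ pw); rewrite ew; apply: par_mul; exists (w 0 1) => //.
  by apply: row3_ext; rewrite !mxE /= ?mulr1 // mulrC divfK.
rewrite (vanishE hF ps) FE; split=> [/eqP|[s' ps']].
  rewrite mulf_eq0 (negPf b0) subr_eq0 => /eqP ez.
  by exists s; rewrite /gamma -ez.
have /(par_unit uB) [a a0 ea] := (coords_par _ ps).1 ps'.
have := congr1 (fun u : 'rV[K]_3 => u 0 1) ea; rewrite !mxE /= mulr1 => a1.
move: ea; rewrite -a1 scale1r => ea.
have := congr1 (fun u : 'rV[K]_3 => u 0 0) ea; rewrite !mxE /= => ->.
have := congr1 (fun u : 'rV[K]_3 => u 0 2) ea; rewrite !mxE /= => ->.
by rewrite subrr mulr0.
Qed.

Lemma graph_pcurve F d B kappa t b : F \is d.-homog -> B \in unitmx -> (2 < size kappa)%N ->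
  coords t (row3 0 0 1 *m B) -> b != 0 ->
  (forall s z, F.@[(row3 s 1 z *m B) 0] = b * (z - kappa.[s])) ->
  (forall x z, F.@[(row3 x 0 z *m B) 0] = 0 <-> x = 0) ->
  pcurve (zeros F) t B kappa.
Proof.
move=> hF uB sk tB b0 FE FE0; apply: pcurve_poly => // p.
have [w1|w1] := eqVneq ((rep p *m invmx B) 0 1) 0; last first.
  rewrite /zeros /= (graph_points hF uB b0 FE w1); split=> [|[pt|//]]; first by right.
  move: w1; rewrite pt; have := coords_eqP tB => /(@par_mul _ _ _ _ _ (invmx B)).
  by rewrite mulmxK // => /par_sym [a _ ->]; rewrite !mxE /= mulr0 eqxx.
have ng s : ~ coords p (gamma B kappa s).
  move=> /coords_eqP /(@par_mul _ _ _ _ _ (invmx B)); rewrite mulmxK // => -[a _ e].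
  have := congr1 (fun u : 'rV[K]_3 => u 0 1) e; rewrite [RHS]mxE w1 mulr0 !mxE /=.
  by move/eqP; rewrite oner_eq0.
move: w1; move e: (rep p *m invmx B) => w w1.
have ew : w = row3 (w 0 0) 0 (w 0 2) by apply: row3_ext; rewrite ?row3E.
rewrite ew in e; have pw := basis_coords uB e.
rewrite /zeros /= (vanishE hF pw) FE0; split=> [x0|[pt|[s /ng //]]].
  left; apply: (coords_trans pw tB); apply: par_mul; rewrite x0; exists (w 0 2).
    apply: contraNneq (coords_neq0 pw) => z0; rewrite x0 z0.
    by rewrite (_ : row3 0 0 0 = 0) ?mul0mx //; apply: row3_ext; rewrite !mxE.
  by apply: row3_ext; rewrite !mxE /= ?mulr0 ?mulr1.
have := coords_eqP pw; rewrite pt; have := coords_eqP tB => h /par_trans /(_ (par_sym h)).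
by move/(par_unit uB) => [a _ /rowP /(_ 0)]; rewrite !mxE /= mulr0.
Qed.

End Graphs.

Section Normal.
Variable K : numFieldType.
Implicit Types (F Q L : {mpoly K[3]}) (B : 'M[K]_3) (kappa : {poly K}) (A : set (pspace K 3)).
Implicit Types (p q t c : pspace K 3).

Lemma form_mulmx n m (M : 'M[K]_(n, m)) i : isform 1 (fun v : 'rV[K]_n => (v *m M) 0 i).
Proof.
apply: (@form_ext _ _ _ (fun v : 'rV[K]_n => \sum_j v 0 j * M j i)) => [v|]; first by rewrite mxE.
by apply: form_sum => j _; apply: form_mulc; apply: form_coord.
Qed.

Lemma meval_form n d (P : {mpoly K[n]}) : P \is d.-homog -> isform d (fun v : 'rV[K]_n => P.@[v 0]).
Proof. by move=> hP; exists P. Qed.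

Lemma meval_scale d F a (v : 'rV[K]_3) : F \is d.-homog -> F.@[(a *: v) 0] = a ^+ d * F.@[v 0].
Proof. by move=> /meval_form /form_scale ->. Qed.

Lemma mderiv_homog d F i : F \is d.+1.-homog -> F^`M(i) \is d.-homog.
Proof.
elim: d F => [|d IH] F /homog_split [Q hQ ->]; rewrite raddf_sum rpred_sum //= => j _;
  rewrite mderivM mderivXU.
  have [a ->] := homog0_const (hQ j); rewrite mderivC mulr0 addr0 -mpolyCM.
  by rewrite -[_%:MP]mulr1 mul_mpolyC dhomogZ ?dhomog1.
apply: rpredD; first by rewrite mul_mpolyC dhomogZ.
rewrite -[d.+1]add1n; apply: dhomogM; last exact: IH.
by rewrite dhomogX /= mdeg1.
Qed.

Lemma line_form L : is_line L -> exists2 n : 'rV[K]_3, n != 0 & forall v : 'rV[K]_3, L.@[v 0] = dot v n.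
Proof.
move=> [/homog_split [Q hQ eL] L0]; pose n : 'rV[K]_3 := \row_i (Q i)@_0.
have E (v : 'rV[K]_3) : L.@[v 0] = dot v n.
  have EQ i : ('X_i * Q i).@[v 0] = v 0 i * n 0 i.
    by have [a ea] := homog0_const (hQ i); rewrite mevalM mevalXU mxE ea mevalC mcoeffC eqxx mulr1.
  by rewrite eL raddf_sum /= sum3 /dot !EQ.
exists n => //; apply: contraNneq L0 => n0; apply/eqP/mpoly_funext => v.
by rewrite E n0 /dot !mxE !mulr0 !addr0.
Qed.

Lemma form_line (n : 'rV[K]_3) : n != 0 ->
  exists2 L, is_line L & forall v : 'rV[K]_3, L.@[v 0] = dot v n.
Proof.
move=> /rV0Pn [i ni].
have [L hL eL] : isform 1 (fun v : 'rV[K]_3 => dot v n).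
  by apply: form_add; [apply: form_add|]; apply: form_mulc; apply: form_coord.
exists L; last by move=> v; rewrite eL.
split=> //; apply: contraNneq ni => L0; rewrite -(dot_delta n i) dotC eL L0.
by rewrite meval0.
Qed.

Lemma line_pcurve L t B b : L \is 1.-homog -> B \in unitmx -> coords t (row3 1 0 0 *m B) ->
  b != 0 -> (forall u : 'rV[K]_3, L.@[(u *m B) 0] = b * u 0 2) -> pcurve (zeros L) t B 0.
Proof.
move=> hL uB tB b0 LE; apply: pcurve_line => // p.
move e: (rep p *m invmx B) => w; have ew : rep p = w *m B by rewrite -e mulmxKV.
have pw := coords_rep p; rewrite /zeros /= (vanishE hL pw) ew LE.
split=> [/eqP|[pt|[s ps]]].
- rewrite mulf_eq0 (negPf b0) => /eqP w2; have [w1|w1] := eqVneq (w 0 1) 0.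
    left; apply: (coords_trans pw tB); rewrite ew; apply: par_mul; exists (w 0 0).
      apply: contraNneq (coords_neq0 pw) => w0; rewrite ew.
      by rewrite (_ : w = 0) ?mul0mx //; apply: row3_ext; rewrite ?w0 ?w1 ?w2 !mxE.
    by apply: row3_ext; rewrite !mxE /= ?mulr0 ?mulr1.
  right; exists (w 0 0 / w 0 1); apply/(coords_par _ pw); rewrite ew; apply: par_mul.
  by exists (w 0 1) => //; apply: row3_ext; rewrite !mxE /= ?mulr1 ?horner0 ?mulr0 // mulrC divfK.
- have := coords_eqP tB; rewrite -pt ew => /(par_unit uB) /par_sym [a _ ->].
  by rewrite !mxE /= !mulr0.
- have := coords_eqP ps; rewrite ew => /(par_unit uB) /par_sym [a _ ->].
  by rewrite !mxE /= horner0 !mulr0.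
Qed.

(** A frame adapted to a point [c] on a line [n]: [b] is a second point of the line, [e] a point off
    it, normalized to value 1. The two orders put [c] last for conics and cubics and first for
    lines. *)
Lemma flag_basis (c n : 'rV[K]_3) : c != 0 -> n != 0 -> dot c n = 0 -> exists b e : 'rV[K]_3,
  [/\ dot b n = 0, dot e n = 1, rows3 b e c \in unitmx & rows3 c b e \in unitmx].
Proof.
move=> c0 n0 cn; have [b eb] := cross_surj c0 cn.
have /rV0Pn [i ni] := n0; exists b, ((n 0 i)^-1 *: delta_mx 0 i).
have en : dot ((n 0 i)^-1 *: delta_mx 0 i) n = 1 by rewrite dotZl dotC dot_delta mulVf.
have N0 : - (1 : K) != 0 by rewrite oppr_eq0 oner_eq0.
split=> //.
- by rewrite -eb dot_crossl.
- apply: basis3; rewrite -[X in X != 0]opprK -en -eb /dot !row3E opprK in N0 *.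
  by apply: contraNneq N0 => <-; apply/eqP; ring.
- apply: basis3; rewrite -en -eb /dot !row3E in N0 *.
  by apply: contraNneq N0 => <-; apply/eqP; ring.
Qed.

Lemma line_normal L t : is_line L -> vanish L t ->
  exists B, pcurve (zeros L) t B 0 /\ coords t (row3 1 0 0 *m B).
Proof.
move=> hL Lt; have [n n0 LE] := line_form hL.
have tn : dot (rep t) n = 0 by rewrite -LE; apply: Lt; apply: coords_rep.
have [b [e [bn en _ uB]]] := flag_basis (rep_neq0 t) n0 tn.
have tB : coords t (row3 1 0 0 *m rows3 (rep t) b e).
  by rewrite rows3E !row3E scale1r !scale0r !addr0; apply: coords_rep.
exists (rows3 (rep t) b e); split=> //.
apply: (line_pcurve hL.1 uB tB (oner_neq0 K)) => u.
by rewrite LE rows3E !dotDl !dotZl tn bn en; ring.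
Qed.

End Normal.

(** * Smooth conics *)

Section Conic.
Variable K : numFieldType.
Implicit Types (F Q L : {mpoly K[3]}) (B : 'M[K]_3) (kappa : {poly K}) (A : set (pspace K 3)).
Implicit Types (p q t c : pspace K 3).

Lemma eq_of_sub (x y a b : K) : a = b -> x - y = a - b -> x = y.
Proof. by move=> -> /eqP; rewrite subrr subr_eq0 => /eqP. Qed.

Definition quad (k0 k1 k2 : K) : {poly K} := Poly [:: k0; k1; k2].
Definition cubic (k0 k1 k2 k3 : K) : {poly K} := Poly [:: k0; k1; k2; k3].

Lemma quadE k0 k1 k2 s : (quad k0 k1 k2).[s] = k0 + k1 * s + k2 * s ^+ 2.
Proof. by rewrite horner_Poly /=; ring. Qed.

Lemma cubicE k0 k1 k2 k3 s :
  (cubic k0 k1 k2 k3).[s] = k0 + k1 * s + k2 * s ^+ 2 + k3 * s ^+ 3.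
Proof. by rewrite horner_Poly /=; ring. Qed.

Lemma size_quad k0 k1 k2 : k2 != 0 -> size (quad k0 k1 k2) = 3.
Proof. by move=> k0'; rewrite (PolyK (c := 0)). Qed.

Lemma size_cubic k0 k1 k2 k3 : k3 != 0 -> size (cubic k0 k1 k2 k3) = 4.
Proof. by move=> k0'; rewrite (PolyK (c := 0)). Qed.

Lemma singular_differential Q p w : ~ smooth_at Q p -> differential Q (rep p) w = 0.
Proof.
move=> ns; rewrite /differential big1 // => i _.
have [h|h] := pselect (vanish Q^`M(i) p); last by case: ns; exists i.
by rewrite (h _ (coords_rep p)) mul0r.
Qed.

Lemma tangent_lineE d Q t p (v : 'rV[K]_3) : Q \is d.+1.-homog -> coords t v ->
  tangent_line Q t p <-> differential Q v (rep p) = 0.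
Proof.
move=> hQ tv; split=> [h|h v' w tv' pw]; first by apply: h => //; exact: coords_rep.
have [a a0 ->] := (coords_par _ tv').1 tv; have [b b0 ->] := coords_eqP pw.
rewrite /differential.
have -> : \sum_i (Q^`M(i)).@[(a *: v) 0] * (b *: rep p) 0 i =
    a ^+ d * b * differential Q v (rep p).
  rewrite mulr_sumr; apply: eq_bigr => i _.
  by rewrite (meval_scale a v (mderiv_homog i hQ)) mxE; ring.
by rewrite h mulr0.
Qed.

(** The conic is the graph of a quadratic polynomial over the chart [y = 1], with [t] at infinity
    and [y = 0] as tangent there. At a singular point the differential vanishes, and increments
    along the three axes then force all coordinates to be zero. *)
Lemma conic_of_formula Q B t k0 k1 k2 : Q \is 2.-homog -> B \in unitmx ->
  coords t (row3 0 0 1 *m B) -> k2 != 0 ->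
  (forall x y z, Q.@[(row3 x y z *m B) 0] = y * z - (k0 * y ^+ 2 + k1 * x * y + k2 * x ^+ 2)) ->
  [/\ smooth_conic Q, vanish Q t, pcurve (zeros Q) t B (quad k0 k1 k2)
    & tangent_line Q t = [set p | (rep p *m invmx B) 0 1 = 0]].
Proof.
move=> hQ uB tB k20 QE; split.
- split=> // p Qp; apply: contrapT => ns; pose u := rep p *m invmx B.
  have ep : rep p = row3 (u 0 0) (u 0 1) (u 0 2) *m B by rewrite row3K /u mulmxKV.
  have T x y z : Q.@[(row3 (u 0 0 + x) (u 0 1 + y) (u 0 2 + z) *m B) 0] = Q.@[(row3 x y z *m B) 0].
    have -> : row3 (u 0 0 + x) (u 0 1 + y) (u 0 2 + z) = row3 (u 0 0) (u 0 1) (u 0 2) + row3 x y z.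
      by apply: row3_ext; rewrite !mxE.
    rewrite mulmxDl -ep -[rep p]scale1r taylor2 // singular_differential //.
    by rewrite (Qp _ (coords_rep p)) !mulr0 !add0r.
  have := T 0 0 1; rewrite !QE; move: (Qp _ (coords_rep p)); rewrite {1}ep QE => e0 e1.
  have u1 : u 0 1 = 0 by apply: (eq_of_sub (congr2 (fun a b => a - b) e1 e0)); ring.
  have e2 := T 1 0 0; rewrite !QE u1 !addr0 in e2 e0.
  have u0 : u 0 0 = 0.
    apply/eqP; have : k2 * u 0 0 ^+ 2 = 0 by apply/esym/(eq_of_sub e0); ring.
    by move/eqP; rewrite mulf_eq0 (negPf k20) expf_eq0.
  have e3 := T 0 1 0; rewrite !QE u1 u0 in e3.
  have u2 : u 0 2 = 0 by apply: (eq_of_sub e3); ring.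
  case: (elimN eqP (rep_neq0 p)); rewrite ep u0 u1 u2 (_ : row3 _ _ _ = 0) ?mul0mx //.
  by apply: row3_ext; rewrite !mxE.
- by apply/(vanishE hQ tB); rewrite QE; ring.
- apply: (graph_pcurve hQ uB _ tB (oner_neq0 K)); first by rewrite size_quad.
    by move=> s z; rewrite QE quadE; ring.
  move=> x z; rewrite QE; split=> [|->]; last by ring.
  move=> e; apply/eqP; have : k2 * x ^+ 2 = 0 by apply/esym/(eq_of_sub e); ring.
  by move/eqP; rewrite mulf_eq0 (negPf k20) expf_eq0.
apply/seteqP; split=> p /=; rewrite (tangent_lineE _ hQ tB);
  move e: (rep p *m invmx B) => u; have -> : rep p = row3 (u 0 0) (u 0 1) (u 0 2) *m B
    by rewrite row3K -e mulmxKV.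
all: have := taylor2 (row3 0 0 1 *m B) (row3 (u 0 0) (u 0 1) (u 0 2) *m B) 1 hQ.
all: rewrite scale1r -mulmxDl (_ : row3 0 0 1 + row3 _ _ _ = row3 (u 0 0) (u 0 1) (1 + u 0 2)).
all: try by apply: row3_ext; rewrite !mxE /= ?add0r.
all: rewrite !QE => E F.
  by apply: (eq_of_sub (congr2 (fun a b => a + b) E F)); ring.
by apply: (eq_of_sub (congr2 (fun a b => b - a) E F)); ring.
Qed.

(** [t] is the last vector of the frame, [b] and [t] span its tangent line, and [e] is normalized so
    that the coefficient of [y z] is 1. *)
Lemma smooth_conic_normal Q t : smooth_conic Q -> vanish Q t -> exists B k0 k1 k2,
  [/\ B \in unitmx, coords t (row3 0 0 1 *m B), k2 != 0 &
   forall x y z, Q.@[(row3 x y z *m B) 0] = y * z - (k0 * y ^+ 2 + k1 * x * y + k2 * x ^+ 2)].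
Proof.
move=> [hQ sm] Qt; have [i hi] := sm t Qt.
pose n : 'rV[K]_3 := \row_i (Q^`M(i)).@[(rep t) 0].
have dn w : differential Q (rep t) w = dot w n.
  by rewrite /differential sum3 /dot !mxE; ring.
have n0 : n != 0.
  apply: contra_notN hi => /eqP /rowP /(_ i); rewrite !mxE => hi.
  exact/(vanishE (mderiv_homog i hQ) (coords_rep t)).
have Qt0 := Qt _ (coords_rep t).
have tn : dot (rep t) n = 0.
  have := taylor2 (rep t) (rep t) 1 hQ; rewrite scale1r -mulr2n -scaler_nat.
  by rewrite (meval_scale _ _ hQ) Qt0 dn !mulr0 mul1r add0r addr0 => <-.
have [b [e [bn en uB _]]] := flag_basis (rep_neq0 t) n0 tn.
have E x y z : Q.@[(row3 x y z *m rows3 b e (rep t)) 0] =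
    y * z + x ^+ 2 * Q.@[b 0] + x * y * differential Q b e + y ^+ 2 * Q.@[e 0].
  rewrite rows3E !row3E addrC taylor2 // Qt0 dn taylor2 // (meval_scale _ _ hQ).
  rewrite dotDl !dotZl bn en (_ : differential Q b (y *: e) = y * differential Q b e); first by ring.
  by rewrite /differential mulr_sumr; apply: eq_bigr => j _; rewrite mxE mulrCA.
exists (rows3 b e (rep t)), (- Q.@[e 0]), (- differential Q b e), (- Q.@[b 0]); split=> //.
- by rewrite rows3E !row3E scale1r !scale0r !add0r; apply: coords_rep.
(* If the coefficient of [x^2] were zero, the conic would contain its tangent line and be singular
   at (1 : 0 : -d). *)
- rewrite oppr_eq0; apply/eqP => Qb; pose d := differential Q b e.
  pose v := row3 1 0 (- d) *m rows3 b e (rep t).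
  have v0 : v != 0.
    by rewrite mul_unit_eq0 //; apply/eqP => /rowP /(_ 0); rewrite !mxE /= => /eqP; rewrite oner_eq0.
  have [p pv] := coords_ex v0.
  have Qv : Q.@[v 0] = 0 by rewrite E Qb; ring.
  have [j hj] := sm p ((vanishE hQ pv).2 Qv).
  apply: hj; apply/(vanishE (mderiv_homog j hQ) pv).
  have D (u : 'rV[K]_3) : differential Q v (u *m rows3 b e (rep t)) = 0.
    have := taylor2 v (u *m rows3 b e (rep t)) 1 hQ; rewrite scale1r /v -mulmxDl.
    rewrite (_ : row3 1 0 (- d) + u = row3 (1 + u 0 0) (u 0 1) (u 0 2 - d)); last first.
      by apply: row3_ext; rewrite !mxE /= ?add0r // addrC.
    have Eu := E (u 0 0) (u 0 1) (u 0 2); rewrite row3K in Eu.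
    rewrite -/v Qv E Eu Qb -/d => h.
    by apply/esym/(eq_of_sub h); ring.
  have := D (delta_mx 0 j *m invmx (rows3 b e (rep t))); rewrite mulmxKV //.
  rewrite /differential (bigD1 j) //= mxE !eqxx mulr1 big1 ?addr0 // => l lj.
  by rewrite mxE (negPf lj) mulr0.
- by move=> x y z; rewrite E; ring.
Qed.

End Conic.

(** * Cuspidal cubics *)

Section Cubic.
Variable K : numFieldType.
Implicit Types (F Q L : {mpoly K[3]}) (B : 'M[K]_3) (kappa : {poly K}) (A : set (pspace K 3)).
Implicit Types (p q t c : pspace K 3).

(** In a factorization of a symmetric matrix as a column times a row, the column is proportional to
    the transpose of the row. *)
Lemma rank1_symmetric (H : 'M[K]_3) : \rank H = 1%N -> H^T = H ->
  exists b (n : 'rV[K]_3), [/\ b != 0, n != 0 & forall i j, H i j = b * (n 0 i * n 0 j)].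
Proof.
move=> r Hs; have [u [v Hu]] : exists (u : 'cV[K]_3) (v : 'rV[K]_3), H = u *m v.
  by move: (mulmx_base H); move: (col_base H) (row_base H); rewrite r => u v <-; exists u, v.
have HE i j : H i j = u i 0 * v 0 j by rewrite Hu mxE big_ord1.
have H0 : H != 0 by rewrite -mxrank_eq0 r.
have v0 : v != 0 by apply: contraNneq H0 => v0; rewrite Hu v0 mulmx0.
have /rV0Pn [k vk] := v0; exists (u k 0 / v 0 k), v.
have E i j : H i j = u k 0 / v 0 k * (v 0 i * v 0 j).
  rewrite HE; suff -> : u i 0 = u k 0 * v 0 i / v 0 k by field.
  by apply: (mulIf vk); rewrite mulfVK // -!HE -[in LHS]Hs mxE.
split=> //; apply: contraNneq H0 => h; apply/eqP/matrixP => i j.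
by rewrite E h mul0r mxE.
Qed.

Lemma hess_form_rank1 F (c : 'rV[K]_3) : \rank (hessian F c) = 1%N ->
  exists b (n : 'rV[K]_3), [/\ b != 0, n != 0 & forall w, hess_form F c w = b * dot w n ^+ 2].
Proof.
move=> r; have [|b [n [b0 n0 E]]] := rank1_symmetric r.
  by apply/matrixP => i j; rewrite !mxE mderiv_comm.
exists b, n; split=> // w; rewrite /hess_form.
have H i j : (F^`M(i)^`M(j)).@[c 0] = b * (n 0 i * n 0 j) by rewrite -E mxE.
by rewrite !sum3 !H /dot; ring.
Qed.

(** One factor would be constant. A constant [L] is zero because it vanishes at the zero vector; a
    constant [G] is excluded by comparing the values at [v] and [2 v], the degree of [F] being at
    least 2. *)
Lemma irreducible_no_line F L G d : F \is d.+2.-homog -> irreducible_form F -> is_line L ->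
  F <> L * G.
Proof.
move=> hF [F0 irr] hL e; have [n n0 LE] := line_form hL.
have K0 (P : {mpoly K[3]}) : (msize P <= 1)%N -> forall v : 'rV[K]_3, P.@[v 0] = P@_0.
  by move=> /msize1_polyC eP v; rewrite eP mevalC mcoeffC eqxx mulr1.
have two v : F.@[(2 *: v : 'rV[K]_3) 0] = 2 ^+ d.+2 * F.@[v 0] by rewrite (meval_scale _ _ hF).
apply: (elimN eqP F0); apply: mpoly_funext => v.
have [/K0 h|/K0 h] := irr _ _ e.
  by rewrite e mevalM h -(h 0) LE /dot !mxE !mul0r !addr0 mul0r.
have := two v; rewrite e !mevalM !h !LE dotZl => E; apply/eqP.
have /eqP : (2 ^+ d.+2 - 2) * (dot v n * G@_0) = 0 by apply/esym/(eq_of_sub E); ring.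
rewrite mulf_eq0 subr_eq0 exprS -[X in _ == X]mulr1 (inj_eq (mulfI _)) ?pnatr_eq0 //.
by rewrite -natrX -[1]/(1%:R) eqr_nat expnS; case: (2 ^ d)%N => [|[|]].
Qed.

(** At the cusp the linear term vanishes and the quadratic term is a multiple of the square of the
    cuspidal tangent [n]. In an adapted frame the cubic is a multiple of [y^2 z] plus a binary cubic
    in [x] and [y], hence a graph over [y = 1]. *)
Lemma cuspidal_cubic_normal F c : cuspidal_cubic F c -> exists B k0 k1 k2 k3,
  [/\ B \in unitmx, coords c (row3 0 0 1 *m B), k3 != 0 &
    pcurve (zeros F) c B (cubic k0 k1 k2 k3)].
Proof.
move=> [hF irr [sing rk]]; have cc := coords_rep c.
have d0 w : differential F (rep c) w = 0.
  by apply: singular_differential => -[i hi]; apply: hi; exact: sing.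
have [b [n [b0 n0 HE]]] := hess_form_rank1 (rk _ cc).
have two0 : (2 : K) != 0 by rewrite pnatr_eq0.
have T w z : F.@[(z *: rep c + w) 0] = z ^+ 3 * F.@[(rep c) 0] + z * (2^-1 * (b * dot w n ^+ 2)) + F.@[w 0].
  by rewrite taylor3 // d0 HE mulr0 addr0.
have cn : dot (rep c) n = 0.
  (* With [w] equal to [rep c], the left side is the value at the zero vector for [z = -1], and 8
     times the value at [rep c] for [z = 1] below. *)
  have := T (rep c) (-1); rewrite scaleN1r addNr -(scale0r 0) (meval_scale _ _ hF) => E.
  have /eqP : b * dot (rep c) n ^+ 2 = 0.
    by apply: (mulfI (invr_neq0 two0)); apply: (eq_of_sub E); field.
  by rewrite mulf_eq0 (negPf b0) expf_eq0 => /eqP.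
have Fc : F.@[(rep c) 0] = 0.
  have := T (rep c) 1; rewrite scale1r -mulr2n -scaler_nat (meval_scale _ _ hF) cn => E.
  have n6 : (6 : K) != 0 by rewrite pnatr_eq0.
  by apply: (mulfI n6); rewrite mulr0; apply: (eq_of_sub E); ring.
have [v [e [vn en uB _]]] := flag_basis (rep_neq0 c) n0 cn.
pose h0 := 2^-1 * b; pose dv := differential F v e; pose hv := 2^-1 * hess_form F v e.
have E x y z : F.@[(row3 x y z *m rows3 v e (rep c)) 0] = h0 * (y ^+ 2 * z) +
    (x ^+ 3 * F.@[v 0] + x ^+ 2 * y * dv + x * y ^+ 2 * hv + y ^+ 3 * F.@[e 0]).
  rewrite rows3E !row3E addrC T Fc taylor3 // (meval_scale _ _ hF) dotDl !dotZl vn en.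
  rewrite (_ : differential F v (y *: e) = y * dv); last first.
    by rewrite /dv /differential mulr_sumr; apply: eq_bigr => j _; rewrite mxE mulrCA.
  rewrite (_ : hess_form F v (y *: e) = y ^+ 2 * hess_form F v e) /hv /h0; first by ring.
  rewrite /hess_form mulr_sumr; apply: eq_bigr => i _; rewrite mulr_sumr.
  by apply: eq_bigr => j _; rewrite !mxE; ring.
have h00 : h0 != 0 by rewrite mulf_neq0 // invr_neq0.
(* Otherwise [y] divides the cubic, which would contain its cuspidal tangent. *)
have Fv : F.@[v 0] != 0.
  apply/eqP => Fv; have [L hL LE] := form_line n0.
  pose l i (w : 'rV[K]_3) := (w *m invmx (rows3 v e (rep c))) 0 i.
  have fl i : isform 1 (l i) by apply: form_mulmx.
  have [G hG GE] : isform 2 (fun w => h0 * (l 1 w * l 2 w) +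
      (l 0 w * l 0 w * dv + l 0 w * l 1 w * hv + l 1 w * l 1 w * F.@[e 0])).
    apply: form_add; first by apply: form_cmul; apply: (form_mul (d := 1) (e := 1)).
    apply: form_add; first by apply: form_add; apply: form_mulc; apply: (form_mul (d := 1) (e := 1)).
    by apply: form_mulc; apply: (form_mul (d := 1) (e := 1)).
  apply: (irreducible_no_line (G := G) hF irr hL); apply/eqP; rewrite -subr_eq0; apply/eqP.
  apply: mpoly_funext => w; rewrite mevalB mevalM -GE LE.
  have ew : w = row3 (l 0 w) (l 1 w) (l 2 w) *m rows3 v e (rep c) by rewrite row3K mulmxKV.
  have -> : dot w n = l 1 w.
    by rewrite {1}ew rows3E !row3E !dotDl !dotZl vn en cn; ring.
  rewrite {1}ew E Fv; ring.
exists (rows3 v e (rep c)), (- h0^-1 * F.@[e 0]), (- h0^-1 * hv), (- h0^-1 * dv), (- h0^-1 * F.@[v 0]).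
have cB : coords c (row3 0 0 1 *m rows3 v e (rep c)).
  by rewrite rows3E !row3E scale1r !scale0r !add0r.
have k3 : - h0^-1 * F.@[v 0] != 0 by rewrite mulf_neq0 // oppr_eq0 invr_eq0.
split=> //; apply: (graph_pcurve hF uB _ cB h00); first by rewrite size_cubic.
  by move=> s z; rewrite E cubicE; field.
move=> x z; rewrite E; split=> [|->]; last by ring.
move=> h; have /eqP : x ^+ 3 * F.@[v 0] = 0 by apply: (eq_of_sub h); ring.
by rewrite mulf_eq0 (negPf Fv) orbF expf_eq0 => /eqP.
Qed.

End Cubic.

(** * The degenerate cubics *)

Section Models.
Variable K : numFieldType.
Implicit Types (F Q L : {mpoly K[3]}) (B : 'M[K]_3) (kappa : {poly K}) (A : set (pspace K 3)).
Implicit Types (p q t c u : pspace K 3).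

(* A basis of base points for a quadratic transformation: the points of the curve at
   [s1], [s2] and infinity, scaled so that [gamma_chord] has polynomial entries. *)
Definition chord B kappa s1 s2 : 'M[K]_3 :=
  rows3 ((s1 - s2)^-1 *: gamma B kappa s1) ((s2 - s1)^-1 *: gamma B kappa s2) (row3 0 0 1 *m B).

Lemma rows3_mul (u v w : 'rV[K]_3) B : rows3 (u *m B) (v *m B) (w *m B) = rows3 u v w *m B.
Proof.
apply/row_matrixP => i; rewrite !rowE mulmxA !rows3E !mulmxDl -!scalemxAl //.
Qed.

Lemma chord_unit B kappa s1 s2 : B \in unitmx -> s1 != s2 -> chord B kappa s1 s2 \in unitmx.
Proof.
move=> uB s12; rewrite /chord /gamma !scalemxAl rows3_mul unitmx_mul uB andbT.
apply: basis3; rewrite /dot !row3E !mxE /=.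
have s0 : s1 - s2 != 0 by rewrite subr_eq0.
have s0' : s2 - s1 != 0 by rewrite subr_eq0 eq_sym.
rewrite (_ : _ + _ = (s2 - s1)^-1) ?invr_eq0 //; field; by rewrite ?s0 ?s0'.
Qed.

(** In this frame the first two coordinates vanish at [s2] and [s1] respectively, and the last at
    both. If [k3] is nonzero, its remaining factor vanishes at the third intersection with the line
    through the points [s1] and [s2]. *)
Lemma gamma_chord B k0 k1 k2 k3 s1 s2 s : s1 != s2 ->
  gamma B (cubic k0 k1 k2 k3) s =
  row3 (s - s2) (s - s1) ((s - s1) * (s - s2) * (k2 + k3 * (s + s1 + s2))) *m
  chord B (cubic k0 k1 k2 k3) s1 s2.
Proof.
move=> s12; have s0 : s1 - s2 != 0 by rewrite subr_eq0.
have s0' : s2 - s1 != 0 by rewrite subr_eq0 eq_sym.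
rewrite /chord /gamma !scalemxAl rows3_mul mulmxA; congr (_ *m _).
rewrite rows3E !cubicE; apply: row3_ext; rewrite !mxE /=; field; by rewrite ?s0 ?s0'.
Qed.

(** Cofinitely many parameters suffice for a strict transform, so the curves are compared at those
    where both avoid all centres. *)
Lemma cremona_curve B1 k1 A t B1' k1' A' t' B B' ps ps' f :
  pcurve A t B1 k1 -> pcurve A' t' B1' k1' -> uniq ps -> uniq ps' ->
  (forall V : set ('rV[K]_3 * 'rV[K]_3), (forall v, V v ->
      [/\ blift ps v.1 != 0, blift ps' v.2 != 0 & inverse (v.1 *m invmx B) (v.2 *m invmx B')]) ->
    f @` pc [set blift ps v.1 | v in V] = pc [set blift ps' v.2 | v in V]) ->
  (forall s, inverse (gamma B1 k1 s *m invmx B) (gamma B1' k1' s *m invmx B')) ->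
  f @` blowup A ps = blowup A' ps'.
Proof.
move=> hA hA' ups ups' hf inv.
have [uB _ _] := hA; have [uB' _ _] := hA'.
rewrite (curve_lifts hA ups (cof_off k1' uB' ps')) (curve_lifts hA' ups' (cof_off k1 uB ps)).
pose V : set ('rV[K]_3 * 'rV[K]_3) := [set v | exists2 s, off B1 k1 ps s /\ off B1' k1' ps' s &
  v = (gamma B1 k1 s, gamma B1' k1' s)].
have E1 : glifts B1 k1 ps (off B1' k1' ps') = [set blift ps v.1 | v in V].
  apply/seteqP; split=> [_ [s [s1 s2] <-]|_ [_ [s [s1 s2] ->] <-]].
    by exists (gamma B1 k1 s, gamma B1' k1' s) => //; exists s.
  by exists s.
have E2 : glifts B1' k1' ps' (off B1 k1 ps) = [set blift ps' v.2 | v in V].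
  apply/seteqP; split=> [_ [s [s1 s2] <-]|_ [_ [s [s1 s2] ->] <-]].
    by exists (gamma B1 k1 s, gamma B1' k1' s) => //; exists s.
  by exists s.
rewrite E1 E2; apply: hf => v [s [o1 o2] ->] /=.
have [p pp] := coords_ex (gamma_neq0 k1 s uB); have [p' pp'] := coords_ex (gamma_neq0 k1' s uB').
by split=> //; [apply: lift_neq0 pp (off_notin o1 pp)|apply: lift_neq0 pp' (off_notin o2 pp')].
Qed.

End Models.

(** * From a cuspidal cubic to a conic and a tangent line *)

Section E7.
Variable K : numFieldType.
Implicit Types (F Q L : {mpoly K[3]}) (B : 'M[K]_3) (kappa : {poly K}) (A : set (pspace K 3)).
Implicit Types (p q t c u : pspace K 3) (us ds ls : seq (pspace K 3)).

Lemma row3_delta0 : row3 1 0 0 = delta_mx 0 0 :> 'rV[K]_3.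
Proof. by apply: row3_ext; rewrite !mxE. Qed.

Lemma row3_delta1 : row3 0 1 0 = delta_mx 0 1 :> 'rV[K]_3.
Proof. by apply: row3_ext; rewrite !mxE. Qed.

Lemma row3_delta2 : row3 0 0 1 = delta_mx 0 2 :> 'rV[K]_3.
Proof. by apply: row3_ext; rewrite !mxE. Qed.

Lemma points_ex : exists pt : 'rV[K]_3 -> pspace K 3, forall v : 'rV[K]_3, v != 0 -> coords (pt v) v.
Proof.
suff h (v : 'rV[K]_3) : exists p : pspace K 3, v != 0 -> coords p v.
  by have [pt hpt] := choice h; exists pt.
have [->|/coords_ex [p pv]] := eqVneq v 0; last by exists p.
have [|p _] := @coords_ex _ _ (delta_mx 0 0 : 'rV[K]_3); last by exists p; rewrite ?eqxx.
by rewrite -row3_delta0; apply/eqP => /rowP /(_ 0); rewrite !mxE /= => /eqP; rewrite oner_eq0.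
Qed.

Lemma delta_neq0 i : delta_mx 0 i != 0 :> 'rV[K]_3.
Proof. by apply/eqP => /rowP /(_ i); rewrite !mxE !eqxx => /eqP; rewrite oner_eq0. Qed.

Lemma par_coord n (u v : 'rV[K]_n) i : par u v -> (u 0 i == 0) = (v 0 i == 0).
Proof. by move=> [a a0 ->]; rewrite mxE mulf_eq0 (negPf a0). Qed.

Lemma coords_eq n (p q : pspace K n) (u v : 'rV[K]_n) : coords p u -> coords q v -> p = q <-> par u v.
Proof.
move=> pu qv; split=> [e|]; last exact: (coords_trans pu qv).
by move: qv; rewrite -e => /(coords_par _ pu).
Qed.

Lemma conic_ex B k0 k1 k2 : B \in unitmx -> exists2 Q, Q \is 2.-homog &
  forall x y z, Q.@[(row3 x y z *m B) 0] = y * z - (k0 * y ^+ 2 + k1 * x * y + k2 * x ^+ 2).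
Proof.
move=> uB; pose l i (w : 'rV[K]_3) := (w *m invmx B) 0 i.
have fl i : isform 1 (l i) by apply: form_mulmx.
have [Q hQ QE] : isform 2 (fun w => l 1 w * l 2 w -
    (k0 * (l 1 w * l 1 w) + k1 * (l 0 w * l 1 w) + k2 * (l 0 w * l 0 w))).
  apply: form_sub; first by apply: (form_mul (d := 1) (e := 1)).
  by apply: form_add; first apply: form_add; apply: form_cmul; apply: (form_mul (d := 1) (e := 1)).
exists Q => // x y z; rewrite -QE /l !mulmxK // !row3E; ring.
Qed.

Lemma noncollinear_dot p q (v : 'rV[K]_3) u : p != q -> coords u v ->
  dot (cross (rep p) (rep q)) v = 0 -> collinear p q u.
Proof.
move=> pq uv d0; have n0 : cross (rep p) (rep q) != 0.
  by apply: (cross_rep (coords_rep p)).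
have [L hL LE] := form_line n0; exists L => //.
have V w x : coords w x -> dot x (cross (rep p) (rep q)) = 0 -> vanish L w.
  by move=> wx dx; apply/(vanishE hL.1 wx); rewrite LE.
split; first exact: V (coords_rep p) (dot_crossl _ _).
  exact: V (coords_rep q) (dot_crossr _ _).
by apply: V uv _; rewrite dotC.
Qed.

Lemma curve_params A c B kappa us : pcurve A c B kappa ->
  (forall u, u \in us -> A u /\ u <> c) ->
  exists tau : pspace K 3 -> K, forall u, u \in us -> coords u (gamma B kappa (tau u)).
Proof.
move=> [uB hA _] hus.
suff h u : exists s, u \in us -> coords u (gamma B kappa s).
  by have [tau ht] := choice h; exists tau.
have [/hus [/hA [->|[s us']] uc]|nu] := boolP (u \in us); [by []|by exists s|by exists 0].
Qed.

(** The image frame is the standard basis: [chord] is scaled so that the transformation is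
    coordinatewise inversion, and what remains to be supplied is the coordinates of the further
    centres. *)
Lemma chord_cremona_data B kappa s1 s2 (p o : 'I_3 -> pspace K 3)
    (rs : seq (pspace K 3 * pspace K 3)) ps ps' :
  B \in unitmx -> s1 != s2 -> coords (p 0) (gamma B kappa s1) ->
  coords (p 1) (gamma B kappa s2) -> coords (p 2) (row3 0 0 1 *m B) ->
  (forall i, coords (o i) (delta_mx 0 i)) ->
  (forall z, z \in rs -> exists (v v' : 'rV[K]_3), [/\ coords z.1 (v *m chord B kappa s1 s2),
    coords z.2 v', forall i, v 0 i != 0 /\ v' 0 i != 0 & inverse v v']) ->
  uniq ps -> uniq ps' ->
  (forall q, q \in ps <-> (exists i, q = p i) \/ exists2 z, z \in rs & q = z.1) ->
  (forall q, q \in ps' <-> (exists i, q = o i) \/ exists2 z, z \in rs & q = z.2) ->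
  cremona_data (chord B kappa s1 s2) 1%:M p o rs ps ps'.
Proof.
move=> uB s12 p0 p1 p2 oE hrs ups ups' hps hps'; have uC := chord_unit kappa uB s12.
have s0 : s1 - s2 != 0 by rewrite subr_eq0.
have s0' : s2 - s1 != 0 by rewrite subr_eq0 eq_sym.
have V q (v : 'rV[K]_3) : coords q (v *m chord B kappa s1 s2) ->
    par (rep q *m invmx (chord B kappa s1 s2)) v.
  by move=> /coords_eqP /par_sym /(@par_mul _ _ _ _ _ (invmx (chord B kappa s1 s2))); rewrite mulmxK.
have V' q (v : 'rV[K]_3) : coords q v -> par (rep q *m invmx 1%:M) v.
  by rewrite invmx1 mulmx1 => /coords_eqP /par_sym.
have D q a (v : 'rV[K]_3) i : a != 0 -> coords q v ->
    delta_mx 0 i *m chord B kappa s1 s2 = a *: v ->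
    par (rep q *m invmx (chord B kappa s1 s2)) (delta_mx 0 i).
  by move=> a0 qv e; apply: V; rewrite e; apply/(coords_par _ qv); exists a^-1;
    rewrite ?invr_eq0 // scalerA mulVf // scale1r.
split=> //.
- exact: unitmx1.
- apply: ord3P.
  + apply: (D _ (s1 - s2)^-1 _ _ _ p0); rewrite ?invr_eq0 //.
    by rewrite -row3_delta0 rows3E !row3E scale1r !scale0r !addr0.
  + apply: (D _ (s2 - s1)^-1 _ _ _ p1); rewrite ?invr_eq0 //.
    by rewrite -row3_delta1 rows3E !row3E scale1r !scale0r add0r addr0.
  apply: (D _ 1 _ _ _ p2); rewrite ?oner_neq0 //.
  by rewrite -row3_delta2 rows3E !row3E scale1r !scale0r !add0r.
- by move=> i; apply: V'.
- by move=> z /hrs [v [v' [z1 _ h _]]] i; rewrite (par_coord i (V _ _ z1)); case: (h i).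
- by move=> z /hrs [v [v' [_ z2 h _]]] i; rewrite (par_coord i (V' _ _ z2)); case: (h i).
by move=> z /hrs [v [v' [z1 z2 _]]]; apply: inverse_par; apply: par_sym; [apply: V|apply: V'].
Qed.

(* The quadratic transform of [gamma_chord] for a cuspidal cubic, as a conic. *)
Lemma gamma_image (a b k s1 s2 s : K) :
  gamma (rows3 (row3 0 ((s1 - s2) * b) 0) (row3 0 ((s1 - s2) * a) 1) (row3 1 1 0))
    (quad (- s1 * a) (a - s1 * b) b) s =
  row3 ((s - s1) * (a + b * s)) ((s - s2) * (a + b * s)) 1.
Proof.
by rewrite /gamma rows3E !row3E quadE; apply: row3_ext; rewrite !mxE /=; ring.
Qed.

Lemma image_unit (a b s1 s2 : K) : s1 != s2 -> b != 0 ->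
  rows3 (row3 0 ((s1 - s2) * b) 0) (row3 0 ((s1 - s2) * a) 1) (row3 1 1 0) \in unitmx.
Proof.
move=> s12 b0; apply: basis3; rewrite /dot !row3E.
by rewrite (_ : _ + _ = (s1 - s2) * b) ?mulf_neq0 ?subr_eq0 //; ring.
Qed.

Lemma smooth_neq_cusp F c u : cusp F c -> smooth_locus F u -> vanish F u /\ u <> c.
Proof.
by move=> [sing _] [Fu [i hi]]; split=> // e; apply: hi; rewrite e; apply: sing.
Qed.

Definition noncollinear us : Prop := forall u v w, u \in us -> v \in us -> w \in us ->
  uniq [:: u; v; w] -> ~ collinear u v w.

(** The number of points is left open because with six points this is also the starting point for
    three lines. The last clause prepares that second transformation: the line joining two of its
    base points, [d] and a point of [ds], avoids [ls]. *)
Lemma E7_construct F c us : cuspidal_cubic F c -> uniq us ->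
  (forall u, u \in us -> smooth_locus F u) -> noncollinear us -> (2 <= size us)%N ->
  exists Q L t d ds ls,
  [/\ smooth_conic Q /\ is_line L, vanish Q t /\ zeros L = tangent_line Q t,
      points_on (zeros Q `\ t) (size us).-1 (d :: ds), points_on (zeros L `\ t) 2 ls
    & E7_model F c us Q L (d :: ds) ls /\ forall e l, e \in ds -> l \in ls ->
        dot (cross (rep d) (rep e)) (rep l) != 0].
Proof.
move=> hF uus hus ncol; have [_ _ hc] := hF.
have hus' u : u \in us -> vanish F u /\ u <> c by move=> /hus; apply: smooth_neq_cusp.
have [B [k0 [k1 [k2 [k3 [uB cB k30 pF]]]]]] := cuspidal_cubic_normal hF.
have [tau htau] := curve_params pF hus'.
case: us uus hus ncol hus' htau => [|u1 [|u2 us]] //= uus hus ncol hus' htau _.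
pose kappa := cubic k0 k1 k2 k3; pose s1 := tau u1; pose s2 := tau u2.
have u1m : u1 \in [:: u1, u2 & us] by rewrite !inE eqxx.
have u2m : u2 \in [:: u1, u2 & us] by rewrite !inE eqxx orbT.
have um u : u \in us -> u \in [:: u1, u2 & us] by rewrite !inE => ->; rewrite !orbT.
have taui u v : u \in [:: u1, u2 & us] -> v \in [:: u1, u2 & us] -> tau u = tau v -> u = v.
  by move=> /htau hu /htau hv e; move: hv; rewrite -e; apply: coords_inj hu.
move: (uus); rewrite /= inE negb_or => /andP [/andP [u12 u1us] /andP [u2us usu]].
have s12 : s1 != s2 by apply: contraNneq u12 => /taui -> //.
(* [m] is the last factor in [gamma_chord]. It is nonzero at the other points because none of them
   is collinear with [u1] and [u2]. *)
pose a := k2 + k3 * (s1 + s2); pose m s := a + k3 * s.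
pose C := chord B kappa s1 s2.
have uC : C \in unitmx by apply: chord_unit.
have gC s : gamma B kappa s = row3 (s - s2) (s - s1) ((s - s1) * (s - s2) * m s) *m C.
  by rewrite (gamma_chord _ _ _ _ _ _ s12) -/C; congr (row3 _ _ (_ * _) *m _); rewrite /m /a; ring.
have tau1 u : u \in us -> tau u - s1 != 0.
  by move=> uu; rewrite subr_eq0; apply: contraNneq u1us => /taui <- //; exact: um.
have tau2 u : u \in us -> tau u - s2 != 0.
  by move=> uu; rewrite subr_eq0; apply: contraNneq u2us => /taui <- //; exact: um.
have mu u : u \in us -> m (tau u) != 0.
  move=> uu; apply/eqP => m0; apply: (ncol u1 u2 u) => //; first exact: um.
    rewrite /= !inE negb_or u12 andbT /=; apply/andP; split.
      by apply: contraNneq u1us => ->.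
    by apply: contraNneq u2us => ->.
  apply: (noncollinear_dot u12 (htau _ (um u uu))).
  rewrite gC m0 mulr0 rows3E !row3E scale0r addr0 !scalerA dotC dotDl !dotZl.
  have e1 := coords_eqP (htau u1 u1m); have e2 := coords_eqP (htau u2 u2m).
  have [b1 b10 ->] := e1; have [b2 b20 ->] := e2.
  by rewrite !dotZl dot_crossl dot_crossr !mulr0 addr0.
have [pt hpt] := points_ex; pose o i := pt (delta_mx 0 i).
have ho i : coords (o i) (delta_mx 0 i) by apply: hpt; apply: delta_neq0.
pose B' := rows3 (row3 0 ((s1 - s2) * k3) 0) (row3 0 ((s1 - s2) * a) 1) (row3 1 1 0).
have uB' : B' \in unitmx by apply: image_unit.
(* The coordinates of [gamma_chord] inverted and cleared of denominators. *)
pose eta s := row3 ((s - s1) * m s) ((s - s2) * m s) 1.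
pose kappa' := quad (- s1 * a) (a - s1 * k3) k3.
have gE s : gamma B' kappa' s = eta s by apply: gamma_image.
have he s : coords (pt (eta s)) (eta s) by apply: hpt; rewrite -gE gamma_neq0.
have [Q hQ QE] := conic_ex (- s1 * a) (a - s1 * k3) k3 uB'.
(* The limit of [eta] as the parameter goes to infinity. *)
pose t := pt (row3 1 1 0).
have tE : coords t (row3 1 1 0).
  by apply: hpt; apply/eqP => /rowP /(_ 0); rewrite !mxE /= => /eqP; rewrite oner_eq0.
have tB' : coords t (row3 0 0 1 *m B').
  by rewrite rows3E !row3E !scale0r !add0r scale1r.
have [smQ Qt pQ tQ] := conic_of_formula hQ uB' tB' k30 QE.
have [L hL LE] := form_line (delta_neq0 2).
have zL : zeros L = [set q | (rep q) 0 2 = 0].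
  by apply/seteqP; split=> q; rewrite /zeros /= (vanishE hL.1 (coords_rep q)) LE dot_delta.
pose ds := [seq pt (eta (tau u)) | u <- us].
have etai u v : u \in us -> v \in us -> pt (eta (tau u)) = pt (eta (tau v)) -> u = v.
  move=> uu vv e; have := he (tau u); rewrite e => h; have := coords_par _ h.
  move=> /(_ (eta (tau v))) [/(_ (he _)) + _]; rewrite -!gE => /(gamma_inj uB') /taui.
  by apply; apply: um.
have eta0 u i : u \in us -> eta (tau u) 0 i != 0.
  move=> uu; move: i; apply: ord3P; rewrite row3E ?oner_eq0 ?mulf_neq0 ?tau1 ?tau2 ?mu //.
have oeta i u : u \in us -> o i != pt (eta (tau u)).
  move=> uu; apply/eqP => /(coords_eq (ho i) (he _)) oe.
  have := par_coord (i + 1) oe; rewrite (negPf (eta0 _ _ uu)) mxE.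
  by have [h _ _] := cyc_neq i; rewrite (negPf h) andbF eqxx.
have oo i j : i != j -> o i != o j.
  by apply: contraNneq => /(coords_eq (ho i) (ho j)) /par_delta_inj ->.
pose ls := [:: o 0; o 1]; pose ps' := (o 2 :: ds) ++ ls.
have uds : uniq ds by rewrite map_inj_in_uniq // => u v; apply: etai.
have dso i : o i \notin ds.
  by apply/mapP => -[u uu e]; have := oeta i u uu; rewrite e eqxx.
have ups' : uniq ps'.
  rewrite /ps' cat_uniq /= uds !inE !negb_or !dso !oo //.
pose p (i : 'I_3) := nth c [:: u1; u2] i.
pose rs := [seq (u, pt (eta (tau u))) | u <- us].
have cd : cremona_data C 1%:M p o rs (c :: [:: u1, u2 & us]) ps'.
  apply: chord_cremona_data => //.
  - exact: htau.
  - exact: htau.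
  - move=> z /mapP [u uu ->] /=; pose s := tau u.
    exists (row3 (s - s2) (s - s1) ((s - s1) * (s - s2) * m s)), (eta s); split.
    + by rewrite -gC; apply: htau; apply: um.
    + exact: he.
    + move=> i; split; last exact: eta0.
      by move: i; apply: ord3P; rewrite row3E ?mulf_neq0 ?tau1 ?tau2 ?mu.
    by apply: ord3P; apply: ord3P; rewrite !row3E; ring.
  - rewrite /= uus andbT; apply/negP => h.
    by case: (hus' _ h).
  - move=> q; rewrite !inE; split.
      move=> /or4P [/eqP ->|/eqP ->|/eqP ->|qu]; [left; exists 2|left; exists 0|left; exists 1|right] => //.
      by exists (q, pt (eta (tau q))) => //; apply/mapP; exists q.
    move=> [[i ->]|[z /mapP [u uu ->] ->]]; last by rewrite uu !orbT.
    by move: i; apply: ord3P; rewrite /p /= eqxx ?orbT.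
  move=> q; rewrite /ps' mem_cat !inE; split.
    move=> /orP [/orP [/eqP ->|/mapP [u uu ->]]|/orP [/eqP ->|/eqP ->]].
    - by left; exists 2.
    - by right; exists (u, pt (eta (tau u))) => //; apply/mapP; exists u.
    - by left; exists 0.
    by left; exists 1.
  move=> [[i ->]|[z /mapP [u uu ->] ->]].
    by move: i; apply: ord3P; rewrite eqxx ?orbT.
  have -> : pt (eta (tau u)) \in ds by apply/mapP; exists u.
  by rewrite orbT.
have [f [f1 f2 f3]] := cremona_iso cd.
(* The line [u1 u2] meets the cubic once more, at the zero of [m]. It is contracted to [o 2], which
   therefore lies on the conic. *)
have eo2 : m (- (a / k3)) = 0 by rewrite /m; field.
have Qo2 : vanish Q (o 2).
  have [_ h _] := pQ; apply/h; right; exists (- (a / k3)).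
  by rewrite gE /eta eo2 !mulr0 row3_delta2.
have nt q v i : coords q v -> (v 0 i == 0) = ~~ (row3 1 1 0 0 i == 0 :> K) -> q <> t.
  by move=> qv h e; move: h; rewrite (par_coord i ((coords_eq qv tE).1 e)); case: (_ == _).
have B'1 (v : 'rV[K]_3) : (v *m invmx B') 0 1 = v 0 2.
  by rewrite -[v in RHS](mulmxKV uB') rows3E !mxE /=; ring.
have zt : zeros L = tangent_line Q t by rewrite zL tQ; apply/seteqP; split=> q /=; rewrite B'1.
exists Q, L, t, (o 2), ds, ls; split=> //.
- split=> [||q]; first by rewrite /= dso.
    by rewrite /= size_map.
  rewrite inE => /orP [/eqP ->|/mapP [u uu ->]].
    by split=> //; apply: (nt _ _ 2 (ho 2)); rewrite -row3_delta2 !row3E oner_eq0 eqxx.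
  split; first by have [_ h _] := pQ; apply/h; right; exists (tau u); rewrite gE.
  by apply: (nt _ _ 2 (he _)); rewrite !row3E oner_eq0 eqxx.
- split=> [||q]; rewrite //= ?inE ?andbT ?oo //.
  have Lo i : i != 2 -> zeros L (o i).
    by move=> i2; apply/(vanishE hL.1 (ho i)); rewrite LE dot_delta mxE eq_sym (negPf i2).
  move=> /orP [/eqP ->|/eqP ->]; split; try exact: Lo.
    by apply: (nt _ _ 1 (ho 0)); rewrite -row3_delta0 !row3E oner_eq0 eqxx.
  by apply: (nt _ _ 0 (ho 1)); rewrite -row3_delta1 !row3E oner_eq0 eqxx.
split.
  exists f => //; split; last first.
    rewrite (f3 2) zL; suff -> : [set q : pspace K 3 | (rep q *m invmx 1%:M) 0 2 = 0] =
      [set q | rep q 0 2 = 0] by [].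
    by apply/seteqP; split=> q /=; rewrite invmx1 mulmx1.
  apply: (cremona_curve pF pQ _ ups' f2) => [|s]; first by have := cr_u cd.
  rewrite gC gE mulmxK // invmx1 mulmx1.
  by apply: ord3P; apply: ord3P; rewrite !row3E; ring.
move=> e l /mapP [u uu ->]; rewrite !inE => hl.
have D i : i != 2 -> dot (cross (rep (o 2)) (rep (pt (eta (tau u))))) (rep (o i)) != 0.
  move=> i2; apply/eqP => h.
  have := dot_par (par_cross (par_sym (coords_eqP (ho 2))) (par_sym (coords_eqP (he _))))
    (par_sym (coords_eqP (ho i))) h.
  rewrite dot_delta -row3_delta2; move: i i2 {h}; apply: ord3P => // _; rewrite /cross !row3E.
    by rewrite mul0r sub0r mul1r => /eqP; rewrite oppr_eq0 mulf_eq0 (negPf (tau2 u uu)) (negPf (mu u uu)).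
  by rewrite mul1r mul0r subr0 => /eqP; rewrite mulf_eq0 (negPf (tau1 u uu)) (negPf (mu u uu)).
by move: hl => /orP [/eqP ->|/eqP ->]; apply: D.
Qed.

End E7.

(** * From a conic and a tangent line to three concurrent lines *)

Section Lines.
Variable K : numFieldType.
Implicit Types (F Q L : {mpoly K[3]}) (B : 'M[K]_3) (kappa : {poly K}) (A : set (pspace K 3)).
Implicit Types (q t c u d : pspace K 3) (us ds ls ps : seq (pspace K 3)).

Lemma quad_cubic (k0 k1 k2 : K) : quad k0 k1 k2 = cubic k0 k1 k2 0.
Proof. by apply/polyP => i; rewrite !coef_Poly; case: i => [|[|[|[|i]]]] //=; rewrite ?nth_nil. Qed.

(** The tangent at infinity is given by the middle coordinate in the frame [B]; in the frame [chord]
    it becomes equality of the first two coordinates. *)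
Lemma chord_mid B kappa s1 s2 (w : 'rV[K]_3) : B \in unitmx -> s1 != s2 ->
  (w *m chord B kappa s1 s2 *m invmx B) 0 1 = (w 0 0 - w 0 1) / (s1 - s2).
Proof.
move=> uB s12; have s0 : s1 - s2 != 0 by rewrite subr_eq0.
have s0' : s2 - s1 != 0 by rewrite subr_eq0 eq_sym.
rewrite rows3E /gamma !scalemxAl -!mulmxDl mulmxK //.
by rewrite !mxE /=; field; rewrite ?s0 ?s0'.
Qed.

Lemma tangent_meets Q L t d : smooth_conic Q -> vanish Q t -> zeros L = tangent_line Q t ->
  vanish Q d -> vanish L d -> d = t.
Proof.
move=> sQ Qt LT Qd Ld; have [B [k0 [k1 [k2 [uB tB k20 QE]]]]] := smooth_conic_normal sQ Qt.
have [_ _ [_ hQ _] tQ] := conic_of_formula sQ.1 uB tB k20 QE.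
have [//|[s ds]] := (hQ d).1 Qd; have : zeros L d by [].
rewrite LT tQ /=; have [a a0 ->] := par_sym (coords_eqP ds).
by rewrite -scalemxAl mulmxK // !mxE /= mulr1 => a1; rewrite a1 eqxx in a0.
Qed.

(** The base points are [d1], [d2] and [t]. The conic passes through all three and the tangent
    through [t], so both become lines; these meet the image of the exceptional curve over [t] in one
    point because conic and tangent have the same direction at [t]. *)
Lemma lines_step Q L t d1 d2 ds ls : smooth_conic Q -> is_line L -> vanish Q t ->
  zeros L = tangent_line Q t -> points_on (zeros Q `\ t) 5 [:: d1, d2 & ds] ->
  points_on (zeros L `\ t) 2 ls ->
  (forall l, l \in ls -> dot (cross (rep d1) (rep d2)) (rep l) != 0) ->
  exists L1 L2 L3 t' x1 x2 x3, concurrent_lines L1 L2 L3 t' x1 x2 x3 /\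
  let ps := rcons ([:: d1, d2 & ds] ++ ls) t in let ps' := x1 ++ x2 ++ x3 in
  exists2 f, is_iso (blowup setT ps) (blowup setT ps') f &
  [/\ f @` blowup (zeros Q) ps = blowup (zeros L1) ps',
      f @` blowup (zeros L) ps = blowup (zeros L2) ps'
    & f @` exceptional setT ps t = blowup (zeros L3) ps'].
Proof.
move=> sQ hL Qt LT [uds sds hds] [uls sls hls] dl.
have [B [k0 [k1 [k2 [uB tB k20 QE]]]]] := smooth_conic_normal sQ Qt.
have [_ _ pQ tQ] := conic_of_formula sQ.1 uB tB k20 QE.
move: pQ; rewrite quad_cubic; set kappa := cubic k0 k1 k2 0 => pQ.
have [tau htau] := curve_params pQ hds.
pose s1 := tau d1; pose s2 := tau d2.
have d1m : d1 \in [:: d1, d2 & ds] by rewrite !inE eqxx.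
have d2m : d2 \in [:: d1, d2 & ds] by rewrite !inE eqxx orbT.
have dm d : d \in ds -> d \in [:: d1, d2 & ds] by rewrite !inE => ->; rewrite !orbT.
have taui u v : u \in [:: d1, d2 & ds] -> v \in [:: d1, d2 & ds] -> tau u = tau v -> u = v.
  by move=> /htau hu /htau hv e; move: hv; rewrite -e; apply: coords_inj hu.
move: (uds); rewrite /= inE negb_or => /andP [/andP [d12 d1ds] /andP [d2ds udss]].
have s12 : s1 != s2 by apply: contraNneq d12 => /taui -> //.
have s0 : s1 - s2 != 0 by rewrite subr_eq0.
pose C := chord B kappa s1 s2.
have uC : C \in unitmx by apply: chord_unit.
have gC s : gamma B kappa s = row3 (s - s2) (s - s1) ((s - s1) * (s - s2) * k2) *m C.
  by rewrite (gamma_chord _ _ _ _ _ _ s12) -/C; congr (row3 _ _ (_ * _) *m _); ring.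
have tau1 d : d \in ds -> tau d - s1 != 0.
  by move=> dd; rewrite subr_eq0; apply: contraNneq d1ds => /taui <- //; exact: dm.
have tau2 d : d \in ds -> tau d - s2 != 0.
  by move=> dd; rewrite subr_eq0; apply: contraNneq d2ds => /taui <- //; exact: dm.
have [n n0 LE] := line_form hL.
(* A frame in which the tangent line is parametrized by (1, 1, z) in the coordinates of [C], with
   [t] at infinity. *)
pose BL := rows3 (row3 0 0 1 *m C) (row3 1 1 0 *m C) (row3 1 0 0 *m C).
have uBL : BL \in unitmx.
  rewrite /BL rows3_mul unitmx_mul uC andbT; apply: basis3; rewrite /dot !row3E.
  by rewrite (_ : _ + _ = -1) ?oppr_eq0 ?oner_eq0 //; ring.
have tC : coords t (row3 0 0 1 *m C).
  by rewrite rows3E !row3E !scale0r !add0r scale1r.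
have LC (w : 'rV[K]_3) : w 0 0 = w 0 1 -> w *m C != 0 -> dot (w *m C) n = 0.
  move=> w01 /coords_ex [q qw]; rewrite -LE; apply/(vanishE hL.1 qw).
  suff : zeros L q by []; rewrite LT tQ /=; apply/eqP.
  rewrite (par_coord 1 (par_mul (invmx B) (par_sym (coords_eqP qw)))).
  by rewrite chord_mid // w01 subrr mul0r.
have C0 (w : 'rV[K]_3) i : w 0 i != 0 -> w *m C != 0.
  by rewrite mul_unit_eq0 //; apply: contraNneq => ->; rewrite mxE.
pose b := dot (row3 1 0 0 *m C) n.
have LB (u : 'rV[K]_3) : L.@[(u *m BL) 0] = b * u 0 2.
  have e0 : dot (row3 0 0 1 *m C) n = 0 by apply: LC; rewrite ?row3E // (C0 _ 2) // row3E oner_eq0.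
  have e1 : dot (row3 1 1 0 *m C) n = 0 by apply: LC; rewrite ?row3E // (C0 _ 0) // row3E oner_eq0.
  by rewrite LE rows3E !dotDl !dotZl e0 e1 !mulr0 !add0r mulrC.
have b0 : b != 0.
  apply: contraNneq n0 => b0; apply/eqP/rowP => i; rewrite mxE -[LHS]dot_delta dotC -LE.
  by rewrite -[delta_mx 0 i](mulmxKV uBL) LB b0 mul0r.
have tBL : coords t (row3 1 0 0 *m BL).
  by rewrite rows3E !row3E !scale0r !addr0 scale1r.
have pL := line_pcurve hL.1 uBL tBL b0 LB.
have gL z : gamma BL 0 z = row3 1 1 z *m C.
  rewrite /gamma /BL rows3_mul mulmxA; congr (_ *m _).
  by rewrite rows3E horner0; apply: row3_ext; rewrite !mxE /=; ring.
have [zeta hzeta] := curve_params pL hls.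
(* The parameter 0 on the tangent belongs to its intersection with the line [d1 d2]. *)
have z0 l : l \in ls -> zeta l != 0.
  move=> ll; apply: contraNneq (dl l ll) => z0; have [a a0 ->] := par_sym (coords_eqP (hzeta l ll)).
  rewrite gL z0 rows3E !row3E !scale1r scale0r addr0 dotC dotZl dotDl !dotZl.
  have [b1 b10 ->] := coords_eqP (htau d1 d1m); have [b2 b20 ->] := coords_eqP (htau d2 d2m).
  by rewrite !dotZl dot_crossl dot_crossr !mulr0 addr0 mulr0.
have [pt hpt] := points_ex K; pose o i := pt (delta_mx 0 i).
have ho i : coords (o i) (delta_mx 0 i) by apply: hpt; apply: delta_neq0.
(* The inverted coordinates of the conic, and in [mu] those of the tangent: both are now affine
   lines, with common limit (1 : 1 : 0). *)
pose eta s := row3 ((s - s1) * k2) ((s - s2) * k2) 1.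
pose mu (z : K) := row3 z z 1.
have pt2 (v : 'rV[K]_3) i : v 0 i != 0 -> coords (pt v) v.
  by move=> vi; apply: hpt; apply/rV0Pn; exists i.
have he s : coords (pt (eta s)) (eta s) by apply: (pt2 _ 2); rewrite row3E oner_eq0.
have hm (z : K) : coords (pt (mu z)) (mu z) by apply: (pt2 _ 2); rewrite row3E oner_eq0.
pose t' := pt (row3 1 1 0).
have tE : coords t' (row3 1 1 0) by apply: (pt2 _ 0); rewrite row3E oner_eq0.
pose B1 := rows3 (row3 k2 k2 0) (row3 (- s1 * k2) (- s2 * k2) 1) (row3 1 0 0).
have uB1 : B1 \in unitmx.
  by apply: basis3; rewrite /dot !row3E; rewrite (_ : _ + _ = k2) //; ring.
pose B2 : 'M[K]_3 := rows3 (row3 1 1 0) (row3 0 0 1) (row3 1 0 0).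
have uB2 : B2 \in unitmx.
  by apply: basis3; rewrite /dot !row3E; rewrite (_ : _ + _ = 1) ?oner_eq0 //; ring.
have g1 s : gamma B1 0 s = eta s.
  by rewrite /gamma rows3E horner0; apply: row3_ext; rewrite !mxE /=; ring.
have g2 (z : K) : gamma B2 0 z = mu z.
  by rewrite /gamma rows3E horner0; apply: row3_ext; rewrite !mxE /=; ring.
have t1 : coords t' (row3 1 0 0 *m B1).
  apply/(coords_par _ tE); rewrite rows3E; exists k2^-1; rewrite ?invr_eq0 //.
  by apply: row3_ext; rewrite !mxE /=; field.
have t2 : coords t' (row3 1 0 0 *m B2).
  by rewrite rows3E !row3E scale1r !scale0r !addr0.
pose n1 : 'rV[K]_3 := row3 1 (-1) ((s1 - s2) * k2); pose n2 : 'rV[K]_3 := row3 1 (-1) 0.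
have n10 : n1 != 0 by apply/rV0Pn; exists 0; rewrite row3E oner_eq0.
have n20 : n2 != 0 by apply/rV0Pn; exists 0; rewrite row3E oner_eq0.
have [L1 hL1 LE1] := form_line n10; have [L2 hL2 LE2] := form_line n20.
have [L3 hL3 LE3] := form_line (delta_neq0 K 2).
have pL1 : pcurve (zeros L1) t' B1 0.
  apply: (line_pcurve hL1.1 uB1 t1 (oner_neq0 K)) => u.
  by rewrite LE1 rows3E /dot !mxE /=; ring.
have pL2 : pcurve (zeros L2) t' B2 0.
  apply: (line_pcurve hL2.1 uB2 t2 (oner_neq0 K)) => u.
  by rewrite LE2 rows3E /dot !mxE /=; ring.
have zL1 q (v : 'rV[K]_3) : coords q v -> zeros L1 q <-> dot v n1 = 0.
  by move=> qv; rewrite /zeros /= (vanishE hL1.1 qv) LE1.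
have zL2 q (v : 'rV[K]_3) : coords q v -> zeros L2 q <-> dot v n2 = 0.
  by move=> qv; rewrite /zeros /= (vanishE hL2.1 qv) LE2.
have zL3 q (v : 'rV[K]_3) : coords q v -> zeros L3 q <-> v 0 2 = 0.
  by move=> qv; rewrite /zeros /= (vanishE hL3.1 qv) LE3 dot_delta.
have at_t' q : rep q 0 0 = rep q 0 1 -> rep q 0 2 = 0 -> q = t'.
  move=> e1 e2; apply: (coords_trans (coords_rep q) tE); exists (rep q 0 0).
    apply: contraNneq (rep_neq0 q) => e0; apply/eqP.
    by apply: row3_ext; rewrite ?e2 -?e1 ?e0 !mxE.
  by apply: row3_ext; rewrite !mxE /= ?mulr1 ?mulr0.
have D1 (v : 'rV[K]_3) : dot v n1 = v 0 0 - v 0 1 + (s1 - s2) * k2 * v 0 2.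
  by rewrite /dot !row3E; ring.
have D2 (v : 'rV[K]_3) : dot v n2 = v 0 0 - v 0 1 by rewrite /dot !row3E; ring.
have I12 : zeros L1 `&` zeros L2 = [set t'].
  apply/seteqP; split=> [q [/(zL1 _ _ (coords_rep q)) + /(zL2 _ _ (coords_rep q))]|q ->].
    rewrite D1 D2 => h /eqP; rewrite subr_eq0 => /eqP e; apply: at_t' => //.
    move: h; rewrite e subrr add0r => /eqP.
    by rewrite !mulf_eq0 (negPf s0) (negPf k20) => /eqP.
  by split; [apply/(zL1 _ _ tE)|apply/(zL2 _ _ tE)]; rewrite ?D1 ?D2 !row3E; ring.
have I13 : zeros L1 `&` zeros L3 = [set t'].
  apply/seteqP; split=> [q [/(zL1 _ _ (coords_rep q)) + /(zL3 _ _ (coords_rep q))]|q ->].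
    rewrite D1 => + e; rewrite e mulr0 addr0 => /eqP; rewrite subr_eq0 => /eqP e'; exact: at_t'.
  by split; [apply/(zL1 _ _ tE)|apply/(zL3 _ _ tE)]; rewrite ?D1 !row3E //; ring.
have I23 : zeros L2 `&` zeros L3 = [set t'].
  apply/seteqP; split=> [q [/(zL2 _ _ (coords_rep q)) + /(zL3 _ _ (coords_rep q))]|q ->].
    rewrite D2 => /eqP; rewrite subr_eq0 => /eqP e' e; exact: at_t'.
  by split; [apply/(zL2 _ _ tE)|apply/(zL3 _ _ tE)]; rewrite ?D2 !row3E //; ring.
pose x1 := [seq pt (eta (tau d)) | d <- ds].
(* The line [d1 d2] is contracted to [o 2]; since it meets the tangent, [o 2] lies on the image of
   the tangent. The lines [d2 t] and [d1 t] are contracted to [o 0] and [o 1]. *)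
pose x2 := o 2 :: [seq pt (mu (zeta l)) | l <- ls].
pose x3 := [:: o 0; o 1].
have oo i j : i != j -> o i != o j.
  by apply: contraNneq => /(coords_eq (ho i) (ho j)) /par_delta_inj ->.
have onz i q (v : 'rV[K]_3) : coords q v -> (forall j, v 0 j != 0) -> o i != q.
  move=> qv v0; apply/eqP => /(coords_eq (ho i) qv) oe.
  have := par_coord (i + 1) oe; rewrite (negPf (v0 _)) mxE.
  by have [h _ _] := cyc_neq i; rewrite (negPf h) andbF eqxx.
have nt q v i : coords q v -> (v 0 i == 0) = ~~ (row3 1 1 0 0 i == 0 :> K) -> q <> t'.
  by move=> qv h e; move: h; rewrite (par_coord i ((coords_eq qv tE).1 e)); case: (_ == _).
have eta0 d : d \in ds -> forall i, eta (tau d) 0 i != 0.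
  by move=> dd; apply: ord3P; rewrite row3E ?oner_eq0 ?mulf_neq0 ?tau1 ?tau2.
have mu0 l : l \in ls -> forall i, mu (zeta l) 0 i != 0.
  by move=> ll; apply: ord3P; rewrite row3E ?oner_eq0 ?z0.
have P1 : points_on (zeros L1 `\ t') 3 x1.
  split=> [||q]; last 1 first.
  - move=> /mapP [d dd ->]; split; last by apply: (nt _ _ 2 (he _)); rewrite !row3E oner_eq0 eqxx.
    by apply/(zL1 _ _ (he _)); rewrite D1 !row3E; ring.
  - rewrite map_inj_in_uniq // => u v uu vv e; apply: taui; [exact: dm|exact: dm|].
    by apply: (@gamma_inj K B1 0 _ _ uB1); rewrite !g1; apply/(coords_eq (he _) (he _)).
  by rewrite size_map; case: sds.
have P2 : points_on (zeros L2 `\ t') 3 x2.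
  split=> [||q]; last 1 first.
  - rewrite inE => /orP [/eqP ->|/mapP [l ll ->]]; split.
    + by apply/(zL2 _ _ (ho 2)); rewrite D2 -row3_delta2 !row3E; ring.
    + by apply: (nt _ _ 2 (ho 2)); rewrite -row3_delta2 !row3E oner_eq0 eqxx.
    + by apply/(zL2 _ _ (hm _)); rewrite D2 !row3E; ring.
    by apply: (nt _ _ 2 (hm _)); rewrite !row3E oner_eq0 eqxx.
  - rewrite /= map_inj_in_uniq ?uls ?andbT => [|u v uu vv e].
      by apply/mapP => -[l ll e]; have := onz 2 _ _ (hm _) (mu0 l ll); rewrite e eqxx.
    have ez : zeta u = zeta v.
      by apply: (@gamma_inj K B2 0 _ _ uB2); rewrite !g2; apply/(coords_eq (hm _) (hm _)).
    by have := hzeta u uu; rewrite ez => hu; apply: coords_inj hu (hzeta v vv).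
  by rewrite /= size_map sls.
have P3 : points_on (zeros L3 `\ t') 2 x3.
  split=> [||q]; rewrite //= ?inE ?andbT ?oo //.
  move=> /orP [/eqP ->|/eqP ->]; split.
  - by apply/(zL3 _ _ (ho 0)); rewrite mxE.
  - by apply: (nt _ _ 1 (ho 0)); rewrite -row3_delta0 !row3E oner_eq0 eqxx.
  - by apply/(zL3 _ _ (ho 1)); rewrite mxE.
  by apply: (nt _ _ 0 (ho 1)); rewrite -row3_delta1 !row3E oner_eq0 eqxx.
exists L1, L2, L3, t', x1, x2, x3; split; first by split.
pose ps := rcons ([:: d1, d2 & ds] ++ ls) t; pose ps' := x1 ++ x2 ++ x3.
have disj (A A' : set (pspace K 3)) q : A `&` A' = [set t'] -> (A `\ t') q -> (A' `\ t') q -> False.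
  by move=> AA [Aq qt] [A'q _]; apply: qt; suff : [set t'] q by []; rewrite -AA.
have ups' : uniq ps'.
  have [[u1 _ h1] [u2 _ h2] [u3 _ h3]] := And3 P1 P2 P3.
  rewrite /ps' !cat_uniq u1 u2 u3; apply/andP; split=> //; apply/andP; split.
    apply/hasPn => q; rewrite mem_cat => /orP [/h2 q2|/h3 q3]; apply/negP => /h1 q1.
      exact: (disj _ _ _ I12 q1 q2).
    exact: (disj _ _ _ I13 q1 q3).
  apply/andP; split=> //; apply/andP; split=> //.
  by apply/hasPn => q /h3 q3; apply/negP => /h2 q2; apply: (disj _ _ _ I23 q2 q3).
have ups : uniq ps.
  rewrite /ps rcons_uniq cat_uniq uds uls mem_cat negb_or !andbT; apply/andP; split.
    by apply/andP; split; apply/negP; [move=> /hds [_ h]|move=> /hls [_ h]]; apply: h.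
  apply/hasPn => q /hls [Lq qt]; apply/negP => /hds [Qq _]; apply: qt.
  exact: tangent_meets sQ Qt LT Qq Lq.
pose p (i : 'I_3) := nth t [:: d1; d2] i.
pose rs := [seq (d, pt (eta (tau d))) | d <- ds] ++ [seq (l, pt (mu (zeta l))) | l <- ls].
have cd : cremona_data C 1%:M p o rs ps ps'.
  apply: chord_cremona_data => //.
  - exact: htau.
  - exact: htau.
  - move=> z; rewrite mem_cat => /orP [/mapP [d dd ->]|/mapP [l ll ->]] /=.
      pose s := tau d; exists (row3 (s - s2) (s - s1) ((s - s1) * (s - s2) * k2)), (eta s); split.
      + by rewrite -gC; apply: htau; apply: dm.
      + exact: he.
      + move=> i; split; last exact: eta0.
        by move: i; apply: ord3P; rewrite row3E ?mulf_neq0 ?tau1 ?tau2.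
      by apply: ord3P; apply: ord3P; rewrite !row3E; ring.
    exists (row3 1 1 (zeta l)), (mu (zeta l)); split.
    + by rewrite -gL; apply: hzeta.
    + exact: hm.
    + move=> i; split; last exact: mu0.
      by move: i; apply: ord3P; rewrite row3E ?oner_eq0 ?z0.
    by apply: ord3P; apply: ord3P; rewrite !row3E; ring.
  - move=> q; rewrite /ps mem_rcons in_cons mem_cat !inE; split.
      move=> /orP [/eqP ->|/orP [/or3P [/eqP ->|/eqP ->|qd]|ql]]; first by left; exists 2.
      - by left; exists 0.
      - by left; exists 1.
      - right.
        by exists (q, pt (eta (tau q))) => //; rewrite mem_cat; apply/orP; left; apply/mapP; exists q.
      by right; exists (q, pt (mu (zeta q))) => //; rewrite mem_cat; apply/orP; right; apply/mapP; exists q.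
    move=> [[i ->]|[z]]; first by move: i; apply: ord3P; rewrite /p /= eqxx ?orbT.
    by rewrite mem_cat => /orP [/mapP [d dd ->]|/mapP [l ll ->]] -> /=; rewrite ?dd ?ll !orbT.
  move=> q; rewrite /ps' !mem_cat !inE; split.
    move=> /orP [/mapP [d dd ->]|/orP [/orP [/eqP ->|/mapP [l ll ->]]|/orP [/eqP ->|/eqP ->]]].
    - right; exists (d, pt (eta (tau d))) => //; rewrite mem_cat; apply/orP; left.
      by apply/mapP; exists d.
    - by left; exists 2.
    - right; exists (l, pt (mu (zeta l))) => //; rewrite mem_cat; apply/orP; right.
      by apply/mapP; exists l.
    - by left; exists 0.
    by left; exists 1.
  move=> [[i ->]|[z]]; first by move: i; apply: ord3P; rewrite eqxx ?orbT.
  rewrite mem_cat => /orP [/mapP [d dd ->]|/mapP [l ll ->]] -> /=.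
    by apply/orP; left; apply/mapP; exists d.
  by apply/orP; right; apply/orP; left; apply/orP; right; apply/mapP; exists l.
have [f [f1 f2 f3]] := cremona_iso cd.
exists f => //; split.
- apply: (cremona_curve pQ pL1 ups ups' f2) => s.
  rewrite gC g1 mulmxK // invmx1 mulmx1.
  by apply: ord3P; apply: ord3P; rewrite !row3E; ring.
- apply: (cremona_curve pL pL2 ups ups' f2) => s.
  rewrite gL g2 mulmxK // invmx1 mulmx1.
  by apply: ord3P; apply: ord3P; rewrite !row3E; ring.
rewrite (f3 2); suff -> : [set q : pspace K 3 | (rep q *m invmx 1%:M) 0 2 = 0] = zeros L3 by [].
by apply/seteqP; split=> q; rewrite (zL3 _ _ (coords_rep q)) /= invmx1 mulmx1.
Qed.

End Lines.

(** * The configuration for six points *)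

Section E6.
Variable K : numFieldType.
Implicit Types (F Q L : {mpoly K[3]}) (B : 'M[K]_3) (kappa : {poly K}) (A : set (pspace K 3)).
Implicit Types (q t c u d : pspace K 3) (us ds ls ps : seq (pspace K 3)).

Lemma zeros_closed (d : nat) F : F \is d.-homog -> zclosed (zeros F).
Proof.
move=> hF p h; apply/(vanishE hF (coords_rep p)); apply: (h d _ (meval_form hF)).
by move=> u [q qF qu]; apply: qF.
Qed.

Lemma blowup_over A ps (t : 'rV[K]_3 * ('rV[K]_3 -> 'rV[K]_3)) y :
  zclosed A -> flags ps t -> coords y (sg ps t.1 t.2) -> uniq ps ->
  blowup A ps y -> forall x, coords x t.1 -> A x.
Proof.
move=> cA ft yt ups /(blowup_flags ups) [t' ft' [yt' At']] x xt.
have [h _] := sg_par (sg_neq0 ft') ((coords_par _ yt').1 yt).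
by apply: cA; apply/(pcE _ xt); apply: vclos_par h At'.
Qed.

Lemma blowup_lift A ps t (t' : pspace K (bldim 3 (size ps))) :
  A t -> t \notin ps -> coords t' (blift ps (rep t)) -> blowup A ps t'.
Proof.
move=> At tp t't; rewrite blowupE; apply/(pcE _ t't); apply: vclos_sub.
by exists (rep t) => //; exists t => //; apply: coords_rep.
Qed.

(** A common point lies over a common point of the two closed curves, hence over [t]; as [t] is not
    a centre, there is only one point over it. *)
Lemma strict_transforms_meet A A' ps t (t' : pspace K (bldim 3 (size ps))) :
  zclosed A -> zclosed A' -> A `&` A' = [set t] ->
  uniq ps -> t \notin ps -> coords t' (blift ps (rep t)) ->
  blowup A ps `&` blowup A' ps = [set t'].
Proof.
move=> cA cA' AA ups tp tt'; apply/seteqP; split=> [y [yA yA']|y ->]; last first.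
  have [At At'] : (A `&` A') t by rewrite AA.
  by split; apply: blowup_lift tt'.
have [s fs [ys _]] := blowup_flags ups yA; have [s0 _] := fs; have [x xs] := coords_ex s0.
have xt : x = t.
  suff : (A `&` A') x by rewrite AA.
  by split; [apply: (blowup_over cA fs ys ups yA)|apply: (blowup_over cA' fs ys ups yA')].
move: xs; rewrite xt => ts; apply: (coords_trans ys tt').
apply: par_trans (sg_off fs ts tp) _; apply: par_lift; exact: coords_eqP.
Qed.

Lemma iso_meet m n (X : set (pspace K m)) (Y : set (pspace K n)) f
    (A A' : set (pspace K m)) (B B' : set (pspace K n)) y :
  is_iso X Y f -> A `<=` X -> A' `<=` X -> f @` A = B -> f @` A' = B' -> B `&` B' = [set y] ->
  exists x, [/\ X x, f x = y & A `&` A' = [set x]].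
Proof.
move=> [g [_ _ fg gf]] AX A'X fA fA' BB.
have [By B'y] : (B `&` B') y by rewrite BB.
move: By; rewrite -fA => -[x Ax fx]; have [Yx gx] := fg x (AX x Ax).
exists x; split=> //; first exact: AX.
apply/seteqP; split=> [z [Az A'z]|_ ->]; last first.
  split=> //; move: B'y; rewrite -fA' => -[x' Ax' fx'].
  by have [_ gx'] := fg x' (A'X x' Ax'); move: gx; rewrite fx -fx' gx' => <-.
have fz : f z = y.
  suff : (B `&` B') (f z) by rewrite BB.
  by split; [rewrite -fA; exists z|rewrite -fA'; exists z].
by have [_ gz] := fg z (AX z Az); rewrite /= -gz fz -fx.
Qed.

Lemma conic_tangent_meet Q L t : smooth_conic Q -> vanish Q t -> zeros L = tangent_line Q t ->
  zeros Q `&` zeros L = [set t].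
Proof.
move=> sQ Qt LT; apply/seteqP; split=> [q [Qq Lq]|q ->]; first exact: tangent_meets sQ Qt LT Qq Lq.
split=> //; have [B [k0 [k1 [k2 [uB tB k20 QE]]]]] := smooth_conic_normal sQ Qt.
have [_ _ _ tQ] := conic_of_formula sQ.1 uB tB k20 QE.
rewrite LT tQ /=; have [a a0 ->] := par_sym (coords_eqP tB).
by rewrite -scalemxAl mulmxK // !mxE /= mulr0.
Qed.

(** The isomorphism of [E7_construct] carries the cubic and the exceptional curve over [c] to the
    conic and its tangent, hence [c'] to the point over [t]. Blowing up [c'] thus becomes blowing up
    [t], after which the second quadratic transformation applies. *)
Lemma E6_construct F c us : cuspidal_cubic F c -> uniq us ->
  (forall u, u \in us -> smooth_locus F u) -> noncollinear us -> size us = 6 ->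
  exists L1 L2 L3 t x1 x2 x3,
    concurrent_lines L1 L2 L3 t x1 x2 x3 /\ E6_model F c us L1 L2 L3 x1 x2 x3.
Proof.
move=> hF uus hus ncol sus.
have [|Q [L [t [d [ds [ls [[sQ hL] [Qt LT] hds hls [hM dl]]]]]]]] := E7_construct hF uus hus ncol.
  by rewrite sus.
rewrite sus /= in hds; case: ds => [|e ds] in hds hM dl *; first by case: hds.
have [|L1 [L2 [L3 [t1 [x1 [x2 [x3 [hcl [h hi [hQ hL' hE]]]]]]]]]] := lines_step sQ hL Qt LT hds hls.
  by move=> l ll; apply: dl ll; rewrite inE eqxx.
exists L1, L2, L3, t1, x1, x2, x3; split=> //.
set ps := [:: d, e & ds] ++ ls in hM h hi hQ hL' hE.
have [f fi [fQ fL]] := hM.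
have cQ : zclosed (zeros Q) := zeros_closed sQ.1.
have cL : zclosed (zeros L) := zeros_closed hL.1.
have QL := conic_tangent_meet sQ Qt LT.
have ups : uniq ps.
  have [u1 _ h1] := hds; have [u2 _ h2] := hls; rewrite /ps cat_uniq u1 u2 andbT /=.
  apply/hasPn => q /h2 [Lq qt]; apply/negP => /h1 [Qq _]; apply: qt.
  exact: tangent_meets sQ Qt LT Qq Lq.
have tps : t \notin ps.
  by rewrite mem_cat negb_or; apply/andP; split; apply/negP => th;
    [have [_ _ /(_ _ th) [_ h1]] := hds|have [_ _ /(_ _ th) [_ h1]] := hls]; apply: h1.
have ucus : uniq (c :: us).
  rewrite /= uus andbT; apply/negP => /hus; have [_ _ hc] := hF.
  by move=> /(smooth_neq_cusp hc) [].
have [t' tt'] := coords_ex (lift_neq0 (coords_rep t) tps).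
have meet := strict_transforms_meet cQ cL QL ups tps tt'.
pose X := blowup setT (c :: us); pose CX := blowup (zeros F) (c :: us).
pose Ec := exceptional setT (c :: us) c.
have CX_X : CX `<=` X by apply: blowup_mono.
have EX : Ec `<=` X by move=> y [].
have [c' [Xc' fc' Cc']] := iso_meet fi CX_X EX fQ fL meet.
exists c' => //.
have clX : zclosed X by exact: blowup_closed.
have clX' : zclosed (blowup setT ps) by exact: blowup_closed.
have [f1 [i1 m1 e1]] := blowup_pt_iso fi clX clX' Xc'.
rewrite fc' in f1 i1 m1 e1.
have [f2 [i2 m2 e2]] := blowup_rcons ups tps tt'.
have comp S S1 S2 S3 : f1 @` S = S1 -> f2 @` S1 = S2 -> h @` S2 = S3 -> (h \o (f2 \o f1)) @` S = S3.
  by move=> <- <- <-; rewrite !image_comp.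
exists (h \o (f2 \o f1)); first exact: is_iso_trans (is_iso_trans i1 i2) hi.
split.
- by apply: comp hQ; [apply: m1|rewrite fQ; apply: m2].
- by apply: comp hL'; [apply: m1|rewrite fL; apply: m2].
by apply: comp hE; [apply: e1|apply: e2].
Qed.

End E6.

(** * Removing the strict transforms *)

Section Complements.
Variable K : numFieldType.
Implicit Types (F Q L : {mpoly K[3]}) (A C : set (pspace K 3)).
Implicit Types (q t c u d : pspace K 3) (us ds ls ps : seq (pspace K 3)).
Notation flag := ('rV[K]_3 * ('rV[K]_3 -> 'rV[K]_3))%type.

Lemma flags_eq ps ps' : ps =i ps' -> flags ps = flags ps'.
Proof. by move=> e; apply/seteqP; split=> t [t0 h]; split=> // p pp; apply: h; rewrite ?e // -e. Qed.

Lemma lifts_flags A ps : lifts A ps = (fun t : flag => sg ps t.1 t.2) @`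
  ((fun v : 'rV[K]_3 => (v, cross v)) @` cone (A `&` [set x | x \notin ps])).
Proof.
apply/seteqP; split=> [_ [v cv <-]|_ [_ [v cv <-] <-]].
  by exists (v, cross v); [exists v|rewrite lift_sg].
by exists v => //; rewrite lift_sg.
Qed.

(** The set of flags depends only on the set of centres, and each Segre point is regular in the
    other through the flag. This moves [c] from the head of the list, where the theorem has it, to
    the end, where a further centre is added. *)
Lemma blowup_perm ps ps' : uniq ps -> uniq ps' -> ps =i ps' ->
  exists f, [/\ is_iso (blowup setT ps) (blowup setT ps') f,
    forall A, f @` blowup A ps = blowup A ps'
  & forall q, f @` exceptional setT ps q = exceptional setT ps' q].
Proof.
move=> ups ups' e; pose D := flags ps; have eD : D = flags ps' := flags_eq e.
pose g (t : flag) := sg ps t.1 t.2; pose h (t : flag) := sg ps' t.1 t.2.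
have gh0 (t : flag) : D t -> g t != 0 /\ h t != 0.
  by move=> Dt; split; apply: sg_neq0; rewrite -?eD.
have mkreg qs qs' (t : flag) : qs =i qs' -> flags qs t ->
    reg (flags qs) (fun t : flag => sg qs t.1 t.2) (fun t : flag => sg qs' t.1 t.2) t.
  move=> e' ft; have s0 := sg_neq0 ft.
  apply: reg_sg => [|p pp]; first exact: (@sg_regx _ _ _ qs fst snd).
  by apply: (@sg_regu _ _ _ qs fst snd); rewrite ?e'.
have gh (t : flag) : D t -> reg D g h t by exact: mkreg.
have hg (t : flag) : D t -> reg D h g t.
  by rewrite eD; apply: mkreg => x; rewrite e.
have HX p : blowup setT ps p <-> exists2 t : flag, D t & coords p (g t) by exact: blowupT.
have HY p : blowup setT ps' p <-> exists2 t : flag, D t & coords p (h t).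
  by rewrite eD; apply: blowupT.
have inh k : exists y : pspace K (bldim 3 k), True.
  have s0 : segre k (delta_mx 0 0 : 'rV[K]_3) (fun=> tens (delta_mx 0 0) (delta_mx 0 0)) != 0.
    by apply: segre_neq0 => [|i _]; rewrite ?tens_neq0 // delta_neq0.
  by have [y _] := coords_ex s0; exists y.
have [p0 _] := inh (size ps); have [q0 _] := inh (size ps').
have [f hf fgh] := iso_param p0 q0 gh0 gh hg HX HY.
have im A : f @` blowup A ps = blowup A ps'.
  pose S := (fun v : 'rV[K]_3 => (v, cross v)) @` cone (A `&` [set x | x \notin ps]).
  have SD : S `<=` D by move=> _ [v [p [_ pp] pv] <-]; apply: flags_cross pv pp.
  have e1 : blowup A ps = pc (g @` S) by rewrite blowupE lifts_flags.
  have e2 : blowup A ps' = pc (h @` S).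
    suff eS : [set x | x \notin ps'] = [set x | x \notin ps] by rewrite blowupE lifts_flags eS.
    by apply/seteqP; split=> x; rewrite /= e.
  rewrite e1 e2.
  apply: (image_pc gh0 gh hg (fun p => (HX p).1) (fun p => (HY p).1) fgh SD).
    by rewrite -e1; apply: blowup_mono.
  by rewrite -e2; apply: blowup_mono.
exists f; split=> // q; apply/seteqP; split=> [_ [y [/HX [s Ds ys] yq] <-]|y [/HY [s Ds ys] yq]].
  have [z zs] := coords_ex (gh0 s Ds).2; rewrite (fgh s y z Ds ys zs); split.
    by apply/HY; exists s.
  have Ds' : flags ps' s by rewrite -eD.
  by apply/(over_sg _ Ds' zs); apply/(over_sg _ Ds ys).
have [z zs] := coords_ex (gh0 s Ds).1; exists z; last exact: fgh zs ys.
split; first by apply/HX; exists s.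
have Ds' : flags ps' s by rewrite -eD.
by apply/(over_sg _ Ds zs); apply/(over_sg _ Ds' ys).
Qed.

Lemma point_closed m (c : pspace K m) : zclosed [set c].
Proof.
move=> p h; apply: (coords_trans (coords_rep p) (coords_rep c)).
apply/(wedge_par (rep_neq0 p) (rep_neq0 c)); apply/eqP/rowP => k; rewrite mxE.
case/mxvec_indexP: k => i j; rewrite wedgeE.
have hf : isform 1 (fun v : 'rV[K]_m => v 0 i * rep c 0 j - v 0 j * rep c 0 i).
  by apply: form_sub; apply: form_mulc; apply: form_coord.
apply: (h _ _ hf) => u [_ -> /coords_eqP [a a0 ->]].
by rewrite !mxE; ring.
Qed.

(** The blow-down map is regular, so the fibre over a point is closed. *)
Lemma exceptional_closed ps c : uniq ps -> zclosed (exceptional setT ps c).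
Proof.
move=> ups y h; have yX : blowup setT ps y.
  have : zclosed (blowup setT ps) by exact: blowup_closed.
  by apply; move: h; apply: vclos_mono => v [z [Xz _] zv]; exists v; [exists z|apply: par_refl].
have [t ft yt] := (blowupT y ups).1 yX; split=> //; apply/(over_sg _ ft yt).
pose S : set flag := [set s | flags ps s /\ coords c s.1].
have SF : S `<=` flags ps by move=> s [].
have cl : vclos ((fun s : flag => sg ps s.1 s.2) @` S) (sg ps t.1 t.2).
  apply: vclos_par (par_sym (coords_eqP yt)) _.
  apply: vclos_mono h => v [z [Xz oz] zv].
  have [s fs zs] := (blowupT z ups).1 Xz; exists (sg ps s.1 s.2); last exact/par_sym/(coords_par _ zs).
  by exists s => //; split=> //; apply/(over_sg _ fs zs).
have rx := @sg_regx _ _ _ ps fst snd t ft (sg_neq0 ft).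
have := cont ft SF rx cl; have [t0 _] := ft; have [x xt] := coords_ex t0 => h'.
suff <- : x = c by [].
apply: (@point_closed 3); apply/(pcE _ xt); apply: vclos_mono h' => _ [s [_ cs] <-].
by exists s.1; [exists c|apply: par_refl].
Qed.

Lemma isomorphic_refl m (X : set (pspace K m)) : isomorphic X X.
Proof.
have [[p0]|nX] := pselect (nonempty X); last first.
  by exists id, id; split=> // x Xx; case: nX; exists x.
move=> Xp0; have n0 (t : pspace K m) : X t -> rep t != 0 /\ rep t != 0 by split; exact: rep_neq0.
have r (t : pspace K m) : X t -> reg X (@rep K m) (@rep K m) t by move=> _; exact: reg_refl.
have H (p : pspace K m) : X p <-> exists2 t, X t & coords p (rep t).
  split=> [Xp|[t Xt pt]]; first by exists p => //; exact: coords_rep.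
  by rewrite (coords_inj pt (coords_rep t)).
by have [f hf _] := iso_param p0 p0 n0 r r H H; exists f.
Qed.

Lemma iso_complement m n (X : set (pspace K m)) (Y : set (pspace K n)) f
    (A : set (pspace K m)) (B : set (pspace K n)) :
  is_iso X Y f -> A `<=` X -> f @` A = B -> isomorphic (X `\` A) (Y `\` B).
Proof. by move=> hf AX fA; exists f; have [] := is_iso_restr hf AX fA. Qed.

(** Adding [c] to the centres [us] is one further blow-up, at a point of the strict transform of C,
    because [c] lies on C and is not a centre. *)
Lemma drop_center C c us : uniq us -> c \notin us -> C c ->
  isomorphic (blowup setT (c :: us) `\` (blowup C (c :: us) `|` exceptional setT (c :: us) c))
    (blowup setT us `\` blowup C us).
Proof.
move=> uus cus Cc; have u1 : uniq (c :: us) by rewrite /= cus.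
have u2 : uniq (rcons us c) by rewrite rcons_uniq cus.
have [|f [f1 f2 f3]] := blowup_perm u1 u2; first by move=> x; rewrite mem_rcons.
have [c' cc'] := coords_ex (lift_neq0 (coords_rep c) cus).
have [h [h1 h2 h3]] := blowup_rcons uus cus cc'.
pose X := blowup setT us; pose CX := blowup C us.
have clX : zclosed X by exact: blowup_closed.
have clC : zclosed CX by exact: blowup_closed.
have CXX : CX `<=` X by exact: blowup_mono.
apply: isomorphic_trans (blowup_complement clX clC CXX (blowup_lift Cc cus cc')).
apply: (@isomorphic_trans _ _ _ _ _ (blowup setT (rcons us c) `\`
  (blowup C (rcons us c) `|` exceptional setT (rcons us c) c))).
  apply: (iso_complement f1); last by rewrite image_setU f2 f3.
  by move=> y [|[]] //; apply: blowup_mono.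
apply/isomorphic_sym; apply: (iso_complement h1); last by rewrite image_setU h2 h3.
by move=> y [|[]] //; apply: blowup_mono.
Qed.

Lemma zerosM (d e : nat) (F G : {mpoly K[3]}) : F \is d.-homog -> G \is e.-homog ->
  zeros (F * G) = zeros F `|` zeros G.
Proof.
move=> hF hG; apply/seteqP; split=> p; have pr := coords_rep p; rewrite /zeros /=;
  rewrite (vanishE (dhomogM hF hG) pr) (vanishE hF pr) (vanishE hG pr) mevalM.
  by move/eqP; rewrite mulf_eq0 => /orP [/eqP ->|/eqP ->]; [left|right].
by move=> [->|->]; rewrite ?mul0r ?mulr0.
Qed.

Lemma E7_complement F c us Q L ds ls : uniq us -> c \notin us -> vanish F c ->
  E7_model F c us Q L ds ls ->
  isomorphic (blowup setT (ds ++ ls) `\` blowup (zeros Q `|` zeros L) (ds ++ ls))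
    (blowup setT us `\` blowup (zeros F) us).
Proof.
move=> uus cus Fc [f f1 [fQ fL]]; apply: isomorphic_trans (drop_center uus cus Fc).
rewrite blowupU; apply/isomorphic_sym; apply: (iso_complement f1); last by rewrite image_setU fQ fL.
by move=> y [|[]] //; apply: blowup_mono.
Qed.

(** The centres [c'] and [c] are dropped in turn. For [c'] the removed curve is the strict transform
    of the cubic together with the exceptional curve over [c], and both pass through [c']. *)
Lemma E6_complement F c us L1 L2 L3 x1 x2 x3 : uniq us -> c \notin us -> vanish F c ->
  E6_model F c us L1 L2 L3 x1 x2 x3 -> let ps := x1 ++ x2 ++ x3 in
  isomorphic (blowup setT ps `\` blowup (zeros L1 `|` zeros L2 `|` zeros L3) ps)
    (blowup setT us `\` blowup (zeros F) us).
Proof.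
move=> uus cus Fc [c' Cc' [f f1 [fQ fL fE]]] ps; apply: isomorphic_trans (drop_center uus cus Fc).
pose X := blowup setT (c :: us); pose CX := blowup (zeros F) (c :: us).
pose Ec := exceptional setT (c :: us) c.
have ucus : uniq (c :: us) by rewrite /= cus.
have clX : zclosed X by exact: blowup_closed.
have clA : zclosed (CX `|` Ec).
  by apply: zclosedU; [exact: blowup_closed|exact: exceptional_closed].
have AX : CX `|` Ec `<=` X by move=> y [|[]] //; apply: blowup_mono.
have Ac' : (CX `|` Ec) c' by left; have [] : (CX `&` Ec) c' by rewrite Cc'.
apply: isomorphic_trans (blowup_complement clX clA AX Ac').
apply/isomorphic_sym; apply: (iso_complement f1).
  by move=> y [|[]] //; apply: blowup_mono.
by rewrite !blowupU !image_setU fQ fL fE.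
Qed.

End Complements.

(** * The Sakai surfaces of the three types *)

Section Sakai.
Variable K : numFieldType.
Implicit Types (F Q L : {mpoly K[3]}) (A C : set (pspace K 3)).
Implicit Types (q t c u d p : pspace K 3) (us ds ls ps : seq (pspace K 3)).

Lemma pcurve_zeros A t B kappa : pcurve A t B kappa -> A = affine_curve B kappa `|` [set t].
Proof. by move=> [_ h _]; apply/seteqP; split=> p; rewrite h; (case=> ?; [by right|by left]). Qed.

(** In the normal form only the cusp is at infinity, so [p] is on the affine curve and the remaining
    part [C'] is the cusp alone. *)
Lemma sakai_E8 F c us p : cuspidal_cubic F c -> uniq us -> smooth_locus F p ->
  sakai_complement F us p (blowup setT us `\` blowup (zeros F) us).
Proof.
move=> hF uus sp; have [_ _ hc] := hF; have [Fp pc] := smooth_neq_cusp hc sp.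
have [B [k0 [k1 [k2 [k3 [uB cB _ pF]]]]]] := cuspidal_cubic_normal hF.
have [_ h _] := pF; have [//|[s ps]] := (h p).1 Fp.
apply: (sakai_of_curve uus uB (pcurve_zeros pF) ps) (isomorphic_refl _).
by move=> /(@point_closed K 3).
Qed.

(** With [t] at infinity on [L], the ninth point is on the affine part of [L] and the remaining part
    of the cubic is the conic, which contains [t] and meets [L] nowhere else. *)
Lemma sakai_E7 F c us Q L t ds ls p : uniq us -> c \notin us -> vanish F c ->
  conic_and_tangent Q L t ds ls -> E7_model F c us Q L ds ls -> (zeros L `\ t) p ->
  sakai_complement (Q * L) (ds ++ ls) p (blowup setT us `\` blowup (zeros F) us).
Proof.
move=> uus cus Fc [sQ hL [Qt LT] [u1 _ h1] [u2 _ h2]] hM [Lp pt].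
have meet := tangent_meets sQ Qt LT.
have Lt : vanish L t.
  by have [] : (zeros Q `&` zeros L) t by rewrite (conic_tangent_meet sQ Qt LT).
have ups : uniq (ds ++ ls).
  rewrite cat_uniq u1 u2 andbT /=; apply/hasPn => q /h2 [Lq qt].
  by apply/negP => /h1 [Qq _]; apply: qt; apply: meet.
have [B [pL _]] := line_normal hL Lt; have [uB h _] := pL.
have [//|[s ps]] := (h p).1 Lp.
have zQL := zerosM sQ.1 hL.1.
have zE : zeros (Q * L) = affine_curve B 0 `|` zeros Q.
  rewrite zQL (pcurve_zeros pL); apply/seteqP; split=> q; last by move=> [|]; [right; left|left].
  by move=> [|[|->]]; [right|left|right].
apply: (sakai_of_curve ups uB zE ps).
  by move=> /(zeros_closed sQ.1) Qp; apply: pt; apply: meet.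
by rewrite zQL; apply: E7_complement hM.
Qed.

Lemma sakai_E6 F c us L1 L2 L3 t x1 x2 x3 p : uniq us -> c \notin us -> vanish F c ->
  concurrent_lines L1 L2 L3 t x1 x2 x3 -> E6_model F c us L1 L2 L3 x1 x2 x3 ->
  (zeros L3 `\ t) p ->
  sakai_complement (L1 * L2 * L3) (x1 ++ x2 ++ x3) p (blowup setT us `\` blowup (zeros F) us).
Proof.
move=> uus cus Fc [[l1 l2 l3] [i12 i13 i23] [u1 _ h1] [u2 _ h2] [u3 _ h3]] hM [Lp pt].
have disj A A' q : A `&` A' = [set t] -> (A `\ t) q -> (A' `\ t) q -> False.
  by move=> AA [Aq qt] [A'q _]; apply: qt; suff : [set t] q by []; rewrite -AA.
have ups : uniq (x1 ++ x2 ++ x3).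
  rewrite !cat_uniq u1 u2 u3; apply/andP; split=> //; apply/andP; split.
    apply/hasPn => q; rewrite mem_cat => /orP [/h2 q2|/h3 q3]; apply/negP => /h1 q1.
      exact: (disj _ _ _ i12 q1 q2).
    exact: (disj _ _ _ i13 q1 q3).
  apply/andP; split=> //; apply/andP; split=> //.
  by apply/hasPn => q /h3 q3; apply/negP => /h2 q2; apply: (disj _ _ _ i23 q2 q3).
have [L1t L3t] : (zeros L1 `&` zeros L3) t by rewrite i13.
have [B [pL _]] := line_normal l3 L3t; have [uB h _] := pL.
have [//|[s ps]] := (h p).1 Lp.
have z12 := zerosM l1.1 l2.1; have h12 := dhomogM l1.1 l2.1.
have zE : zeros (L1 * L2 * L3) = affine_curve B 0 `|` zeros (L1 * L2).
  rewrite (zerosM h12 l3.1) (pcurve_zeros pL); apply/seteqP; split=> q; last first.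
    by move=> [|]; [right; left|left].
  by move=> [|[|->]]; [right|left|right; rewrite z12; left].
apply: (sakai_of_curve ups uB zE ps).
  move=> /(zeros_closed h12); rewrite z12 => -[Ap|Ap]; apply: pt.
    by suff : (zeros L1 `&` zeros L3) p by rewrite i13.
  by suff : (zeros L2 `&` zeros L3) p by rewrite i23.
by rewrite (zerosM h12 l3.1) z12; apply: E6_complement hM.
Qed.

(** [phi] and [a] are injective, so distinct indices give distinct points, and collinearity of three
    of them is vanishing of the sum of their parameters. *)
Lemma identification_points F c (phi : K -> pspace K 3) r (a : 'I_r -> K) :
  cuspidal_cubic F c -> group_identification F phi -> off_hyperplanes a ->
  let us := [seq phi (a i) | i : 'I_r] in
  [/\ uniq us, forall u, u \in us -> smooth_locus F u, noncollinear us, c \notin us & vanish F c].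
Proof.
move=> hF [[g [g' [_ _ gg' _]] gphi] _ hcol] [a1 a2 _ _] us.
have ptE (s : K) : exists2 x : pspace K 2, affine_line x & coords x (affine_coords s).
  by have [x xs] := coords_ex (affine_neq0 s); exists x => //; exists s.
have sm s : smooth_locus F (phi s).
  by have [x ax xs] := ptE s; rewrite -(gphi _ _ xs); case: (gg' x ax).
have inj : injective phi.
  move=> s s'; have [x ax xs] := ptE s; have [x' ax' xs'] := ptE s'.
  rewrite -(gphi _ _ xs) -(gphi _ _ xs') => e.
  have xx : x = x' by have [_ ex] := gg' x ax; have [_ ex'] := gg' x' ax'; rewrite -ex -ex' e.
  by apply: par_affine; apply: (coords_par _ xs).1; rewrite xx.
have ainj : injective a.
  by move=> i j e; apply/eqP; apply: contraT => ij; exfalso; apply: (a1 i j); rewrite /= ?inE ?ij.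
have hus u : u \in us -> smooth_locus F u by move=> /mapP [i _ ->].
have [hH _ hc] := hF.
split=> //.
- by rewrite map_inj_uniq ?enum_uniq // => i j /inj /ainj.
- move=> u v w /mapP [i _ ->] /mapP [j _ ->] /mapP [k _ ->].
  have e := map_inj_uniq (inj_comp inj ainj) [:: i; j; k]; rewrite /= in e.
  rewrite /= e => ijk /(hcol (a i) (a j) (a k)) h; apply: (a2 i j k) => //; apply: h.
  by have := map_inj_uniq ainj [:: i; j; k]; rewrite /= => ->.
- by apply/negP => /hus /(smooth_neq_cusp hc) [].
have [B [k0 [k1 [k2 [k3 [_ _ _ [_ h _]]]]]]] := cuspidal_cubic_normal hF.
by apply/h; left.
Qed.

End Sakai.

Theorem mainTheorem2 (R : realType) (F : {mpoly R[i][3]}) (c : pspace R[i] 3)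
    (phi : R[i] -> pspace R[i] 3) (r : nat) (a : 'I_r -> R[i]) :
  cuspidal_cubic F c ->
  group_identification F phi ->
  r \in [:: 6; 7; 8]%N ->
  off_hyperplanes a ->
  let us := [seq phi (a i) | i : 'I_r] in
  let Y := blowup setT us `\` blowup (zeros F) us in
  [/\ r = 7%N -> exists Q L t ds ls,
        conic_and_tangent Q L t ds ls /\ E7_model F c us Q L ds ls,
      r = 6%N -> exists L1 L2 L3 t s1 s2 s3,
        concurrent_lines L1 L2 L3 t s1 s2 s3 /\
        E6_model F c us L1 L2 L3 s1 s2 s3
    & [/\ r = 8%N -> forall p,
            smooth_locus F p -> only_cubic F us p ->
            sakai_complement F us p Y,
          r = 7%N -> forall Q L t ds ls,
            conic_and_tangent Q L t ds ls -> E7_model F c us Q L ds ls ->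
            forall p, (zeros L `\ t) p -> only_cubic (Q * L) (ds ++ ls) p ->
            sakai_complement (Q * L) (ds ++ ls) p Y
        & r = 6%N -> forall L1 L2 L3 t s1 s2 s3,
            concurrent_lines L1 L2 L3 t s1 s2 s3 ->
            E6_model F c us L1 L2 L3 s1 s2 s3 ->
            forall p, (zeros L3 `\ t) p ->
            only_cubic (L1 * L2 * L3) (s1 ++ s2 ++ s3) p ->
            sakai_complement (L1 * L2 * L3) (s1 ++ s2 ++ s3) p Y]].
Proof.
move=> hF hphi _ ha us Y.
have [uus hus ncol cus Fc] := identification_points hF hphi ha.
have sus : size us = r by rewrite size_map -cardE card_ord.
split.
- move=> r7; have [|Q [L [t [d [ds [ls [[sQ hL] hQL hds hls [hM _]]]]]]]] := E7_construct hF uus hus ncol.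
    by rewrite sus r7.
  by exists Q, L, t, (d :: ds), ls; split=> //; split=> //; rewrite sus r7 in hds.
- by move=> r6; apply: (E6_construct hF uus hus ncol); rewrite sus.
split.
- by move=> _ p sp _; apply: sakai_E8 hF uus sp.
- by move=> _ Q L t ds ls hQL hM p Lp _; apply: sakai_E7 hQL hM Lp.
by move=> _ L1 L2 L3 t s1 s2 s3 hL hM p Lp _; apply: sakai_E6 hL hM Lp.
Qed.
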